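(* Let $0<e\le 1$ and let $f(v,t)$ be a solution of (E1) with initial datum $f_0$ a probability density with zero mean velocity, and let $g(v,t)=e^{-3Et}f(e^{-Et}v,t)$ be the rescaled solution, which solves (E2). Then for all $t\ge0$ $$I(g(\cdot,t))\le \exp\!\Big(\Big[\frac{(1-e)(2+e+15e^2)}{8e^3}-2E\Big]t\Big)\,I(g(\cdot,0)).$$ Moreover, for every admissible $\widetilde B$ the exponent $\frac{(1-e)(2+e+15e^2)}{8e^3}-2E$ is strictly positive when $0<e<1$, and it tends to $0$ as $e\to1$.
   Context: Restitution coefficient $0<e\le1$. $\widetilde B$ is a positive, integrable, even function on $[-1,1]$ with $\int_{-1}^1\widetilde B(s)\,ds=2$. $dn$ is the uniform measure on $S^2$ of total mass $4\pi$; $v'=v-\frac{1+e}{2}((v-w)\cdot n)n$. $\langle Q_e(f,f),\varphi\rangle=\frac1{4\pi}\iiint\widetilde B(n\cdot\frac{v-w}{|v-w|})f(v)f(w)[\varphi(v')-\varphi(v)]\,dn\,dv\,dw$. (E1): $\frac{d}{dt}\int f\varphi\,dv=\langle Q_e(f,f),\varphi\rangle$ for all bounded continuous $\varphi$. $E=\frac{1-e^2}{8}\int_{-1}^1 s^2\widetilde B(s)\,ds$. (E2), the rescaled equation: $\frac{d}{dt}\int g\varphi\,dv=-E\int g\,(v\cdot\nabla\varphi)\,dv+\langle Q_e(g,g),\varphi\rangle$ for all smooth bounded test functions $\varphi$. Fisher information: $I(f)=4\int|\nabla\sqrt f|^2dv$ (or $+\infty$). *)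

(* Defs.v *)
From HB Require Import structures.
From mathcomp Require Import all_boot all_order all_algebra.
From mathcomp Require Import all_classical all_reals all_analysis.
Set Implicit Arguments. Unset Strict Implicit. Unset Printing Implicit Defensive.
Import Order.TTheory GRing.Theory Num.Theory.
Import numFieldNormedType.Exports.
Local Open Scope classical_set_scope.
Local Open Scope ring_scope.

Section Defs.
Variable R : realType.

Definition V := ((R * R) * R)%type.

Definition leb3 := ((@lebesgue_measure R \x @lebesgue_measure R) \x @lebesgue_measure R)%E.

Definition coord (v : V) (i : 'I_3) : R :=
  match val i with 0%N => v.1.1 | 1%N => v.1.2 | _ => v.2 end.

Definition addV (v w : V) : V := ((v.1.1 + w.1.1, v.1.2 + w.1.2), v.2 + w.2).
Definition scaleV (a : R) (v : V) : V := ((a * v.1.1, a * v.1.2), a * v.2).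
Definition subV (v w : V) : V := addV v (scaleV (-1) w).
Definition dotV (v w : V) : R := v.1.1 * w.1.1 + v.1.2 * w.1.2 + v.2 * w.2.
Definition enorm (v : V) : R := Num.sqrt (dotV v v).

Definition shiftV (v : V) (i : 'I_3) (s : R) : V :=
  ((v.1.1 + (if val i == 0%N then s else 0),
    v.1.2 + (if val i == 1%N then s else 0)),
    v.2 + (if val i == 2%N then s else 0)).

Definition partial (h : V -> R) (i : 'I_3) (v : V) : R :=
  derive1 (fun s => h (shiftV v i s)) 0.

Definition C1c (phi : V -> R) : Prop :=
  continuous phi /\
  (forall i v, derivable (fun s => phi (shiftV v i s)) 0 1) /\
  (forall i, continuous (partial phi i)) /\
  (exists M : R, forall v, M < enorm v -> phi v = 0).

Definition weak_grad (h : V -> R) (G : 'I_3 -> V -> R) : Prop :=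
  measurable_fun setT h /\
  (forall i, measurable_fun setT (G i)) /\
  forall phi, C1c phi -> forall i,
    leb3.-integrable setT (fun v => (h v * partial phi i v)%:E) /\
    leb3.-integrable setT (fun v => (G i v * phi v)%:E) /\
    Rintegral leb3 setT (fun v => h v * partial phi i v)
      = - Rintegral leb3 setT (fun v => G i v * phi v).

(* Fisher information I(f) = 4 \int |grad sqrt f|^2 , or +oo if sqrt f has
   no weak gradient *)
Definition fisher (f : V -> R) : \bar R :=
  ereal_inf [set y | exists G, weak_grad (fun v => Num.sqrt (f v)) G /\
     y = (4%:E * \int[leb3]_v (\sum_(i < 3) (G i v) ^+ 2)%:E)%E].

(* integral over S^2 w.r.t. the uniform (surface) measure dn of mass 4 pi,
   via the cone measure: \int_{S^2} h dn = 3 \int_{|x|<=1} h(x/|x|) dx *)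
Definition sphere_int (h : V -> R) : R :=
  3 * Rintegral leb3 [set x | enorm x <= 1] (fun x => h (scaleV (enorm x)^-1 x)).

Definition vprime (e : R) (v w n : V) : V :=
  subV v (scaleV ((1 + e) / 2 * dotV (subV v w) n) n).

Definition Qform (e : R) (B : R -> R) (f : V -> R) (phi : V -> R) : R :=
  (4 * pi)^-1 * Rintegral leb3 setT (fun w => Rintegral leb3 setT (fun v =>
     sphere_int (fun n =>
       B (dotV n (scaleV (enorm (subV v w))^-1 (subV v w))) * f v * f w *
       (phi (vprime e v w n) - phi v)))).

Definition admissible_B (B : R -> R) : Prop :=
  (forall s, s \in `[-1, 1] -> 0 < B s) /\
  (@lebesgue_measure R).-integrable `[-1, 1] (fun s => (B s)%:E) /\
  (forall s, s \in `[-1, 1] -> B (- s) = B s) /\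
  Rintegral (@lebesgue_measure R) `[-1, 1] B = 2.

Definition Ecoef (e : R) (B : R -> R) : R :=
  (1 - e ^+ 2) / 8 * Rintegral (@lebesgue_measure R) `[-1, 1] (fun s => s ^+ 2 * B s).

Definition rate (e : R) (B : R -> R) : R :=
  (1 - e) * (2 + e + 15 * e ^+ 2) / (8 * e ^+ 3) - 2 * Ecoef e B.

Definition bounded_continuous (phi : V -> R) : Prop :=
  continuous phi /\ exists M : R, forall v, `|phi v| <= M.

Definition solves_E1 (e : R) (B : R -> R) (f : V -> R -> R) : Prop :=
  (forall t, 0 <= t ->
     measurable_fun setT (fun v => f v t) /\
     (forall v, 0 <= f v t) /\
     leb3.-integrable setT (fun v => (f v t)%:E)) /\
  forall phi, bounded_continuous phi ->
    let m := fun t => Rintegral leb3 setT (fun v => f v t * phi v) in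
    m t @[t --> 0^'+] --> m 0 /\
    forall t, 0 < t ->
      derivable m t 1 /\ derive1 m t = Qform e B (fun v => f v t) phi.

Definition prob_density_zero_mean (f0 : V -> R) : Prop :=
  measurable_fun setT f0 /\ (forall v, 0 <= f0 v) /\
  leb3.-integrable setT (fun v => (f0 v)%:E) /\
  Rintegral leb3 setT f0 = 1 /\
  forall i, leb3.-integrable setT (fun v => (coord v i * f0 v)%:E) /\
            Rintegral leb3 setT (fun v => coord v i * f0 v) = 0.

Definition rescale (e : R) (B : R -> R) (f : V -> R -> R) (v : V) (t : R) : R :=
  expR (- (3 * Ecoef e B * t)) * f (scaleV (expR (- (Ecoef e B * t))) v) t.

End Defs.

(* Main.v *)
(* Idea. The Fisher information of [f] is the supremum of the integrals of [f phi_xi] with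
   [phi_xi = \sum_i (- 2 d_i xi_i - xi_i^2)], over bounded C^1 fields [xi] with bounded derivatives.
   The average of [phi_xi (v') + phi_xi (w')] over the collisions of a pair [v, w] is at most
   [e^-2] times the symmetrization of [phi_zeta], where [zeta] is an average of [xi] transported
   back through the collision: in this average the derivative in the relative velocity is taken
   along rotations and dilations, which leave the angular law invariant.  As [zeta] has derivatives
   at most [400 L] if those of [xi] are at most [L], Duhamel's formula for the integral of
   [f phi_xi] can be iterated, the remainder after [N] steps being [6 L (400 t / e^2)^N / N!].
   Hence I(f_t) <= exp((e^-2 - 1) t) I(f_0); the rescaling contributes exp(- 2 E t), and
   [e^-2 - 1 <= (1 - e) (2 + e + 15 e^2) / (8 e^3)]. *)
Require Import Defs.
From HB Require Import structures.
From mathcomp Require Import all_boot all_order all_algebra.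
From mathcomp Require Import all_classical all_reals all_analysis.
From mathcomp Require Import measurable_realfun ring lra.
Import Order.TTheory GRing.Theory Num.Theory.
Import numFieldNormedType.Exports.
Set Implicit Arguments.
Unset Strict Implicit.
Unset Printing Implicit Defensive.
Local Open Scope classical_set_scope.
Local Open Scope ring_scope.

(** The solution is known only through integrals against bounded continuous functions, so [I(f_t)]
    cannot be differentiated in time; a functional with [xi] fixed can, at the price of a new field
    at each collision. The supremum formula is not immediate: [fisher] is defined by a weak gradient
    of [sqrt f], and for a merely integrable density no chain rule relates it to [f]. The link is
    [hell], the squared L^2 distance between [sqrt f] and a translate: a bound [s^2 M / 4] on it is
    equivalent both to a weak derivative of squared norm at most [M / 4] and to the bound [M] on the
    functional in one direction. The weight [B] is only integrable too, which is why the relative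
    velocity is moved by maps under which the collision law is equivariant. As for [e^-2]: if the
    transported field is multiplied by [c] and the inequality carries a factor [K], equality of the
    divergences forces [K c = 2]; the squares, where [|u| <= 2 |Y| / e] for the relative velocities
    [u] before and [2 Y] after, need [K >= e^-2]. The transported field is controlled only off the
    diagonal [v = w], so it is cut off there. *)

Section RealIntegrals.
Context d (T : measurableType d) (R : realType).
Variable mu : {measure set T -> \bar R}.
Implicit Types f g h : T -> R.

Definition L1 f : Prop := mu.-integrable setT (EFin \o f).
Definition Int f : R := Rintegral mu setT f.

Lemma L1_measurable f : L1 f -> measurable_fun setT f.
Proof. by move/measurable_int/measurable_EFinP. Qed.

Lemma L1_le f g : measurable_fun setT f -> (forall x, `|f x| <= g x) ->
  L1 g -> L1 f.
Proof.
move=> mf fg gi; apply: (le_integrable measurableT _ _ gi).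
  exact/measurable_EFinP.
by move=> x _ /=; rewrite lee_fin (le_trans (fg x))// ler_norm.
Qed.

Lemma L1_0 : L1 (fun=> 0).
Proof. exact: integrable0. Qed.

Lemma L1D f g : L1 f -> L1 g -> L1 (fun x => f x + g x).
Proof. exact: integrableD. Qed.

Lemma L1B f g : L1 f -> L1 g -> L1 (fun x => f x - g x).
Proof. exact: integrableB. Qed.

Lemma L1Z k f : L1 f -> L1 (fun x => k * f x).
Proof. exact: integrableZl. Qed.

Lemma L1M f g M : L1 f -> measurable_fun setT g -> (forall x, `|g x| <= M) ->
  L1 (fun x => f x * g x).
Proof.
move=> fi mg gM; apply: (@L1_le _ (fun x => M * `|f x|)).
- by apply: measurable_funM => //; exact: L1_measurable.
- by move=> x; rewrite normrM mulrC ler_wpM2r.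
- by apply: L1Z; exact: integrable_norm.
Qed.

Lemma L1_norm f : L1 f -> L1 (fun x => `|f x|).
Proof. exact: integrable_norm. Qed.

Lemma L1_sum (I : Type) (s : seq I) (F : I -> T -> R) :
  (forall i, L1 (F i)) -> L1 (fun x => \sum_(i <- s) F i x).
Proof.
move=> h; elim: s => [|i s IH].
  by under eq_fun do rewrite big_nil; exact: L1_0.
by under eq_fun do rewrite big_cons; exact: L1D.
Qed.

Lemma IntD f g : L1 f -> L1 g -> Int (fun x => f x + g x) = Int f + Int g.
Proof. exact: RintegralD. Qed.

Lemma IntB f g : L1 f -> L1 g -> Int (fun x => f x - g x) = Int f - Int g.
Proof. exact: RintegralB. Qed.

Lemma IntZ k f : L1 f -> Int (fun x => k * f x) = k * Int f.
Proof. exact: RintegralZl. Qed.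

Lemma IntN f : L1 f -> Int (fun x => - f x) = - Int f.
Proof.
move=> fi; rewrite -[RHS]mulN1r -IntZ//; congr Int.
by apply/funext => x; rewrite mulN1r.
Qed.

Lemma Int0 : Int (fun=> 0) = 0.
Proof. by rewrite /Int /Rintegral integral0. Qed.

Lemma Int_sum (I : Type) (s : seq I) (F : I -> T -> R) :
  (forall i, L1 (F i)) ->
  Int (fun x => \sum_(i <- s) F i x) = \sum_(i <- s) Int (F i).
Proof.
move=> h; elim: s => [|i s IH].
  by under eq_fun do rewrite big_nil; rewrite big_nil Int0.
under eq_fun do rewrite big_cons.
by rewrite big_cons IntD ?IH//; exact: L1_sum.
Qed.

Lemma Int_le f g : L1 f -> L1 g -> (forall x, f x <= g x) -> Int f <= Int g.
Proof. by move=> fi gi fg; apply: le_Rintegral. Qed.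

Lemma Int_ge0 f : (forall x, 0 <= f x) -> 0 <= Int f.
Proof. by move=> f0; apply: Rintegral_ge0. Qed.

Lemma Int_EFin f : L1 f -> (\int[mu]_x (f x)%:E)%E = (Int f)%:E.
Proof. by move=> fi; rewrite /Int /Rintegral fineK//; exact: integrable_fin_num. Qed.

Lemma Int_eq_ae f g : measurable_fun setT f -> measurable_fun setT g ->
  {ae mu, forall x, f x = g x} -> Int f = Int g.
Proof.
move=> mf mg fg; rewrite /Int /Rintegral; congr fine.
apply: ae_eq_integral => //; [exact/measurable_EFinP|exact/measurable_EFinP|].
by apply: filterS fg => x + _ => ->.
Qed.

Lemma Int_dct_ae (fn : nat -> T -> R) f g :
  (forall n, measurable_fun setT (fn n)) -> measurable_fun setT f -> L1 g ->
  (forall n x, `|fn n x| <= g x) ->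
  {ae mu, forall x, fn ^~ x @ \oo --> f x} ->
  L1 f /\ Int (fn n) @[n --> \oo] --> Int f.
Proof.
move=> mfn mf gi fg fnf.
have [| | |||fi _ h] := @dominated_convergence _ _ _ mu _ measurableT
  (fun n => EFin \o fn n) (EFin \o f) (EFin \o g).
- by move=> n; exact/measurable_EFinP.
- exact/measurable_EFinP.
- by apply: filterS fnf => x h _; apply/cvg_EFin => //; exact: nearW.
- exact: gi.
- by apply: filterE => x n _ /=; rewrite lee_fin.
split=> //; move: h.
rewrite [X in _ --> X -> _](_ : _ = (Int f)%:E); last exact: Int_EFin.
by move/fine_cvgP => [].
Qed.

Lemma Int_dct (fn : nat -> T -> R) f g :
  (forall n, measurable_fun setT (fn n)) -> measurable_fun setT f -> L1 g ->
  (forall n x, `|fn n x| <= g x) -> (forall x, fn ^~ x @ \oo --> f x) ->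
  L1 f /\ Int (fn n) @[n --> \oo] --> Int f.
Proof.
by move=> mfn mf gi fg fnf; apply: (Int_dct_ae mfn mf gi fg); exact: filterE.
Qed.

End RealIntegrals.

(** * Fubini's theorem for real-valued integrals *)

Section Fubini.
Context d1 d2 (T1 : measurableType d1) (T2 : measurableType d2) (R : realType).
Variables (m1 : {sigma_finite_measure set T1 -> \bar R})
          (m2 : {sigma_finite_measure set T2 -> \bar R}).

(** [Int] of a slice is the [fine] part of an extended real, so it is the true slice integral only
    where that one is finite; this is almost everywhere, which suffices for the outer integral. *)
Lemma Int_fubini12 (F : T1 * T2 -> R) : L1 (m1 \x m2)%E F ->
  L1 m1 (fun x => Int m2 (fun y => F (x, y))) /\
  Int m1 (fun x => Int m2 (fun y => F (x, y))) = Int (m1 \x m2)%E F.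
Proof.
move=> Fi; have := integrable_fubini_F Fi; have := integral12_prod_meas1 Fi.
rewrite /fubini_F => E Gi.
have mG := measurable_int _ Gi.
have mI : measurable_fun setT (fun x => Int m2 (fun y => F (x, y))).
  exact: (measurableT_comp _ mG).
have ae : {ae m1, forall x, (Int m2 (fun y => F (x, y)))%:E
    = \int[m2]_y (EFin \o F) (x, y)}%E.
  have := integrable_ae measurableT Gi.
  apply: filterS => x /(_ I) h.
  by rewrite /Int /Rintegral fineK.
split.
  apply/integrableP; split; first exact/measurable_EFinP.
  case/integrableP : Gi => _; apply: le_lt_trans.
  apply: ae_ge0_le_integral => //.
  - exact/measurableT_comp/measurable_EFinP.
  - exact/measurableT_comp.
  - by apply: filterS ae => x h _; rewrite -h.
rewrite {1}/Int /Rintegral /Int /Rintegral -E; congr fine.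
apply: ae_eq_integral => //; first exact/measurable_EFinP.
by apply: filterS ae => x h _.
Qed.

Lemma Int_fubini21 (F : T1 * T2 -> R) : L1 (m1 \x m2)%E F ->
  L1 m2 (fun y => Int m1 (fun x => F (x, y))) /\
  Int m2 (fun y => Int m1 (fun x => F (x, y))) = Int (m1 \x m2)%E F.
Proof.
move=> Fi; have := measurable_fubini_G Fi; have := integral21_prod_meas1 Fi.
rewrite /fubini_G => E mG0.
have Gi : m2.-integrable setT (fun y => \int[m1]_x (EFin \o F) (x, y))%E.
  apply/integrableP; split => //.
  have mF := measurable_int _ Fi.
  have := (integrable21ltyP m1 m2 mF).1 Fi.
  apply: le_lt_trans.
  apply: ge0_le_integral => //.
  - exact/measurableT_comp.
  - have ? : measurable_fun setT (abse \o (EFin \o F)) by exact: measurableT_comp.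
    by apply: (measurable_fun_fubini_tonelli_G (abse \o (EFin \o F))) => //= z; exact: abse_ge0.
  - move=> y _; apply: le_abse_integral => //.
    exact: (measurableT_comp mF (pair2_measurable y)).
have mG := measurable_int _ Gi.
have mI : measurable_fun setT (fun y => Int m1 (fun x => F (x, y))).
  exact: (measurableT_comp _ mG).
have ae : {ae m2, forall y, (Int m1 (fun x => F (x, y)))%:E
    = \int[m1]_x (EFin \o F) (x, y)}%E.
  have := integrable_ae measurableT Gi.
  apply: filterS => x /(_ I) h.
  by rewrite /Int /Rintegral fineK.
split.
  apply/integrableP; split; first exact/measurable_EFinP.
  case/integrableP : Gi => _; apply: le_lt_trans.
  apply: ae_ge0_le_integral => //.
  - exact/measurableT_comp/measurable_EFinP.
  - exact/measurableT_comp.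
  - by apply: filterS ae => x h _; rewrite -h.
rewrite {1}/Int /Rintegral /Int /Rintegral -E; congr fine.
apply: ae_eq_integral => //; first exact/measurable_EFinP.
by apply: filterS ae => x h _.
Qed.

(** The shape of every double integral over a pair of colliding velocities: two integrable densities
    and a bounded kernel. Tonelli factorizes the integral of [|f| |g|]. *)
Lemma L1_prod (f : T1 -> R) (g : T2 -> R) (h : T1 * T2 -> R) M :
  L1 m1 f -> L1 m2 g -> measurable_fun setT h -> (forall z, `|h z| <= M) ->
  L1 (m1 \x m2)%E (fun z => f z.1 * g z.2 * h z).
Proof.
move=> fi gi mh hM.
have mf := L1_measurable fi; have mg := L1_measurable gi.
apply: L1M hM => //.
have mF : measurable_fun setT (fun z : T1 * T2 => f z.1 * g z.2).
  by apply: measurable_funM; apply: measurableT_comp.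
apply/integrable12ltyP; first exact/measurable_EFinP.
under eq_integral => x _.
  under eq_integral => y _ do rewrite /= normrM EFinM.
  rewrite (integralZl measurableT (integrable_norm gi)).
  rewrite -/(Int _ _) (Int_EFin (L1_norm gi)) -EFinM mulrC.
  over.
have : L1 m1 (fun x => Int m2 (fun y => `|g y|) * `|f x|) by apply: L1Z; exact: L1_norm.
move=> /integrableP[_]; apply: le_lt_trans.
apply: ge0_le_integral => //=.
- by move=> x _; rewrite lee_fin mulr_ge0// Int_ge0.
- apply/measurable_EFinP/measurable_funM => //.
  exact: measurableT_comp.
- apply/measurable_EFinP/measurableT_comp => //; apply: measurable_funM => //.
  exact: measurableT_comp.
- by move=> x _; rewrite lee_fin ler_norm.
Qed.

End Fubini.

(** * Change of variables as a relation between two measures *)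

Section Scales.
Local Open Scope ereal_scope.

(** Says that [phi] pushes [mu] forward to [k nu]. Phrased with nonnegative integrals, it passes to
    products by Tonelli and to integrable functions by splitting into positive and negative
    parts. *)
Definition scales d1 d2 (T1 : measurableType d1) (T2 : measurableType d2)
    (R : realType) (mu : {measure set T1 -> \bar R})
    (nu : {measure set T2 -> \bar R}) (phi : T1 -> T2) (k : R) : Prop :=
  measurable_fun setT phi /\
  forall g : T2 -> \bar R, measurable_fun setT g -> (forall x, 0 <= g x) ->
    \int[mu]_x g (phi x) = k%:E * \int[nu]_x g x.

Lemma scales_Int d1 d2 (T1 : measurableType d1) (T2 : measurableType d2)
    (R : realType) (mu : {measure set T1 -> \bar R})
    (nu : {measure set T2 -> \bar R}) (phi : T1 -> T2) (k : R) (f : T2 -> R) :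
  (0 <= k)%R -> scales mu nu phi k -> L1 nu f ->
  L1 mu (fun x => f (phi x)) /\ Int mu (fun x => f (phi x)) = (k * Int nu f)%R.
Proof.
move=> k0 [mphi h] fi.
have mf : measurable_fun setT (EFin \o f) := measurable_int _ fi.
have fpi : L1 mu (fun x => f (phi x)).
  apply/integrableP; split; first exact: (measurableT_comp mf mphi).
  rewrite (h (fun x => `|(EFin \o f) x|)) //; last exact: measurableT_comp.
  by apply: lte_mul_pinfty => //; case/integrableP : fi.
split=> //; apply: EFin_inj.
rewrite -Int_EFin// EFinM -Int_EFin// integralE.
rewrite (funepos_comp (EFin \o f) phi) (funeneg_comp (EFin \o f) phi).
have hp := h _ (measurable_funepos mf) (funepos_ge0 _).
have hn := h _ (measurable_funeneg mf) (funeneg_ge0 _).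
have ? := integrable_fin_num measurableT (integrable_funepos measurableT fi).
transitivity (k%:E * (\int[nu]_x (EFin \o f)^\+ x - \int[nu]_x (EFin \o f)^\- x)).
  rewrite muleBr//; last exact: fin_num_adde_defr.
  by rewrite -hp -hn.
by rewrite -integralE.
Qed.

Lemma scales_preimage d1 d2 (T1 : measurableType d1) (T2 : measurableType d2)
    (R : realType) (mu : {measure set T1 -> \bar R})
    (nu : {measure set T2 -> \bar R}) (phi : T1 -> T2) (k : R) : (0 <= k)%R ->
  measurable_fun setT phi ->
  (forall A, measurable A -> mu (phi @^-1` A) = k%:E * nu A) -> scales mu nu phi k.
Proof.
move=> k0 mphi E; split=> // g mg g0.
pose phi_mixin := isMeasurableFun.Build _ _ _ _ phi mphi.
pose phim : {mfun T1 >-> T2} := HB.pack phi phi_mixin.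
have -> : \int[mu]_x g (phi x) = \int[pushforward mu phim]_x g x.
  by rewrite (ge0_integral_pushforward (phi := phim)).
rewrite -[k]/((NngNum k0)%:num) -ge0_integral_mscale//.
by apply: eq_measure_integral => A mA _; exact: E.
Qed.

(** Uniqueness of Lebesgue measure: [l] times the image measure has the right value on half-open
    intervals. *)
Lemma lebesgue_measure_affine (R : realType) (l c : R) (A : set (measurableTypeR R)) :
  (0 < l)%R -> measurable A ->
  lebesgue_measure ((fun x => l * x + c)%R @^-1` A) = l^-1%:E * lebesgue_measure A.
Proof.
move=> l0 mA; set phi : measurableTypeR R -> measurableTypeR R := (fun x => _)%R.
have mphi : measurable_fun setT phi.
  apply: (measurable_funD (f := fun x => (l * x)%R)) => //.
  exact: mulrl_measurable.
pose phi_mixin := @isMeasurableFun.Build _ _ (measurableTypeR R)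
  (measurableTypeR R) phi mphi.
pose phim : {mfun measurableTypeR R >-> measurableTypeR R} := HB.pack phi phi_mixin.
pose P := pushforward (@lebesgue_measure R) phim.
have l0' : (0 <= l)%R by exact: ltW.
have EA B : measurable B -> @lebesgue_measure R B = mscale (NngNum l0') P B.
  apply: lebesgue_measure_unique => _ [[a b]] _ <-.
  have E : phi @^-1` `]a, b] = `]((a - c) / l)%R, ((b - c) / l)%R]%classic.
    apply/seteqP; split=> x /=; rewrite !in_itv/= /phi ltr_pdivrMr// ler_pdivlMr//;
      rewrite ltrBlDr lerBrDr mulrC//.
  transitivity (l%:E * lebesgue_measure `]((a - c) / l)%R, ((b - c) / l)%R]%classic);
    last by congr (_ * lebesgue_measure _); rewrite -E.
  rewrite lebesgue_measure_itv/= lebesgue_measure_itv/= !lte_fin.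
  rewrite ltr_pM2r ?invr_gt0// ltrD2r.
  case: ifPn => _; last by rewrite mule0.
  rewrite -!EFinB -EFinM; congr (_%:E); field.
  by rewrite gt_eqF.
by rewrite (EA mphi _ mA) /mscale/= muleA -EFinM mulVf ?mul1e// gt_eqF.
Qed.

Lemma scales_prod d1 d2 d1' d2' (T1 : measurableType d1) (T2 : measurableType d2)
    (U1 : measurableType d1') (U2 : measurableType d2') (R : realType)
    (m1 : {sigma_finite_measure set T1 -> \bar R})
    (m2 : {sigma_finite_measure set T2 -> \bar R})
    (n1 : {sigma_finite_measure set U1 -> \bar R})
    (n2 : {sigma_finite_measure set U2 -> \bar R}) p1 p2 (k1 k2 : R) :
  (0 <= k1)%R -> (0 <= k2)%R -> scales m1 n1 p1 k1 -> scales m2 n2 p2 k2 ->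
  scales (m1 \x m2) (n1 \x n2) (fun z => (p1 z.1, p2 z.2)) (k1 * k2)%R.
Proof.
move=> k10 k20 [mp1 h1] [mp2 h2].
have mp : measurable_fun setT (fun z : T1 * T2 => (p1 z.1, p2 z.2)).
  by apply: measurable_fun_pair => /=; exact: measurableT_comp.
split=> // g mg g0.
rewrite (fubini_tonelli1 (g \o (fun z => (p1 z.1, p2 z.2)))); last 2 first.
- exact: (measurableT_comp mg mp).
- by move=> z; exact: g0.
rewrite /fubini_F/=.
transitivity (\int[m1]_x (k2%:E * \int[n2]_y g (p1 x, y))).
  apply: eq_integral => x _.
  apply: (h2 (fun y => g (p1 x, y))) => //.
  exact: (measurableT_comp mg).
have mG : measurable_fun setT (fun x => \int[n2]_y g (x, y)).
  exact: (measurable_fun_fubini_tonelli_F g).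
have mGp : measurable_fun setT (fun x => \int[n2]_y g (p1 x, y)).
  exact: (measurableT_comp mG mp1).
rewrite ge0_integralZl//; last by move=> x _; exact: integral_ge0.
rewrite (h1 (fun x => \int[n2]_y g (x, y)))//; last first.
  by move=> x; exact: integral_ge0.
by rewrite fubini_tonelli1// muleA -EFinM mulrC.
Qed.

Section SigmaFiniteProduct.
Context d1 d2 (T1 : measurableType d1) (T2 : measurableType d2) (R : realType).
Variables (m1 : {sigma_finite_measure set T1 -> \bar R})
          (m2 : {sigma_finite_measure set T2 -> \bar R}).

Lemma sigma_finite_prod : sigma_finite setT (m1 \x m2).
Proof.
have /sigma_finiteP[F [TF ndF Foo]] := sigma_finiteT m1.
have /sigma_finiteP[G [TG ndG Goo]] := sigma_finiteT m2.
exists (fun n => F n `*` G n).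
  rewrite -setXTT TF TG predeqE => -[x y]; split.
    move=> [/= [n _ Fnx] [k _ Gky]]; exists (maxn n k) => //; split.
    - by move: x Fnx; exact/subsetPset/ndF/leq_maxl.
    - by move: y Gky; exact/subsetPset/ndG/leq_maxr.
  by move=> [n _ []/= ? ?]; split; exists n.
move=> k; have [? ?] := Foo k; have [? ?] := Goo k.
split; first exact: measurableX.
by rewrite product_measure1E// lte_mul_pinfty// ge0_fin_numE.
Qed.

(* The library's own sigma-finite instance on [m1 \x m2] is shadowed by the one
   for subprobabilities. *)
Definition sprod : {sigma_finite_measure set (T1 * T2)%type -> \bar R} :=
  let f := (m1 \x m2) : {measure set (T1 * T2)%type -> \bar R} in
  HB.pack (m1 \x m2)
    (Measure.class f)
    (Measure_isSigmaFinite.Build _ _ _ f sigma_finite_prod).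

End SigmaFiniteProduct.
Arguments sprod : simpl never.

End Scales.

(** * Lebesgue measure on R^3 and its behaviour under dilations and translations *)

Section Mu3.
Variable R : realType.

Lemma measurable_idR : measurable_fun setT (id : measurableTypeR R -> R).
Proof. by []. Qed.

Let lam0 : {measure set R -> \bar R} :=
  measure_function_pushforward__canonical__measure_function_Measure
        (lebesgue_measure_lebesgue_measure__canonical__measure_function_Measure R)
        measurable_idR.

Lemma sigma_finite_lam : sigma_finite setT lam0.
Proof. exact: (sigma_finiteT (@lebesgue_measure R)). Qed.

(* The type carrying [lebesgue_measure] and the canonical measurable structure of
   [R] have different displays; [lam] is Lebesgue measure for the latter. *)
Definition lam : {sigma_finite_measure set R -> \bar R} :=
  HB.pack (lam0 : set R -> \bar R) (Measure.class lam0)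
    (Measure_isSigmaFinite.Build _ _ _ lam0 sigma_finite_lam).

Lemma lamE A : lam A = @lebesgue_measure R A.
Proof. by []. Qed.

Lemma scales_lam_id : scales (@lebesgue_measure R) lam id 1.
Proof.
apply: scales_preimage => //.
by move=> A mA; rewrite mul1e.
Qed.

Lemma scales_id_lam : scales lam (@lebesgue_measure R) id 1.
Proof.
apply: scales_preimage => //.
by move=> A mA; rewrite mul1e.
Qed.

Lemma scales_lam (l c : R) : 0 < l -> scales lam lam (fun x => l * x + c) l^-1.
Proof.
move=> l0; apply: scales_preimage.
- by rewrite invr_ge0 ltW.
- apply: (measurable_funD (f := fun x => (l * x)%R)) => //.
  exact: mulrl_measurable.
- by move=> A mA; apply: lebesgue_measure_affine.
Qed.

Definition mu3 : {sigma_finite_measure set (V R) -> \bar R} :=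
  sprod (sprod lam lam) lam.

Lemma scales_mu3 (l : R) (c : V R) : 0 < l ->
  scales mu3 mu3 (fun v => addV (scaleV l v) c) (l^-1 ^+ 3).
Proof.
move=> l0; have l1 : (0 <= l^-1)%R by rewrite invr_ge0 ltW.
have -> : (l^-1 ^+ 3 = l^-1 * l^-1 * l^-1)%R by rewrite !exprS expr0 mulr1 mulrA.
have h c' := scales_lam c' l0.
have h12 : scales (sprod lam lam) (sprod lam lam) _ _ :=
  scales_prod l1 l1 (h c.1.1) (h c.1.2).
exact: (scales_prod (mulr_ge0 l1 l1) l1 h12 (h c.2)).
Qed.

(** The identity is a map between two measurable structures with different displays; each direction
    gives one implication of [leb3_L1]. *)
Let scales_leb3_id : scales (@leb3 R) mu3 id 1.
Proof.
have h := scales_lam_id.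
have h12 : scales (sprod lebesgue_measure lebesgue_measure) (sprod lam lam) _ _ :=
  scales_prod ler01 ler01 h h.
have := scales_prod (mulr_ge0 ler01 ler01) ler01 h12 h.
rewrite !mulr1.
by have -> : (fun z : V R => (id (id z.1.1, id z.1.2), id z.2)) = id
  by apply/funext => -[[]].
Qed.

Let scales_id_leb3 : scales mu3 (@leb3 R) id 1.
Proof.
have h := scales_id_lam.
have h12 : scales (sprod lam lam) (sprod lebesgue_measure lebesgue_measure) _ _ :=
  scales_prod ler01 ler01 h h.
have := scales_prod (mulr_ge0 ler01 ler01) ler01 h12 h.
rewrite !mulr1.
by have -> : (fun z : V R => (id (id z.1.1, id z.1.2), id z.2)) = id
  by apply/funext => -[[]].
Qed.

Lemma leb3_integral_ge0 (g : V R -> \bar R) :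
  measurable_fun setT g -> (forall x, 0 <= g x)%E ->
  (\int[@leb3 R]_x g x = \int[mu3]_x g x)%E.
Proof.
by move=> mg g0; have [_ ->//] := scales_leb3_id; rewrite mul1e.
Qed.

Lemma leb3_L1 (f : V R -> R) :
  (@leb3 R).-integrable setT (fun v => (f v)%:E) <-> L1 mu3 f.
Proof.
split=> fi.
- have fi' : L1 (@leb3 R) f by exact: fi.
  exact: (scales_Int ler01 scales_id_leb3 fi').1.
- exact: (scales_Int ler01 scales_leb3_id fi).1.
Qed.

Lemma leb3_Int (f : V R -> R) : L1 mu3 f -> Rintegral (@leb3 R) setT f = Int mu3 f.
Proof.
move=> fi; have [_ h] := scales_Int ler01 scales_leb3_id fi.
by rewrite -[RHS]mul1r -h.
Qed.

Lemma leb3_Int_in (D : set (V R)) (f : V R -> R) : L1 mu3 (f \_ D) ->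
  Rintegral (@leb3 R) D f = Int mu3 (f \_ D).
Proof. by move=> fi; rewrite -leb3_Int// Rintegral_mkcond. Qed.

Lemma L1_mu3_affine (l : R) (c : V R) (f : V R -> R) : 0 < l -> L1 mu3 f ->
  L1 mu3 (fun v => f (addV (scaleV l v) c)).
Proof.
move=> l0 fi; apply: (scales_Int _ (scales_mu3 c l0) fi).1.
by rewrite exprn_ge0// invr_ge0 ltW.
Qed.

Lemma Int_mu3_affine (l : R) (c : V R) (f : V R -> R) : 0 < l -> L1 mu3 f ->
  Int mu3 (fun v => f (addV (scaleV l v) c)) = l^-1 ^+ 3 * Int mu3 f.
Proof.
move=> l0 fi; apply: (scales_Int _ (scales_mu3 c l0) fi).2.
by rewrite exprn_ge0// invr_ge0 ltW.
Qed.

End Mu3.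
Arguments lam : simpl never.
Arguments mu3 : simpl never.

(** * Measurability of Caratheodory functions and sequential continuity *)

Section ContinuityMeasurability.
Variable R : realType.

Lemma pair_cvg (I : Type) (F : set_system I) (FF : Filter F)
    (T U : topologicalType) (f : I -> T) (g : I -> U) (a : T) (b : U) :
  f x @[x --> F] --> a -> g x @[x --> F] --> b ->
  (f x, g x) @[x --> F] --> (a, b).
Proof. by move=> fa gb; exact: cvg_pair. Qed.

(** The real variable is rounded down to a multiple of [1 / (n + 1)]. The rounded function is
    measurable on each of countably many strips, and continuity in the second variable gives the
    pointwise limit. *)
Lemma measurable_caratheodory d (T : measurableType d) (F : T -> R -> R) :
  (forall r, measurable_fun setT (F ^~ r)) -> (forall t, continuous (F t)) ->
  measurable_fun setT (fun z : T * R => F z.1 z.2).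
Proof.
move=> mF cF.
pose q (n : nat) (r : R) : R := (Num.floor (r * n.+1%:R))%:~R / n.+1%:R.
have n0 (n : nat) : 0 < n.+1%:R :> R by rewrite ltr0n.
apply: (measurable_fun_cvg (h := fun n (z : T * R) => F z.1 (q n z.2))).
  move=> n _ Y mY; rewrite setTI.
  have -> : (fun z : T * R => F z.1 (q n z.2)) @^-1` Y =
      \bigcup_(k : int) (((F ^~ (k%:~R / n.+1%:R)) @^-1` Y) `*`
        `[(k%:~R / n.+1%:R), ((k + 1)%:~R / n.+1%:R)[%classic).
    apply/seteqP; split=> [[t r] /= Ytr|[t r] [k _] /= []].
      exists (Num.floor (r * n.+1%:R)) => //; split => //=.
      by rewrite in_itv/= ler_pdivrMr// ltr_pdivlMr// floor_itv.
    rewrite in_itv/= ler_pdivrMr// ltr_pdivlMr// => Yt /floor_def E.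
    by rewrite /q E.
  apply: countable_bigcupT_measurable; first exact: countableP.
  move=> k; apply: measurableX; last exact: measurable_itv.
  by rewrite -[X in measurable X]setTI; exact: mF.
move=> [t r] _ /=.
apply: (cvg_comp (fun n => q n r) (F t)); last exact: cF.
apply/cvgrPdist_le => e e0.
near=> n.
have /andP[h1 h2] := floor_itv (r * n.+1%:R).
rewrite -ler_pdivrMr// in h1 *; rewrite -ltr_pdivlMr// in h2.
rewrite ger0_norm ?subr_ge0// /q lerBlDl.
apply: (le_trans (ltW h2)); rewrite intrD mulrDl lerD2l mul1r.
by apply/ltW; near: n; exact: (near_infty_natSinv_lt (PosNum e0)).
Unshelve. all: by end_near. Qed.

(** The three coordinates are absorbed one at a time, the ones already treated becoming part of the
    parameter. *)
Lemma measurable_caratheodoryV d (T : measurableType d) (F : T -> V R -> R) :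
  (forall v, measurable_fun setT (F ^~ v)) -> (forall t, continuous (F t)) ->
  measurable_fun setT (fun z : T * V R => F z.1 z.2).
Proof.
move=> mF cF.
have m1 : measurable_fun setT (fun z : (T * R * R) * R =>
    F z.1.1.1 ((z.1.1.2, z.1.2), z.2)).
  apply: (@measurable_caratheodory _ _ (fun t r => F t.1.1 ((t.1.2, t.2), r))).
    move=> r.
    apply: (@measurable_caratheodory _ _ (fun t y => F t.1 ((t.2, y), r))).
      move=> y.
      apply: (@measurable_caratheodory _ _ (fun t x => F t ((x, y), r))) => //.
      move=> t x; apply: (cvg_comp (fun x => ((x, y), r)) (F t)); last exact: cF.
      by apply: pair_cvg; [apply: pair_cvg => //; exact: cvg_cst|exact: cvg_cst].
    move=> [t x] y; apply: (cvg_comp (fun y => ((x, y), r)) (F t)); last exact: cF.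
    by apply: pair_cvg; [apply: pair_cvg => //; exact: cvg_cst|exact: cvg_cst].
  move=> [[t x] y] r; apply: (cvg_comp (fun r => ((x, y), r)) (F t)); last exact: cF.
  by apply: pair_cvg => //; exact: cvg_cst.
have -> : (fun z : T * V R => F z.1 z.2) =
    (fun z : (T * R * R) * R => F z.1.1.1 ((z.1.1.2, z.1.2), z.2)) \o
    (fun z : T * V R => (((z.1, z.2.1.1), z.2.1.2), z.2.2)).
  by apply/funext => -[t [[x y] r]].
apply: (measurableT_comp m1).
have m2 : measurable_fun setT (fun z : T * V R => z.2.1).
  exact: (measurableT_comp measurable_fst).
apply: measurable_fun_pair; last exact: (measurableT_comp measurable_snd).
apply: measurable_fun_pair; last exact: (measurableT_comp measurable_snd m2).
apply: measurable_fun_pair => //; exact: (measurableT_comp measurable_fst m2).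
Qed.

Lemma continuous_measurableV (f : V R -> R) : continuous f -> measurable_fun setT f.
Proof.
move=> cf.
have h := @measurable_caratheodoryV _ R (fun _ => f) (fun v => measurable_cst _) (fun=> cf).
exact: (measurableT_comp h (pair1_measurable (0:R))).
Qed.

(* Convergence of vectors is spelled out coordinatewise, so that limits of the
   polynomial expressions below reduce to limits of real sequences. *)
Definition cvg3 (x : nat -> V R) (l : V R) : Prop :=
  [/\ (x n).1.1 @[n --> \oo] --> l.1.1, (x n).1.2 @[n --> \oo] --> l.1.2 &
      (x n).2 @[n --> \oo] --> l.2].

Lemma continuous_cvg3 (f : V R -> R) x l : continuous f -> cvg3 x l ->
  f (x n) @[n --> \oo] --> f l.
Proof.
move=> cf [h1 h2 h3]; apply: (cvg_comp x f); last exact: cf.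
have : ((x n).1.1, (x n).1.2, (x n).2) @[n --> \oo] --> ((l.1.1, l.1.2), l.2).
  by apply: pair_cvg => //; exact: pair_cvg.
have -> : (fun n => ((x n).1.1, (x n).1.2, (x n).2)) = x.
  by apply/funext => n; case: (x n) => -[].
by case: l {h1 h2 h3} => -[].
Qed.

Lemma cvg3_continuous (f : V R -> R) :
  (forall x l, cvg3 x l -> f (x n) @[n --> \oo] --> f l) -> continuous f.
Proof.
move=> h l; apply/cvgrPdist_lt => e e0.
apply: contrapT => hn.
have hx n : exists x : V R, ball l (n.+1%:R^-1 : R) x /\ e <= `|f l - f x|.
  apply: contrapT => hN; apply: hn; apply/(@nbhs_ballP R (R * R * R)%type); exists n.+1%:R^-1 => //=.
  move=> x xl; rewrite ltNge; apply/negP => hx.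
  by apply: hN; exists x.
have [x hxl] := choice hx.
have xl : cvg3 x l.
  suff P (g : V R -> R) : (forall a b d, ball a d b -> `|g a - g b| < d) ->
      g (x n) @[n --> \oo] --> g l.
    by split; [apply: (P (fun v => v.1.1))|apply: (P (fun v => v.1.2))
      |apply: (P snd)] => a b d [] // [].
  move=> hg; apply/cvgrPdist_lt => d d0; near=> n.
  apply: (lt_trans (hg _ _ _ (hxl n).1)).
  by near: n; exact: (near_infty_natSinv_lt (PosNum d0)).
have /cvgrPdist_lt/(_ e e0) := h x l xl.
case=> N _ /(_ N (leqnn N)) /=.
by rewrite ltNge (hxl N).2.
Unshelve. all: by end_near. Qed.

End ContinuityMeasurability.

(** * One-dimensional integrals behind the areas of discs and slices *)

Section Areas.
Variable R : realType.
Local Notation lebesgue := (@lebesgue_measure R).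

Lemma lam_integral_ge0 (D : set R) (f : R -> \bar R) : measurable D ->
  measurable_fun setT f -> (forall x, D x -> 0 <= f x)%E ->
  (\int[lam R]_(x in D) f x = \int[lebesgue]_(x in D) f x)%E.
Proof.
move=> mD mf f0; rewrite integral_mkcond [RHS]integral_mkcond.
have [_ h] := scales_lam_id R.
rewrite (h (f \_ D)) ?mul1e//.
  by apply/(measurable_restrictT f) => //; exact: measurable_funS mf.
by move=> x; rewrite patchE; case: ifPn => // /set_mem; exact: f0.
Qed.

Lemma smooth_FTC2 (f F : R -> R) (a b : R) : a <= b -> continuous f ->
  (forall x, a <= x <= b -> 0 <= f x) -> (forall x : R, is_derive x (1 : R) F (f x)) ->
  (\int[lam R]_(x in `[a, b]) (f x)%:E)%E = (F b - F a)%:E.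
Proof.
move=> ab cf f0 dF; have mf : measurable_fun setT (EFin \o f).
  by apply/measurable_EFinP; exact: continuous_measurable_fun.
rewrite (lam_integral_ge0 (measurable_itv _) mf); last first.
  by move=> x; rewrite /= in_itv/= lee_fin; exact: f0.
move: ab; rewrite le_eqVlt => /predU1P[->|ab].
  by rewrite set_itv1 integral_set1 subrr.
have cF x : {for x, continuous F}.
  by apply: differentiable_continuous; apply/derivable1_diffP; case: (dF x).
have dF' : {in `]a, b[, F^`()%classic =1 f}.
  by move=> x _; rewrite derive1E; have -> := @derive_val _ _ _ _ _ _ _ (dF x).
rewrite (continuous_FTC2 (F := F) ab _ _ dF') ?EFinB//.
  exact: continuous_subspaceT.
split; first by move=> x _; case: (dF x).
  by apply: cvg_at_right_filter; exact: cF.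
by apply: cvg_at_left_filter; exact: cF.
Qed.

Lemma integral_quadratic (a b c d : R) : a <= b ->
  (forall x, a <= x <= b -> 0 <= c + d * x ^+ 2) ->
  (\int[lam R]_(x in `[a, b]) (c + d * x ^+ 2)%:E)%E =
  (c * (b - a) + d * (b ^+ 3 - a ^+ 3) / 3)%:E.
Proof.
move=> ab h0.
have cf : continuous (fun x : R => c + d * x ^+ 2).
  move=> x; apply: cvgD; first exact: cvg_cst.
  by apply: cvgM; [exact: cvg_cst|exact: exprn_continuous].
have dF (x : R) : is_derive x (1 : R) (fun x => c * x + d * x ^+ 3 / 3) (c + d * x ^+ 2).
  by apply: is_derive_eq; rewrite /GRing.scale/=; field.
by rewrite (smooth_FTC2 ab cf h0 dF); congr (_%:E); ring.
Qed.

(** The substitution [x = sin t] turns the integrand into [2 cos^2 t], with primitive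
    [t + sin t cos t]. *)
Lemma integral_disc :
  (\int[lam R]_(x in `[(-1)%R, 1%R]) (2 * Num.sqrt (1 - x ^+ 2))%:E)%E = pi%:E.
Proof.
have pi0 : (0:R) < pi := pi_gt0 R.
have cG : continuous (fun x : R => 2 * Num.sqrt (1 - x ^+ 2)).
  move=> x; apply: cvgM; first exact: cvg_cst.
  apply: (cvg_comp (fun x : R => 1 - x ^+ 2) Num.sqrt); last exact: sqrt_continuous.
  by apply: cvgB; [exact: cvg_cst|exact: exprn_continuous].
have mG : measurable_fun setT (fun x : R => (2 * Num.sqrt (1 - x ^+ 2))%:E).
  by apply/measurable_EFinP; exact: continuous_measurable_fun.
rewrite (lam_integral_ge0 (measurable_itv _) mG); last first.
  by move=> x _; rewrite lee_fin mulr_ge0.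
have ppi : - (pi / 2) < pi / 2 :> R by lra.
have dsin : (sin : R -> R)^`()%classic = cos.
  by apply/funext => x; rewrite derive1E; have -> := @derive_val _ _ _ _ _ _ _ (is_derive_sin x).
have csin : continuous (sin : R -> R) := @continuous_sin R.
have ccos : continuous (cos : R -> R) := @continuous_cos R.
have := @integration_by_substitution_increasing R sin
  (fun x => 2 * Num.sqrt (1 - x ^+ 2)) (- (pi / 2)) (pi / 2) (ltW ppi).
rewrite sinN sin_pihalf dsin => ->; last first.
- exact: continuous_subspaceT.
- split; first by move=> x _.
    by apply: cvg_at_right_filter; exact: csin.
  by apply: cvg_at_left_filter; exact: csin.
- by apply/cvg_ex; eexists; apply: cvg_at_left_filter; exact: ccos.
- by apply/cvg_ex; eexists; apply: cvg_at_right_filter; exact: ccos.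
- by move=> x _; exact: ccos.
- by move=> x y xI yI xy; rewrite ltr_sin.
have h (x : R) : - (pi / 2) <= x <= pi / 2 -> 0 <= 2 * cos x ^+ 2.
  by move=> _; rewrite mulr_ge0// sqr_ge0.
have ch : continuous (fun x : R => 2 * cos x ^+ 2).
  move=> x; apply: cvgM; first exact: cvg_cst.
  by apply: cvgM; exact: ccos.
transitivity (\int[lam R]_(x in `[(- (pi / 2))%R, (pi / 2)%R]) (2 * cos x ^+ 2)%:E)%E.
  have mh : measurable_fun setT (fun x : R => (2 * cos x ^+ 2)%:E).
    by apply/measurable_EFinP; exact: continuous_measurable_fun.
  rewrite (lam_integral_ge0 (measurable_itv _) mh); last first.
    by move=> x _; rewrite lee_fin mulr_ge0// sqr_ge0.
  apply: eq_integral => x; rewrite inE/= in_itv/= => xI.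
  transitivity ((2 * Num.sqrt (1 - sin x ^+ 2) * cos x)%:E); first by [].
  rewrite -cos2sin2 sqrtr_sqr ger0_norm ?cos_ge0_pihalf//.
  by congr (_%:E); rewrite -mulrA.
have dF (x : R) : is_derive x (1 : R) (fun x => x + sin x * cos x) (2 * cos x ^+ 2).
  apply: is_derive_eq; rewrite /GRing.scale/=.
  by have := cos2Dsin2 x; nra.
rewrite (smooth_FTC2 (ltW ppi) ch h dF) sinN cosN sin_pihalf cos_pihalf.
by congr (_%:E); lra.
Qed.

End Areas.

(** * Euclidean geometry and measurability of the vector operations *)

Section Vectors.
Variable R : realType.
Implicit Types u v w : V R.

Lemma eqV u v : u.1.1 = v.1.1 -> u.1.2 = v.1.2 -> u.2 = v.2 -> u = v.
Proof. by case: u => [[? ?] ?]; case: v => [[? ?] ?] /= -> -> ->. Qed.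

Lemma ler_sqr_imp (a b : R) : 0 <= b -> a ^+ 2 <= b ^+ 2 -> a <= b.
Proof. by move=> b0 h; case: (leP a b) => // ab; nra. Qed.

Lemma dotV_ge0 v : 0 <= dotV v v.
Proof. by rewrite /dotV -!expr2 !addr_ge0// sqr_ge0. Qed.

Lemma dotVC u v : dotV u v = dotV v u.
Proof. by rewrite /dotV; ring. Qed.

Lemma enorm_ge0 v : 0 <= enorm v.
Proof. exact: sqrtr_ge0. Qed.

Lemma sqr_enorm v : enorm v ^+ 2 = dotV v v.
Proof. by rewrite sqr_sqrtr// dotV_ge0. Qed.

Lemma dotV_eq0 v : (dotV v v == 0) = (v == ((0, 0), 0)).
Proof.
apply/eqP/eqP => [|->]; last by rewrite /dotV/=; ring.
case: v => [[a b] c]; rewrite /dotV/= => h.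
by apply: eqV => /=; nra.
Qed.

Lemma enorm_eq0 v : (enorm v == 0) = (v == ((0, 0), 0)).
Proof. by rewrite -dotV_eq0 -sqr_enorm sqrf_eq0. Qed.

Lemma enorm_gt0 v : (0 < enorm v) = (v != ((0, 0), 0)).
Proof. by rewrite lt_neqAle enorm_ge0 andbT eq_sym enorm_eq0. Qed.

Lemma dotVDl u v w : dotV (addV u v) w = dotV u w + dotV v w.
Proof. by rewrite /dotV/=; ring. Qed.

Lemma dotVZl a u w : dotV (scaleV a u) w = a * dotV u w.
Proof. by rewrite /dotV/=; ring. Qed.

Lemma dotVZr a u w : dotV u (scaleV a w) = a * dotV u w.
Proof. by rewrite /dotV/=; ring. Qed.

Lemma enormZ a v : enorm (scaleV a v) = `|a| * enorm v.
Proof.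
rewrite /enorm dotVZl dotVZr mulrA -expr2 sqrtrM ?sqr_ge0//.
by rewrite sqrtr_sqr.
Qed.

Lemma enormN v : enorm (scaleV (-1) v) = enorm v.
Proof. by rewrite enormZ normrN1 mul1r. Qed.

Lemma cauchy_schwarzV u v : `|dotV u v| <= enorm u * enorm v.
Proof.
rewrite -(@ler_pXn2r _ 2)// ?nnegrE ?mulr_ge0 ?enorm_ge0//.
rewrite -normrX ger0_norm ?sqr_ge0// exprMn !sqr_enorm.
case: u => [[a b] c]; case: v => [[x y] z]; rewrite /dotV/=.
rewrite -subr_ge0 [leRHS](_ : _ = (a * y - b * x) ^+ 2 + (a * z - c * x) ^+ 2 +
  (b * z - c * y) ^+ 2); last by ring.
by rewrite !addr_ge0// sqr_ge0.
Qed.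

Lemma ler_enormD u v : enorm (addV u v) <= enorm u + enorm v.
Proof.
rewrite -(@ler_pXn2r _ 2)// ?nnegrE ?addr_ge0 ?enorm_ge0//.
rewrite sqr_enorm sqrrD !sqr_enorm dotVDl ![dotV _ (addV _ _)]dotVC !dotVDl.
have := cauchy_schwarzV u v; rewrite (dotVC v u).
have := ler_norm (dotV u v); lra.
Qed.

Lemma ler_coord_enorm v : [/\ `|v.1.1| <= enorm v, `|v.1.2| <= enorm v &
  `|v.2| <= enorm v].
Proof.
have h (x : R) : x ^+ 2 <= dotV v v -> `|x| <= enorm v.
  move=> xv; rewrite -sqrtr_sqr; exact: ler_wsqrtr.
by split; apply: h; rewrite /dotV -!expr2; case: v => [[a b] c]/=;
  have := sqr_ge0 a; have := sqr_ge0 b; have := sqr_ge0 c; lra.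
Qed.

Lemma measurable_c1 : measurable_fun setT (fun v : V R => v.1.1).
Proof. exact: (measurableT_comp measurable_fst). Qed.

Lemma measurable_c2 : measurable_fun setT (fun v : V R => v.1.2).
Proof. exact: (measurableT_comp measurable_snd). Qed.

Lemma measurable_c3 : measurable_fun setT (fun v : V R => v.2).
Proof. exact: measurable_snd. Qed.

Lemma measurable_toV d (T : measurableType d) (f : T -> V R) :
  measurable_fun setT (fun t => (f t).1.1) ->
  measurable_fun setT (fun t => (f t).1.2) ->
  measurable_fun setT (fun t => (f t).2) -> measurable_fun setT f.
Proof.
move=> h1 h2 h3.
have -> : f = fun t => (((f t).1.1, (f t).1.2), (f t).2).
  by apply/funext => t; apply: eqV.
by apply: measurable_fun_pair => //; exact: measurable_fun_pair.
Qed.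

(** Pointwise limit of the continuous functions [x / (x^2 + 1 / (n + 1))]; at [0] they all vanish,
    in agreement with [0^-1 = 0]. *)
Lemma measurable_invr : measurable_fun setT (@GRing.inv R).
Proof.
apply: (measurable_fun_cvg (h := fun n (x : R) => x / (x ^+ 2 + n.+1%:R^-1))).
  move=> n; apply: continuous_measurable_fun => x.
  apply: cvgM => //; apply: cvgV.
    by rewrite gt_eqF// ltr_wpDl ?sqr_ge0// invr_gt0 ltr0n.
  by apply: cvgD; [exact: exprn_continuous|exact: cvg_cst].
move=> x _.
have [->|x0] := eqVneq x 0.
  by under eq_fun do rewrite mul0r; rewrite invr0; exact: cvg_cst.
have -> : x^-1 = x * (x ^+ 2 + 0)^-1 by field.
apply: cvgM; first exact: cvg_cst.
apply: cvgV; first by rewrite addr0 sqrf_eq0.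
by apply: cvgD; [exact: cvg_cst|exact: cvg_harmonic].
Qed.

Section MeasurableOps.
Context d (T : measurableType d).
Implicit Types f g : T -> V R.

Lemma measurable_coords f : measurable_fun setT f ->
  [/\ measurable_fun setT (fun t => (f t).1.1),
   measurable_fun setT (fun t => (f t).1.2) & measurable_fun setT (fun t => (f t).2)].
Proof.
by split; [exact: (measurableT_comp measurable_c1)|
  exact: (measurableT_comp measurable_c2)|exact: (measurableT_comp measurable_c3)].
Qed.

Lemma measurable_addV f g : measurable_fun setT f -> measurable_fun setT g ->
  measurable_fun setT (fun t => addV (f t) (g t)).
Proof.
move=> /measurable_coords[? ? ?] /measurable_coords[? ? ?].
by apply: measurable_toV => /=; exact: measurable_funD.
Qed.

Lemma measurable_scaleV (a : T -> R) f : measurable_fun setT a ->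
  measurable_fun setT f -> measurable_fun setT (fun t => scaleV (a t) (f t)).
Proof.
move=> ? /measurable_coords[? ? ?].
by apply: measurable_toV => /=; exact: measurable_funM.
Qed.

Lemma measurable_subV f g : measurable_fun setT f -> measurable_fun setT g ->
  measurable_fun setT (fun t => subV (f t) (g t)).
Proof. by move=> ? ?; apply: measurable_addV => //; exact: measurable_scaleV. Qed.

Lemma measurable_dotV f g : measurable_fun setT f -> measurable_fun setT g ->
  measurable_fun setT (fun t => dotV (f t) (g t)).
Proof.
move=> /measurable_coords[? ? ?] /measurable_coords[? ? ?]; rewrite /dotV.
by do 2?[apply: measurable_funD]; exact: measurable_funM.
Qed.

Lemma measurable_enorm f : measurable_fun setT f ->
  measurable_fun setT (fun t => enorm (f t)).
Proof.
move=> mf; have ms : measurable_fun setT (@Num.sqrt R).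
  by apply: continuous_measurable_fun; exact: sqrt_continuous.
exact: (measurableT_comp ms (measurable_dotV mf mf)).
Qed.

Lemma measurable_inv (a : T -> R) : measurable_fun setT a ->
  measurable_fun setT (fun t => (a t)^-1).
Proof. exact: (measurableT_comp measurable_invr). Qed.

End MeasurableOps.

Lemma measurable_unit_ball : measurable [set v : V R | enorm v <= 1].
Proof.
have := measurable_enorm (@measurable_id _ (V R) setT).
move=> /(_ measurableT _ (measurable_itv `]-oo, 1])).
by rewrite setTI.
Qed.

End Vectors.

(** * Volumes by slices and Archimedes' hat-box theorem *)

Section Slices.
Context d1 d2 (T1 : measurableType d1) (T2 : measurableType d2) (R : realType).
Variables (m1 : {sigma_finite_measure set T1 -> \bar R})
          (m2 : {sigma_finite_measure set T2 -> \bar R}).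

Lemma sprod_xsection (A : set (T1 * T2)) : measurable A ->
  (sprod m1 m2 A = \int[m1]_x m2 (xsection A x))%E.
Proof. by []. Qed.

Lemma sprod_ysection (A : set (T1 * T2)) : measurable A ->
  (sprod m1 m2 A = \int[m2]_y m1 (ysection A y))%E.
Proof.
move=> mA; rewrite /sprod/= (@product_measure_unique _ _ _ _ _ m1 m2 (m1 \x^ m2)%E)//.
by move=> B C mB mC; exact: product_measure2E.
Qed.

Lemma scales_measure (phi : T1 -> T2) (k : R) (A : set T2) :
  scales m1 m2 phi k -> measurable A -> (m1 (phi @^-1` A) = k%:E * m2 A)%E.
Proof.
move=> [mphi h] mA.
have mpA : measurable (phi @^-1` A) by rewrite -[X in measurable X]setTI; exact: mphi.
rewrite -{2}(setIT A) -(integral_indic m2 measurableT mA) -(h (fun x => (\1_A x)%:E)).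
- by rewrite -[in LHS](setIT (phi @^-1` A)) -integral_indic.
- exact/measurable_EFinP.
- by move=> x; rewrite lee_fin.
Qed.

End Slices.

Section Archimedes.
Variable R : realType.
Local Notation lam2 := (sprod (lam R) (lam R)).

Lemma lam_itv (i : interval R) : lam R [set` i] =
  (if (i.1 < i.2)%E then (i.2 - i.1)%E else 0).
Proof. by rewrite lamE lebesgue_measure_itv. Qed.

Lemma measurable_sublevel d (T : measurableType d) (f g : T -> R) :
  measurable_fun setT f -> measurable_fun setT g -> measurable [set x | f x <= g x].
Proof.
move=> mf mg.
have := measurable_funB mg mf measurableT (measurable_itv `[0, +oo[).
rewrite setTI => h.
have -> : [set x | f x <= g x] = (fun x => g x - f x) @^-1` `[0, +oo[.
  by apply/seteqP; split=> x /=; rewrite in_itv/= andbT subr_ge0.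
exact: h.
Qed.

Let sq (p : R * R) : R := p.1 ^+ 2 + p.2 ^+ 2.

Let measurable_sq : measurable_fun setT sq.
Proof.
by apply: measurable_funD; apply: measurable_funX.
Qed.

(** The unit disc is sliced into segments; a disc of positive radius is its image under a dilation,
    and the degenerate disc is treated apart. *)
Lemma disc_area (r : R) : 0 <= r -> lam2 [set p | p.1 ^+ 2 + p.2 ^+ 2 <= r] = (pi * r)%:E.
Proof.
have md r' : measurable [set p | sq p <= r'] by exact: measurable_sublevel.
have unit : lam2 [set p | sq p <= 1] = pi%:E.
  rewrite sprod_xsection// -integral_disc.
  transitivity (\int[lam R]_x (2 * Num.sqrt (1 - x ^+ 2))%:E)%E.
    apply: eq_integral => x _.
    have -> : xsection [set p | sq p <= 1] x =
        (if x ^+ 2 <= 1 then `[- Num.sqrt (1 - x ^+ 2), Num.sqrt (1 - x ^+ 2)]%classic else set0).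
      rewrite xsectionE; apply/seteqP; split=> y; rewrite /sq/=.
        case: ifPn => [x1|] h.
          rewrite /= in_itv/= -ler_norml -sqrtr_sqr ler_wsqrtr//; lra.
        by have := sqr_ge0 y; lra.
      case: ifPn => [x1|//]; rewrite /= in_itv/= -ler_norml => h.
      have := h; rewrite -(@ler_pXn2r _ 2)// ?nnegrE// sqr_sqrtr ?subr_ge0//.
      rewrite -normrX ger0_norm ?sqr_ge0//; lra.
    case: ifPn => x1.
      rewrite lam_itv/= lte_fin.
      have s0 := sqrtr_ge0 (1 - x ^+ 2).
      case: ifPn => h; first by rewrite -EFinD; congr (_%:E); lra.
      by congr (_%:E); lra.
    by rewrite measure0 ler0_sqrtr ?mulr0//; lra.
  rewrite [RHS]integral_mkcond; apply: eq_integral => x _; rewrite patchE.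
  case: ifPn => // /negP; rewrite inE/= in_itv/= -ler_norml => h.
  rewrite ler0_sqrtr ?mulr0// subr_le0; move/negP: h; rewrite -ltNge => h.
  by rewrite -(normr_idP (sqr_ge0 x)) normrX expr_ge1// ltW.
rewrite le_eqVlt => /predU1P[<-|r0].
  rewrite mulr0 sprod_xsection; last exact: md.
  rewrite -[RHS](integral0 (lam R) setT); apply: eq_integral => x _.
  have -> : xsection [set p | sq p <= 0] x = if x == 0 then [set 0] else set0.
    rewrite xsectionE /sq; apply/seteqP; split=> y /=.
      move=> h; have := sqr_ge0 x; have := sqr_ge0 y => ? ?.
      have -> : x = 0 by nra.
      by rewrite eqxx /=; nra.
    by case: eqP => // -> ->; rewrite expr0n/= addr0.
  by case: ifP => _; [rewrite lamE lebesgue_measure_set1|exact: measure0].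
set l := Num.sqrt r.
have l0 : 0 < l by rewrite sqrtr_gt0.
have l0' : 0 < l^-1 by rewrite invr_gt0.
have l0'' : 0 <= l^-1^-1 by rewrite invr_ge0 ltW.
have h : scales lam2 lam2 _ _ := scales_prod l0'' l0''
  (scales_lam 0 l0') (scales_lam 0 l0').
have <- : (fun p : R * R => (l^-1 * p.1 + 0, l^-1 * p.2 + 0)) @^-1` [set p | sq p <= 1]
    = [set p | sq p <= r].
  have lr : r = l ^+ 2 by rewrite sqr_sqrtr// ltW.
  apply/seteqP; split=> p; rewrite /sq /= !addr0 !exprMn -mulrDr exprVn -lr;
    by rewrite mulrC ler_pdivrMr// mul1r.
have E := scales_measure h (md 1).
apply: (etrans E).
by rewrite unit -EFinM invrK -expr2 sqr_sqrtr ?(ltW r0)// mulrC.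
Qed.

(** The part of the unit ball in the double cone of directions whose angle with the third axis has
    cosine at least [t] in absolute value, for [t >= 0], the apex being removed. *)
Let cap (t : R) : set (V R) :=
  [set v | [/\ dotV v v <= 1, t ^+ 2 * dotV v v <= v.2 ^+ 2 & v != ((0, 0), 0)]].

Let measurable_cap t : measurable (cap t).
Proof.
have mv := @measurable_id _ (V R) setT.
have md := measurable_dotV mv mv.
have -> : cap t = [set v | dotV v v <= 1] `&` [set v | t ^+ 2 * dotV v v <= v.2 ^+ 2]
    `&` ~` [set v | dotV v v <= 0].
  apply/seteqP; split=> v /= => [[h1 h2 v0]|[[h1 h2] /negP v0]].
    split=> //; apply/negP; rewrite -ltNge lt_neqAle dotV_ge0 andbT eq_sym.
    by rewrite dotV_eq0.
  split=> //; apply: contraNN v0 => /eqP ->.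
  by rewrite /dotV/= !mulr0 !addr0.
apply: measurableI; first apply: measurableI.
- exact: measurable_sublevel.
- apply: measurable_sublevel; first exact: measurable_funM.
  by apply: measurable_funX; exact: measurable_c3.
- by apply: measurableC; exact: measurable_sublevel.
Qed.

(** Cavalieri: at height [z] the slice is a disc of the cone when [|z| <= t] and a disc of the ball
    when [t < |z| <= 1]. *)
Lemma mu3_cap t : 0 < t <= 1 -> mu3 R (cap t) = (4 / 3 * pi * (1 - t))%:E.
Proof.
move=> /andP[t0 t1].
have pi0 : (0 : R) < pi := pi_gt0 R.
have mq (c d : R) : measurable_fun setT (fun z : R => (c + d * z ^+ 2)%:E).
  apply/measurable_EFinP; apply: measurable_funD => //.
  by apply: measurable_funM => //; exact: measurable_funX.
(* On the boundary of the cone at height [z] the squared distance to the origin is [k z^2]. *)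
pose k := t ^- 2.
have k1 : 1 <= k by rewrite invr_ge1 ?unitfE ?sqrf_eq0 ?gt_eqF// ?exprn_gt0// ?expr_le1// ltW.
have kt : k * t ^+ 2 = 1 by rewrite mulVf// sqrf_eq0 gt_eqF.
pose S z := lam2 (ysection (cap t) z).
have ycapE z : ysection (cap t) z = [set p | [/\ sq p + z ^+ 2 <= 1,
    t ^+ 2 * (sq p + z ^+ 2) <= z ^+ 2 & (p, z) != ((0, 0), 0)]].
  by rewrite ysectionE /cap; apply/seteqP; split=> p /=; rewrite /dotV /sq/= -!expr2.
have sq0 p : 0 <= sq p by rewrite addr_ge0// sqr_ge0.
have S1 z : z ^+ 2 <= t ^+ 2 -> S z = (pi * (k - 1) * z ^+ 2)%:E.
  move=> zt; rewrite /S ycapE; have [->|z0] := eqVneq z 0.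
    rewrite [0 ^+ 2]expr2 !mulr0; set A := [set _ | _]; have -> : A = set0.
      apply/seteqP; split=> // -[x y] [_ /= + /eqP].
      rewrite /sq/= addr0 pmulr_rle0 ?exprn_gt0// => h; case.
      by have := sqr_ge0 x; have := sqr_ge0 y => ? ?; congr (_, _, _); nra.
    exact: measure0.
  have z2 : 0 < z ^+ 2 by rewrite exprn_even_gt0.
  have kz : 0 <= (k - 1) * z ^+ 2 by apply: mulr_ge0; [rewrite subr_ge0|exact: ltW].
  rewrite -mulrA -(disc_area kz).
  congr (lam2 _); apply/seteqP; split=> p /=; rewrite -/(sq p).
    move=> [_ h _]; suff : sq p + z ^+ 2 <= k * z ^+ 2 by lra.
    by rewrite -[leLHS]mul1r -kt -mulrA ler_wpM2l//; lra.
  move=> h; split.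
  - apply: (@le_trans _ _ (k * z ^+ 2)); first by lra.
    by rewrite -kt ler_wpM2l//; lra.
  - apply: (@le_trans _ _ (t ^+ 2 * (k * z ^+ 2))).
      by apply: ler_wpM2l; [exact: sqr_ge0|lra].
    by rewrite mulrA (mulrC _ k) kt mul1r.
  - by apply/eqP => -[_ zz]; rewrite zz eqxx in z0.
have S2 z : t ^+ 2 < z ^+ 2 -> z ^+ 2 <= 1 -> S z = (pi * (1 - z ^+ 2))%:E.
  move=> zt z1; have kz : 0 <= 1 - z ^+ 2 by rewrite subr_ge0.
  rewrite /S ycapE -(disc_area kz).
  congr (lam2 _); apply/seteqP; split=> p /=; rewrite -/(sq p).
    by move=> [h _ _]; lra.
  move=> h; split; first by lra.
  - have t2 := sqr_ge0 t; have : sq p + z ^+ 2 <= 1 by lra.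
    by have := sq0 p; nra.
  - by apply/eqP => -[_ zz]; move: zt; rewrite zz expr0n/= ltNge sqr_ge0.
have S3 z : 1 < z ^+ 2 -> S z = 0%E.
  move=> z1; rewrite /S ycapE; set A := [set _ | _]; have -> : A = set0.
    by apply/seteqP; split=> // p [h _ _]; have := sq0 p; lra.
  exact: measure0.
rewrite [LHS]sprod_ysection; last exact: measurable_cap.
have mS : measurable_fun setT S.
  by apply: measurable_fun_ysection; exact: measurable_cap.
have i1 : (\int[lam R]_(z in `[(- t)%R, t]) (pi + (- pi * k) * z ^+ 2)%:E = (4 / 3 * pi * t)%:E)%E.
  rewrite integral_quadratic; last 2 first.
  - lra.
  - move=> z zt; have : `|z| <= t by rewrite ler_norml.
    rewrite -(@ler_pXn2r _ 2)// ?nnegrE ?(ltW t0)// -normrX ger0_norm ?sqr_ge0// => h.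
    have : k * z ^+ 2 <= 1 by rewrite -kt ler_wpM2l//; lra.
    move=> ?; have -> : pi + - pi * k * z ^+ 2 = pi * (1 - k * z ^+ 2) by ring.
    by rewrite mulr_ge0 ?subr_ge0// ltW.
  have kt3 : k * t ^+ 3 = t by rewrite exprS mulrCA kt mulr1.
  congr (_%:E); transitivity (pi * (2 * t) - 2 / 3 * pi * (k * t ^+ 3)); first by field.
  by rewrite kt3; field.
have i2 : (\int[lam R]_(z in `[(- 1)%R, 1%R]) (pi + (- pi) * z ^+ 2)%:E = (4 / 3 * pi)%:E)%E.
  rewrite integral_quadratic; last 2 first.
  - lra.
  - move=> z zt; have : `|z| <= 1 by rewrite ler_norml.
    rewrite -(@ler_pXn2r _ 2)// ?nnegrE// -normrX ger0_norm ?sqr_ge0// expr1n => h.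
    have -> : pi + - pi * z ^+ 2 = pi * (1 - z ^+ 2) by ring.
    by rewrite mulr_ge0 ?subr_ge0// ltW.
  by congr (_%:E); lra.
(* For [|z| <= t] the part of the ball outside the cone has slices of area [pi (1 - k z^2)]; adding
   them to those of the cone restores the whole ball and avoids integrating over two ranges of
   heights. *)
have h : (\int[lam R]_z S z + (4 / 3 * pi * t)%:E = (4 / 3 * pi)%:E)%E.
  rewrite -i1 -i2 [X in (_ + X)%E]integral_mkcond [in RHS]integral_mkcond -ge0_integralD//.
  - apply: eq_integral => z _; rewrite !patchE !mem_setE/= !in_itv/= -!ler_norml.
    have hn (a : R) : 0 <= a -> (`|z| <= a) = (z ^+ 2 <= a ^+ 2).
      by move=> a0; rewrite -(@ler_pXn2r _ 2)// ?nnegrE// -normrX ger0_norm ?sqr_ge0.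
    rewrite (hn t (ltW t0)) (hn 1)// expr1n.
    have t2 : t ^+ 2 <= 1 by rewrite expr_le1// ltW.
    case: (leP (z ^+ 2) (t ^+ 2)) => zt.
      by rewrite S1// (le_trans zt t2) -EFinD; congr (_%:E); ring.
    case: (leP (z ^+ 2) 1) => z1.
      by rewrite S2// adde0; congr (_%:E); ring.
    by rewrite S3// adde0.
  - move=> z _; rewrite patchE; case: ifPn => //.
    rewrite mem_setE/= in_itv/= -ler_norml lee_fin => zt.
    have : `|z| ^+ 2 <= t ^+ 2 by rewrite ler_pXn2r// nnegrE// ltW.
    rewrite -normrX ger0_norm ?sqr_ge0// => h.
    have : k * z ^+ 2 <= 1 by rewrite -kt ler_wpM2l//; lra.
    move=> ?; have -> : pi + - pi * k * z ^+ 2 = pi * (1 - k * z ^+ 2) by ring.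
    by rewrite mulr_ge0 ?subr_ge0// ltW.
  - have m := mq pi (- pi * k).
    apply/(measurable_restrictT (fun z : R => (pi + - pi * k * z ^+ 2)%:E)) => //.
    exact: measurable_funTS m.
have : (\int[lam R]_z S z = (4 / 3 * pi)%:E - (4 / 3 * pi * t)%:E)%E.
  by rewrite -h addeK.
by move=> ->; rewrite -EFinB; congr (_%:E); ring.
Qed.


Lemma mem_itvNr (a z : R) : 0 <= a ->
  (z \in `[(- a)%R, a]%classic) = (z ^+ 2 <= a ^+ 2).
Proof.
move=> a0; rewrite mem_setE/= in_itv/= -ler_norml.
by rewrite -(@ler_pXn2r _ 2)// ?nnegrE// -normrX ger0_norm ?sqr_ge0.
Qed.

Lemma enorm_le1 (v : V R) : (enorm v <= 1) = (dotV v v <= 1).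
Proof. by rewrite -sqr_enorm expr_le1// enorm_ge0. Qed.

Lemma mu3_unit_ball : mu3 R [set v | enorm v <= 1] = (4 / 3 * pi)%:E.
Proof.
have pi0 : (0 : R) < pi := pi_gt0 R.
have mB := @measurable_unit_ball R.
rewrite [LHS]sprod_ysection//.
transitivity (\int[lam R]_(z in `[(- 1)%R, 1%R]) (pi + (- pi) * z ^+ 2)%:E)%E.
  rewrite [RHS]integral_mkcond; apply: eq_integral => z _.
  rewrite patchE mem_itvNr// expr1n.
  have -> : ysection [set v : V R | enorm v <= 1] z = [set p | sq p <= 1 - z ^+ 2].
    rewrite ysectionE; apply/seteqP.
    by split=> p /=; rewrite enorm_le1 /dotV /sq/= -!expr2; lra.
  case: (leP (z ^+ 2) 1) => z1.
    by rewrite disc_area ?subr_ge0//; congr (_%:E); ring.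
  set A := [set _ | _]; have -> : A = set0.
    apply/seteqP; split=> // p; rewrite /A/= /sq.
    by have := sqr_ge0 p.1; have := sqr_ge0 p.2; lra.
  exact: measure0.
rewrite integral_quadratic; last 2 first.
- lra.
- move=> z zt; have : `|z| <= 1 by rewrite ler_norml.
  rewrite -(@ler_pXn2r _ 2)// ?nnegrE// -normrX ger0_norm ?sqr_ge0// expr1n => h.
  have -> : pi + - pi * z ^+ 2 = pi * (1 - z ^+ 2) by ring.
  by rewrite mulr_ge0 ?subr_ge0// ltW.
by congr (_%:E); lra.
Qed.

Let measurable_height : measurable_fun setT (fun v : V R => `|v.2| / enorm v).
Proof.
apply: measurable_funM; last exact/measurable_inv/measurable_enorm.
by apply: measurableT_comp => //; exact: measurable_c3.
Qed.

(** The height of a uniformly random direction is uniformly distributed. Both measures are compared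
    on the half-lines [[x, +oo[], which generate and are stable under intersection; the preimage of
    such a half-line in the ball is a [cap] when [0 < x <= 1]. *)
Lemma archimedes : scales (mrestr (mu3 R) (@measurable_unit_ball R))
  (mrestr (lam R) (measurable_itv `[0, 1])) (fun v => `|v.2| / enorm v) (4 / 3 * pi).
Proof.
set mB := @measurable_unit_ball R; set mI := measurable_itv _.
have pi43 : (0 : R) <= 4 / 3 * pi by rewrite mulr_ge0// pi_ge0.
have mphi := measurable_height.
have fin A : measurable A -> (mu3 R ((fun v : V R => (`|v.2| / enorm v)%R) @^-1` A `&`
    [set v | (enorm v <= 1)%R]) < +oo)%E.
  move=> mA; apply: (@le_lt_trans _ _ (mu3 R [set v | enorm v <= 1])).
    apply: le_measure; rewrite ?inE//.
    apply: measurableI => //.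
    by rewrite -[X in measurable X]setTI; exact: mphi.
  by rewrite mu3_unit_ball ltry.
pose M0 : {measure set (V R) -> \bar R} := mrestr (mu3 R) mB.
pose M1 : {measure set R -> \bar R} :=
  measure_function_pushforward__canonical__measure_function_Measure M0 mphi.
pose M2 : {measure set R -> \bar R} := mscale (NngNum pi43) (mrestr (lam R) mI).
apply: scales_preimage => // A mA.
suff : M1 A = M2 A by [].
pose G : set (set R) := [set A | exists x, A = `[x, +oo[%classic].
apply: (measure_unique G (fun n => `[- n%:R, +oo[%classic)) => //.
- exact: RGenCInfty.measurableE.
- move=> _ _ [x ->] [y ->]; exists (Num.max x y).
  by apply/seteqP; split=> r /=; rewrite !in_itv/= !andbT ge_max; [move=> []/= -> ->|move=> /andP[]].
- by move=> n; exists (- n%:R).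
- apply/seteqP; split=> // r _; exists (Num.truncn `|r|).+1 => //=.
  rewrite in_itv/= andbT lerNl (le_trans _ (ltW (truncnS_gt _)))//.
  by rewrite -normrN ler_norm.
- move=> _ [x ->].
  have M1E : M1 `[x, +oo[%classic =
      mu3 R ([set v | x <= `|v.2| / enorm v] `&` [set v | enorm v <= 1]).
    have Es : (fun v : V R => `|v.2| / enorm v) @^-1` `[x, +oo[%classic =
        [set v | x <= `|v.2| / enorm v].
      by apply/seteqP; split=> v /=; rewrite in_itv/= andbT.
    by rewrite -Es.
  have M2E : M2 `[x, +oo[%classic =
      ((4 / 3 * pi)%:E * lam R (`[x, +oo[%classic `&` `[0%R, 1%R]%classic))%E by [].
  rewrite M1E M2E.
  have [x0|x0] := leP x 0.
    rewrite (_ : _ `&` _ = [set v | enorm v <= 1]); last first.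
      apply/seteqP; split=> [v [//]|v /= v1]; split=> //.
      by rewrite (le_trans x0)// divr_ge0// enorm_ge0.
    rewrite mu3_unit_ball (_ : _ `&` _ = `[0%R, 1%R]%classic); last first.
      apply/seteqP; split=> [r [//]|r /=]; rewrite !in_itv/= andbT => /andP[r0 r1].
      by rewrite r0 r1 (le_trans x0).
    by rewrite lam_itv/= lte_fin ltr01 sube0 mule1.
  have [x1|x1] := leP x 1.
    rewrite (_ : _ `&` _ = cap x); last first.
      apply/seteqP; split=> v /=.
        move=> [h1 h2].
        (* At the origin the quotient is [0], by the convention [0^-1 = 0], hence below [x]. *)
        have v0 : v != (0, 0, 0).
          by apply: contraTneq h1 => ->; rewrite /= normr0 mul0r -ltNge.
        split=> //; first by rewrite -sqr_enorm expr_le1// enorm_ge0.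
        move: h1; rewrite ler_pdivlMr ?enorm_gt0// => h1.
        rewrite -sqr_enorm -exprMn -[leRHS](normr_idP (sqr_ge0 _)) normrX.
        by rewrite ler_pXn2r// nnegrE ?mulr_ge0 ?enorm_ge0// ltW.
      move=> [h1 h2 v0]; split; last by rewrite enorm_le1.
      rewrite ler_pdivlMr ?enorm_gt0// -ler_sqr ?nnegrE//.
        by rewrite exprMn sqr_enorm -normrX ger0_norm ?sqr_ge0.
      by rewrite mulr_ge0 ?enorm_ge0// ltW.
    rewrite mu3_cap ?x0//.
    rewrite (_ : _ `&` _ = `[x, 1]%classic); last first.
      apply/seteqP; split=> r /=; rewrite !in_itv/= andbT.
        by move=> [-> /andP[_ ->]].
      by move=> /andP[xr r1]; rewrite xr r1 (le_trans (ltW x0)).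
    rewrite lam_itv/= lte_fin.
    case: ltP => x1'; first by rewrite -EFinB -EFinM.
    have -> : x = 1 by apply/le_anti; rewrite x1.
    by rewrite subrr mulr0 mule0.
  rewrite (_ : _ `&` _ = set0); last first.
    apply/seteqP; split=> // v /= [h _].
    have [v0|v0] := eqVneq v (0, 0, 0).
      by move: h; rewrite v0/= normr0 mul0r leNgt x0.
    move: h; rewrite ler_pdivlMr ?enorm_gt0//; have [_ _ h] := ler_coord_enorm v.
    have : 0 < enorm v by rewrite enorm_gt0.
    by nra.
  rewrite measure0 (_ : _ `&` _ = set0) ?measure0 ?mule0//.
  apply/seteqP; split=> // r /=; rewrite !in_itv/= andbT => -[xr /andP[_ r1]].
  by have := le_trans xr r1; rewrite leNgt x1.
- by move=> k; apply: fin; exact: measurable_itv.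
Qed.

End Archimedes.

(** * Integrals with respect to a restricted measure *)

Section Restriction.
Context d (T : measurableType d) (R : realType).
Variables (mu : {measure set T -> \bar R}) (D : set T) (mD : measurable D).

Let mr : {measure set T -> \bar R} := mrestr mu mD.

Let mr_eq : mr (~` D) = 0%E.
Proof. by rewrite /mr /= /mrestr setICl measure0. Qed.

Let ae_mr (U : Type) (f g : T -> U) : (forall x, D x -> f x = g x) ->
  {ae mr, forall x, f x = g x}.
Proof.
move=> fg; exists (~` D); split; [exact: measurableC|exact: mr_eq|].
by move=> x /= h Dx; apply: h; exact: fg.
Qed.

Let integral_mr (f : T -> \bar R) : (\int[mr]_(x in D) f x = \int[mu]_(x in D) f x)%E.
Proof.
apply: eq_measure_integral => A mA AD.
by rewrite /mr /= /mrestr setIidl.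
Qed.

Let integral_mrT (f : T -> \bar R) : measurable_fun setT f ->
  (\int[mr]_x f x = \int[mu]_(x in D) f x)%E.
Proof.
move=> mf; rewrite -integral_mr [RHS]integral_mkcond.
have mfD : measurable_fun setT (f \_ D).
  by apply/(measurable_restrictT f) => //; exact: measurable_funTS.
apply: ae_eq_integral => //.
have h : {ae mr, forall x, f x = (f \_ D) x}.
  by apply: ae_mr => x Dx; rewrite patchE mem_set.
by apply: filterS h.
Qed.

Lemma L1_mrestr (f : T -> R) : measurable_fun setT f ->
  L1 (mrestr mu mD) f <-> L1 mu (f \_ D).
Proof.
move=> mf; have mfD : measurable_fun setT (f \_ D).
  by apply/(measurable_restrictT f) => //; exact: measurable_funTS.
have mf' := (measurable_EFinP setT f).2 mf.
rewrite /L1 -restrict_EFin -(integrable_mkcond _ mD).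
split=> /integrableP[_ h]; apply/integrableP; split.
- exact: measurable_funTS.
- by rewrite -(integral_mrT (f := abse \o (EFin \o f)))//; exact: measurableT_comp.
- by [].
- by rewrite (integral_mrT (f := abse \o (EFin \o f)))//; exact: measurableT_comp.
Qed.

Lemma Int_mrestr (f : T -> R) : measurable_fun setT f ->
  Int (mrestr mu mD) f = Int mu (f \_ D).
Proof.
move=> mf; rewrite /Int -Rintegral_mkcond /Rintegral; congr fine.
apply: integral_mrT; exact/measurable_EFinP.
Qed.

End Restriction.

(** * Linear isometries preserve Lebesgue measure *)

Section Isometries.
Variable R : realType.
Implicit Types (x y u v : V R) (T : V R -> V R).

(** These are the properties consumed by the proof of measure preservation, which goes through no
    matrix and no determinant. *)
Record isometryV T : Prop := IsometryV {
  isometryD : forall x y, T (addV x y) = addV (T x) (T y);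
  isometryZ : forall a x, T (scaleV a x) = scaleV a (T x);
  isometry_surj : forall y, exists x, T x = y;
  isometry_enorm : forall x, enorm (T x) = enorm x;
  isometry_measurable : measurable_fun setT T }.

Let ball (v : V R) : \bar R := (\1_[set v : V R | enorm v <= 1] v)%:E.

Let mball : measurable_fun setT ball.
Proof. by apply/measurable_EFinP/measurable_indic; exact: measurable_unit_ball. Qed.

Let ball0 v : (0 <= ball v)%E.
Proof. by rewrite lee_fin. Qed.

Let mu3_shift (g : V R -> \bar R) c : measurable_fun setT g ->
  (forall x, 0 <= g x)%E -> (\int[mu3 R]_x g (addV x c) = \int[mu3 R]_x g x)%E.
Proof.
move=> mg g0; have [_ /(_ g mg g0)] := scales_mu3 c (@ltr01 R).
rewrite invr1 expr1n mul1e => <-; apply: eq_integral => x _; congr g.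
by apply: eqV; rewrite /= mul1r.
Qed.

Let measurable_addV2 : measurable_fun setT (fun z : V R * V R => addV z.1 z.2).
Proof. exact: measurable_addV. Qed.

(* Haar's argument: the integral of [g (T x + y) * 1_ball y] over both variables
   is computed in either order. *)
Lemma isometry_preserving T : isometryV T -> scales (mu3 R) (mu3 R) T 1.
Proof.
move=> [TD TZ Ts Tn mT]; split=> // g mg g0; rewrite mul1e.
pose F (z : V R * V R) : \bar R := (g (addV (T z.1) z.2) * ball z.2)%E.
have mT1 : measurable_fun setT (fun z : V R * V R => T z.1).
  by apply: (measurableT_comp mT); exact: measurable_fst.
have mb2 : measurable_fun setT (fun z : V R * V R => ball z.2).
  by apply: (measurableT_comp mball); exact: measurable_snd.
have mF : measurable_fun setT F.
  apply: (@emeasurable_funM _ _ _ _ (fun z => g (addV (T z.1) z.2)) (fun z => ball z.2)) => //.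
  by apply: (measurableT_comp mg); exact: measurable_addV.
have F0 z : (0 <= F z)%E by rewrite mule_ge0.
have Ib : (\int[mu3 R]_x ball x = (4 / 3 * pi)%:E)%E.
  apply: (etrans (integral_indic (mu3 R) measurableT (@measurable_unit_ball R))).
  by rewrite setIT; exact: mu3_unit_ball.
have mgT : measurable_fun setT (g \o T) by exact: (measurableT_comp mg mT).
have pi43 : (0 : R) <= 4 / 3 * pi by rewrite mulr_ge0// pi_ge0.
have balle u v : enorm u = enorm v -> ball u = ball v.
  move=> h; rewrite /ball !indicE; congr ((nat_of_bool _)%:R%:E).
  by apply/idP/idP => /set_mem /= k; apply/mem_set; rewrite /= ?h// -h.
(* With [y = T s], linearity and preservation of the norm give [|y - T x| = |x - s|]: the integral
   is the volume of a translated ball. *)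
have IbT y : (\int[mu3 R]_x ball (addV y (scaleV (-1) (T x))) = \int[mu3 R]_x ball x)%E.
  have [s Es] := Ts y.
  have E x : ball (addV y (scaleV (-1) (T x))) = ball (addV x (scaleV (-1) s)).
    apply: balle; rewrite -(Tn (addV x _)) TD TZ Es -(enormN (addV y _)).
    by congr enorm; apply: eqV => /=; ring.
  by under eq_integral do rewrite E; exact: mu3_shift.
have mb (c : V R) : measurable_fun setT (fun y => ball (addV y c)).
  by apply: (measurableT_comp mball); exact: measurable_addV.
pose F' (z : V R * V R) : \bar R :=
  (g z.2 * ball (addV z.2 (scaleV (-1) (T z.1))))%E.
have mF' : measurable_fun setT F'.
  apply: (@emeasurable_funM _ _ _ _ (fun z => g z.2)
    (fun z => ball (addV z.2 (scaleV (-1) (T z.1))))).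
    by apply: (measurableT_comp mg); exact: measurable_snd.
  apply: (measurableT_comp mball); apply: measurable_addV => //.
  by apply: measurable_scaleV.
have F'0 z : (0 <= F' z)%E by rewrite mule_ge0.
have L : (\int[mu3 R]_x \int[mu3 R]_y F (x, y) = (4 / 3 * pi)%:E * \int[mu3 R]_x g x)%E.
  transitivity (\int[mu3 R]_x \int[mu3 R]_y F' (x, y))%E.
    apply: eq_integral => x _.
    rewrite -(@mu3_shift (fun y => F' (x, y)) (T x)) //; last first.
      exact: (measurableT_comp mF' (pair1_measurable x)).
    apply: eq_integral => y _; rewrite /F /F' /=.
    by congr (g _ * ball _)%E; apply: eqV => /=; ring.
  rewrite (fubini_tonelli _ mF' F'0).
  transitivity (\int[mu3 R]_y ((4 / 3 * pi)%:E * g y))%E; last first.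
    by rewrite ge0_integralZl// lee_fin.
  apply: eq_integral => y _; rewrite /F' /=.
  have mbx : measurable_fun setT (fun x => ball (addV y (scaleV (-1) (T x)))).
    apply: (measurableT_comp mball); apply: measurable_addV => //.
    by apply: measurable_scaleV.
  apply: (etrans (ge0_integralZl (mu3 R) measurableT mbx _ _)) => //.
  by rewrite IbT Ib muleC.
have Rr : (\int[mu3 R]_y \int[mu3 R]_x F (x, y) =
    (4 / 3 * pi)%:E * \int[mu3 R]_x g (T x))%E.
  transitivity (\int[mu3 R]_y ((\int[mu3 R]_x g (T x)) * ball y))%E; last first.
    by rewrite ge0_integralZl// ?Ib 1?muleC//; apply: integral_ge0 => x _; exact: g0.
  apply: eq_integral => y _; rewrite /F /=.
  have [s Es] := Ts y.
  have mgs : measurable_fun setT (fun x => g (addV (T x) y)).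
    by apply: (measurableT_comp mg); exact: measurable_addV.
  apply: (etrans (ge0_integralZr (mu3 R) measurableT mgs _ _)) => //.
  congr (_ * _)%E.
  rewrite -(@mu3_shift (g \o T) s)//; last by move=> x; exact: g0.
  by apply: eq_integral => x _; rewrite /= TD Es.
have LR : ((4 / 3 * pi)%:E * \int[mu3 R]_x g x = (4 / 3 * pi)%:E * \int[mu3 R]_x g (T x))%E.
  by rewrite -L -Rr; exact: fubini_tonelli.
have pi43' : (0 : R) < 4 / 3 * pi by rewrite mulr_gt0// pi_gt0.
have := f_equal (fun r => ((4 / 3 * pi)^-1%:E * r)%E) LR.
by rewrite !muleA -!EFinM mulVf ?mul1e ?gt_eqF.
Qed.

Lemma isometry_dotV T x y : isometryV T -> dotV (T x) (T y) = dotV x y.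
Proof.
move=> iT; have h v : dotV (T v) (T v) = dotV v v by rewrite -!sqr_enorm isometry_enorm.
have := h (addV x y); rewrite (isometryD iT) !dotVDl ![dotV _ (addV _ _)]dotVC !dotVDl.
by rewrite !h [dotV (T y) (T x)]dotVC [dotV y x]dotVC; lra.
Qed.

Lemma isometry_id : isometryV (fun x => x).
Proof. by split=> // y; exists y. Qed.

Lemma isometry_opp : isometryV (scaleV (-1)).
Proof.
split.
- by move=> x y; apply: eqV => /=; ring.
- by move=> a x; apply: eqV => /=; ring.
- by move=> y; exists (scaleV (-1) y); apply: eqV => /=; ring.
- exact: enormN.
- exact: measurable_scaleV.
Qed.

Definition crossV (x y : V R) : V R :=
  ((x.1.2 * y.2 - x.2 * y.1.2, x.2 * y.1.1 - x.1.1 * y.2),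
   x.1.1 * y.1.2 - x.1.2 * y.1.1).

(* Euler-Rodrigues form of a similarity: scalar part [al], axis [A]. *)
Definition rod (al : R) (A : V R) (be : R) (x : V R) : V R :=
  addV (addV (scaleV al x) (crossV A x)) (scaleV (be * dotV A x) A).

Lemma measurable_rod al A be : measurable_fun setT (rod al A be).
Proof.
have mx := @measurable_id _ (V R) setT.
have [m1 m2 m3] := measurable_coords mx.
have md : measurable_fun setT (fun x => dotV A x) by exact: measurable_dotV.
apply: measurable_addV; last by apply: measurable_scaleV => //; exact: measurable_funM.
apply: measurable_addV; first exact: measurable_scaleV.
by apply: measurable_toV; apply: measurable_funB; exact: measurable_funM.
Qed.

Lemma rod_dot al A be x : dotV (rod al A be x) (rod al A be x) =
  (al ^+ 2 + dotV A A) * dotV x x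
  + (2 * al * be + be ^+ 2 * dotV A A - 1) * dotV A x ^+ 2.
Proof. by rewrite /rod /dotV /crossV /=; ring. Qed.

Lemma rodK al A be x : rod al A be (rod al (scaleV (-1) A) be x) =
  addV (scaleV (al ^+ 2 + dotV A A) x)
   (scaleV ((2 * al * be + be ^+ 2 * dotV A A - 1) * dotV A x) A).
Proof. by apply: eqV; rewrite /rod /dotV /crossV /=; ring. Qed.

(** By [rod_dot], the first equation makes [rod] scale squared norms by [rho^2] and the second one
    kills the additional multiple of the squared component along [A]. The inverse, up to a factor,
    is the same map with the opposite axis ([rodK]). *)
Lemma isometry_rod al A be rho : 0 < rho -> al ^+ 2 + dotV A A = rho ^+ 2 ->
  2 * al * be + be ^+ 2 * dotV A A = 1 ->
  isometryV (fun x => scaleV rho^-1 (rod al A be x)).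
Proof.
move=> r0 h1 h2; have rn : rho != 0 by rewrite gt_eqF.
split.
- by move=> x y; apply: eqV; rewrite /rod /dotV /crossV /=; ring.
- by move=> a x; apply: eqV; rewrite /rod /dotV /crossV /=; ring.
- move=> y; exists (scaleV rho^-1 (rod al (scaleV (-1) A) be y)).
  have -> : scaleV rho^-1 (rod al A be (scaleV rho^-1 (rod al (scaleV (-1) A) be y)))
     = scaleV (rho ^- 2) (rod al A be (rod al (scaleV (-1) A) be y)).
    by apply: eqV; rewrite /rod /dotV /crossV /=; field.
  rewrite rodK h1 h2 subrr mul0r.
  by apply: eqV => /=; field.
- move=> x; rewrite enormZ gtr0_norm ?invr_gt0//.
  rewrite {1}/enorm rod_dot h1 h2 subrr mul0r addr0 sqrtrM ?sqr_ge0//.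
  by rewrite sqrtr_sqr gtr0_norm// mulKf.
- by apply: measurable_scaleV => //; exact: measurable_rod.
Qed.

Lemma isometry_reflection m : m != ((0, 0), 0) ->
  isometryV (fun x => subV x (scaleV (2 * dotV m x / dotV m m) m)).
Proof.
move=> m0; have mm : dotV m m != 0 by rewrite dotV_eq0.
have inv x : subV (subV x (scaleV (2 * dotV m x / dotV m m) m))
    (scaleV (2 * dotV m (subV x (scaleV (2 * dotV m x / dotV m m) m)) / dotV m m) m) = x.
  have -> : dotV m (subV x (scaleV (2 * dotV m x / dotV m m) m)) = - dotV m x.
    have -> : forall a, dotV m (subV x (scaleV a m)) = dotV m x - a * dotV m m.
      by move=> a; rewrite /dotV/=; ring.
    by field.
  by apply: eqV => /=; field.
split.
- move=> x y; have -> : dotV m (addV x y) = dotV m x + dotV m y.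
    by rewrite /dotV/=; ring.
  by apply: eqV => /=; field.
- by move=> a x; rewrite dotVZr; apply: eqV => /=; field.
- by move=> y; eexists; exact: inv.
- move=> x; rewrite /enorm; congr Num.sqrt.
  have -> : forall a, dotV (subV x (scaleV a m)) (subV x (scaleV a m)) =
      dotV x x - 2 * a * dotV m x + a ^+ 2 * dotV m m.
    by move=> a; rewrite /dotV/=; ring.
  by field.
- apply: measurable_subV => //; apply: measurable_scaleV => //.
  apply: measurable_funM => //; apply: measurable_funM => //.
  exact: measurable_dotV.
Qed.

End Isometries.

(** * The law of the collision direction as a density on the ball *)

Section Collision.
Variables (R : realType) (e : R) (B : R -> R).
Hypotheses (he : 0 < e <= 1) (hB : admissible_B B).
Implicit Types (u v w x : V R).

Let e0 : 0 < e. Proof. by case/andP: he. Qed.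
Let e1 : e <= 1. Proof. by case/andP: he. Qed.

Definition e3 : V R := ((0, 0), 1).

Definition unitV (x : V R) : V R := scaleV (enorm x)^-1 x.

(* The direction of [0] is an arbitrary unit vector, which keeps [W] a
   probability density. *)
Definition dirV (u : V R) : V R := if u == ((0, 0), 0) then e3 else unitV u.

Definition Bt : R -> R := B \_ `[-1, 1].

(* Density on the unit ball of a law whose radial projection on the sphere is
   [B (n . k) dn / (4 pi)]. *)
Definition W (k x : V R) : R :=
  3 / (4 * pi) * \1_[set v | enorm v <= 1] x * Bt (dotV (unitV x) k).

(** Half of the relative velocity after the collision: with [u = v - w], the outgoing velocities are
    [(v + w) / 2 + Yv u n] and [(v + w) / 2 - Yv u n]. *)
Definition Yv (u n : V R) : V R :=
  subV (scaleV 2^-1 u) (scaleV ((1 + e) / 2 * dotV u n) n).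

Definition EY (u : V R) (g : V R -> R) : R :=
  Int (mu3 R) (fun x => W (dirV u) x * g (Yv u (unitV x))).

Lemma measurable_unitV d (T : measurableType d) (f : T -> V R) :
  measurable_fun setT f -> measurable_fun setT (fun t => unitV (f t)).
Proof.
by move=> mf; apply: measurable_scaleV => //; apply/measurable_inv/measurable_enorm.
Qed.

Lemma measurable_Bt : measurable_fun setT Bt.
Proof.
have [_ [/measurable_int/measurable_EFinP mB _]] := hB.
by apply/(measurable_restrictT B).
Qed.

Lemma Bt_ge0 s : 0 <= Bt s.
Proof.
rewrite /Bt patchE; case: ifPn => // /set_mem /= s1.
by apply: ltW; apply: hB.1.
Qed.

Lemma BtN s : Bt (- s) = Bt s.
Proof.
rewrite /Bt !patchE !mem_setE /= !in_itv/=.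
have -> : (-1 <= - s <= 1) = (-1 <= s <= 1).
  by apply/idP/idP => /andP[? ?]; apply/andP; split; lra.
case: ifPn => // h; have [_ [_ [+ _]]] := hB; apply.
by rewrite in_itv.
Qed.

Lemma measurable_W d (T : measurableType d) (f g : T -> V R) :
  measurable_fun setT f -> measurable_fun setT g ->
  measurable_fun setT (fun t => W (f t) (g t)).
Proof.
move=> mf mg; apply: measurable_funM.
  apply: measurable_funM => //; apply: (measurableT_comp (measurable_indic _)) => //.
  exact: measurable_unit_ball.
apply: (measurableT_comp measurable_Bt).
by apply: measurable_dotV => //; exact: measurable_unitV.
Qed.

Lemma W_ge0 k x : 0 <= W k x.
Proof. by rewrite /W !mulr_ge0 ?Bt_ge0// ?invr_ge0 ?mulr_ge0 ?pi_ge0. Qed.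

Lemma scales_lamN : scales (lam R) (lam R) (fun s : R => - s) 1.
Proof.
apply: scales_preimage => // [|A mA]; first exact: measurable_funN.
by rewrite mul1e; exact: (lebesgue_measureN mA).
Qed.

Lemma L1_Bt : L1 (lam R) Bt.
Proof.
have [_ [hi _]] := hB.
have h : L1 (@lebesgue_measure R) Bt.
  by rewrite /L1 /Bt -restrict_EFin -integrable_mkcond.
exact: (scales_Int ler01 (scales_id_lam R) h).1.
Qed.

Lemma Int_Bt : Int (lam R) Bt = 2.
Proof.
have [_ [hi [_ hI]]] := hB.
have h : L1 (@lebesgue_measure R) Bt.
  by rewrite /L1 /Bt -restrict_EFin -integrable_mkcond.
have := (scales_Int ler01 (scales_id_lam R) h).2; rewrite mul1r => ->.
by rewrite /Int /Bt -Rintegral_mkcond.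
Qed.

Lemma Int_Bt_half : L1 (lam R) (Bt \_ `[0, 1]) /\ Int (lam R) (Bt \_ `[0, 1]) = 1.
Proof.
set b := Bt \_ `[0, 1].
have mb : measurable_fun setT b.
  by apply/(measurable_restrictT Bt) => //; exact: measurable_funTS measurable_Bt.
have bi : L1 (lam R) b.
  apply: L1_le L1_Bt => // s; rewrite /b patchE; case: ifP => _.
    by rewrite ger0_norm// Bt_ge0.
  by rewrite normr0 Bt_ge0.
split=> //.
have [bNi bN] := scales_Int ler01 scales_lamN bi.
have : Int (lam R) Bt = Int (lam R) (fun s => b s + b (- s)).
  apply: Int_eq_ae; first exact: measurable_Bt.
    by apply: measurable_funD => //; apply: (measurableT_comp mb); exact: measurable_funN.
  (* The two halves of [[-1, 1]] overlap only at [0]. *)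
  exists [set 0]; split => //; first exact: (lebesgue_measure_set1 0).
  move=> s /=; apply: contra_notP => /eqP s0.
  rewrite /b !patchE !mem_setE/= !in_itv/= BtN.
  have [s1|s1|s1] := ltgtP s 0.
  - rewrite oppr_ge0 (ltW s1) add0r; case: ifPn => // h.
    by rewrite /Bt patchE mem_setE/= in_itv/=; case: ifPn => // /andP[? ?]; lra.
  - have -> : (0 <= - s) = false by lra.
    rewrite addr0; case: ifPn => // h.
    by rewrite /Bt patchE mem_setE/= in_itv/=; case: ifPn => // /andP[? ?]; lra.
  - by rewrite s1 eqxx in s0.
rewrite IntD// Int_Bt bN; lra.
Qed.

Lemma W_isometry T k x : isometryV T -> W (T k) (T x) = W k x.
Proof.
move=> iT; rewrite /W /unitV !indicE (isometry_enorm iT) -(isometryZ iT).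
rewrite (isometry_dotV _ _ iT); congr (_ * (nat_of_bool _)%:R * _).
by apply/idP/idP => /set_mem/= h; apply/mem_set; rewrite /= ?(isometry_enorm iT)// -(isometry_enorm iT).
Qed.

Lemma enorm_e3 : enorm e3 = 1.
Proof. by rewrite /enorm /dotV/= !mulr0 !add0r mulr1 sqrtr1. Qed.

Lemma W_e3 x : W e3 x = 3 / (4 * pi) *
  ((fun v => (Bt \_ `[0, 1]) (`|v.2| / enorm v)) \_ [set v : V R | enorm v <= 1]) x.
Proof.
rewrite /W -mulrA; congr (_ * _); rewrite indicE patchE.
case: ifPn => h; last by rewrite mul0r.
rewrite mul1r.
have -> : dotV (unitV x) e3 = x.2 / enorm x.
  by rewrite /dotV /unitV/= !mulr0 !add0r mulr1 mulrC.
have -> : Bt (x.2 / enorm x) = Bt (`|x.2| / enorm x).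
  by have [_|_] := ger0P x.2 => //; rewrite mulNr BtN.
rewrite [RHS]patchE mem_setE/= in_itv/=; case: ifPn => //.
have h0 : 0 <= `|x.2| / enorm x by rewrite divr_ge0 ?enorm_ge0.
rewrite h0/= -ltNge => h1; rewrite /Bt patchE mem_setE/= in_itv/=.
by case: ifPn => // /andP[_]; rewrite leNgt h1.
Qed.

(** By the hat-box theorem the integral over the ball becomes that of [Bt] over [[0, 1]], which is
    [1] because [B] is even of integral [2]. *)
Lemma Int_W_e3 : L1 (mu3 R) (W e3) /\ Int (mu3 R) (W e3) = 1.
Proof.
have [bi bI] := Int_Bt_half.
set b := Bt \_ `[0, 1] in bi bI.
have mb : measurable_fun setT b := L1_measurable bi.
have mI : measurable (`[0%R, 1%R]%classic : set R) := measurable_itv _.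
have bb : b \_ `[0, 1] = b.
  by apply/funext => s; rewrite patchE; case: ifPn => // h; rewrite /b patchE (negbTE h).
have bi' : L1 (mrestr (lam R) (measurable_itv `[0, 1])) b.
  by apply/(L1_mrestr (lam R) _ mb); rewrite bb.
have pi43 : (0 : R) <= 4 / 3 * pi by rewrite mulr_ge0// pi_ge0.
have [h1 h2] := scales_Int pi43 (archimedes R) bi'.
have mf := L1_measurable h1.
move: h1 h2; rewrite Int_mrestr// Int_mrestr// bb bI => /(L1_mrestr (mu3 R) _ mf) h1 h2.
have -> : W e3 = fun x => 3 / (4 * pi) *
  ((fun v => b (`|v.2| / enorm v)) \_ [set v : V R | enorm v <= 1]) x.
  by apply/funext => x; rewrite W_e3.
split; first exact: L1Z.
have pin : (pi : R) != 0 by rewrite gt_eqF ?pi_gt0.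
have E (p : R) : p != 0 -> 3 / (4 * p) * (4 / 3 * p * 1) = 1 by move=> p0; field.
by rewrite IntZ// h2; exact: E.
Qed.

(** The reflection in the bisecting plane of [e3] and [k]. *)
Lemma isometry_e3 k : enorm k = 1 -> exists2 T, isometryV T & T e3 = k.
Proof.
move=> k1; have [<-|ke] := eqVneq k e3; first by exists (fun x => x) => //; exact: isometry_id.
have m0 : subV k e3 != ((0, 0), 0).
  apply: contraNneq ke; rewrite /subV => -[] h1 h2 h3.
  by apply/eqP; apply: eqV => /=; lra.
exists (fun x => subV x (scaleV (2 * dotV (subV k e3) x / dotV (subV k e3) (subV k e3)) (subV k e3))).
  exact: isometry_reflection.
have kk : dotV k k = 1 by rewrite -sqr_enorm k1 expr1n.
have mm : dotV (subV k e3) (subV k e3) = 2 - 2 * k.2.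
  rewrite (_ : dotV _ _ = dotV k k + 1 - 2 * k.2); first by rewrite kk; ring.
  by rewrite /dotV/=; ring.
have me : dotV (subV k e3) e3 = k.2 - 1 by rewrite /dotV/=; ring.
have k2 : 2 - 2 * k.2 != 0 by rewrite -mm dotV_eq0.
rewrite me mm (_ : 2 * (k.2 - 1) / (2 - 2 * k.2) = -1); last by field.
by apply: eqV => /=; ring.
Qed.

Lemma enorm_unitV u : u != ((0, 0), 0) -> enorm (unitV u) = 1.
Proof.
move=> u0; rewrite /unitV enormZ ger0_norm ?invr_ge0 ?enorm_ge0// mulVf//.
by rewrite enorm_eq0.
Qed.

Lemma enorm_dirV u : enorm (dirV u) = 1.
Proof. by rewrite /dirV; case: eqVneq => [_|/enorm_unitV//]; exact: enorm_e3. Qed.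

Lemma Int_W k : enorm k = 1 -> L1 (mu3 R) (W k) /\ Int (mu3 R) (W k) = 1.
Proof.
move=> /isometry_e3[T iT <-]; have [h1 h2] := Int_W_e3.
have [T' iT' _] := @isometry_e3 e3 enorm_e3.
have mW : measurable_fun setT (W (T e3)) by exact: measurable_W.
have E : (fun x => W (T e3) (T x)) = W e3.
  by apply/funext => x; exact: W_isometry.
have [mT hT] := isometry_preserving iT.
have L : L1 (mu3 R) (W (T e3)).
  apply/integrableP; split; first exact/measurable_EFinP.
  have := hT (fun x => `|(W (T e3) x)%:E|)%E; rewrite mul1e => <-//; last first.
    by apply: measurableT_comp => //; exact/measurable_EFinP.
  have /integrableP[_] := h1.
  by under eq_integral do rewrite /= -(W_isometry _ _ iT).
split=> //.
have [_] := scales_Int ler01 (isometry_preserving iT) L.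
by rewrite mul1r E h2.
Qed.

End Collision.

(** * Averages over the outcome of a collision *)

Section CollisionAverage.
Variables (R : realType) (e : R) (B : R -> R).
Hypotheses (he : 0 < e <= 1) (hB : admissible_B B).
Implicit Types (u v w x Y : V R) (g : V R -> R).
Local Notation EY := (EY e B).
Local Notation Yv := (Yv e).
Local Notation W := (W B).

Let e0 : 0 < e. Proof. by case/andP: he. Qed.
Let e1 : e <= 1. Proof. by case/andP: he. Qed.

Definition Ann u Y : Prop := e / 2 * enorm u <= enorm Y <= enorm u / 2.

(** [|Y|^2 = |u|^2 / 4 - (1 - e^2) (u . n)^2 / 4] and [0 <= (u . n)^2 <= |u|^2]. The lower bound on
    [|Y|] is what later costs the factor [e^-2]. *)
Lemma Yv_Ann u x : Ann u (Yv u (unitV x)).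
Proof.
(* For [x = 0] the direction is the zero vector and [Y = u / 2], which still lies in the annulus, so
   no point of the ball is exceptional. *)
have : unitV x = ((0, 0), 0) \/ enorm (unitV x) = 1.
  have [->|x0] := eqVneq x ((0, 0), 0); last by right; exact: enorm_unitV.
  by left; rewrite /unitV; apply: eqV; rewrite /= mulr0.
move: (unitV x) => n [->|n1].
  rewrite /Ann; have -> : Yv u ((0, 0), 0) = scaleV 2^-1 u.
    by apply: eqV => /=; ring.
  rewrite enormZ ger0_norm ?invr_ge0//.
  have u0 := enorm_ge0 u; have : 0 <= (1 - e) * enorm u by rewrite mulr_ge0 ?subr_ge0.
  by move=> h; apply/andP; split; lra.
have nn : dotV n n = 1 by rewrite -sqr_enorm n1 expr1n.
have E : enorm (Yv u n) ^+ 2 = enorm u ^+ 2 / 4 - (1 - e ^+ 2) / 4 * dotV u n ^+ 2.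
  rewrite !sqr_enorm.
  transitivity (dotV u u / 4 + (((1 + e) / 2) ^+ 2 * dotV n n - (1 + e) / 2) * dotV u n ^+ 2).
    by rewrite /Yv /dotV/=; field.
  by rewrite nn; field.
have h : dotV u n ^+ 2 <= enorm u ^+ 2.
  rewrite -(ger0_norm (sqr_ge0 _)) normrX ler_sqr ?nnegrE ?enorm_ge0//.
  by have := cauchy_schwarzV u n; rewrite n1 mulr1.
have ee : 0 <= 1 - e ^+ 2 by rewrite subr_ge0 expr_le1// ltW.
have p : 0 <= (1 - e ^+ 2) * (enorm u ^+ 2 - dotV u n ^+ 2) by rewrite mulr_ge0// subr_ge0.
have p' : 0 <= (1 - e ^+ 2) * dotV u n ^+ 2 by rewrite mulr_ge0// sqr_ge0.
have u0 := enorm_ge0 u; have Y0 := enorm_ge0 (Yv u n).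
apply/andP; split; apply: ler_sqr_imp => //.
- by rewrite E; move: p; lra.
- by lra.
- by rewrite E; move: p'; lra.
Qed.

Lemma measurable_Yv d (T : measurableType d) (f g : T -> V R) :
  measurable_fun setT f -> measurable_fun setT g ->
  measurable_fun setT (fun t => Yv (f t) (unitV (g t))).
Proof.
move=> mf mg; have mn := measurable_unitV mg.
apply: measurable_subV; apply: measurable_scaleV => //.
by apply: measurable_funM => //; exact: measurable_dotV.
Qed.

(* Only the values of [g] on the annulus [Ann u] matter in [EY u g]. *)
Definition okY u g : Prop := measurable_fun setT g /\
  exists M, forall Y, Ann u Y -> `|g Y| <= M.

Lemma okY_cst u c : okY u (fun=> c).
Proof. by split=> //; exists `|c|. Qed.

Lemma okYD u g1 g2 : okY u g1 -> okY u g2 -> okY u (fun Y => g1 Y + g2 Y).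
Proof.
move=> [m1 [M1 h1]] [m2 [M2 h2]]; split; first exact: measurable_funD.
by exists (M1 + M2) => Y hY; rewrite (le_trans (ler_normD _ _))// lerD ?h1 ?h2.
Qed.

Lemma okYM u g1 g2 : okY u g1 -> okY u g2 -> okY u (fun Y => g1 Y * g2 Y).
Proof.
move=> [m1 [M1 h1]] [m2 [M2 h2]]; split; first exact: measurable_funM.
by exists (M1 * M2) => Y hY; rewrite normrM ler_pM ?h1 ?h2.
Qed.

Lemma okYZ u c g : okY u g -> okY u (fun Y => c * g Y).
Proof. exact/okYM/okY_cst. Qed.

Lemma okYN u g : okY u g -> okY u (fun Y => - g Y).
Proof.
move=> [m1 [M1 h1]]; split; first exact: measurable_funN.
by exists M1 => Y; rewrite normrN; exact: h1.
Qed.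

Lemma okYB u g1 g2 : okY u g1 -> okY u g2 -> okY u (fun Y => g1 Y - g2 Y).
Proof. by move=> h1 h2; apply: okYD => //; exact: okYN. Qed.

Lemma okYX u g n : okY u g -> okY u (fun Y => g Y ^+ n).
Proof.
move=> hg; elim: n => [|n IH]; first exact: okY_cst.
by under eq_fun do rewrite exprS; exact: okYM.
Qed.

Lemma okY_sum u (I : Type) (r : seq I) (F : I -> V R -> R) :
  (forall i, okY u (F i)) -> okY u (fun Y => \sum_(i <- r) F i Y).
Proof.
move=> h; elim: r => [|i r IH].
  by under eq_fun do rewrite big_nil; exact: okY_cst.
by under eq_fun do rewrite big_cons; exact: okYD.
Qed.

Lemma okY_comp u g : okY u g ->
  measurable_fun setT (fun x => g (Yv u (unitV x))) /\
  exists M, forall x, `|g (Yv u (unitV x))| <= M.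
Proof.
move=> [mg [M h]]; split.
  by apply: (measurableT_comp mg); exact: measurable_Yv.
by exists M => x; apply: h; exact: Yv_Ann.
Qed.

Lemma EY_L1 u g : okY u g -> L1 (mu3 R) (fun x => W (dirV u) x * g (Yv u (unitV x))).
Proof.
move=> /okY_comp[mg [M h]]; apply: (L1M _ mg h).
exact: (Int_W hB (enorm_dirV u)).1.
Qed.

Lemma EYD u g1 g2 : okY u g1 -> okY u g2 ->
  EY u (fun Y => g1 Y + g2 Y) = EY u g1 + EY u g2.
Proof.
move=> h1 h2; rewrite /EY -IntD; [|exact: EY_L1|exact: EY_L1].
by congr Int; apply/funext => x; rewrite mulrDr.
Qed.

Lemma EYZ u c g : okY u g -> EY u (fun Y => c * g Y) = c * EY u g.
Proof.
move=> h; rewrite /EY -IntZ; last exact: EY_L1.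
by congr Int; apply/funext => x; rewrite mulrCA.
Qed.

Lemma EYN u g : okY u g -> EY u (fun Y => - g Y) = - EY u g.
Proof.
move=> h; rewrite -[RHS]mulN1r -EYZ//; congr EY.
by apply/funext => Y; rewrite mulN1r.
Qed.

Lemma EYB u g1 g2 : okY u g1 -> okY u g2 ->
  EY u (fun Y => g1 Y - g2 Y) = EY u g1 - EY u g2.
Proof. by move=> h1 h2; rewrite EYD ?EYN//; exact: okYN. Qed.

Lemma EY_cst u c : EY u (fun=> c) = c.
Proof.
rewrite -[in LHS](mulr1 c) EYZ; last exact: okY_cst.
rewrite /EY; have [_] := Int_W hB (enorm_dirV u).
have -> : (fun x => W (dirV u) x * 1) = W (dirV u) by apply/funext => x; rewrite mulr1.
by move=> ->; rewrite mulr1.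
Qed.

Lemma EY_sum u (I : Type) (r : seq I) (F : I -> V R -> R) :
  (forall i, okY u (F i)) ->
  EY u (fun Y => \sum_(i <- r) F i Y) = \sum_(i <- r) EY u (F i).
Proof.
move=> h; elim: r => [|i r IH].
  by under eq_fun do rewrite big_nil; rewrite big_nil EY_cst.
under eq_fun do rewrite big_cons.
by rewrite big_cons EYD// ?IH//; exact: okY_sum.
Qed.

Lemma eq_EY u g1 g2 : (forall Y, Ann u Y -> g1 Y = g2 Y) -> EY u g1 = EY u g2.
Proof.
move=> h; rewrite /EY; congr Int; apply/funext => x.
by rewrite h//; exact: Yv_Ann.
Qed.

Lemma EY_le u g1 g2 : okY u g1 -> okY u g2 -> (forall Y, Ann u Y -> g1 Y <= g2 Y) ->
  EY u g1 <= EY u g2.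
Proof.
move=> h1 h2 h; apply: Int_le; [exact: EY_L1|exact: EY_L1|move=> x].
by rewrite ler_wpM2l ?W_ge0// h//; exact: Yv_Ann.
Qed.

Lemma EY_norm u g M : okY u g -> (forall Y, Ann u Y -> `|g Y| <= M) -> `|EY u g| <= M.
Proof.
move=> hg h; rewrite ler_norml -{1}(EY_cst u (- M)) -{2}(EY_cst u M).
by apply/andP; split; apply: EY_le => //; try exact: okY_cst;
  move=> Y /h; rewrite ler_norml => /andP[].
Qed.

Lemma EY_sqr u g : okY u g -> EY u g ^+ 2 <= EY u (fun Y => g Y ^+ 2).
Proof.
move=> hg; set m := EY u g.
have h1 := okYX 2 hg; have h2 := okYZ (2 * m) hg.
have oB := okYB h1 h2; have oc := okY_cst u (m ^+ 2).
have : EY u (fun=> 0) <= EY u (fun Y => g Y ^+ 2 - 2 * m * g Y + m ^+ 2).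
  apply: EY_le; [exact: okY_cst|exact: okYD|move=> Y _].
  by have := sqr_ge0 (g Y - m); rewrite sqrrB; lra.
rewrite EY_cst (EYD oB oc) (EYB h1 h2) (EYZ _ hg) EY_cst -/m; lra.
Qed.

(** The weight [W] is invariant under a joint isometry of axis and point, [Yv] is equivariant and
    homogeneous in [u], and Lebesgue measure is preserved. This equivariance replaces any regularity
    of [B]: a motion of [u] is transferred to the integrand. *)
Lemma EY_similarity T lam u g : isometryV T -> 0 < lam -> u != ((0, 0), 0) -> okY (scaleV lam (T u)) g ->
  EY (scaleV lam (T u)) g = EY u (fun Y => g (scaleV lam (T Y))).
Proof.
move=> iT l0 u0 hg; have hi := EY_L1 hg.
have [_] := scales_Int ler01 (isometry_preserving iT) hi; rewrite mul1r.
rewrite /EY => <-; congr Int; apply/funext => x.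
have Tx : unitV (T x) = T (unitV x) by rewrite /unitV (isometry_enorm iT) -(isometryZ iT).
have Tu0 : scaleV lam (T u) != ((0, 0), 0).
  by rewrite -enorm_eq0 enormZ (isometry_enorm iT) mulf_eq0 enorm_eq0 (negbTE u0) orbF normr_eq0 gt_eqF.
have du : dirV (scaleV lam (T u)) = T (dirV u).
  rewrite /dirV (negbTE u0) (negbTE Tu0) /unitV enormZ (isometry_enorm iT) (isometryZ iT).
  rewrite gtr0_norm//; apply: eqV => /=; rewrite invfM mulrCA mulrA;
  by rewrite -!mulrA mulrCA mulrA mulVf ?mul1r ?gt_eqF.
rewrite du (W_isometry _ _ _ iT) Tx; congr (_ * g _).
rewrite /Yv dotVZl (isometry_dotV _ _ iT) /subV !(isometryD iT) !(isometryZ iT).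
by apply: eqV => /=; ring.
Qed.

Lemma EY_opp u g : u != ((0, 0), 0) -> okY (scaleV (-1) u) g ->
  EY (scaleV (-1) u) g = EY u (fun Y => g (scaleV (-1) Y)).
Proof.
move=> u0; have E v : scaleV 1 (scaleV (-1) v) = scaleV (-1) v by apply: eqV => /=; ring.
move=> hg; rewrite -(E u) EY_similarity ?E//; first by congr EY; apply/funext => Y; rewrite E.
exact: isometry_opp.
Qed.

End CollisionAverage.

(** * Limits of vector expressions *)

Section VectorLimits.
Variable R : realType.
Implicit Types (x y : nat -> V R) (a b : nat -> R) (l m : V R).

Lemma cvg3_cst l : cvg3 (fun=> l) l.
Proof. by split; exact: cvg_cst. Qed.

Lemma cvg3_add x y l m : cvg3 x l -> cvg3 y m ->
  cvg3 (fun n => addV (x n) (y n)) (addV l m).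
Proof. by move=> [? ? ?] [? ? ?]; split; exact: cvgD. Qed.

Lemma cvg3_scale a x (r : R) l : a @ \oo --> r -> cvg3 x l ->
  cvg3 (fun n => scaleV (a n) (x n)) (scaleV r l).
Proof. by move=> ? [? ? ?]; split; exact: cvgM. Qed.

Lemma cvg3_sub x y l m : cvg3 x l -> cvg3 y m ->
  cvg3 (fun n => subV (x n) (y n)) (subV l m).
Proof. by move=> ? ?; apply: cvg3_add => //; apply: cvg3_scale => //; exact: cvg_cst. Qed.

Lemma cvg3_dot x y l m : cvg3 x l -> cvg3 y m ->
  dotV (x n) (y n) @[n --> \oo] --> dotV l m.
Proof. by move=> [? ? ?] [? ? ?]; apply: cvgD; [apply: cvgD|]; exact: cvgM. Qed.

Lemma cvg3_enorm x l : cvg3 x l -> enorm (x n) @[n --> \oo] --> enorm l.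
Proof.
move=> xl; apply: (cvg_comp (fun n => dotV (x n) (x n)) Num.sqrt);
  [exact: (cvg3_dot xl xl)|exact: sqrt_continuous].
Qed.

Lemma cvg3_cross x y l m : cvg3 x l -> cvg3 y m ->
  cvg3 (fun n => crossV (x n) (y n)) (crossV l m).
Proof. by move=> [? ? ?] [? ? ?]; split; apply: cvgB; exact: cvgM. Qed.

Lemma cvg3_rod a x b y (r s : R) l m :
  a @ \oo --> r -> cvg3 x l -> b @ \oo --> s -> cvg3 y m ->
  cvg3 (fun n => rod (a n) (x n) (b n) (y n)) (rod r l s m).
Proof.
move=> ar xl bs ym; apply: cvg3_add.
  by apply: cvg3_add; [exact: cvg3_scale|exact: cvg3_cross].
by apply: cvg3_scale => //; apply: cvgM => //; exact: cvg3_dot.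
Qed.

Lemma cvg3_coord x l i : cvg3 x l -> Defs.coord (x n) i @[n --> \oo] --> Defs.coord l i.
Proof.
by move=> [h1 h2 h3]; case: i => [[|[|k]] ik]; [exact: h1|exact: h2|exact: h3].
Qed.

Lemma cvg3_shift x l N : cvg3 x l -> cvg3 (fun n => x (n + N)%N) l.
Proof.
by move=> [h1 h2 h3]; split;
  [rewrite (cvg_shiftn N (fun n => (x n).1.1))|rewrite (cvg_shiftn N (fun n => (x n).1.2))
  |rewrite (cvg_shiftn N (fun n => (x n).2))].
Qed.

End VectorLimits.

(** * Moving the relative velocity by rotation-dilations *)

Section Steering.
Variables (R : realType) (e : R) (B : R -> R).
Hypotheses (he : 0 < e <= 1) (hB : admissible_B B).
Implicit Types (u v w x Y : V R) (g : V R -> R).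
Local Notation EY := (EY e B).
Local Notation Yv := (Yv e).
Local Notation Ann := (Ann e).
Local Notation okY := (okY e).

(* The rotation-dilation taking [u] to [w] along the shortest arc. *)
Definition steer u w x : V R :=
  scaleV (enorm u ^- 2) (rod (dotV u w) (crossV u w) (enorm u * enorm w + dotV u w)^-1 x).

Let enorm0 : enorm (((0, 0), 0) : V R) = 0.
Proof. by apply/eqP; rewrite enorm_eq0. Qed.

Let pos_factors u w : 0 < enorm u * enorm w + dotV u w -> 0 < enorm u /\ 0 < enorm w.
Proof.
move=> h; split; rewrite enorm_gt0; apply: contraTneq h => ->.
  by rewrite enorm0 mul0r add0r (_ : dotV _ w = 0) ?ltxx// /dotV/=; ring.
by rewrite enorm0 mulr0 add0r (_ : dotV u _ = 0) ?ltxx// /dotV/=; ring.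
Qed.

Let lagrange u w : dotV u w ^+ 2 + dotV (crossV u w) (crossV u w) =
  (enorm u * enorm w) ^+ 2.
Proof. by rewrite exprMn !sqr_enorm /dotV /crossV/=; ring. Qed.

(** Lagrange's identity for [u . w] and [u x w] is the norm condition of [isometry_rod]. The
    hypothesis excludes the zero vectors and opposite directions, between which there is no
    preferred arc. *)
Lemma steer_similarity u w : 0 < enorm u * enorm w + dotV u w ->
  exists T, [/\ isometryV T, scaleV (enorm w / enorm u) (T u) = w &
    forall x, scaleV (enorm w / enorm u) (T x) = steer u w x].
Proof.
move=> q0; have [r0 r'0] := pos_factors q0.
have rr : 0 < enorm u * enorm w by exact: mulr_gt0.
have rn : enorm u != 0 by rewrite gt_eqF.
have r'n : enorm w != 0 by rewrite gt_eqF.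
have qn : enorm u * enorm w + dotV u w != 0 by rewrite gt_eqF.
exists (fun x => scaleV (enorm u * enorm w)^-1
  (rod (dotV u w) (crossV u w) (enorm u * enorm w + dotV u w)^-1 x)); split.
- apply: (isometry_rod rr (lagrange u w)).
  have -> : dotV (crossV u w) (crossV u w) = (enorm u * enorm w) ^+ 2 - dotV u w ^+ 2.
    by rewrite -lagrange; ring.
  by field.
- have -> : rod (dotV u w) (crossV u w) (enorm u * enorm w + dotV u w)^-1 u =
      scaleV (enorm u ^+ 2) w.
    rewrite sqr_enorm; have : dotV (crossV u w) u = 0 by rewrite /dotV /crossV/=; ring.
    by rewrite /rod => ->; apply: eqV; rewrite /dotV /crossV/=; ring.
  by apply: eqV => /=; field; rewrite rn r'n.
- by move=> x; apply: eqV; rewrite /steer /=; field; rewrite ?rn ?r'n ?qn.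
Qed.

Lemma enorm_steer u w Y : 0 < enorm u * enorm w + dotV u w ->
  enorm (steer u w Y) = enorm w / enorm u * enorm Y.
Proof.
move=> /steer_similarity[T [iT _ <-]]; rewrite enormZ (isometry_enorm iT).
by rewrite ger0_norm// divr_ge0 ?enorm_ge0.
Qed.

Lemma steer_Ann u w Y : 0 < enorm u * enorm w + dotV u w -> Ann u Y -> Ann w (steer u w Y).
Proof.
move=> q0 /andP[h1 h2]; have [r0 r'0] := pos_factors q0.
rewrite /Ann enorm_steer//.
have c0 : 0 <= enorm w / enorm u by rewrite divr_ge0// ltW.
have E : enorm w / enorm u * enorm u = enorm w by rewrite divfK// gt_eqF.
apply/andP; split.
  have -> : e / 2 * enorm w = enorm w / enorm u * (e / 2 * enorm u) by rewrite mulrCA E.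
  exact: ler_wpM2l.
have -> : enorm w / 2 = enorm w / enorm u * (enorm u / 2) by rewrite mulrA E.
exact: ler_wpM2l.
Qed.

Lemma measurable_steer u w : measurable_fun setT (steer u w).
Proof. by apply: measurable_scaleV => //; exact: measurable_rod. Qed.

Lemma EY_steer u w g : 0 < enorm u * enorm w + dotV u w -> okY w g ->
  EY w g = EY u (fun Y => g (steer u w Y)).
Proof.
move=> q0; have [r0 r'0] := pos_factors q0.
have [T [iT Tu Ts]] := steer_similarity q0.
rewrite -{1 2}Tu => hg; rewrite (EY_similarity he hB iT)//.
- by congr EY; apply/funext => Y; rewrite Ts.
- exact: divr_gt0.
- by rewrite -enorm_gt0.
Qed.

Lemma steer_id u Y : u != ((0, 0), 0) -> steer u u Y = Y.
Proof.
rewrite -enorm_eq0 => u0; rewrite /steer.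
have -> : crossV u u = ((0, 0), 0) by apply: eqV => /=; ring.
rewrite -sqr_enorm; apply: eqV; rewrite /rod /crossV /dotV/=; field;
by rewrite u0 ?(mulf_neq0 u0 u0) -?mulr2n ?mulrn_eq0 ?sqrf_eq0 ?u0.
Qed.

(** The weights [W (dirV (un n))] need not converge pointwise, as [B] is only integrable. Steering
    [un n] back to [u] leaves one fixed weight and puts the variation into the integrand, where
    dominated convergence applies. *)
Lemma EY_cvg (un : nat -> V R) u (gn : nat -> V R -> R) g M :
  cvg3 un u -> u != ((0, 0), 0) ->
  (forall n, measurable_fun setT (gn n)) -> measurable_fun setT g ->
  (forall n Y, Ann (un n) Y -> `|gn n Y| <= M) ->
  (forall Yn Y, Ann u Y -> cvg3 Yn Y -> gn n (Yn n) @[n --> \oo] --> g Y) ->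
  EY (un n) (gn n) @[n --> \oo] --> EY u g.
Proof.
move=> unu u0 mgn mg hM hg.
have r0 : 0 < enorm u by rewrite enorm_gt0.
have q : enorm u * enorm (un n) + dotV u (un n) @[n --> \oo] -->
    enorm u * enorm u + dotV u u.
  apply: cvgD; last by apply: cvg3_dot => //; exact: cvg3_cst.
  by apply: cvgM; [exact: cvg_cst|exact: cvg3_enorm].
have q0 : 0 < enorm u * enorm u + dotV u u by rewrite addr_gt0 ?mulr_gt0// -sqr_enorm exprn_gt0.
have [N _ hN] : \forall n \near \oo, 0 < enorm u * enorm (un n) + dotV u (un n).
  by apply: (cvgr_gt _ q).
rewrite -(cvg_shiftn N (fun n => EY (un n) (gn n))).
have hN' n : 0 < enorm u * enorm (un (n + N)%N) + dotV u (un (n + N)%N).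
  by apply: hN; rewrite /= leq_addl.
have ok n : okY (un (n + N)%N) (gn (n + N)%N).
  by split; [exact: mgn|exists M => Y; exact: hM].
have -> : (fun n => EY (un (n + N)%N) (gn (n + N)%N)) =
    (fun n => EY u (fun Y => gn (n + N)%N (steer u (un (n + N)%N) Y))).
  by apply/funext => n; rewrite (EY_steer (hN' n) (ok n)).
have mW := L1_measurable (Int_W hB (enorm_dirV u)).1.
have mY := @measurable_Yv R e _ _ _ _ (@measurable_cst _ _ (V R) (V R) setT u)
  (@measurable_id _ (V R) setT).
apply: (Int_dct (g := fun x => M * W B (dirV u) x) _ _ _ _ _).2.
- move=> n; apply: measurable_funM => //.
  by apply: (measurableT_comp (mgn _)); apply: (measurableT_comp (measurable_steer _ _)).
- by apply: measurable_funM => //; exact: (measurableT_comp mg).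
- by apply: L1Z; exact: (Int_W hB (enorm_dirV u)).1.
- move=> n x; rewrite normrM (ger0_norm (W_ge0 hB _ _)) mulrC.
  apply: ler_wpM2r; first exact: W_ge0.
  by apply: hM; apply: steer_Ann => //; exact: Yv_Ann.
move=> x; apply: cvgM; first exact: cvg_cst.
set Y := Yv u (unitV x).
have hY : Ann u Y by exact: Yv_Ann.
pose Yn n := steer u (un n) Y.
have : gn n (Yn n) @[n --> \oo] --> g Y.
  apply: hg => //; rewrite -[X in cvg3 _ X](steer_id Y u0).
  apply: cvg3_scale; first exact: cvg_cst.
  apply: cvg3_rod.
  - by apply: cvg3_dot => //; exact: cvg3_cst.
  - by apply: cvg3_cross => //; exact: cvg3_cst.
  - by apply: cvgV; rewrite ?gt_eqF.
  - exact: cvg3_cst.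
by rewrite -(cvg_shiftn N (fun n => gn n (Yn n))).
Qed.

End Steering.

Section Index3.
Definition i0 : 'I_3 := @Ordinal 3 0 isT.
Definition i1 : 'I_3 := @Ordinal 3 1 isT.
Definition i2 : 'I_3 := @Ordinal 3 2 isT.

Lemma I3_ind (P : 'I_3 -> Prop) : P i0 -> P i1 -> P i2 -> forall i, P i.
Proof.
move=> h0 h1 h2 [[|[|[|k]]] ik].
- by rewrite (_ : Ordinal ik = i0)//; exact: val_inj.
- by rewrite (_ : Ordinal ik = i1)//; exact: val_inj.
- by rewrite (_ : Ordinal ik = i2)//; exact: val_inj.
- by [].
Qed.

Lemma sum3E (M : nmodType) (F : 'I_3 -> M) : \sum_(i < 3) F i = F i0 + F i1 + F i2.
Proof.
rewrite !big_ord_recl big_ord0 addr0 addrA.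
by congr (F _ + F _ + F _); exact: val_inj.
Qed.
End Index3.

(** * Derivatives through sequences and mean values *)

Section SequentialDerivative.
Variable R : realType.
Implicit Types (F : R -> R) (a l : R).

Lemma cvg_ext (u v : nat -> R) l : u @ \oo --> l -> (forall n, v n = u n) -> v @ \oo --> l.
Proof. by move=> h /funext ->. Qed.

Lemma cvg_le (u v : nat -> R) l m : u @ \oo --> l -> v @ \oo --> m -> (forall n, u n <= v n) -> l <= m.
Proof. by move=> ul vm uv; apply: (ler_cvg_to ul vm); exact: nearW. Qed.

Lemma derive_seqP F a l : is_derive a 1 F l <->
  forall s : nat -> R, (forall n, s n != 0) -> s @ \oo --> 0 ->
    (s n)^-1 * (F (a + s n) - F a) @[n --> \oo] --> l.
Proof.
have E : (fun h : R => h^-1 *: ((F \o shift a) (h *: (1 : R)) - F a)) =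
    (fun h => h^-1 * (F (a + h) - F a)).
  by apply/funext => h /=; rewrite /GRing.scale/= mulr1 [h + a]addrC.
split=> [[dF dl] s s0 s_0|h].
  move: dF dl; rewrite /derivable /derive E => dF dl.
  have : h^-1 * (F (a + h) - F a) @[h --> 0^'] --> l by rewrite -dl.
  by move/cvgr_dnbhsP; apply.
have h' : h^-1 * (F (a + h) - F a) @[h --> 0^'] --> l.
  by apply/cvgr_dnbhsP => u [u0 u_0]; exact: h.
split; rewrite /derivable /derive E; first by apply/cvg_ex; exists l.
exact: (cvg_lim (@Rhausdorff R) h').
Qed.

Lemma is_derive_affine (d c : R) F a l : is_derive a 1 F l ->
  is_derive a 1 (fun y => d + c * F y) (c * l).
Proof.
move=> /derive_seqP h; apply/derive_seqP => s s0 s_0.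
pose u n := c * ((s n)^-1 * (F (a + s n) - F a)).
apply: (@cvg_ext u) => [|n]; last by rewrite /u; ring.
by apply: cvgM; [exact: cvg_cst|exact: h].
Qed.

Lemma is_derive_lip F a l : is_derive a 1 F l ->
  exists C eps, [/\ 0 <= C, 0 < eps & forall s, `|s| < eps -> `|F (a + s) - F a| <= C * `|s|].
Proof.
move=> [dF dl]; move: dF dl; rewrite /derivable /derive => dF dl.
have {dF} : h^-1 *: ((F \o shift a) (h *: (1 : R)) - F a) @[h --> 0^'] --> l by rewrite -dl.
move=> /cvgrPdist_lt/(_ 1 ltr01); rewrite near_withinE => -[eps /= eps0 h].
exists (`|l| + 1), eps; split => //.
move=> s se; have [->|s0] := eqVneq s 0; first by rewrite addr0 subrr !normr0 mulr0.
have := h s; rewrite /= sub0r normrN => /(_ se s0).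
rewrite /GRing.scale/= mulr1 [s + a]addrC => hs.
have {}hs : `|s^-1 * (F (a + s) - F a)| <= `|l| + 1.
  rewrite -[X in `|X|](subrK l) (le_trans (ler_normD _ _))// addrC lerD2l distrC.
  exact: ltW.
by rewrite -[X in `|X|](mulVKf s0) normrM mulrC ler_wpM2r.
Qed.

Lemma is_derive_quadratic F a l C eps : 0 < eps ->
  (forall s, `|s| < eps -> `|F (a + s) - F a - l * s| <= C * s ^+ 2) -> is_derive a 1 F l.
Proof.
move=> e0 h; apply/derive_seqP => s s0 s_0.
apply/subr_cvg0/cvgr0Pnorm_le => r r0; move: (s_0) => /cvgr0_norm_lt/(_ _ e0) near1.
have C1 : 0 < r / (`|C| + 1) by rewrite divr_gt0// ltr_wpDl.
move: s_0 => /cvgr0_norm_lt/(_ _ C1) near2.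
near=> n.
have -> : (s n)^-1 * (F (a + s n) - F a) - l = (s n)^-1 * (F (a + s n) - F a - l * s n).
  by field; exact: s0.
rewrite normrM normfV.
have h1 : `|s n| < eps by near: n.
have /ltW h2 : `|s n| < r / (`|C| + 1) by near: n.
rewrite ler_pdivrMl ?normr_gt0// (le_trans (h _ h1))//.
apply: (@le_trans _ _ (`|s n| * (`|C| * `|s n|))).
  have -> : `|s n| * (`|C| * `|s n|) = `|C| * s n ^+ 2.
    by rewrite -(real_normK (num_real (s n))); ring.
  by rewrite ler_wpM2r ?sqr_ge0 ?ler_norm.
rewrite ler_wpM2l//; move: h2; rewrite ler_pdivlMr ?ltr_wpDl// => h2.
by rewrite (le_trans _ h2)// [leRHS]mulrC ler_wpM2r// lerDl.
Unshelve. all: by end_near. Qed.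

Lemma MVT_between F (dF : R -> R) a b : (forall x : R, is_derive x 1 F (dF x)) ->
  exists2 c, `|c - a| <= `|b - a| & F b - F a = dF c * (b - a).
Proof.
move=> h; have cF x y : {within `[x, y], continuous F}.
  by apply: derivable_within_continuous => z _; have [] := h z.
have [ab|/ltW ba] := leP a b.
  have [c cab E] := MVT_segment ab (fun x _ => h x) (cF a b).
  exists c => //; move: cab; rewrite in_itv/= => /andP[h1 h2].
  by rewrite !ger0_norm ?subr_ge0// lerD2r.
have [c cab E] := MVT_segment ba (fun x _ => h x) (cF b a).
exists c; last by rewrite -[LHS]opprB E -mulrN opprB.
move: cab; rewrite in_itv/= => /andP[h1 h2].
by rewrite !ler0_norm ?subr_le0// lerN2 lerD2r.
Qed.

End SequentialDerivative.

(** * Derivatives with bounds uniform in a parameter *)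

Section UniformDerivative.
Variables (R : realType) (X : Type) (D : X -> Prop).
Implicit Types (F G : X -> R -> R) (dF dG : X -> R).

(* Differentiability at s = 0, uniform enough in x to pass under an integral. *)
Definition udiff F dF := exists C eps, [/\ 0 <= C, 0 < eps & forall x, D x ->
  [/\ `|F x 0| <= C, (forall s, `|s| < eps -> `|F x s - F x 0| <= C * `|s|)
    & is_derive (0 : R) 1 (F x) (dF x)]].

Lemma udiff_cst (c : X -> R) C : (forall x, D x -> `|c x| <= C) -> udiff (fun x _ => c x) (fun=> 0).
Proof.
move=> h; exists (`|C|), 1; split => // x Dx; split.
- by rewrite (le_trans (h _ Dx))// ler_norm.
- by move=> s _; rewrite subrr normr0 mulr_ge0.
- exact: is_derive_cst.
Qed.

Lemma udiff_scalar (a : R -> R) l : is_derive (0 : R) 1 a l -> udiff (fun _ => a) (fun=> l).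
Proof.
move=> h; have [C [eps [C0 e0 hC]]] := is_derive_lip h.
exists (C + `|a 0|), eps; split => //; first by rewrite addr_ge0.
move=> x _; split => //; first by rewrite lerDr.
by move=> s se; have := hC _ se; rewrite add0r => /le_trans; apply; rewrite ler_wpM2r// lerDl.
Qed.

Lemma udiff_id : udiff (fun _ s => s) (fun=> 1).
Proof. by apply: udiff_scalar; exact: is_derive_id. Qed.

Lemma udiffD F dF G dG : udiff F dF -> udiff G dG ->
  udiff (fun x s => F x s + G x s) (fun x => dF x + dG x).
Proof.
move=> [C1 [e1 [C10 e10 h1]]] [C2 [e2 [C20 e20 h2]]].
exists (C1 + C2), (Num.min e1 e2); split; [exact: addr_ge0|by rewrite lt_min e10|].
move=> x Dx; have [a1 b1 c1] := h1 x Dx; have [a2 b2 c2] := h2 x Dx; split.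
- by rewrite (le_trans (ler_normD _ _))// lerD.
- move=> s; rewrite lt_min => /andP[s1 s2].
  rewrite opprD addrACA (le_trans (ler_normD _ _))// mulrDl lerD//; [exact: b1|exact: b2].
- exact: is_deriveD.
Qed.

Lemma udiffM F dF G dG : udiff F dF -> udiff G dG ->
  udiff (fun x s => F x s * G x s) (fun x => F x 0 * dG x + dF x * G x 0).
Proof.
move=> [C1 [e1 [C10 e10 h1]]] [C2 [e2 [C20 e20 h2]]].
pose C3 := C1 * e1 + C1.
have C30 : 0 <= C3 by rewrite addr_ge0// mulr_ge0// ltW.
exists (C1 * C2 + C3 * C2), (Num.min e1 e2); split.
- by rewrite addr_ge0// mulr_ge0.
- by rewrite lt_min e10.
move=> x Dx; have [a1 b1 c1] := h1 x Dx; have [a2 b2 c2] := h2 x Dx; split.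
- rewrite normrM; apply: (@le_trans _ _ (C1 * C2)); first by rewrite ler_pM.
  by rewrite lerDl mulr_ge0.
- move=> s; rewrite lt_min => /andP[s1 s2].
  have -> : F x s * G x s - F x 0 * G x 0 =
    (F x s - F x 0) * G x 0 + F x s * (G x s - G x 0) by ring.
  rewrite (le_trans (ler_normD _ _))// !normrM mulrDl lerD//.
    by rewrite mulrAC ler_pM// b1.
  rewrite -mulrA ler_pM//; last exact: b2.
  rewrite -[F x s](subrK (F x 0)) (le_trans (ler_normD _ _))// lerD//.
  by rewrite (le_trans (b1 _ s1))// ler_wpM2l// ltW.
- by apply: (is_derive_eq (is_deriveM c1 c2)); rewrite /GRing.scale/= [G x 0 * _]mulrC.
Qed.

Lemma udiff_eq F dF dG : udiff F dF -> (forall x, D x -> dF x = dG x) -> udiff F dG.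
Proof.
move=> [C [eps [C0 e0 h]]] E; exists C, eps; split => // x Dx.
by have [h1 h2 h3] := h x Dx; split => //; rewrite -E.
Qed.

Lemma udiffZ F dF (c : R) : udiff F dF -> udiff (fun x s => c * F x s) (fun x => c * dF x).
Proof.
move=> h; have hc : udiff (fun _ _ => c) (fun=> 0) by apply: (udiff_cst (C := `|c|)).
by apply: udiff_eq (udiffM hc h) _ => x _; rewrite mul0r addr0.
Qed.

Lemma udiffN F dF : udiff F dF -> udiff (fun x s => - F x s) (fun x => - dF x).
Proof.
move=> [C [eps [C0 e0 h]]]; exists C, eps; split => // x Dx.
have [h1 h2 h3] := h x Dx; split; [by rewrite normrN| |exact: is_deriveN].
by move=> s se; rewrite -opprD normrN h2.
Qed.

Lemma udiffB F dF G dG : udiff F dF -> udiff G dG ->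
  udiff (fun x s => F x s - G x s) (fun x => dF x - dG x).
Proof. by move=> h1 h2; apply: udiffD => //; exact: udiffN. Qed.

Lemma udiff_sum (F : 'I_3 -> X -> R -> R) (dF : 'I_3 -> X -> R) : (forall i, udiff (F i) (dF i)) ->
  udiff (fun x s => \sum_(i < 3) F i x s) (fun x => \sum_(i < 3) dF i x).
Proof.
move=> h; under eq_fun do under eq_fun do rewrite sum3E.
by under [X in udiff _ X]eq_fun do rewrite sum3E; do 2?apply: udiffD.
Qed.

Lemma udiffV F dF (m : R) : 0 < m -> (forall x, D x -> m <= `|F x 0|) -> udiff F dF ->
  udiff (fun x s => (F x s)^-1) (fun x => - dF x / F x 0 ^+ 2).
Proof.
move=> m0 hm [C [eps [C0 e0 h]]].
(* Within this radius [F x s] moves by at most [m / 2], so it stays at distance [m / 2] from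
   zero. *)
pose e' := Num.min eps (m / 2 / (C + 1)).
have C1 : 0 < C + 1 by rewrite ltr_wpDl.
have e'0 : 0 < e' by rewrite lt_min e0/= divr_gt0// divr_gt0.
exists (m^-1 + C * (2 / m ^+ 2)), e'; split => //.
  by rewrite addr_ge0 ?invr_ge0 ?(ltW m0)// mulr_ge0// divr_ge0// exprn_ge0// ltW.
move=> x Dx; have [h1 h2 h3] := h x Dx; have hmx := hm x Dx; split.
- rewrite normfV (@le_trans _ _ m^-1)//; first by rewrite lef_pV2 ?posrE// (lt_le_trans m0).
  by rewrite lerDl mulr_ge0// divr_ge0// exprn_ge0// ltW.
- move=> s; rewrite lt_min => /andP[s1 s2].
  have hs := h2 _ s1.
  have hF : m / 2 <= `|F x s|.
    have : `|F x s - F x 0| <= m / 2.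
      rewrite (le_trans hs)//; move: s2; rewrite ltr_pdivlMr// => /ltW s2.
      by rewrite (le_trans _ s2)// mulrC ler_wpM2l// lerDl.
    have := ler_normD (F x 0 - F x s) (F x s); rewrite subrK distrC; move: hmx; clear; lra.
  have F0 : F x 0 != 0 by rewrite -normr_gt0 (lt_le_trans m0).
  have Fs : F x s != 0 by rewrite -normr_gt0 (lt_le_trans _ hF)// divr_gt0.
  have -> : (F x s)^-1 - (F x 0)^-1 = (F x s - F x 0) * (- ((F x s)^-1 * (F x 0)^-1)).
    by field; rewrite F0 Fs.
  rewrite normrM normrN normrM mulrDl ler_wpDl//.
    by rewrite mulr_ge0// invr_ge0 ltW.
  rewrite mulrAC ler_pM//.
  have -> : 2 / m ^+ 2 = (m / 2)^-1 * m^-1 by field; rewrite gt_eqF.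
  by rewrite !normfV ler_pM// lef_pV2 ?posrE// ?normr_gt0// divr_gt0.
- have F0 : F x 0 != 0 by rewrite -normr_gt0 (lt_le_trans m0)// hm.
  apply: (is_derive_eq (is_deriveV F0 h3)); rewrite /GRing.scale/=.
  by rewrite mulNr mulrC mulNr.
Qed.

End UniformDerivative.

(** * Bounded C^1 functions with bounded derivatives *)

Section C1Bounded.
Variable R : realType.
Implicit Types (v a b : V R) (f g : V R -> R) (L : R).

(** Only the bound on the derivatives is tracked, since it alone governs the iteration; the bound on
    the function is needed just for integrability, hence existential. *)
Record C1b L f : Prop := {
  C1b_bounded : exists p, forall v, `|f v| <= p;
  C1b_derivable : forall i v, derivable (fun s => f (shiftV v i s)) 0 1;
  C1b_continuous : forall i, continuous (partial f i);
  C1b_le : forall i v, `|partial f i v| <= L }.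

Lemma shiftVD v i r s : shiftV (shiftV v i r) i s = shiftV v i (r + s).
Proof. by apply: eqV => /=; case: ifP => _; rewrite -addrA ?addr0. Qed.

Lemma shiftV0 v i : shiftV v i 0 = v.
Proof. by apply: eqV => /=; case: ifP => _; rewrite addr0. Qed.

Lemma derivable_partial f i v : derivable (fun s => f (shiftV v i s)) 0 1 ->
  is_derive (0 : R) 1 (fun s => f (shiftV v i s)) (partial f i v).
Proof. by move=> h; apply: DeriveDef => //; rewrite /partial derive1E. Qed.

Lemma partial_eq f i v l : is_derive (0 : R) 1 (fun s => f (shiftV v i s)) l ->
  derivable (fun s => f (shiftV v i s)) 0 1 /\ partial f i v = l.
Proof. by move=> [h1 h2]; rewrite /partial derive1E. Qed.

Lemma is_derive_line f i : (forall v, derivable (fun s => f (shiftV v i s)) 0 1) ->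
  forall v (r : R), is_derive r 1 (fun s => f (shiftV v i s)) (partial f i (shiftV v i r)).
Proof.
move=> h v r; apply/derive_seqP => s s0 s_0.
have /derive_seqP/(_ _ s0 s_0) := derivable_partial (h (shiftV v i r)).
by under eq_fun do rewrite !shiftVD add0r addr0.
Qed.

Definition between a b m := forall i : 'I_3,
  `|Defs.coord m i - Defs.coord a i| <= `|Defs.coord b i - Defs.coord a i|.

(** One coordinate is moved at a time, so each mean value is taken at a point of the coordinate box
    spanned by [a] and [b]; such points converge to [a] as [b] does. *)
Lemma C1_increment f : (forall i v, derivable (fun s => f (shiftV v i s)) 0 1) ->
  forall a b, exists2 m : 'I_3 -> V R, (forall i, between a b (m i)) &
  f b - f a = \sum_(i < 3) partial f i (m i) * (Defs.coord b i - Defs.coord a i).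
Proof.
move=> h a b.
pose d (i : 'I_3) := Defs.coord b i - Defs.coord a i.
pose a1 := shiftV a i0 (d i0); pose a2 := shiftV a1 i1 (d i1).
have Eb : shiftV a2 i2 (d i2) = b by apply: eqV; rewrite /= /d /=; ring.
have M v i r : exists2 c, `|c| <= `|r| & f (shiftV v i r) - f v = partial f i (shiftV v i c) * r.
  have [c] := MVT_between 0 r (is_derive_line (h i) v).
  by rewrite !subr0 shiftV0 => hc E; exists c.
have [c0 k0 E0] := M a i0 (d i0); have [c1 k1 E1] := M a1 i1 (d i1).
have [c2 k2 E2] := M a2 i2 (d i2).
exists (fun i => match val i with 0%N => shiftV a i0 c0 | 1%N => shiftV a1 i1 c1
  | _ => shiftV a2 i2 c2 end).
  have Z (x y : R) : x + y - x = y by ring.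
  move: k0 k1 k2; rewrite /d /Defs.coord /= => k0 k1 k2; rewrite /between /a2 /a1 /d.
  by apply: I3_ind; apply: I3_ind; rewrite /Defs.coord /= ?addr0 ?Z ?subrr ?normr0.
rewrite sum3E /= -/(d i0) -/(d i1) -/(d i2) -E0 -E1 -E2 Eb -/a1 -/a2.
by ring.
Qed.

Lemma between_cvg (x m : nat -> V R) l : cvg3 x l -> (forall n, between l (x n) (m n)) -> cvg3 m l.
Proof.
move=> xl h.
have K i : Defs.coord (m n) i @[n --> \oo] --> Defs.coord l i.
  have xi := cvg3_coord (i := i) xl; apply/cvgrPdist_lt => r r0.
  move: xi => /cvgrPdist_lt/(_ _ r0) near1; near=> n.
  rewrite distrC (le_lt_trans (h n i))// distrC; near: n; exact: near1.
by split; [exact: (K i0)|exact: (K i1)|exact: (K i2)].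
Unshelve. all: by end_near. Qed.

Lemma C1_chain f (P : R -> V R) (dP : V R) :
  (forall i v, derivable (fun s => f (shiftV v i s)) 0 1) ->
  (forall i, continuous (partial f i)) ->
  (forall i, is_derive (0 : R) 1 (fun s => Defs.coord (P s) i) (Defs.coord dP i)) ->
  is_derive (0 : R) 1 (fun s => f (P s)) (\sum_(i < 3) partial f i (P 0) * Defs.coord dP i).
Proof.
move=> h hc hP; apply/derive_seqP => s s0 s_0.
have cP : cvg3 (fun n => P (s n)) (P 0).
  have K i : Defs.coord (P (s n)) i @[n --> \oo] --> Defs.coord (P 0) i.
    have /derive_seqP/(_ _ s0 s_0) q := hP i.
    have -> : Defs.coord (P 0) i = 0 * Defs.coord dP i + Defs.coord (P 0) i by rewrite mul0r add0r.
    pose u n := s n * ((s n)^-1 * (Defs.coord (P (0 + s n)) i - Defs.coord (P 0) i)) + Defs.coord (P 0) i.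
    apply: (@cvg_ext _ u) => [|n].
      by apply: cvgD; [exact: cvgM|exact: cvg_cst].
    by rewrite /u add0r mulrA divff// mul1r subrK.
  by split; [exact: (K i0)|exact: (K i1)|exact: (K i2)].
have /choice[m hm] : forall n, exists m : 'I_3 -> V R, (forall i, between (P 0) (P (s n)) (m i)) /\
  f (P (s n)) - f (P 0) = \sum_(i < 3) partial f i (m i) * (Defs.coord (P (s n)) i - Defs.coord (P 0) i).
  by move=> n; have [m m1 m2] := C1_increment h (P 0) (P (s n)); exists m.
have Q i : partial f i (m n i) * ((s n)^-1 * (Defs.coord (P (s n)) i - Defs.coord (P 0) i))
    @[n --> \oo] --> partial f i (P 0) * Defs.coord dP i.
  apply: cvgM; last first.
    by have /derive_seqP/(_ _ s0 s_0) := hP i; under eq_fun do rewrite add0r.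
  apply: (continuous_cvg3 (hc i)); apply: (between_cvg cP) => n.
  by have [] := hm n.
rewrite sum3E; apply: cvg_ext; first exact: (cvgD (cvgD (Q i0) (Q i1)) (Q i2)).
move=> n.
by rewrite !fctE add0r; have [_ ->] := hm n; rewrite sum3E; ring.
Qed.

Lemma C1b_lipschitz L f : C1b L f ->
  forall a b, `|f b - f a| <= L * \sum_(i < 3) `|Defs.coord b i - Defs.coord a i|.
Proof.
move=> [_ h _ hL] a b; have [m _ ->] := C1_increment h a b.
rewrite mulr_sumr (le_trans (ler_norm_sum _ _ _))// ler_sum// => i _.
by rewrite normrM ler_wpM2r.
Qed.

Lemma C1b_lipschitz_enorm L f : C1b L f ->
  forall a b, `|f b - f a| <= 3 * L * enorm (subV b a).
Proof.
move=> hf a b; have L0 : 0 <= L by rewrite (le_trans _ (C1b_le hf i0 a)).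
rewrite (le_trans (C1b_lipschitz hf a b))// [3 * L]mulrC -mulrA ler_wpM2l//.
have K i : `|Defs.coord b i - Defs.coord a i| <= enorm (subV b a).
  have [] := ler_coord_enorm (subV b a); rewrite /= !mulN1r.
  by elim/I3_ind: i.
by rewrite sum3E; move: (K i0) (K i1) (K i2); lra.
Qed.

Lemma C1b_continuous0 L f : C1b L f -> continuous f.
Proof.
move=> hf; apply: cvg3_continuous => x l xl.
have L0 : 0 <= L by rewrite (le_trans _ (C1b_le hf i0 l)).
have D0 : 3 * L * enorm (subV (x n) l) @[n --> \oo] --> 0.
  have := cvg3_enorm (cvg3_sub xl (cvg3_cst l)).
  have -> : subV l l = ((0, 0), 0) by apply: eqV => /=; ring.
  rewrite (_ : enorm _ = 0); last by apply/eqP; rewrite enorm_eq0.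
  by move=> /(cvgM (cvg_cst (3 * L))); rewrite mulr0.
rewrite -[f l]add0r; under eq_fun do rewrite -[f _](subrK (f l)).
apply: cvgD; last exact: cvg_cst.
apply: (@squeeze_cvgr _ _ _ _ (fun n => - (3 * L * enorm (subV (x n) l))) (fun n => 3 * L * enorm (subV (x n) l))) => //.
  by near=> n; rewrite -ler_norml; exact: C1b_lipschitz_enorm.
by rewrite -oppr0; exact: cvgN.
Unshelve. all: by end_near. Qed.

Lemma C1b_measurable L f : C1b L f -> measurable_fun setT f.
Proof. by move=> /C1b_continuous0/continuous_measurableV. Qed.

Lemma C1b_measurable_partial L f i : C1b L f -> measurable_fun setT (partial f i).
Proof. by move=> h; apply: continuous_measurableV; exact: C1b_continuous h i. Qed.

Lemma C1b_weak L L' f : L <= L' -> C1b L f -> C1b L' f.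
Proof. by move=> h [h1 h2 h3 h4]; split => // i v; rewrite (le_trans (h4 i v)). Qed.

Lemma C1b_build L f (df : 'I_3 -> V R -> R) p : (forall v, `|f v| <= p) ->
  (forall i v, is_derive (0 : R) 1 (fun s => f (shiftV v i s)) (df i v)) ->
  (forall i, continuous (df i)) -> (forall i v, `|df i v| <= L) ->
  C1b L f /\ partial f = df.
Proof.
move=> hp hd hc hL.
have E : partial f = df by apply/funext => i; apply/funext => v; have [] := partial_eq (hd i v).
split => //; split => //; rewrite ?E//; by exists p.
Qed.

Lemma partial_chain L f i v : C1b L f ->
  is_derive (0 : R) 1 (fun s => f (shiftV v i s)) (partial f i v).
Proof. by move=> [_ h _ _]; exact: derivable_partial. Qed.

Lemma C1b_cst (c : R) : C1b 0 (fun=> c) /\ forall i v, partial (fun=> c) i v = 0.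
Proof.
have [h E] : C1b 0 (fun=> c) /\ partial (fun=> c) = (fun _ _ => 0).
  apply: (@C1b_build _ _ _ (`|c|)) => [v|i v|i|i v]; rewrite ?normr0//.
  - exact: is_derive_cst.
  - exact: cst_continuous.
by split => // i v; rewrite E.
Qed.

Lemma C1bM L1 L2 f g : C1b L1 f -> C1b L2 g -> exists L, C1b L (fun v => f v * g v) /\
  forall i v, partial (fun v => f v * g v) i v = f v * partial g i v + g v * partial f i v.
Proof.
move=> hf hg; have [p hp] := C1b_bounded hf; have [q hq] := C1b_bounded hg.
have [] := @C1b_build (p * L2 + q * L1) (fun v => f v * g v)
  (fun i v => f v * partial g i v + g v * partial f i v) (p * q).
- by move=> v; rewrite normrM ler_pM.
- move=> i v; apply: (is_derive_eq (is_deriveM (partial_chain i v hf) (partial_chain i v hg))).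
  by rewrite /GRing.scale/= !shiftV0.
- move=> i; apply: cvg3_continuous => x l xl; apply: cvgD; apply: cvgM.
  + exact: (continuous_cvg3 (C1b_continuous0 hf)).
  + exact: (continuous_cvg3 (C1b_continuous hg (i := i))).
  + exact: (continuous_cvg3 (C1b_continuous0 hg)).
  + exact: (continuous_cvg3 (C1b_continuous hf (i := i))).
- move=> i v; rewrite (le_trans (ler_normD _ _))// !normrM lerD// ler_pM//; exact: C1b_le.
- by move=> h E; exists (p * L2 + q * L1); split => // i v; rewrite E.
Qed.

Lemma C1b_comp L f (psi dpsi : R -> R) (p K M : R) : C1b L f -> (forall v, `|f v| <= p) ->
  (forall x : R, `|x| <= p -> is_derive x 1 psi (dpsi x)) ->
  (forall x : R, `|x| <= p -> {for x, continuous dpsi}) ->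
  (forall x : R, `|x| <= p -> `|dpsi x| <= K) -> (forall x : R, `|x| <= p -> `|psi x| <= M) ->
  C1b (K * L) (fun v => psi (f v)) /\
  forall i v, partial (fun v => psi (f v)) i v = dpsi (f v) * partial f i v.
Proof.
move=> hf hp hd hc hK hM.
have [] := @C1b_build (K * L) (fun v => psi (f v)) (fun i v => dpsi (f v) * partial f i v) M.
- by move=> v; exact: hM.
- move=> i v; have h1 : is_derive (f (shiftV v i 0)) 1 psi (dpsi (f v)).
    by rewrite shiftV0; exact: hd.
  exact: (is_derive1_comp h1 (partial_chain i v hf)).
- move=> i; apply: cvg3_continuous => x l xl; apply: cvgM.
    apply: continuous_cvg; first exact: hc.
    exact: (continuous_cvg3 (C1b_continuous0 hf)).
  exact: (continuous_cvg3 (C1b_continuous hf (i := i))).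
- by move=> i v; rewrite normrM ler_pM ?hK//; exact: C1b_le.
- by move=> h E; split => // i v; rewrite E.
Qed.

Lemma udiff_C1b (X : Type) (D : X -> Prop) L f (P : X -> R -> V R) (dP : X -> V R) : C1b L f ->
  (forall i, udiff D (fun x s => Defs.coord (P x s) i) (fun x => Defs.coord (dP x) i)) ->
  udiff D (fun x s => f (P x s)) (fun x => \sum_(i < 3) partial f i (P x 0) * Defs.coord (dP x) i).
Proof.
move=> hf hP; have [p hp] := C1b_bounded hf.
have L0 : 0 <= L by rewrite (le_trans _ (C1b_le hf i0 ((0, 0), 0))).
have [C0 [e0 [C00 e00 k0]]] := hP i0; have [C1 [e1 [C10 e10 k1]]] := hP i1.
have [C2 [e2 [C20 e20 k2]]] := hP i2.
exists (`|p| + L * (C0 + C1 + C2)), (Num.min e0 (Num.min e1 e2)); split.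
- by rewrite addr_ge0// mulr_ge0// !addr_ge0.
- by rewrite !lt_min e00 e10 e20.
move=> x Dx; have [_ l0 d0] := k0 x Dx; have [_ l1 d1] := k1 x Dx.
have [_ l2 d2] := k2 x Dx; split.
- by rewrite (le_trans (hp _))// (le_trans (ler_norm p))// lerDl mulr_ge0// !addr_ge0.
- move=> s; rewrite lt_min => /andP[s0]; rewrite lt_min => /andP[s1 s2].
  rewrite (le_trans (C1b_lipschitz hf _ _))// mulrDl ler_wpDl// ?mulr_ge0//.
  rewrite -mulrA ler_wpM2l// sum3E !mulrDl !lerD//; [exact: l0|exact: l1|exact: l2].
- apply: C1_chain; [exact: C1b_derivable hf|exact: C1b_continuous hf|exact: I3_ind].
Qed.

End C1Bounded.

(** * An integrable function orthogonal to all test functions vanishes *)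

Section Vanishing.
Variable R : realType.
Implicit Types (v a : V R) (k f : V R -> R).

(** Open octants: a generating family stable under intersection, whose indicators are products of
    three functions of one variable. *)
Definition box a : set (V R) := [set v | [/\ a.1.1 < v.1.1, a.1.2 < v.1.2 & a.2 < v.2]].

Lemma measurable_box a : measurable (box a).
Proof.
have -> : box a = (`]a.1.1, +oo[ `*` `]a.1.2, +oo[) `*` `]a.2, +oo[.
  apply/seteqP; split => v; rewrite /box /= !in_itv/= !andbT; first by case.
  by case=> -[].
by do 2?apply: measurableX.
Qed.

Lemma measurable_boxes : @measurable _ (V R) = <<s range box>>.
Proof.
apply/seteqP; split; last first.
  apply: smallest_sub; first exact: sigma_algebra_measurable.
  by move=> _ [a _ <-]; exact: measurable_box.
have arch (y z : R) : exists n : nat, - n%:R < y /\ - n%:R < z.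
  have := archi_boundP (addr_ge0 (normr_ge0 y) (normr_ge0 z)).
  set n := Num.bound _ => h; exists n.
  have h1 := ler_norm (- y); have h2 := ler_norm (- z); rewrite !normrN in h1 h2.
  by move: h h1 h2 (normr_ge0 y) (normr_ge0 z); clear; split; lra.
have K (c : V R -> R) (b : R -> nat -> V R) :
    (forall v x, x < c v <-> exists n, box (b x n) v) ->
    measurable_fun [set: g_sigma_algebraType (range box)] (c : g_sigma_algebraType (range box) -> R).
  move=> hc; apply: (measurability (@RGenOInfty.G R)); first exact: RGenOInfty.measurableE.
  move=> _ [_ [x ->] <-].
  have -> : [set: V R] `&` c @^-1` `]x, +oo[ = \bigcup_n box (b x n).
    rewrite setTI; apply/seteqP; split => v; rewrite /= in_itv/= andbT.
      by move=> /hc[n hn]; exists n.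
    by move=> [n _ hn]; apply/hc; exists n.
  apply: (@bigcup_measurable _ (g_sigma_algebraType (range box))) => n _.
  by apply: sub_sigma_algebra; exists (b x n).
suff h : measurable_fun [set: g_sigma_algebraType (range box)]
    (id : g_sigma_algebraType (range box) -> V R).
  by move=> A mA; have := h measurableT A mA; rewrite setTI.
apply/measurable_fun_pairP; split; [apply/measurable_fun_pairP; split|].
- apply: (K (fun v => v.1.1) (fun x n => ((x, - n%:R), - n%:R))) => v x; split.
    by move=> xv; have [n [h1 h2]] := arch v.1.2 v.2; exists n; split.
  by move=> [n []].
- apply: (K (fun v => v.1.2) (fun x n => ((- n%:R, x), - n%:R))) => v x; split.
    by move=> xv; have [n [h1 h2]] := arch v.1.1 v.2; exists n; split.
  by move=> [n []].
- apply: (K (fun v => v.2) (fun x n => ((- n%:R, - n%:R), x))) => v x; split.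
    by move=> xv; have [n [h1 h2]] := arch v.1.1 v.1.2; exists n; split.
  by move=> [n []].
Qed.

Lemma C1b_coord (s ds : R -> R) (L M : R) (j : 'I_3) : (forall x : R, is_derive x 1 s (ds x)) ->
  continuous ds -> (forall x, `|ds x| <= L) -> (forall x, `|s x| <= M) ->
  C1b L (fun v => s (Defs.coord v j)).
Proof.
move=> hs hc hL hM; have L0 : 0 <= L by rewrite (le_trans _ (hL 0)).
suff [] : C1b L (fun v => s (Defs.coord v j)) /\
  partial (fun v => s (Defs.coord v j)) = (fun i v => ds (Defs.coord v j) * (i == j)%:R) by [].
apply: (@C1b_build _ _ _ _ M) => [v|i v|i|i v]; first exact: hM.
- have E : (fun r => Defs.coord (shiftV v i r) j) = (fun r => Defs.coord v j + (i == j)%:R * r).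
    apply/funext => r; move: i j; apply: I3_ind; apply: I3_ind;
    by rewrite /Defs.coord /= ?mul0r ?mul1r.
  rewrite [X in is_derive _ _ X](_ : _ = s \o (fun r => Defs.coord v j + (i == j)%:R * r)); last first.
    by apply/funext => r /=; rewrite -(congr1 (@^~ r) E).
  have h0 : is_derive (Defs.coord v j + (i == j)%:R * 0) 1 s (ds (Defs.coord v j)).
    by rewrite mulr0 addr0.
  have hi : is_derive (0 : R) 1 (fun r : R => Defs.coord v j + (i == j)%:R * r) ((i == j)%:R).
    by apply: (is_derive_eq (is_derive_affine _ _ (is_derive_id (0 : R) (1 : R)))); rewrite mulr1.
  exact: (@is_derive1_comp _ s (fun r => Defs.coord v j + (i == j)%:R * r) 0 _ _ h0 hi).
- apply: cvg3_continuous => x l xl; apply: cvgM; last exact: cvg_cst.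
  by apply: continuous_cvg; [exact: hc|exact: cvg3_coord].
- rewrite normrM; case: (i == j); first by rewrite normr1 mulr1.
  by rewrite normr0 mulr0.
Qed.

(** A C^1 substitute for the positive part, vanishing exactly for [t <= 0]. *)
Definition sqp (t : R) := Num.max 0 t ^+ 2.

Lemma is_derive_sqp (t : R) : is_derive t 1 sqp (2 * Num.max 0 t).
Proof.
apply: (@is_derive_quadratic _ _ _ _ 1 1) => // s _; rewrite mul1r ler_norml /sqp.
by case: (leP 0 t) => h1; case: (leP 0 (t + s)) => h2; apply/andP; split; nra.
Qed.

Lemma continuous_maxr0 : continuous (fun t : R => Num.max 0 t).
Proof.
have -> : (fun t : R => Num.max 0 t) = (fun t => (t + `|t|) / 2).
  by apply/funext => t; case: leP => h; [rewrite ger0_norm|rewrite ltr0_norm]; lra.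
move=> t; apply: cvgM; last exact: cvg_cst.
by apply: cvgD; [exact: cvg_id|exact: norm_continuous].
Qed.

(** The functions [s n] are C^1, bounded by [1], and tend to the indicator of []0, +oo[]. Their
    products give a vanishing integral of [k] over every octant, and a Dynkin argument extends this
    to all measurable sets. *)
Lemma integral_zero_ae k : L1 (mu3 R) k ->
  (forall L f, C1b L f -> Int (mu3 R) (fun v => k v * f v) = 0) -> {ae mu3 R, forall x, k x = 0}.
Proof.
move=> ki h.
pose s (n : nat) (t : R) := n.+1%:R * sqp t / (1 + n.+1%:R * sqp t).
have s1 n t : `|s n t| <= 1.
  have q0 : 0 <= n.+1%:R * sqp t by rewrite mulr_ge0// sqr_ge0.
  rewrite ger0_norm; last by rewrite divr_ge0// addr_ge0.
  by rewrite ler_pdivrMr ?ltr_wpDr// mul1r lerDr.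
have C1s n (a : R) j : exists L, C1b L (fun v => s n (Defs.coord v j - a)).
  exists n.+1%:R.
  pose ds (x : R) := n.+1%:R * (2 * Num.max 0 (x - a)) / (1 + n.+1%:R * sqp (x - a)) ^+ 2.
  have D1 x : 1 <= 1 + n.+1%:R * sqp (x - a) by rewrite lerDl mulr_ge0// sqr_ge0.
  apply: (@C1b_coord (fun x => s n (x - a)) ds n.+1%:R 1 j) => //.
  - move=> x; have d0 : 1 + n.+1%:R * sqp (x - a) != 0 by rewrite gt_eqF// (lt_le_trans _ (D1 x)).
    have hi : is_derive x 1 (fun y : R => y - a) (1 * 1).
      rewrite (_ : (fun y : R => y - a) = (fun y => - a + 1 * y)); first exact: is_derive_affine.
      by apply/funext => y; rewrite mul1r addrC.
    have h1 : is_derive x 1 (fun y : R => sqp (y - a)) (2 * Num.max 0 (x - a) * (1 * 1)).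
      exact: (@is_derive1_comp _ sqp (fun y : R => y - a) x _ _ (is_derive_sqp (x - a)) hi).
    have hq := is_derive_affine 1 n.+1%:R h1.
    have Es : (fun y : R => s n (y - a)) = (fun y => 1 + -1 * (1 + n.+1%:R * sqp (y - a))^-1).
      have fE (q : R) : 1 + q != 0 -> q / (1 + q) = 1 + -1 * (1 + q)^-1 by move=> ?; field.
      by apply/funext => y; rewrite /s fE// gt_eqF// (lt_le_trans _ (D1 y)).
    rewrite Es; have hv : is_derive x 1 (fun y : R => 1 + -1 * (1 + n.+1%:R * sqp (y - a))^-1) _ :=
      is_derive_affine 1 (-1) (@is_deriveV _ (fun y : R => 1 + n.+1%:R * sqp (y - a)) x _ _ d0 hq).
    apply: (is_derive_eq hv).
    have gE (p q : R) : -1 * (- p * q) = q * p by ring.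
    by rewrite /ds /GRing.scale /= !mulr1 gE.
  - have cm x : Num.max 0 (y - a) @[y --> x] --> Num.max 0 (x - a).
      apply: (@continuous_comp _ _ _ (fun y => y - a) (fun t => Num.max 0 t)); last exact: continuous_maxr0.
      by apply: cvgB; [exact: cvg_id|exact: cvg_cst].
    have d0 x : (1 + n.+1%:R * sqp (x - a)) ^+ 2 != 0 by rewrite gt_eqF// exprn_gt0// (lt_le_trans _ (D1 x)).
    move=> x; rewrite /ds; apply: cvgM.
      by apply: cvgM; [exact: cvg_cst|apply: cvgM; [exact: cvg_cst|exact: cm]].
    apply: cvgV; first exact: d0.
    have cq : 1 + n.+1%:R * sqp (y - a) @[y --> x] --> 1 + n.+1%:R * sqp (x - a).
      apply: cvgD; first exact: cvg_cst.
      by apply: cvgM; [exact: cvg_cst|apply: cvgM; exact: cm].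
    exact: (cvgM cq cq).
  - move=> x; rewrite /ds normrM normfV normrX [in X in _ / X ^+ _]ger0_norm; last exact: le_trans (D1 x).
    have m0 : 0 <= Num.max 0 (x - a) by rewrite le_max lexx.
    rewrite ger0_norm ?mulr_ge0// ler_pdivrMr; last by rewrite exprn_gt0// (lt_le_trans _ (D1 x)).
    rewrite ler_wpM2l//; have n1 : 1 <= n.+1%:R :> R by rewrite ler1n.
    move: (D1 x); rewrite /sqp; move: (Num.max 0 (x - a)) m0 => m m0 d1.
    have a1 : m ^+ 2 <= n.+1%:R * m ^+ 2 by rewrite ler_peMl ?sqr_ge0.
    have a2 : 1 + n.+1%:R * m ^+ 2 <= (1 + n.+1%:R * m ^+ 2) ^+ 2 by rewrite expr2 ler_peMl// (le_trans _ d1).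
    apply: (le_trans _ a2); apply: (@le_trans _ _ (1 + m ^+ 2)); last by rewrite lerD2l.
    by have := sqr_ge0 (m - 1); rewrite sqrrB expr1n; lra.
pose phi n a v := s n (v.1.1 - a.1.1) * s n (v.1.2 - a.1.2) * s n (v.2 - a.2).
have C1phi n a : exists L, C1b L (phi n a).
  have [L1' H1] := C1s n a.1.1 i0; have [L2' H2] := C1s n a.1.2 i1.
  have [L3' H3] := C1s n a.2 i2; have [L4 [H4 _]] := C1bM H1 H2.
  by have [L5 [H5 _]] := C1bM H4 H3; exists L5.
have mk := L1_measurable ki.
have slim (a : R) : s n a @[n --> \oo] --> ((0 < a)%R%:R : R).
  case: ltP => a0; last first.
    rewrite /s /sqp max_l//; apply: cvg_ext (cvg_cst (0 : R)) _ => n.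
    by rewrite expr0n mulr0 mul0r.
  have q0 : 0 < sqp a by rewrite /sqp max_r ?(ltW a0)// exprn_gt0.
  have E n : s n a = 1 - (1 + n.+1%:R * sqp a)^-1.
    by rewrite /s; field; rewrite gt_eqF// ltr_wpDr// mulr_ge0// ltW.
  have : (sqp a)^-1 * n.+1%:R^-1 @[n --> \oo] --> 0.
    by rewrite -(mulr0 (sqp a)^-1); apply: cvgM; [exact: cvg_cst|exact: cvg_harmonic].
  move=> h1; have h2 : (1 + n.+1%:R * sqp a)^-1 @[n --> \oo] --> 0.
    apply: (squeeze_cvgr _ (cvg_cst 0) h1); near=> n.
    have p0 : 0 < n.+1%:R * sqp a by rewrite mulr_gt0.
    have hh : n.+1%:R * sqp a <= 1 + n.+1%:R * sqp a by rewrite lerDr.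
    have p1 : 0 < 1 + n.+1%:R * sqp a by rewrite ltr_wpDl.
    by rewrite invr_ge0 (ltW p1)/= -invfM [sqp a * _]mulrC lef_pV2.
  have h3 : 1 - (1 + n.+1%:R * sqp a)^-1 @[n --> \oo] --> (1 - 0 : R).
    by apply: cvgB; [exact: cvg_cst|exact: h2].
  by rewrite subr0 in h3; exact: (cvg_ext h3 E).
have hbox a : (\int[mu3 R]_(x in box a) (k x)%:E = 0)%E.
  have mb := measurable_box a.
  rewrite integral_mkcond.
  have -> : (EFin \o k) \_ (box a) = EFin \o (fun v => k v * \1_(box a) v).
    apply/funext => v; rewrite patchE.
    have -> : (EFin \o (fun v => k v * \1_(box a) v)) v = (k v * (v \in box a)%:R)%:E.
      by rewrite /= indicE.
    by case: ifPn => _; rewrite ?mulr1 ?mulr0.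
  have i1 : L1 (mu3 R) (fun v => k v * \1_(box a) v).
    apply: (@L1M _ _ _ _ _ _ 1) => // v; rewrite indicE; case: (v \in box a);
    by rewrite ?normr1 ?normr0.
  rewrite Int_EFin//; congr EFin.
  have : Int (mu3 R) (fun v => k v * phi n a v) @[n --> \oo] --> Int (mu3 R) (fun v => k v * \1_(box a) v).
    apply: (@Int_dct _ _ _ _ _ _ (fun v => `|k v|) _ _ _ _ _).2.
    - move=> n; have [L H] := C1phi n a; apply: measurable_funM => //; exact: C1b_measurable H.
    - exact: L1_measurable i1.
    - exact: L1_norm.
    - move=> n v; rewrite normrM ler_piMr// /phi.
      rewrite normrM (normrM (s n (v.1.1 - a.1.1)) (s n (v.1.2 - a.1.2))).
      by rewrite !mulr_ile1 ?mulr_ge0.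
    - move=> v; apply: cvgM; first exact: cvg_cst.
      have -> : \1_(box a) v = (0 < v.1.1 - a.1.1)%R%:R * (0 < v.1.2 - a.1.2)%R%:R * (0 < v.2 - a.2)%R%:R :> R.
        rewrite indicE !subr_gt0 -!natrM !mulnb; congr (nat_of_bool _)%:R.
        apply/idP/idP => [|/andP[/andP[h1 h2] h3]]; first by rewrite inE => -[-> -> ->].
        by rewrite inE.
      by apply: cvgM => //; exact: cvgM.
  have E0 n : Int (mu3 R) (fun v => k v * phi n a v) = 0 by have [L /h] := C1phi n a.
  under eq_fun do rewrite E0.
  by move=> /cvg_lim -/(_ (@Rhausdorff R)) <-; rewrite lim_cst.
have all S : measurable S -> (\int[mu3 R]_(x in S) (k x)%:E = 0)%E.
  move=> mS.
  have int_S S' : measurable S' -> (mu3 R).-integrable S' (EFin \o k).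
    by move=> mS'; apply: integrableS ki.
  have hT : (\int[mu3 R]_x (k x)%:E = 0)%E.
    rewrite Int_EFin//; congr EFin; have := h _ _ (C1b_cst (1 : R)).1.
    by under eq_fun do rewrite mulr1.
  apply: (@dynkin_induction _ _ (range box) (fun S => (\int[mu3 R]_(x in S) (k x)%:E = 0)%E)).
  - exact: measurable_boxes.
  - move=> _ _ [a _ <-] [b _ <-].
    exists ((Num.max a.1.1 b.1.1, Num.max a.1.2 b.1.2), Num.max a.2 b.2) => //.
    apply/seteqP; split => v; rewrite /box /= !gt_max.
      by move=> [/andP[? ?] /andP[? ?] /andP[? ?]].
    by move=> [[-> -> ->] [-> -> ->]].
  - exact: hT.
  - by move=> _ [a _ <-]; exact: hbox.
  - move=> S' mS' hS'; move: hT; rewrite -(setUv S') integral_setU//; last first.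
    + by apply/disj_setPS; rewrite setICr.
    + by rewrite setUv; apply/measurable_EFinP.
    + exact: measurableC.
    + by rewrite hS' add0e.
  - move=> F mF tF hF; rewrite integral_bigcup//; last by apply: int_S; exact: bigcup_measurable.
    by rewrite eseries0.
  - by rewrite -measurable_boxes.
have H := @integral_ae_eq _ _ _ (mu3 R) setT measurableT (cst 0%E) (EFin \o k) ki (measurable_cst _).
have : ae_eq (mu3 R) setT (EFin \o k) (cst 0%E).
  by apply: H => E _ mE; rewrite all// integral0.
by apply: filterS => v /(_ I) /= [].
Unshelve. all: by end_near. Qed.

End Vanishing.

(** * Riesz representation on a space of functions that is not closed *)

Section Riesz.
Context d (T : measurableType d) (R : realType) (mu : {measure set T -> \bar R}).
Implicit Types a b : T -> R.
Local Notation L1 := (L1 mu).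
Local Notation Int := (Int mu).

Lemma L1_mul a b : measurable_fun setT a -> measurable_fun setT b ->
  L1 (fun x => a x ^+ 2) -> L1 (fun x => b x ^+ 2) -> L1 (fun x => a x * b x).
Proof.
move=> ma mb a2 b2; apply: (L1_le _ _ (L1D a2 b2)); first exact: measurable_funM.
move=> x; rewrite ler_norml; have := sqr_ge0 (a x + b x); have := sqr_ge0 (a x - b x).
by have := sqr_ge0 (a x); have := sqr_ge0 (b x); rewrite sqrrB sqrrD; lra.
Qed.

Lemma L1_sqrD a b k : measurable_fun setT a -> measurable_fun setT b ->
  L1 (fun x => a x ^+ 2) -> L1 (fun x => b x ^+ 2) ->
  L1 (fun x => (a x + k * b x) ^+ 2) /\
  Int (fun x => (a x + k * b x) ^+ 2) =
    Int (fun x => a x ^+ 2) + 2 * k * Int (fun x => a x * b x) + k ^+ 2 * Int (fun x => b x ^+ 2).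
Proof.
move=> ma mb a2 b2; have ab := L1_mul ma mb a2 b2.
have E : (fun x => (a x + k * b x) ^+ 2) =
    (fun x => a x ^+ 2 + 2 * k * (a x * b x) + k ^+ 2 * b x ^+ 2).
  by apply/funext => x; ring.
have h1 := L1Z (2 * k) ab; have h2 := L1Z (k ^+ 2) b2; have h3 := L1D a2 h1.
by rewrite E; split; [exact: L1D|rewrite !IntD// !IntZ].
Qed.

Lemma sum_half (n : nat) : \sum_(k < n) (2^-1 : R) ^+ k = 2 - 2 * 2^-1 ^+ n.
Proof.
elim: n => [|n IH]; first by rewrite big_ord0 expr0; ring.
by rewrite big_ord_recr /= IH exprS; field.
Qed.

(** Cauchy-Schwarz with the weights [2^-k], whose sum is below [2]. *)
Lemma sqr_sum_le (u : nat -> R) n :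
  (\sum_(k < n) `|u k|) ^+ 2 <= 2 * \sum_(k < n) 2 ^+ k * u k ^+ 2.
Proof.
suff [h1 h2] : (\sum_(k < n) `|u k|) ^+ 2 <=
    (\sum_(k < n) 2^-1 ^+ k) * (\sum_(k < n) 2 ^+ k * u k ^+ 2) /\
    0 <= \sum_(k < n) 2 ^+ k * u k ^+ 2.
  apply: (le_trans h1); rewrite ler_wpM2r// sum_half lerBlDr lerDl.
  by rewrite mulr_ge0// exprn_ge0// invr_ge0.
elim: n => [|n [IH IH2]]; first by rewrite !big_ord0 expr0n mulr0.
split; last by apply: sumr_ge0 => i _; rewrite mulr_ge0 ?sqr_ge0// exprn_ge0.
have p0 : 0 <= \sum_(k < n) (2^-1 : R) ^+ k.
  by apply: sumr_ge0 => i _; rewrite exprn_ge0// invr_ge0.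
have S0 : 0 <= \sum_(k < n) `|u k| by apply: sumr_ge0.
rewrite !big_ord_recr /=; move: IH IH2 p0 S0.
move: (\sum_(k < n) `|u k|) (\sum_(k < n) 2^-1 ^+ k) (\sum_(k < n) 2 ^+ k * u k ^+ 2) => S p H.
move=> IH H0 p0 S0; rewrite -[u n ^+ 2]real_normK ?num_real//.
have := normr_ge0 (u n); move: (`|u n|) => x x0.
have y0 : 0 < (2 : R) ^+ n by rewrite exprn_gt0.
rewrite exprVn; move: (2 ^+ n) y0 => y y0.
have -> : (p + y^-1) * (H + y * x ^+ 2) = p * H + (p * y * x ^+ 2 + y^-1 * H) + x ^+ 2.
  by field; rewrite gt_eqF.
have i0 : 0 <= y^-1 by rewrite invr_ge0 ltW.
have A0 : 0 <= p * y * x ^+ 2 by rewrite !mulr_ge0// ?sqr_ge0// ltW.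
have B0 : 0 <= y^-1 * H by exact: mulr_ge0.
have h : 2 * (S * x) <= p * y * x ^+ 2 + y^-1 * H.
  apply: ler_sqr_imp; first exact: addr_ge0.
  have : (S * x) ^+ 2 <= (p * y * x ^+ 2) * (y^-1 * H).
    have -> : p * y * x ^+ 2 * (y^-1 * H) = p * H * x ^+ 2 by field; rewrite gt_eqF.
    by rewrite exprMn ler_wpM2r// sqr_ge0.
  move: (p * y * x ^+ 2) (y^-1 * H) => a b; have := sqr_ge0 (a - b).
  by rewrite sqrrB !exprMn; lra.
by rewrite sqrrD; move: h IH; lra.
Qed.

Variables (A : (T -> R) -> Prop) (l : (T -> R) -> R) (c : R).
Hypotheses (A0 : A (fun=> 0))
  (AD : forall a b k, A a -> A b -> A (fun x => a x + k * b x))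
  (lD : forall a b k, A a -> A b -> l (fun x => a x + k * b x) = l a + k * l b)
  (Am : forall a, A a -> measurable_fun setT a)
  (A2 : forall a, A a -> L1 (fun x => a x ^+ 2))
  (c0 : 0 <= c)
  (lc : forall a, A a -> l a ^+ 2 <= c * Int (fun x => a x ^+ 2)).

(** A concave functional; up to a constant it is minus the squared distance from [a] to the vector
    representing [l], so a maximizing sequence approaches that vector. *)
Let J a := 2 * l a - Int (fun x => a x ^+ 2).
Let S := sup [set J a | a in A].

Let J_shift a b k : A a -> A b ->
  J (fun x => a x + k * b x) = J a + k * (2 * l b - 2 * Int (fun x => a x * b x)) - k ^+ 2 * Int (fun x => b x ^+ 2).
Proof.
move=> ha hb; rewrite /J lD// (L1_sqrD k (Am ha) (Am hb) (A2 ha) (A2 hb)).2.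
by ring.
Qed.

Let J_sup : has_sup [set J a | a in A].
Proof.
split; first by exists (J (fun=> 0)), (fun=> 0).
exists c => _ [a ha <-]; rewrite /J.
have h := lc ha; have N0 : 0 <= Int (fun x => a x ^+ 2) by apply: Int_ge0 => x; exact: sqr_ge0.
move: N0 h; move: (Int _) (l a) => N y N0 h.
suff : 2 * y <= c + N by lra.
apply: ler_sqr_imp; first exact: addr_ge0.
by have := sqr_ge0 (c - N); rewrite sqrrB sqrrD exprMn; lra.
Qed.

Let J_le a : A a -> J a <= S.
Proof. by move=> ha; apply: (ub_le_sup J_sup.2); exists a. Qed.

(* The parallelogram identity: near-maximizers of [J] are close to each other in L^2. *)
Let J_close a b : A a -> A b ->
  Int (fun x => (b x - a x) ^+ 2) <= 2 * (S - J a) + 2 * (S - J b).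
Proof.
move=> ha hb; have hd := AD (-1) hb ha.
pose dd x := b x + -1 * a x; rewrite -/dd in hd.
have E1 : b = (fun x => a x + 1 * dd x) by apply/funext => x; rewrite /dd; ring.
have -> : (fun x => (b x - a x) ^+ 2) = (fun x => dd x ^+ 2).
  by apply/funext => x; rewrite /dd mulN1r.
have := J_le (AD (2^-1) ha hd); have := J_shift 1 ha hd; rewrite -E1 (J_shift _ ha hd) => ->.
by move: (J a) (Int _) (l dd) (Int _) => j i q r; rewrite expr1n; lra.
Qed.

(** The maximum of [J] need not be attained in [A], so the representative is the limit of a
    maximizing sequence. The sequence is part of the conclusion: when [l] is already the product
    with a known function, it yields approximations from [A] that converge almost everywhere. *)
Lemma riesz_limit : exists (G : T -> R) (a_ : nat -> T -> R),
  [/\ measurable_fun setT G, L1 (fun x => G x ^+ 2), Int (fun x => G x ^+ 2) <= c,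
    (forall a, A a -> Int (fun x => G x * a x) = l a) &
    (forall n, A (a_ n)) /\ {ae mu, forall x, a_ ^~ x @ \oo --> G x}].
Proof.
(* The gap [16^-n] makes the squared distance of consecutive terms at most [4 * 16^-n], so the
   weighted squares [2^n (a_{n+1} - a_n)^2] have summable integrals and the series of differences
   converges almost everywhere. *)
have /choice[a_ ha] : forall n : nat, exists a, A a /\ S - (16^-1) ^+ n < J a.
  move=> n; have e0 : 0 < (16^-1 : R) ^+ n by rewrite exprn_gt0// invr_gt0.
  by have [_ [a ha <-] h] := sup_adherent e0 J_sup; exists a.
pose dn n x := a_ n.+1 x - a_ n x.
have Aa n : A (a_ n) by have [] := ha n.
have mdn n : measurable_fun setT (dn n) by apply: measurable_funB; exact: Am.
have d2 n : L1 (fun x => dn n x ^+ 2) /\ Int (fun x => dn n x ^+ 2) <= 4 * (16^-1) ^+ n.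
  split.
    have [+ _] := L1_sqrD (-1) (Am (Aa n.+1)) (Am (Aa n)) (A2 (Aa n.+1)) (A2 (Aa n)).
    by congr L1; apply/funext => x; rewrite mulN1r.
  apply: (le_trans (J_close (Aa n) (Aa n.+1))).
  have [_ h1] := ha n; have [_ h2] := ha n.+1; rewrite exprS in h2.
  have : 0 < (16^-1 : R) ^+ n by rewrite exprn_gt0// invr_gt0.
  by move: h1 h2; move: (J _) (J _) (_ ^+ n) => p q r; lra.
pose He x := (\sum_(k <oo) (2 ^+ k * dn k x ^+ 2)%:E)%E.
have t0 k x : (0 <= (2 ^+ k * dn k x ^+ 2)%:E)%E.
  by rewrite lee_fin mulr_ge0 ?sqr_ge0// exprn_ge0.
have mt k : measurable_fun setT (fun x => (2 ^+ k * dn k x ^+ 2)%:E).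
  by apply/measurable_EFinP; apply: measurable_funM => //; exact: measurable_funX.
have He0 x : (0 <= He x)%E by apply: nneseries_ge0 => k _ _; exact: t0.
have mHe : measurable_fun setT He.
  by apply: ge0_emeasurable_sum => k *; [exact: t0|exact: mt].
have IHe : (\int[mu]_x He x < +oo)%E.
  rewrite /He integral_nneseries//.
  apply: (@le_lt_trans _ _ 8%:E); last exact: ltry.
  apply: lime_le.
    by apply: is_cvg_nneseries => k _ _; apply: integral_ge0 => x _; exact: t0.
  apply: nearW => n; rewrite big_mkord.
  apply: (@le_trans _ _ (\sum_(k < n) (4 * 2^-1 ^+ k)%:E)%E).
    apply: lee_sum => k _; rewrite Int_EFin; last by apply: L1Z; exact: (d2 k).1.
    rewrite lee_fin IntZ; last exact: (d2 k).1.
    rewrite (le_trans (ler_wpM2l _ (d2 k).2)) ?exprn_ge0//.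
    rewrite mulrCA -exprMn ler_wpM2l//.
    have -> : 2 * 16^-1 = 8^-1 :> R by field.
    by rewrite lerXn2r ?nnegrE ?invr_ge0// lef_pV2 ?posrE// ler_nat.
  rewrite sumEFin lee_fin -mulr_sumr sum_half.
  have : 0 < (2^-1 : R) ^+ n by rewrite exprn_gt0// invr_gt0.
  by move: (_ ^+ n) => y; lra.
pose N := He @^-1` [set +oo%E].
have mN : measurable N by rewrite -[N]setTI; apply: mHe => //; exact: emeasurable_set1.
have HeN x : x \notin N -> He x \is a fin_num.
  move=> xN; rewrite ge0_fin_numE// ltey; apply: contra xN => /eqP E; exact/mem_set.
have iHe : mu.-integrable setT He.
  by apply/integrableP; split => //; under eq_integral do rewrite gee0_abs//.
have aeN : {ae mu, forall x, x \notin N}.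
  have := integrable_ae measurableT iHe; apply: filterS => x /(_ I) h.
  by apply/negP; rewrite inE /N /= => E; rewrite E in h.
pose H x := fine (He x).
have H0 x : 0 <= H x by exact: fine_ge0.
have mH : measurable_fun setT H by exact: measurableT_comp mHe.
have L1H : L1 H.
  apply/integrableP; split; first exact/measurable_EFinP.
  apply: le_lt_trans IHe; apply: ge0_le_integral => //.
    by apply: measurableT_comp => //; exact/measurable_EFinP.
  move=> x _ /=; rewrite ger0_norm//.
  by have := He0 x; rewrite /H; case: (He x) => [r||]//= _; rewrite leey.
(* Put to [0] on the null set [N], the sequence converges at every point and is dominated. *)
pose h n x := a_ n x * \1_(~` N) x.
have mh n : measurable_fun setT (h n) by apply: measurable_funM; [exact: Am|apply: measurable_indic; exact: measurableC].
have hN n x : x \notin N -> h n x = a_ n x.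
  by move=> xN; rewrite /h indicE in_setC xN mulr1.
have hN' n x : x \in N -> h n x = 0 by move=> xN; rewrite /h indicE in_setC xN mulr0.
have sumH n x : x \notin N -> (\sum_(k < n) `|dn k x|) ^+ 2 <= 2 * H x.
  move=> xN; apply: (le_trans (sqr_sum_le (dn^~ x) n)); rewrite ler_wpM2l//.
  rewrite -lee_fin /H fineK ?HeN// -sumEFin -(big_mkord xpredT (fun k => (2 ^+ k * dn k x ^+ 2)%:E)).
  by apply: nneseries_lim_ge => k _ _; exact: t0.
have tele n x : a_ n x = a_ 0%N x + \sum_(k < n) dn k x.
  elim: n => [|n IH]; first by rewrite big_ord0 addr0.
  by rewrite big_ord_recr /= addrA -IH /dn addrC subrK.
have hcvg x : cvgn (h ^~ x).
  have [xN|xN] := boolP (x \in N).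
    by apply/cvg_ex; exists 0; apply: cvg_ext (cvg_cst (0 : R)) _ => n; exact: hN'.
  have cs : cvgn (series (dn ^~ x)).
    apply: normed_cvg; apply: nondecreasing_is_cvgn.
      by apply/nondecreasing_seqP => n; rewrite /= /series /= big_nat_recr//= lerDl.
    exists (2 * H x + 1) => _ [n _ <-]; rewrite /= /series /= big_mkord.
    have := sumH n x xN; have : 0 <= \sum_(k < n) `|dn k x| by apply: sumr_ge0.
    by move: (\sum_(k < n) _) => q q0 hq; nra.
  apply/cvg_ex; exists (a_ 0%N x + limn (series (dn ^~ x))).
  apply: (@cvg_ext _ (fun n => a_ 0%N x + series (dn ^~ x) n)) => [|n].
    by apply: cvgD; [exact: cvg_cst|exact: cs].
  by rewrite hN// tele /series /= big_mkord.
pose G x := limn (h ^~ x).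
have hG x : h ^~ x @ \oo --> G x by exact: hcvg.
have mG : measurable_fun setT G.
  by apply: (measurable_fun_cvg (h := h)) => [n|x _]; [exact: mh|exact: hG].
pose g x := 2 * a_ 0%N x ^+ 2 + 4 * H x.
have L1g : L1 g by apply: L1D; apply: L1Z => //; exact: A2.
have hg n x : `|h n x ^+ 2| <= g x.
  have g0 : 0 <= g x by rewrite /g addr_ge0// mulr_ge0// sqr_ge0.
  have [xN|xN] := boolP (x \in N); first by rewrite hN'// expr0n normr0.
  rewrite hN// tele ger0_norm ?sqr_ge0//.
  have h1 := sumH n x xN; have h2 : `|\sum_(k < n) dn k x| <= \sum_(k < n) `|dn k x| := ler_norm_sum _ _ _.
  have h3 : (\sum_(k < n) dn k x) ^+ 2 <= 2 * H x.
    apply: le_trans h1; rewrite -[leLHS]real_normK ?num_real// lerXn2r ?nnegrE//.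
    by apply: sumr_ge0.
  rewrite /g; move: h3; move: (\sum_(k < n) _) (a_ 0%N x) => p q h3.
  by have := sqr_ge0 (p - q); rewrite sqrrB sqrrD; lra.
have mh2 n : measurable_fun setT (fun x => h n x ^+ 2) by exact: measurable_funX.
have hG2 x : h n x ^+ 2 @[n --> \oo] --> G x ^+ 2 by rewrite !expr2; apply: cvgM.
have [L1G2 cG2] := Int_dct mh2 (measurable_funX 2 mG) L1g hg hG2.
have cGa a : A a -> Int (fun x => h n x * a x) @[n --> \oo] --> Int (fun x => G x * a x).
  move=> ha'; have ma := Am ha'.
  apply: (Int_dct _ _ (L1D L1g (A2 ha')) _ _).2.
  - by move=> n; exact: measurable_funM.
  - exact: measurable_funM.
  - move=> n x; have := hg n x; rewrite ger0_norm ?sqr_ge0// normrM.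
    rewrite -(real_normK (num_real (h n x))) -(real_normK (num_real (a x))).
    have := sqr_ge0 (`|h n x| - `|a x|); have := normr_ge0 (h n x); have := normr_ge0 (a x).
    by move: (`|h n x|) (`|a x|) => p q p0 q0; rewrite sqrrB; nra.
  - by move=> x; apply: cvgM; [exact: hG|exact: cvg_cst].
have eqh n : Int (fun x => h n x ^+ 2) = Int (fun x => a_ n x ^+ 2).
  apply: Int_eq_ae => //; first by apply: measurable_funX; exact: Am.
  by apply: filterS aeN => x /hN ->.
have eqha n a : A a -> Int (fun x => h n x * a x) = Int (fun x => a_ n x * a x).
  move=> ha'; apply: Int_eq_ae; try (by apply: measurable_funM => //; exact: Am).
  by apply: filterS aeN => x /hN ->.
have JS : J (a_ n) @[n --> \oo] --> S.
  have g0 : (16^-1 : R) ^+ n @[n --> \oo] --> 0.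
    by apply: cvg_expr; rewrite ger0_norm ?invr_ge0// invf_lt1// ltr1n.
  apply: (@squeeze_cvgr _ _ _ _ (fun n => S - 16^-1 ^+ n) (fun=> S)).
  - near=> n.
    by have [h1 h2] := ha n; rewrite (ltW h2)/= J_le.
  - by rewrite -[X in _ --> X]subr0; apply: cvgB => //; exact: cvg_cst.
  - exact: cvg_cst.
have lG a : A a -> Int (fun x => G x * a x) = l a.
  move=> ha'; set q := Int (fun x => a x ^+ 2).
  have q0 : 0 <= q by apply: Int_ge0 => x; exact: sqr_ge0.
  pose p := 2 * l a - 2 * Int (fun x => G x * a x).
  (* Optimality in the direction [a], passed to the limit: a parabola in [k] that never exceeds its
     value at [0] has slope zero there. *)
  have K k : S + k * p - k ^+ 2 * q <= S.
    apply: (@cvg_le R (fun n => J (a_ n) + k * (2 * l a - 2 * Int (fun x => h n x * a x)) - k ^+ 2 * q) (fun=> S)).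
    - apply: cvgB; last exact: cvg_cst.
      apply: cvgD => //; apply: cvgM; first exact: cvg_cst.
      apply: cvgB; first exact: cvg_cst.
      by apply: cvgM; [exact: cvg_cst|exact: cGa].
    - exact: cvg_cst.
    - by move=> n; rewrite eqha// -J_shift// J_le//; exact: AD.
  have q1 : 0 < q + 1 by rewrite ltr_wpDl.
  (* Dividing by [q + 1] instead of [q] covers a vanishing [q] as well. *)
  have := K (p / (q + 1)).
  have -> : p / (q + 1) * p = p ^+ 2 / (q + 1) ^+ 2 * (q + 1) by field; rewrite gt_eqF.
  rewrite exprMn exprVn; set y := p ^+ 2 / (q + 1) ^+ 2; move=> hy.
  have y0 : 0 <= y by rewrite divr_ge0 ?sqr_ge0.
  have /eqP : y = 0 by apply/eqP; rewrite eq_le y0 andbT; lra.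
  rewrite mulf_eq0 invr_eq0 !sqrf_eq0 (gt_eqF q1) orbF /p => /eqP.
  by lra.
exists G, a_; split => //.
  set X := Int (fun x => G x ^+ 2).
  have X0 : 0 <= X by apply: Int_ge0 => x; exact: sqr_ge0.
  have la : l (a_ n) @[n --> \oo] --> X.
    have E n : l (a_ n) = Int (fun x => G x * h n x).
      rewrite -lG//; apply: Int_eq_ae; try (by apply: measurable_funM => //; exact: Am).
      by apply: filterS aeN => x /hN ->.
    rewrite (_ : (fun n => l (a_ n)) = (fun n => Int (fun x => G x * h n x))); last exact/funext.
    have L1G2g := L1D L1G2 L1g.
    apply: (Int_dct _ _ L1G2g _ _).2.
    - by move=> n; exact: measurable_funM.
    - exact: measurable_funX.
    - move=> n x; have := hg n x; rewrite ger0_norm ?sqr_ge0// normrM.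
      rewrite -(real_normK (num_real (h n x))) -(real_normK (num_real (G x))).
      have := sqr_ge0 (`|h n x| - `|G x|); have := normr_ge0 (h n x); have := normr_ge0 (G x).
      by move: (`|h n x|) (`|G x|) => p q p0 q0; rewrite sqrrB; nra.
    - by move=> x; rewrite expr2; apply: cvgM; [exact: cvg_cst|exact: hG].
  have : X ^+ 2 <= c * X.
    rewrite expr2; apply: (cvg_le (cvgM la la) (cvgM (cvg_cst c) cG2)) => n.
    by have := lc (Aa n); rewrite -eqh expr2.
  have [->|Xn0] := eqVneq X 0; first by [].
  by rewrite expr2 ler_pM2r// lt_neqAle eq_sym Xn0.
split=> //; apply: filterS aeN => x xN.
by apply: cvg_ext (hG x) _ => n; rewrite hN.
Unshelve. all: by end_near. Qed.

End Riesz.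

(** * Translates of a density and difference quotients *)

Section Translations.
Variable R : realType.
Implicit Types (f g h k a phi : V R -> R) (i : 'I_3) (s t : R).
Local Notation mu3 := (mu3 R).
Local Notation L1 := (L1 mu3).
Local Notation Int := (Int mu3).
Local Notation V0 := (((0, 0), 0) : V R).

Lemma cauchy_schwarz_Int g h : measurable_fun setT g -> measurable_fun setT h ->
  L1 (fun x => g x ^+ 2) -> L1 (fun x => h x ^+ 2) ->
  Int (fun x => g x * h x) ^+ 2 <= Int (fun x => g x ^+ 2) * Int (fun x => h x ^+ 2).
Proof.
move=> mg mh g2 h2.
have K (k : R) : 0 <= Int (fun x => g x ^+ 2) + 2 * k * Int (fun x => g x * h x) + k ^+ 2 * Int (fun x => h x ^+ 2).
  by rewrite -(L1_sqrD k mg mh g2 h2).2; apply: Int_ge0 => x; exact: sqr_ge0.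
have b0 : 0 <= Int (fun x => h x ^+ 2) by apply: Int_ge0 => x; exact: sqr_ge0.
have a0 : 0 <= Int (fun x => g x ^+ 2) by apply: Int_ge0 => x; exact: sqr_ge0.
move: (Int (fun x => g x ^+ 2)) (Int (fun x => h x ^+ 2)) (Int (fun x => g x * h x)) a0 b0 K => p q r p0 q0 K.
have [q_0|qn] := eqVneq q 0.
  have := K (- (p + 1) * r); rewrite q_0 !mulr0 addr0 => h1.
  have r0 := sqr_ge0 r; have pr : 0 <= p * r ^+ 2 by exact: mulr_ge0.
  have [->|rn] := eqVneq r 0; first by rewrite expr0n.
  have [_|rp] := leP (r ^+ 2) 0; first by [].
  have := K (- (p + 1) / r); rewrite q_0 mulr0 addr0.
  have -> : 2 * (- (p + 1) / r) * r = - 2 * (p + 1) by field.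
  by lra.
have qp : 0 < q by rewrite lt_def qn.
have := K (- r / q); have -> : p + 2 * (- r / q) * r + (- r / q) ^+ 2 * q = p - r ^+ 2 / q by field.
by rewrite subr_ge0 ler_pdivrMr.
Qed.

Lemma shiftVE v i s : shiftV v i s = addV (scaleV 1 v) (shiftV V0 i s).
Proof. by apply: eqV => /=; ring. Qed.

Lemma L1_shift f i s : L1 f -> L1 (fun v => f (shiftV v i s)).
Proof. by move=> fi; under eq_fun do rewrite shiftVE; exact: L1_mu3_affine. Qed.

Lemma Int_shift f i s : L1 f -> Int (fun v => f (shiftV v i s)) = Int f.
Proof.
move=> fi; under eq_fun do rewrite shiftVE.
by rewrite Int_mu3_affine// invr1 expr1n mul1r.
Qed.

Lemma measurable_shift i s : measurable_fun setT (fun v : V R => shiftV v i s).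
Proof.
under eq_fun do rewrite shiftVE; apply: measurable_addV; last exact: measurable_cst.
by apply: measurable_scaleV; [exact: measurable_cst|exact: measurable_id].
Qed.

Lemma cvg3_shiftV v i (sn : nat -> R) s : sn @ \oo --> s -> cvg3 (fun n => shiftV v i (sn n)) (shiftV v i s).
Proof.
move=> h; split => /=; apply: cvgD; try exact: cvg_cst;
by case: ifP => _ //; exact: cvg_cst.
Qed.

Lemma C1b_shift L a i s : C1b L a -> C1b L (fun v => a (shiftV v i s)) /\
  forall j v, partial (fun v => a (shiftV v i s)) j v = partial a j (shiftV v i s).
Proof.
move=> ha; have [p hp] := C1b_bounded ha.
have [h E] : C1b L (fun v => a (shiftV v i s)) /\
    partial (fun v => a (shiftV v i s)) = (fun j v => partial a j (shiftV v i s)).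
  apply: (@C1b_build _ _ _ _ p) => [v|j v|j|j v]; rewrite ?hp//.
  - have E r : shiftV (shiftV v j r) i s = shiftV (shiftV v i s) j r by apply: eqV => /=; ring.
    by under eq_fun do rewrite E; exact: partial_chain ha.
  - apply: cvg3_continuous => x y xy; apply: (continuous_cvg3 (C1b_continuous ha (i := j))).
    have := cvg3_add xy (cvg3_cst (shiftV V0 i s)).
    have E (z : V R) : addV z (shiftV V0 i s) = shiftV z i s by apply: eqV => /=; ring.
    by rewrite E; under eq_fun do rewrite E.
  - exact: C1b_le.
by split => // j v; rewrite E.
Qed.

Lemma C1bZ L a (c : R) : C1b L a -> C1b (`|c| * L) (fun v => c * a v) /\
  forall j v, partial (fun v => c * a v) j v = c * partial a j v.
Proof.
move=> ha; have [p hp] := C1b_bounded ha.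
have [h E] : C1b (`|c| * L) (fun v => c * a v) /\
    partial (fun v => c * a v) = (fun j v => c * partial a j v).
  apply: (@C1b_build _ _ _ _ (`|c| * p)) => [v|j v|j|j v].
  - by rewrite normrM ler_wpM2l.
  - have := is_derive_affine 0 c (partial_chain j v ha).
    by under eq_fun do rewrite add0r.
  - by apply: cvg3_continuous => x y xy; apply: cvgM; [exact: cvg_cst|exact: (continuous_cvg3 (C1b_continuous ha (i := j)))].
  - by rewrite normrM ler_wpM2l//; exact: C1b_le.
by split => // j v; rewrite E.
Qed.

Lemma Int_derive (F dF : R -> V R -> R) (G : V R -> R) (u v : R) :
  (forall x, u < x < v -> L1 (F x)) ->
  (forall (x : R) y, u < x < v -> is_derive x 1 (F ^~ y) (dF x y)) ->
  L1 G -> (forall x y, u < x < v -> `|dF x y| <= G y) ->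
  forall x : R, u < x < v -> is_derive x 1 (fun x => Int (F x)) (Int (dF x)).
Proof.
move=> hF hd hG hb x hx.
have Ix : `]u, v[%classic x by rewrite /= in_itv.
have h1 z : `]u, v[%classic z -> mu3.-integrable setT (EFin \o F z) by rewrite /= in_itv; exact: hF.
have h2 z y : `]u, v[%classic z -> setT y -> derivable (F ^~ y) z 1.
  by rewrite /= in_itv => hz _; have [] := hd z y hz.
have G0 y : 0 <= G y by apply: le_trans (hb x y hx).
have E z y : u < z < v -> partial1of2 F z y = dF z y.
  by move=> hz; rewrite partial1of2E; have [] := hd z y hz.
have h3 z y : `]u, v[%classic z -> setT y -> `|partial1of2 F z y| <= G y.
  by rewrite /= in_itv => hz _; rewrite E//; exact: hb.
have D := derivable_under_integral measurableT Ix h1 h2 G0 hG h3.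
have V := differentiation_under_integral measurableT Ix h1 h2 G0 hG h3.
apply: DeriveDef => //; rewrite -derive1E; apply: (etrans V).
by congr Rintegral; apply/funext => y; exact: E.
Qed.

(** The squared Hellinger distance, without the customary factor [1/2], between [f] and its
    translate in direction [i]. *)
Definition hell f i s := Int (fun v => (Num.sqrt (f (shiftV v i s)) - Num.sqrt (f v)) ^+ 2).

Section Density.
Variables (f : V R -> R) (i : 'I_3).
Hypotheses (f0 : forall v, 0 <= f v) (fi : L1 f).
Let mf := L1_measurable fi.

Let mfs s : measurable_fun setT (fun v => f (shiftV v i s)).
Proof. exact: (measurableT_comp mf (measurable_shift i s)). Qed.

Let msq (g : V R -> R) : measurable_fun setT g -> measurable_fun setT (fun v => Num.sqrt (g v)).
Proof.
move=> mg; apply: (measurableT_comp _ mg).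
by apply: continuous_measurable_fun; exact: sqrt_continuous.
Qed.

Lemma L1_hell s : L1 (fun v => (Num.sqrt (f (shiftV v i s)) - Num.sqrt (f v)) ^+ 2).
Proof.
apply: (L1_le _ _ (L1Z 2 (L1D (L1_shift i s fi) fi))).
  by apply: measurable_funX; apply: measurable_funB; exact: msq.
move=> v; rewrite ger0_norm ?sqr_ge0//.
rewrite -[in leRHS](sqr_sqrtr (f0 v)) -[f (shiftV v i s) in leRHS](sqr_sqrtr (f0 _)).
move: (Num.sqrt (f v)) (Num.sqrt _) => x y.
by have := sqr_ge0 (x + y); rewrite sqrrD sqrrB; lra.
Qed.

Variables (L : R) (a : V R -> R).
Hypothesis ha : C1b L a.

Let L1fa k : measurable_fun setT k -> (exists M, forall v, `|k v| <= M) -> L1 (fun v => f v * k v).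
Proof. by move=> mk [M hM]; exact: L1M mk hM. Qed.

Let ba : exists M, forall v, `|a v| <= M. Proof. exact: C1b_bounded ha. Qed.

Lemma quotient_lim (sn : nat -> R) : (forall n, sn n != 0) -> sn @ \oo --> 0 ->
  (sn n)^-1 * (Int (fun v => f v * a (shiftV v i (- sn n))) - Int (fun v => f v * a v)) @[n --> \oo]
  --> - Int (fun v => f v * partial a i v).
Proof.
move=> s0 s_0; have [M hM] := ba.
have La : 0 <= L by rewrite (le_trans _ (C1b_le ha i V0)).
have ms n : measurable_fun setT (fun v => a (shiftV v i (- sn n))).
  exact: (measurableT_comp (C1b_measurable ha) (measurable_shift i _)).
have mp := C1b_measurable_partial i ha; have ma := C1b_measurable ha.
have il : L1 (fun v => f v * partial a i v).
  by apply: L1fa => //; exists L; exact: C1b_le ha i.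
rewrite -(IntN il).
have [_ c] : L1 (fun v => - (f v * partial a i v)) /\
    Int (fun v => f v * ((sn n)^-1 * (a (shiftV v i (- sn n)) - a v))) @[n --> \oo] --> Int (fun v => - (f v * partial a i v)).
  apply: (Int_dct _ _ (L1Z L fi)).
  - by move=> n; apply: measurable_funM => //; apply: measurable_funM => //; exact: measurable_funB.
  - by apply: measurable_funN; exact: measurable_funM.
  - move=> n v; rewrite normrM ger0_norm// mulrC ler_wpM2r// normrM normfV ler_pdivrMl ?normr_gt0//.
    have [c _] := MVT_between 0 (- sn n) (is_derive_line (C1b_derivable ha (i := i)) v).
    rewrite shiftV0 subr0 => ->; rewrite normrM normrN mulrC ler_wpM2l//; exact: C1b_le.
  - move=> v; rewrite -mulrN; apply: cvgM; first exact: cvg_cst.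
    have /derive_seqP D := partial_chain i v ha.
    have n0 n : - sn n != 0 by rewrite oppr_eq0.
    have n_0 : - sn n @[n --> \oo] --> (0 : R) by rewrite -oppr0; exact: cvgN.
    have hh : - ((- sn n)^-1 * (a (shiftV v i (0 + - sn n)) - a (shiftV v i 0))) @[n --> \oo] --> - partial a i v.
      by apply: cvgN; exact: D.
    apply: (cvg_ext hh) => n.
    by rewrite add0r shiftV0 invrN mulNr opprK.
apply: (cvg_ext c) => n; rewrite -IntB; [|apply: L1fa => //; exists M => v; exact: hM|exact: L1fa].
rewrite -IntZ; last by apply: L1B; [apply: L1fa => //; exists M => v; exact: hM|exact: L1fa].
by congr Int; apply/funext => v; ring.
Qed.

End Density.
End Translations.

(** * From infinitesimal to finite translations *)

Section Homotopy.
Variable R : realType.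
Implicit Types (s t : R).
Local Notation mu3 := (mu3 R).
Local Notation L1 := (L1 mu3).
Local Notation Int := (Int mu3).
Local Notation V0 := (((0, 0), 0) : V R).
Variables (f : V R -> R) (i : 'I_3) (M : R).
Hypotheses (f0 : forall v, 0 <= f v) (fi : L1 f).
Hypothesis hM : forall L (a : V R -> R), C1b L a ->
  - 2 * Int (fun v => f v * partial a i v) - Int (fun v => f v * a v ^+ 2) <= M.

Let mf := L1_measurable fi.

Let L1f L (a : V R -> R) : C1b L a -> L1 (fun v => f v * a v).
Proof. by move=> ha; have [p hp] := C1b_bounded ha; apply: (L1M fi (C1b_measurable ha) hp). Qed.

Let L1fp L (a : V R -> R) : C1b L a -> L1 (fun v => f v * partial a i v).
Proof. by move=> ha; apply: (L1M fi (C1b_measurable_partial i ha) (C1b_le ha i)). Qed.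

Let L1f2 L (a : V R -> R) : C1b L a -> L1 (fun v => f v * a v ^+ 2).
Proof.
move=> ha; have [p hp] := C1b_bounded ha.
apply: (L1M (M := p ^+ 2) fi (measurable_funX 2 (C1b_measurable ha))) => v.
by rewrite normrX lerXn2r ?nnegrE// (le_trans _ (hp v)).
Qed.

(** The hypothesis [hM] for the function [2 b / s], multiplied by [s^2 / 4]. *)
Let score_scaled L (b : V R -> R) s : C1b L b -> s != 0 ->
  - s * Int (fun v => f v * partial b i v) - Int (fun v => f v * b v ^+ 2) <= s ^+ 2 * M / 4.
Proof.
move=> hb s0; have [hc Ec] := C1bZ (2 / s) hb; have := hM hc.
have -> : (fun v => f v * partial (fun v => 2 / s * b v) i v) = (fun v => 2 / s * (f v * partial b i v)).
  by apply/funext => v; rewrite Ec mulrCA.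
have -> : (fun v => f v * (2 / s * b v) ^+ 2) = (fun v => (2 / s) ^+ 2 * (f v * b v ^+ 2)).
  by apply/funext => v; rewrite exprMn mulrCA.
rewrite (IntZ _ (L1fp hb)) (IntZ _ (L1f2 hb)).
set P := Int (fun v => f v * partial b i v); set Q := Int (fun v => f v * b v ^+ 2) => h.
have s2 : 0 < s ^+ 2 / 4 by rewrite divr_gt0// lt_def sqr_ge0 sqrf_eq0 s0.
have -> : - s * P - Q = s ^+ 2 / 4 * (- 2 * (2 / s * P) - (2 / s) ^+ 2 * Q) by field.
by rewrite [s ^+ 2 * M / 4]mulrAC ler_wpM2l// ltW.
Qed.

(* Along [theta |-> a / (1 + theta a)], translated by [theta s], the derivative of the [f]-integral is
   a score functional, hence at most [s^2 M / 4]. *)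
Lemma homotopy L (a : V R -> R) eta s : C1b L a -> 0 < eta <= 1 -> (forall v, eta <= 1 + a v) ->
  Int (fun v => f (shiftV v i s) * (a v / (1 + a v))) - Int (fun v => f v * a v) <= s ^+ 2 * M / 4.
Proof.
move=> ha /andP[eta0 eta1] hpos.
have M0 : 0 <= M.
  have := hM (C1b_cst (0 : R)).1; under eq_fun do rewrite (C1b_cst (0 : R)).2 mulr0.
  rewrite (_ : (fun v => f v * 0 ^+ 2) = (fun=> 0)); last by apply/funext => v; rewrite expr0n mulr0.
  by rewrite !Int0 mulr0 subr0.
have [p hp] := C1b_bounded ha; have p0 : 0 <= p := le_trans (normr_ge0 _) (hp V0).
have L0 : 0 <= L := le_trans (normr_ge0 _) (C1b_le ha i V0).
(* The range of [theta] is enlarged to []-del, 1 + del[], so that [0] and [1] are interior points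
   while the denominators [1 + theta a] remain at least [eta / 2]. *)
pose del := eta / (2 * (p + 1)).
have p1 : 0 < p + 1 by rewrite ltr_wpDl.
have del0 : 0 < del by rewrite divr_gt0// mulr_gt0.
have delp : del * p <= eta / 2.
  rewrite /del -mulrA ler_wpM2l ?(ltW eta0)// invfM -mulrA ler_piMr ?invr_ge0//.
  by rewrite ler_pdivrMl// mulr1 lerDl.
pose h := eta / 2; have h0 : 0 < h by rewrite divr_gt0.
have den th v : - del < th < 1 + del -> h <= 1 + th * a v.
  move=> /andP[t1 t2]; have := hp v; rewrite ler_norml => /andP[a1 a2]; have := hpos v => a3.
  have d1 : del * a v <= del * p by rewrite ler_wpM2l// ltW.
  have d2 : - (del * p) <= del * a v by rewrite -mulrN ler_wpM2l// ltW.
  rewrite /h; have [av|av] := leP 0 (a v).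
    have : - del * a v <= th * a v by rewrite ler_wpM2r// ltW.
    by move: d1 delp eta1; rewrite mulNr; lra.
  have : (1 + del) * a v <= th * a v by rewrite ler_wnM2r// ltW.
  by move: d2 delp a3; rewrite mulrDl mul1r; lra.
pose b th v := a v / (1 + th * a v).
have in1 : - del < 1 < 1 + del by rewrite ltrDl del0 andbT (lt_trans _ ltr01)// oppr_lt0.
have C1bb th : - del < th < 1 + del -> exists L', C1b L' (b th) /\
    forall v, partial (b th) i v = partial a i v / (1 + th * a v) ^+ 2.
  move=> ht; pose rng (x : R) := h <= 1 + th * x.
  (* the map x/(1+th x) is smooth only where 1 + th x is bounded below *)
  have E v : b th v = a v * (1 + th * a v)^-1 by [].
  have [hh Eh] : C1b (L / h ^+ 2) (b th) /\ partial (b th) = (fun j v => partial a j v / (1 + th * a v) ^+ 2).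
    apply: (@C1b_build _ _ _ _ (p / h)) => [v|j v|j|j v].
    - have dv := den th v ht; rewrite normrM normfV (ger0_norm (le_trans (ltW h0) dv)).
      by rewrite ler_pM ?invr_ge0 ?(le_trans (ltW h0) dv)// lef_pV2 ?posrE// (lt_le_trans h0 dv).
    - have ph := partial_chain j v ha.
      have d0 : 1 + th * a (shiftV v j 0) != 0 by rewrite shiftV0 gt_eqF// (lt_le_trans h0)// den.
      have hq := is_derive_affine 1 th ph.
      have D : is_derive (0 : R) 1 (fun s => a (shiftV v j s) * (1 + th * a (shiftV v j s))^-1) _ :=
        is_deriveM ph (@is_deriveV _ (fun s : R => 1 + th * a (shiftV v j s)) 0 _ _ d0 hq).
      apply: (is_derive_eq D); rewrite /GRing.scale /= shiftV0; rewrite shiftV0 in d0.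
      by field.
    - apply: cvg3_continuous => x y xy; have ca := continuous_cvg3 (C1b_continuous0 ha) xy.
      have cd : (1 + th * a (x n))^-1 @[n --> \oo] --> (1 + th * a y)^-1.
        apply: cvgV; first by rewrite gt_eqF// (lt_le_trans h0)// den.
        by apply: cvgD; [exact: cvg_cst|apply: cvgM => //; exact: cvg_cst].
      apply: cvgM; first exact: (continuous_cvg3 (C1b_continuous ha (i := j))).
      rewrite -exprVn expr2; under eq_fun do rewrite -exprVn expr2.
      exact: cvgM.
    - have dv := den th v ht; rewrite normrM normfV [`|(_ + _) ^+ 2|]ger0_norm ?sqr_ge0//.
      rewrite ler_pM ?invr_ge0 ?sqr_ge0//; first exact: C1b_le.
      by rewrite lef_pV2 ?posrE ?exprn_gt0 ?(lt_le_trans h0)// lerXn2r ?nnegrE ?(ltW h0)// (le_trans (ltW h0)).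
  by exists (L / h ^+ 2); split => // v; rewrite Eh.
(* [score_scaled] divides by [s]; without translation the claim reduces to [a / (1 + a) <= a]. *)
have [->|s0] := eqVneq s 0.
  rewrite expr0n !mul0r subr_le0; under eq_fun do rewrite shiftV0.
  have Ia : L1 (fun v => f v * (a v / (1 + a v))).
    have [L' [h1 _]] := C1bb 1 in1.
    by have := L1f h1; rewrite /b; under eq_fun do rewrite mul1r.
  apply: Int_le => //; first exact: L1f ha.
  move=> v; rewrite ler_wpM2l// ler_pdivrMr ?(lt_le_trans eta0)//.
  by have := sqr_ge0 (a v); rewrite mulrDr mulr1 expr2 lerDl.
pose F th v := f v * b th (shiftV v i (- (th * s))).
pose dF th v := f v * ((- s * partial a i (shiftV v i (- (th * s))) - a (shiftV v i (- (th * s))) ^+ 2) /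
  (1 + th * a (shiftV v i (- (th * s)))) ^+ 2).
have L1F th : - del < th < 1 + del -> L1 (F th).
  by move=> ht; have [L' [h1 _]] := C1bb th ht; exact: L1f (C1b_shift i _ h1).1.
have DF (th : R) v : - del < th < 1 + del -> is_derive th 1 (F ^~ v) (dF th v).
  move=> ht; pose al (r : R) := a (shiftV v i (- (r * s))).
  have hal : is_derive th 1 al (- s * partial a i (shiftV v i (- (th * s)))).
    have h1 : is_derive (0 + - s * th) 1 (fun r : R => a (shiftV v i r)) (partial a i (shiftV v i (- (th * s)))).
      by rewrite (_ : - (th * s) = 0 + - s * th); [exact: is_derive_line (C1b_derivable ha (i := i)) v _|ring].
    have h2 := is_derive_affine 0 (- s) (is_derive_id th (1 : R)).
    have D := @is_derive1_comp _ _ (fun r : R => 0 + - s * r) th _ _ h1 h2.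
    have E : al = (fun r : R => a (shiftV v i r)) \o (fun r : R => 0 + - s * r).
      by apply/funext => r; rewrite /al /=; congr (a (shiftV _ _ _)); ring.
    by rewrite E; apply: (is_derive_eq D); rewrite mulr1 mulrC.
  have d0 : 1 + th * al th != 0 by rewrite gt_eqF// (lt_le_trans h0)// den.
  have hm : is_derive th 1 (fun r : R => r * al r) _ := is_deriveM (is_derive_id th (1 : R)) hal.
  have hq := is_derive_affine 1 1 hm.
  have hq' : is_derive th 1 (fun r : R => 1 + r * al r) (1 * (th *: (- s * partial a i (shiftV v i (- (th * s)))) + al th *: 1)).
    by move: hq; under eq_fun do rewrite mul1r.
  have D : is_derive th 1 (fun r => al r * (1 + r * al r)^-1) _ :=
    is_deriveM hal (@is_deriveV _ (fun r : R => 1 + r * al r) th _ _ d0 hq').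
  have D2 := is_derive_affine 0 (f v) D.
  have E : F ^~ v = (fun r => 0 + f v * (al r * (1 + r * al r)^-1)).
    by apply/funext => r; rewrite add0r.
  rewrite E; apply: (is_derive_eq D2); rewrite /dF -/(al th) /GRing.scale /=.
  by move: d0; move: (al th) (partial _ _ _) => x y d0; field.
pose K := (`|s| * L + p ^+ 2) / h ^+ 2.
have BF (th : R) v : - del < th < 1 + del -> `|dF th v| <= K * f v.
  move=> ht; rewrite /dF normrM ger0_norm// mulrC ler_wpM2r// normrM normfV.
  have dv := den th (shiftV v i (- (th * s))) ht.
  rewrite [`|(_ + _) ^+ 2|]ger0_norm ?sqr_ge0// ler_pM ?invr_ge0 ?sqr_ge0//.
    rewrite (le_trans (ler_normB _ _))// lerD//.
      by rewrite normrM normrN ler_wpM2l//; exact: C1b_le.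
    by rewrite normrX lerXn2r ?nnegrE.
  by rewrite lef_pV2 ?posrE ?exprn_gt0 ?(lt_le_trans h0)// lerXn2r ?nnegrE ?(ltW h0)// (le_trans (ltW h0)).
have ID := Int_derive L1F DF (L1Z K fi) BF.
have ledF th : - del < th < 1 + del -> Int (dF th) <= s ^+ 2 * M / 4.
  move=> ht; have [L' [hb Eb]] := C1bb th ht; have [hc Ec] := C1b_shift i (- (th * s)) hb.
  apply: le_trans (score_scaled hc s0).
  rewrite -IntZ; last exact: L1fp hc.
  rewrite -IntB; [|exact: L1Z (L1fp hc)|exact: L1f2 hc].
  rewrite le_eqVlt; apply/orP; left; apply/eqP; congr Int; apply/funext => v.
  rewrite Ec Eb /dF /b.
  have : 1 + th * a (shiftV v i (- (th * s))) != 0 by rewrite gt_eqF// (lt_le_trans h0)// den.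
  move: (a (shiftV _ _ _)) (partial a i _) => x y d0.
  by field.
have in01 (x : R) : x \in `[0, 1] -> - del < x < 1 + del.
  by rewrite in_itv /= => /andP[x0 x1]; rewrite (lt_le_trans _ x0) ?oppr_lt0// (le_lt_trans x1)// ltrDl.
have c01 : {within `[0, 1], continuous (fun th => Int (F th))}.
  by apply: derivable_within_continuous => x /in01 hx; have [] := ID x hx.
have [c hc E] := @MVT_segment R (fun th => Int (F th)) (fun th => Int (dF th)) 0 1 ler01
  (fun x hx => ID x (in01 x (subset_itv_oo_cc hx))) c01.
have -> : Int (fun v => f (shiftV v i s) * (a v / (1 + a v))) = Int (F 1).
  rewrite -(Int_shift i s (L1F 1 in1)); congr Int; apply/funext => v.
  by rewrite /F /b mul1r shiftVD subrr shiftV0 mul1r.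
have -> : Int (fun v => f v * a v) = Int (F 0).
  by congr Int; apply/funext => v; rewrite /F /b !mul0r oppr0 shiftV0 addr0 divr1.
by rewrite E subr0 mulr1; apply: ledF; exact: in01.
Qed.

End Homotopy.

(** * Compactly supported test functions and cutoffs in space *)

Section CompactSupport.
Variable R : realType.
Implicit Types (s t : R) (f g h k phi : V R -> R) (i : 'I_3).
Local Notation mu3 := (mu3 R).
Local Notation L1 := (L1 mu3).
Local Notation Int := (Int mu3).
Local Notation V0 := (((0, 0), 0) : V R).

Lemma bounded_of_support g M : continuous g -> (forall v, M < enorm v -> g v = 0) ->
  exists p, forall v, `|g v| <= p.
Proof.
move=> cg hM.
pose Q : set (V R) := (`[- M, M]%classic `*` `[- M, M]%classic) `*` `[- M, M]%classic.
have cQ : compact Q by apply: compact_setX; [apply: compact_setX|]; exact: segment_compact.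
have := compact_bounded (continuous_compact (continuous_subspaceT cg) cQ).
move=> [N [_ hN]]; exists (Num.max 0 (N + 1)) => v.
have [Mv|vM] := ltP M (enorm v); first by rewrite hM// normr0 le_max lexx.
rewrite le_max; apply/orP; right; apply: (hN (N + 1)); first by rewrite ltrDl.
exists v => //; have := ler_coord_enorm v => -[h1 h2 h3].
by split; [split|] => /=; rewrite in_itv /= -ler_norml (le_trans _ vM).
Qed.

Lemma partial_support phi M : (forall v, M < enorm v -> phi v = 0) ->
  forall i v, M + 1 < enorm v -> partial phi i v = 0.
Proof.
move=> hM i v Mv.
have D : is_derive (0 : R) 1 (fun s => phi (shiftV v i s)) 0.
  apply: (@is_derive_quadratic _ _ _ _ 0 1) => // s s1.
  rewrite add0r mul0r subr0 mul0r shiftV0 (hM v); last by rewrite (lt_trans _ Mv)// ltrDl.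
  rewrite hM ?subrr ?normr0//.
  have := ler_enormD (shiftV v i s) (shiftV V0 i (- s)).
  have -> : addV (shiftV v i s) (shiftV V0 i (- s)) = v by elim/I3_ind: i; apply: eqV => /=; ring.
  have -> : enorm (shiftV V0 i (- s)) = `|s|.
    rewrite /enorm (_ : dotV _ _ = s ^+ 2) ?sqrtr_sqr//.
    by elim/I3_ind: i; rewrite /dotV /=; ring.
  by move: Mv s1; lra.
by have [_] := partial_eq D.
Qed.

Lemma C1c_C1b phi : C1c phi -> exists L, C1b L phi.
Proof.
move=> [cphi [dphi [cp [M hM]]]].
have [p hp] := bounded_of_support cphi hM.
have K i := bounded_of_support (cp i) (partial_support hM i).
have [p0 h0] := K i0; have [p1 h1] := K i1; have [p2 h2] := K i2.
exists (`|p0| + `|p1| + `|p2|); split => //; first by exists p.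
move=> i v; have a0 := ler_norm p0; have a1 := ler_norm p1; have a2 := ler_norm p2.
have b0 := normr_ge0 p0; have b1 := normr_ge0 p1; have b2 := normr_ge0 p2.
by elim/I3_ind: i; [have := h0 v|have := h1 v|have := h2 v]; lra.
Qed.

Lemma C1b_C1c L phi M : C1b L phi -> (forall v, M < enorm v -> phi v = 0) -> C1c phi.
Proof.
move=> h hM; split; first exact: C1b_continuous0 h.
split; first exact: C1b_derivable h.
by split; [exact: C1b_continuous h|exists M].
Qed.

Definition ball1 (M : R) : V R -> R := \1_[set v | enorm v <= M].

Lemma measurable_ball1 M : measurable_fun setT (ball1 M).
Proof.
apply: measurable_indic; have := measurable_enorm (@measurable_id _ (V R) setT).
by move=> /(_ measurableT _ (measurable_itv `]-oo, M])); rewrite setTI.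
Qed.

Lemma L1_ball1 M : L1 (ball1 M).
Proof.
have h1 : L1 (ball1 1).
  apply/integrableP; split; first by apply/measurable_EFinP; exact: measurable_ball1.
  under eq_integral do rewrite /= ger0_norm ?indic_ge0//.
  have mB := @measurable_unit_ball R.
  rewrite integral_indic// setIT; have hb := @mu3_unit_ball R.
  by apply: (eq_ind_r (fun x => (x < +oo)%E) _ hb); exact: ltry.
pose N := `|M| + 1; have N0 : 0 < N by rewrite ltr_wpDl.
have Ni : 0 < N^-1 by rewrite invr_gt0.
apply: (L1_le (measurable_ball1 M) _ (L1_mu3_affine V0 Ni h1)) => v.
rewrite /ball1 !indicE; case: (boolP (v \in _)) => [|_]; last by rewrite normr0.
rewrite inE /= => vM; rewrite normr1.
suff hin : addV (scaleV N^-1 v) V0 \in [set v : V R | enorm v <= 1] by rewrite hin.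
apply/mem_set => /=.
have -> : addV (scaleV N^-1 v) V0 = scaleV N^-1 v by apply: eqV => /=; ring.
rewrite enormZ ger0_norm ?(ltW Ni)// ler_pdivrMl// mulr1 (le_trans vM)// /N.
by rewrite (le_trans (ler_norm M))// lerDl.
Qed.

Lemma support_L1 k phi M p : (forall v, M < enorm v -> phi v = 0) -> (forall v, `|phi v| <= p) ->
  measurable_fun setT phi -> measurable_fun setT k -> L1 (fun v => k v ^+ 2) -> L1 (fun v => k v * phi v).
Proof.
move=> hM hp mphi mk k2; have p0 : 0 <= p := le_trans (normr_ge0 _) (hp V0).
apply: (L1_le _ _ (L1D k2 (L1Z (p ^+ 2) (L1_ball1 M)))).
  exact: measurable_funM.
move=> v; rewrite normrM /ball1 indicE; case: (boolP (v \in _)) => [_|].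
  rewrite mulr1; have := hp v; have := normr_ge0 (phi v); have := normr_ge0 (k v).
  rewrite -(real_normK (num_real (k v))); move: (`|k v|) (`|phi v|) => x y x0 y0 hy.
  by have := sqr_ge0 (x - y); rewrite sqrrB; nra.
rewrite notin_setE /= => /negP; rewrite -ltNge => /hM ->.
by rewrite normr0 !mulr0 addr0 sqr_ge0.
Qed.

Lemma support_L1_sqr phi M p : (forall v, M < enorm v -> phi v = 0) -> (forall v, `|phi v| <= p) ->
  measurable_fun setT phi -> L1 (fun v => phi v ^+ 2).
Proof.
move=> hM hp mphi; have p0 : 0 <= p := le_trans (normr_ge0 _) (hp V0).
apply: (L1_le _ _ (L1Z (p ^+ 2) (L1_ball1 M))); first exact: measurable_funX.
move=> v; rewrite /ball1 indicE; case: (boolP (v \in _)) => [_|].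
  by rewrite mulr1 normrX lerXn2r ?nnegrE.
rewrite notin_setE /= => /negP; rewrite -ltNge => /hM ->.
by rewrite expr0n normr0 mulr0.
Qed.

Lemma C1c_facts phi : C1c phi -> exists L M p, [/\ C1b L phi, (forall v, M < enorm v -> phi v = 0),
  (forall v, `|phi v| <= p), measurable_fun setT phi & L1 (fun v => phi v ^+ 2)].
Proof.
move=> hphi; have [L hL] := C1c_C1b hphi; have [_ [_ [_ [M hM]]]] := hphi.
have [p hp] := C1b_bounded hL; exists L, M, p; split => //; first exact: C1b_measurable hL.
exact: (support_L1_sqr hM hp (C1b_measurable hL)).
Qed.

Lemma C1c_zero : C1c (fun _ : V R => 0 : R).
Proof. by apply: (C1b_C1c (M := 0) (C1b_cst (0 : R)).1). Qed.

Lemma C1c_lin phi psi (c : R) : C1c phi -> C1c psi -> C1c (fun v => phi v + c * psi v) /\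
  forall i v, partial (fun v => phi v + c * psi v) i v = partial phi i v + c * partial psi i v.
Proof.
move=> h1 h2; have [L1' [M1 [p1 [b1 s1 k1 _ _]]]] := C1c_facts h1.
have [L2' [M2 [p2 [b2 s2 k2 _ _]]]] := C1c_facts h2.
have [h E] : C1b (L1' + `|c| * L2') (fun v => phi v + c * psi v) /\
    partial (fun v => phi v + c * psi v) = (fun i v => partial phi i v + c * partial psi i v).
  apply: (@C1b_build _ _ _ _ (p1 + `|c| * p2)) => [v|i v|i|i v].
  - by rewrite (le_trans (ler_normD _ _))// lerD// normrM ler_wpM2l.
  - have := is_deriveD (partial_chain i v b1) (is_derive_affine 0 c (partial_chain i v b2)).
    by under [in X in is_derive _ _ (_ + X) _ -> _]eq_fun do rewrite add0r.
  - apply: cvg3_continuous => x y xy; apply: cvgD; first exact: (continuous_cvg3 (C1b_continuous b1 (i := i))).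
    by apply: cvgM; [exact: cvg_cst|exact: (continuous_cvg3 (C1b_continuous b2 (i := i)))].
  - by rewrite (le_trans (ler_normD _ _))// lerD ?(C1b_le b1)// normrM ler_wpM2l// (C1b_le b2).
split; last by move=> i v; rewrite E.
apply: (C1b_C1c (M := Num.max M1 M2) h) => v; rewrite gt_max => /andP[m1 m2].
by rewrite s1// s2// mulr0 addr0.
Qed.

Definition bump1 (n : nat) (t : R) := sqp (n.+1%:R ^+ 2 - t ^+ 2).

Lemma bump1_C1b n j : exists L, C1b L (fun v : V R => bump1 n (Defs.coord v j)).
Proof.
pose N : R := n.+1%:R; have N0 : 0 <= N by rewrite ler0n.
pose ds (t : R) := 2 * Num.max 0 (N ^+ 2 - t ^+ 2) * (- 2 * t).
exists (4 * N ^+ 3); apply: (@C1b_coord _ (bump1 n) ds _ (N ^+ 4)).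
- move=> x.
  have h1 : is_derive x 1 (fun t : R => N ^+ 2 - t ^+ 2) (- 2 * x).
    apply: (@is_derive_quadratic _ _ _ _ 1 1) => // s _.
    by rewrite (_ : _ - _ - _ = - s ^+ 2); [rewrite normrN ger0_norm ?sqr_ge0// mul1r|ring].
  have D := @is_derive1_comp _ (@sqp R) (fun t : R => N ^+ 2 - t ^+ 2) x _ _ (is_derive_sqp (N ^+ 2 - x ^+ 2)) h1.
  exact: D.
- move=> x; apply: cvgM; last by apply: cvgM; [exact: cvg_cst|exact: cvg_id].
  apply: cvgM; first exact: cvg_cst.
  have c1 : (N ^+ 2 - y ^+ 2 : R) @[y --> (x : R)] --> (N ^+ 2 - x ^+ 2 : R).
    apply: cvgB; first exact: cvg_cst.
    by rewrite [x ^+ 2]expr2; under eq_fun do rewrite expr2; apply: cvgM; exact: cvg_id.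
  have cmx := @continuous_maxr0 R (N ^+ 2 - x ^+ 2 : R).
  exact: (cvg_comp _ _ c1 cmx).
- move=> x; rewrite /ds; have [h|h] := leP (N ^+ 2 - x ^+ 2) 0.
    by rewrite ?max_l// mulr0 mul0r normr0 mulr_ge0// exprn_ge0.
  rewrite ?max_r ?(ltW h)//.
  have xN : `|x| <= N.
    by apply: ler_sqr_imp => //; rewrite real_normK ?num_real//; move: h; lra.
  rewrite normrM normrM normrM (ger0_norm (ler0n _ 2)) normrN (ger0_norm (ler0n _ 2)) (ger0_norm (ltW h)).
  have : N ^+ 2 - x ^+ 2 <= N ^+ 2 by rewrite gerDl oppr_le0 sqr_ge0.
  move=> h2; have := ler_pM (ltW h) (normr_ge0 x) h2 xN.
  by move=> H; move: H; clear; move: (`|x|) => q; lra.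
- move=> x; rewrite /bump1 /sqp ger0_norm ?sqr_ge0//.
  have -> : N ^+ 4 = (N ^+ 2) ^+ 2 by ring.
  rewrite lerXn2r ?nnegrE ?le_max ?lexx ?sqr_ge0// ge_max sqr_ge0 /=.
  by rewrite gerDl oppr_le0 sqr_ge0.
Qed.

Definition bump3 n (v : V R) := bump1 n v.1.1 * bump1 n v.1.2 * bump1 n v.2.

Lemma bump3_C1b n : exists L, C1b L (bump3 n).
Proof.
have [L1' H1] := bump1_C1b n i0; have [L2' H2] := bump1_C1b n i1; have [L3' H3] := bump1_C1b n i2.
by have [L4 [H4 _]] := C1bM H1 H2; have [L5 [H5 _]] := C1bM H4 H3; exists L5.
Qed.

Lemma bump3_support n v : 3 * n.+1%:R < enorm v -> bump3 n v = 0.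
Proof.
move=> hv; have bz x : n.+1%:R <= `|x| -> bump1 n x = 0.
  move=> h; rewrite /bump1 /sqp max_l ?expr0n//.
  by rewrite subr_le0 -(real_normK (num_real x)) lerXn2r ?nnegrE.
have : enorm v <= `|v.1.1| + `|v.1.2| + `|v.2|.
  apply: ler_sqr_imp; first by rewrite !addr_ge0.
  rewrite sqr_enorm /dotV -!expr2 -(real_normK (num_real v.1.1)) -(real_normK (num_real v.1.2)) -(real_normK (num_real v.2)).
  have := normr_ge0 v.1.1; have := normr_ge0 v.1.2; have := normr_ge0 v.2.
  by move: (`|v.1.1|) (`|v.1.2|) (`|v.2|) => x y z x0 y0 z0; nra.
have [h1|h1] := leP n.+1%:R `|v.1.1|; first by rewrite /bump3 bz// !mul0r.
have [h2|h2] := leP n.+1%:R `|v.1.2|; first by rewrite /bump3 (bz v.1.2)// mulr0 mul0r.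
have [h3|h3] := leP n.+1%:R `|v.2|; first by rewrite /bump3 (bz v.2)// mulr0.
by move: hv h1 h2 h3; lra.
Qed.

(** Here [k] is only locally under control. Multiplied by a bump it becomes integrable and is tested
    by every [C1b] function; the open sets where the bumps are positive exhaust space. *)
Lemma integral_zero_ae_C1c k : measurable_fun setT k ->
  (forall phi, C1c phi -> L1 (fun v => k v * phi v) /\ Int (fun v => k v * phi v) = 0) ->
  {ae mu3, forall x, k x = 0}.
Proof.
move=> mk hk.
have H n : {ae mu3, forall x, k x * bump3 n x = 0}.
  have [L hL] := bump3_C1b n.
  apply: integral_zero_ae; first exact: (hk _ (C1b_C1c hL (@bump3_support n))).1.
  move=> L' a ha; have [L'' [hM _]] := C1bM hL ha.
  have hc : C1c (fun v => bump3 n v * a v).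
    by apply: (C1b_C1c hM (M := 3 * n.+1%:R)) => v /bump3_support ->; rewrite mul0r.
  by under eq_fun do rewrite -mulrA; exact: (hk _ hc).2.
have := ae_foralln H; apply: filterS => x hx.
have := archi_boundP (enorm_ge0 x); set n := Num.bound _ => hn.
have := hx n => /eqP; rewrite mulf_eq0 => /orP[/eqP//|]; rewrite gt_eqF//.
have b0 y : `|y| <= enorm x -> 0 < bump1 n y.
  move=> hy; rewrite /bump1 /sqp max_r; last first.
    rewrite subr_ge0 -(real_normK (num_real y)) lerXn2r ?nnegrE//.
    by rewrite (le_trans hy)// (le_trans (ltW hn))// ler_nat.
  rewrite exprn_gt0// subr_gt0 -(real_normK (num_real y)) ltrXn2r ?nnegrE//.
  by rewrite (le_lt_trans hy)// (lt_le_trans hn)// ler_nat.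
have [h1 h2 h3] := ler_coord_enorm x; rewrite /bump3.
by apply: mulr_gt0; [apply: mulr_gt0|]; apply: b0.
Qed.

End CompactSupport.

(** * From weak gradients to Hellinger distances, and from these to score bounds *)

Section Hellinger.
Variable R : realType.
Implicit Types (s t : R) (f g h k phi : V R -> R).
Local Notation mu3 := (mu3 R).
Local Notation L1 := (L1 mu3).
Local Notation Int := (Int mu3).
Local Notation V0 := (((0, 0), 0) : V R).
Local Notation sqrt := (@Num.sqrt R).

Lemma measurable_sqrtf f : measurable_fun setT f -> measurable_fun setT (fun v => sqrt (f v)).
Proof.
move=> mf; apply: (measurableT_comp _ mf).
by apply: continuous_measurable_fun; exact: sqrt_continuous.
Qed.

(** With [x] and [y] the values of [sqrt f] at the two ends of a translation by [s], the difference
    [y^2 - x^2 = (y - x) (y + x)] and Young's inequality give [2 a (y^2 - x^2) / s <= a^2 (x^2 +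
    y^2) / 2 + 4 (y - x)^2 / s^2]. Integrating and letting [s] tend to [0] replaces the chain
    rule. *)
Lemma score_of_hellinger f i N : (forall v, 0 <= f v) -> L1 f ->
  (forall s, hell f i s <= s ^+ 2 * N) ->
  forall L a, C1b L a -> - 2 * Int (fun v => f v * partial a i v) - Int (fun v => f v * a v ^+ 2) <= 4 * N.
Proof.
move=> f0 fi hN L a ha; have [p hp] := C1b_bounded ha.
have ma := C1b_measurable ha; have mf := L1_measurable fi.
pose sn (n : nat) : R := n.+1%:R^-1.
have s0 n : sn n != 0 by rewrite invr_eq0 pnatr_eq0.
have s_0 : sn @ \oo --> 0 by exact: cvg_harmonic.
have ma2 : measurable_fun setT (fun v => a v ^+ 2) by exact: measurable_funX.
have ba2 v : `|a v ^+ 2| <= p ^+ 2.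
  by rewrite (normrX 2 (a v)); apply: lerXn2r => //; rewrite nnegrE// (le_trans _ (hp v)).
have mas n : measurable_fun setT (fun v => a (shiftV v i (- sn n)) ^+ 2).
  by apply: measurable_funX; exact: (measurableT_comp ma (measurable_shift i _)).
have lim1 := quotient_lim f0 fi ha s0 s_0.
have lim2 : Int (fun v => f v * a (shiftV v i (- sn n)) ^+ 2) @[n --> \oo] --> Int (fun v => f v * a v ^+ 2).
  apply: (Int_dct _ _ (L1Z (p ^+ 2) fi) _ _).2.
  - by move=> n; exact: measurable_funM.
  - exact: measurable_funM.
  - move=> n v; have h1 := ler_wpM2r (f0 v) (ba2 (shiftV v i (- sn n))).
    by rewrite normrM (ger0_norm (f0 v)) [f v * _]mulrC.
  - move=> v; apply: cvgM; first exact: cvg_cst.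
    have n_0 : - sn n @[n --> \oo] --> (0 : R) by rewrite -oppr0; exact: cvgN.
    have := continuous_cvg3 (C1b_continuous0 ha) (cvg3_shiftV v i n_0); rewrite shiftV0 => ca.
    by rewrite expr2; under eq_fun do rewrite expr2; exact: cvgM.
have key n : 2 * ((sn n)^-1 * (Int (fun v => f v * a (shiftV v i (- sn n))) - Int (fun v => f v * a v))) <=
    2^-1 * (Int (fun v => f v * a (shiftV v i (- sn n)) ^+ 2) + Int (fun v => f v * a v ^+ 2)) + 4 * N.
  have s1 : sn n ^+ 2 != 0 by rewrite sqrf_eq0.
  have i1 : L1 (fun v => f v * a (shiftV v i (- sn n))).
    by apply: (L1M (M := p) fi) => //; exact: (measurableT_comp ma (measurable_shift i _)).
  have i2 : L1 (fun v => f v * a v) by exact: (L1M fi ma hp).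
  have i3 : L1 (fun v => f v * a (shiftV v i (- sn n)) ^+ 2).
    by apply: (L1M (M := p ^+ 2) fi (mas n)) => v; rewrite normrX lerXn2r ?nnegrE// (le_trans _ (hp v)).
  have i4 : L1 (fun v => f v * a v ^+ 2) by exact: (L1M fi ma2 ba2).
  rewrite -(Int_shift i (sn n) i1) -(Int_shift i (sn n) i3).
  have j1 := L1_shift i (sn n) i1; have j3 := L1_shift i (sn n) i3.
  have E r : shiftV (shiftV r i (sn n)) i (- sn n) = r by rewrite shiftVD subrr shiftV0.
  have hh := L1_hell i f0 fi (sn n).
  have -> : 2 * ((sn n)^-1 * (Int (fun v => f (shiftV v i (sn n)) * a (shiftV (shiftV v i (sn n)) i (- sn n))) - Int (fun v => f v * a v))) =
      Int (fun v => 2 * ((sn n)^-1 * (f (shiftV v i (sn n)) * a (shiftV (shiftV v i (sn n)) i (- sn n)) - f v * a v))).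
    rewrite IntZ; last by apply: L1Z; exact: (L1B j1 i2).
    by rewrite IntZ ?(IntB j1 i2)//; exact: (L1B j1 i2).
  have -> : 2^-1 * (Int (fun v => f (shiftV v i (sn n)) * a (shiftV (shiftV v i (sn n)) i (- sn n)) ^+ 2) + Int (fun v => f v * a v ^+ 2)) =
      Int (fun v => 2^-1 * (f (shiftV v i (sn n)) * a (shiftV (shiftV v i (sn n)) i (- sn n)) ^+ 2 + f v * a v ^+ 2)).
    by rewrite IntZ ?(IntD j3 i4)//; exact: (L1D j3 i4).
  have hNn := hN (sn n); rewrite /hell in hNn.
  have : 4 * N >= Int (fun v => 4 * (sn n)^-1 ^+ 2 * (sqrt (f (shiftV v i (sn n))) - sqrt (f v)) ^+ 2).
    rewrite IntZ// exprVn.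
    have c0 : 0 <= 4 * (sn n ^+ 2)^-1 by rewrite mulr_ge0// invr_ge0 sqr_ge0.
    apply: (le_trans (ler_wpM2l c0 hNn)).
    by rewrite mulrA -[4 * _ * _]mulrA mulVf// mulr1.
  move=> h4; rewrite -lerBlDr in h4 *; rewrite lerBlDr.
  apply: (le_trans _ (lerD (lexx _) h4)).
  have j5 : L1 (fun v => 2^-1 * (f (shiftV v i (sn n)) * a (shiftV (shiftV v i (sn n)) i (- sn n)) ^+ 2 + f v * a v ^+ 2)).
    by apply: L1Z; exact: L1D.
  have j6 : L1 (fun v => 4 * (sn n)^-1 ^+ 2 * (sqrt (f (shiftV v i (sn n))) - sqrt (f v)) ^+ 2) by exact: L1Z.
  rewrite -IntD//; apply: Int_le; [by do 2!apply: L1Z; exact: L1B|exact: L1D|].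
  move=> v; rewrite E.
  rewrite -[in leRHS](sqr_sqrtr (f0 v)) -[in leLHS](sqr_sqrtr (f0 v)).
  rewrite -[in leRHS](sqr_sqrtr (f0 (shiftV v i (sn n)))) -[in leLHS](sqr_sqrtr (f0 (shiftV v i (sn n)))).
  rewrite !sqrtr_sqr !ger0_norm ?sqrtr_ge0//.
  move: (sqrt (f v)) (sqrt (f (shiftV v i (sn n)))) (a v) ((sn n)^-1) => x y b r.
  have := sqr_ge0 (2^-1 * b * (y + x) - 2 * r * (y - x)); have := sqr_ge0 (b * (y - x)).
  by rewrite -subr_ge0 => h1 h2; rewrite -subr_ge0; nra.
have c1 : 2 * ((sn n)^-1 * (Int (fun v => f v * a (shiftV v i (- sn n))) - Int (fun v => f v * a v))) @[n --> \oo]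
    --> 2 * - Int (fun v => f v * partial a i v) by apply: cvgM => //; exact: cvg_cst.
have c2 : 2^-1 * (Int (fun v => f v * a (shiftV v i (- sn n)) ^+ 2) + Int (fun v => f v * a v ^+ 2)) + 4 * N @[n --> \oo]
    --> 2^-1 * (Int (fun v => f v * a v ^+ 2) + Int (fun v => f v * a v ^+ 2)) + 4 * N.
  apply: cvgD; last exact: cvg_cst.
  by apply: cvgM; [exact: cvg_cst|apply: cvgD => //; exact: cvg_cst].
have := cvg_le c1 c2 key; move: (Int _) (Int _) => P Q; lra.
Qed.

(* Translating a weak derivative along a line and testing: [|<h(.+s) - h, phi>| <= |s| |G| |phi|]. *)
Lemma hellinger_of_weak_grad f G i : (forall v, 0 <= f v) -> L1 f ->
  weak_grad (fun v => sqrt (f v)) G -> L1 (fun v => G i v ^+ 2) ->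
  forall s, hell f i s <= s ^+ 2 * Int (fun v => G i v ^+ 2).
Proof.
move=> f0 fi [mh [mG hG]] G2 s; set N := Int _.
have mf := L1_measurable fi.
have N0 : 0 <= N by apply: Int_ge0 => v; exact: sqr_ge0.
pose h v := sqrt (f v); have h2 : L1 (fun v => h v ^+ 2).
  by under eq_fun do rewrite sqr_sqrtr//.
pose k v := h (shiftV v i s) - h v.
have mk : measurable_fun setT k.
  by apply: measurable_funB => //; exact: (measurableT_comp mh (measurable_shift i s)).
have k2 : L1 (fun v => k v ^+ 2) by exact: L1_hell.
have test phi : C1c phi -> Int (fun v => k v * phi v) ^+ 2 <= s ^+ 2 * N * Int (fun v => phi v ^+ 2).
  move=> hphi; have [L [M [p [b1 s1 p1 mphi phi2]]]] := C1c_facts hphi.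
  have L0 : 0 <= L := le_trans (normr_ge0 _) (C1b_le b1 i V0).
  pose ph (r : R) v := phi (shiftV v i (- r)).
  have C1r r : C1c (ph r).
    apply: (C1b_C1c (M := M + `|r|) (C1b_shift i (- r) b1).1) => v hv; apply: s1.
    have := ler_enormD (shiftV v i (- r)) (shiftV V0 i r).
    have -> : addV (shiftV v i (- r)) (shiftV V0 i r) = v by elim/I3_ind: (i); apply: eqV => /=; ring.
    have -> : enorm (shiftV V0 i r) = `|r|.
      rewrite /enorm (_ : dotV _ _ = r ^+ 2) ?sqrtr_sqr//.
      by elim/I3_ind: (i); rewrite /dotV /=; ring.
    by move: hv; lra.
  have Er r v : partial (ph r) i v = partial phi i (shiftV v i (- r)) by exact: (C1b_shift i (- r) b1).2.
  pose F r v := h v * ph r v.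
  pose dF r v := h v * - partial phi i (shiftV v i (- r)).
  pose W := `|s| + 1.
  have Fi r : L1 (F r).
    by have [L' [M' [p' [_ s' p'' m' _]]]] := C1c_facts (C1r r); exact: (support_L1 s' p'' m').
  have D (r : R) v : is_derive r 1 (F ^~ v) (dF r v).
    have h1 : is_derive (0 + -1 * r) 1 (fun r : R => phi (shiftV v i r)) (partial phi i (shiftV v i (- r))).
      by rewrite (_ : - r = 0 + -1 * r); [exact: is_derive_line (C1b_derivable b1 (i := i)) v _|ring].
    have hl := is_derive_affine 0 (-1) (is_derive_id r (1 : R)).
    have D1 := @is_derive1_comp _ _ (fun r : R => 0 + -1 * r) r _ _ h1 hl.
    have E : F ^~ v = (fun r => 0 + h v * ((fun r : R => phi (shiftV v i r)) \o (fun r : R => 0 + -1 * r)) r).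
      by apply/funext => r' /=; rewrite add0r /F /ph; congr (_ * phi (shiftV _ _ _)); ring.
    rewrite E; apply: (is_derive_eq (is_derive_affine 0 (h v) D1)).
    by rewrite /dF; ring.
  (* The ball contains the supports of the derivatives of all translates by less than [W], so one
     function dominates the whole family. *)
  pose G0 v := `|h v * (L * ball1 (M + 1 + W) v)|.
  have G0i : L1 G0.
    apply: L1_norm; apply: L1_mul => //.
    - by apply: measurable_funM => //; exact: measurable_ball1.
    - under eq_fun do rewrite exprMn; apply: L1Z.
      apply: (L1_le _ _ (L1_ball1 (M + 1 + W))); first by apply: measurable_funX; exact: measurable_ball1.
      by move=> v; rewrite /ball1 indicE; case: (_ \in _); rewrite ?expr1n ?expr0n ?normr0 ?normr1.
  have Gb r v : - W < r < W -> `|dF r v| <= G0 v.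
    move=> /andP[r1 r2]; rewrite /dF /G0 !normrM normrN ler_wpM2l//.
    rewrite (ger0_norm L0) /ball1 indicE; case: (boolP (v \in _)) => [_|].
      by rewrite normr1 mulr1; exact: (C1b_le b1).
    rewrite notin_setE /= => /negP; rewrite -ltNge => hv.
    rewrite (partial_support s1) ?normr0 ?mulr0//.
    have := ler_enormD (shiftV v i (- r)) (shiftV V0 i r).
    have -> : addV (shiftV v i (- r)) (shiftV V0 i r) = v by elim/I3_ind: (i); apply: eqV => /=; ring.
    have -> : enorm (shiftV V0 i r) = `|r|.
      rewrite /enorm (_ : dotV _ _ = r ^+ 2) ?sqrtr_sqr//.
      by elim/I3_ind: (i); rewrite /dotV /=; ring.
    have : `|r| < W by rewrite ltr_norml r1 r2.
    by move: hv; lra.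
  have ID := Int_derive (fun r (_ : - W < r < W) => Fi r) (fun r v (_ : - W < r < W) => D r v) G0i Gb.
  pose m r := Int (F r).
  have IE r : Int (dF r) = Int (fun v => G i v * ph r v).
    have [j1 [j2 E]] := hG _ (C1r r) i.
    have i1 : L1 (fun v => sqrt (f v) * partial (ph r) i v) by apply/leb3_L1.
    have i2 : L1 (fun v => G i v * ph r v) by apply/leb3_L1.
    rewrite !leb3_Int// in E; rewrite -[RHS]opprK -E -IntN//.
    by congr Int; apply/funext => v; rewrite Er /dF /h mulrN.
  have ml : exists2 c, - W < c < W & m s - m 0 = Int (dF c) * s.
    have W1 : `|s| < W by rewrite ltrDl.
    have sW : - W < s < W by rewrite -ltr_norml.
    have W0 : - W < 0 < W by rewrite oppr_lt0 andbb (le_lt_trans _ W1).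
    have cm x y : - W < x -> y < W -> {within `[x, y], continuous m}.
      move=> hx hy; apply: derivable_within_continuous => z; rewrite in_itv /= => /andP[z1 z2].
      have hz : - W < z < W by rewrite (lt_le_trans hx z1) (le_lt_trans z2 hy).
      by have [] := ID z hz.
    have dm x y : - W < x -> y < W -> forall z, z \in `]x, y[ -> is_derive z 1 m (Int (dF z)).
      move=> hx hy z; rewrite in_itv /= => /andP[z1 z2].
      by apply: ID; rewrite (lt_trans hx z1) (lt_trans z2 hy).
    have [wm wp] := andP sW; have [zm zp] := andP W0.
    have [s_0|s_0] := leP 0 s.
      have [c hc E] := @MVT_segment R m (fun z => Int (dF z)) 0 s s_0 (dm _ _ zm wp) (cm _ _ zm wp).
      exists c; last by rewrite E subr0.
      by move: hc; rewrite in_itv /= => /andP[c1 c2]; rewrite (lt_le_trans zm c1) (le_lt_trans c2 wp).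
    have [c hc E] := @MVT_segment R m (fun z => Int (dF z)) s 0 (ltW s_0) (dm _ _ wm zp) (cm _ _ wm zp).
    exists c; last by rewrite -[LHS]opprB E sub0r mulrN opprK.
    by move: hc; rewrite in_itv /= => /andP[c1 c2]; rewrite (lt_le_trans wm c1) (le_lt_trans c2 zp).
  have [c _ Em] := ml.
  have -> : Int (fun v => k v * phi v) = m s - m 0.
    have f1 : L1 (fun v => F s (shiftV v i s)) by exact: L1_shift i s (Fi s).
    rewrite /m -(Int_shift i s (Fi s)) -(IntB f1 (Fi 0)).
    congr Int; apply/funext => v; rewrite /k /F /ph shiftVD subrr shiftV0 oppr0 shiftV0; ring.
  rewrite Em exprMn IE mulrC -mulrA ler_wpM2l ?sqr_ge0//.
  have [L' [M' [p' [b' s' p'' m' q2]]]] := C1c_facts (C1r c).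
  apply: (le_trans (cauchy_schwarz_Int (mG i) m' G2 q2)).
  by rewrite ler_wpM2l// (Int_shift i (- c) phi2).
(* The inequality [test] bounds the L^2 norm of the Riesz representative [K] of [k]; testing with
   [C1c] functions shows [K = k] almost everywhere. *)
pose A (g : V R -> R) := C1c g.
have [K [a_ [mK K2 KN Kl _]]] : exists (K : V R -> R) (a_ : nat -> V R -> R),
  [/\ measurable_fun setT K, L1 (fun x => K x ^+ 2), Int (fun x => K x ^+ 2) <= s ^+ 2 * N,
    (forall a, A a -> Int (fun x => K x * a x) = Int (fun v => k v * a v)) &
    (forall n, A (a_ n)) /\ {ae mu3, forall x, a_ ^~ x @ \oo --> K x}].
  apply: (@riesz_limit _ _ R mu3 A (fun a => Int (fun v => k v * a v)) (s ^+ 2 * N)).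
  - exact: C1c_zero.
  - by move=> a b c ha hb; exact: (C1c_lin c ha hb).1.
  - move=> a b c ha hb; have [_ [_ [_ [_ _ _ ma a2]]]] := C1c_facts ha.
    have [_ [_ [_ [_ _ _ mb b2]]]] := C1c_facts hb.
    have i1 := L1_mul mk ma k2 a2; have i2 := L1_mul mk mb k2 b2.
    rewrite -IntZ// -IntD//; last exact: L1Z.
    by congr Int; apply/funext => v; ring.
  - by move=> a ha; have [_ [_ [_ [_ _ _ ma _]]]] := C1c_facts ha.
  - by move=> a ha; have [_ [_ [_ [_ _ _ _ a2]]]] := C1c_facts ha.
  - by rewrite mulr_ge0 ?sqr_ge0.
  - by move=> a ha; exact: test.
have ae0 : {ae mu3, forall x, K x - k x = 0}.
  apply: integral_zero_ae_C1c; first exact: measurable_funB.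
  move=> phi hphi; have [_ [_ [_ [_ _ _ mphi phi2]]]] := C1c_facts hphi.
  have i1 := L1_mul mK mphi K2 phi2; have i2 := L1_mul mk mphi k2 phi2.
  have E : (fun v => (K v - k v) * phi v) = (fun v => K v * phi v - k v * phi v).
    by apply/funext => v; rewrite mulrBl.
  by rewrite E; split; [exact: L1B|rewrite IntB// Kl// subrr].
apply: le_trans KN; rewrite le_eqVlt; apply/orP; left; apply/eqP.
apply: Int_eq_ae; [exact: measurable_funX|exact: measurable_funX|].
by apply: filterS ae0 => v /eqP; rewrite subr_eq0 => /eqP ->.
Qed.

End Hellinger.

(** * From score bounds back to Hellinger distances *)

Section ScoreToHellinger.
Variable R : realType.
Implicit Types (s t : R).
Local Notation mu3 := (mu3 R).
Local Notation L1 := (L1 mu3).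
Local Notation Int := (Int mu3).
Local Notation V0 := (((0, 0), 0) : V R).
Local Notation sqrt := (@Num.sqrt R).

Lemma C1b_lin L1' L2' (a b : V R -> R) (c : R) : C1b L1' a -> C1b L2' b ->
  C1b (L1' + `|c| * L2') (fun v => a v + c * b v).
Proof.
move=> b1 b2; have [p1 k1] := C1b_bounded b1; have [p2 k2] := C1b_bounded b2.
suff [] : C1b (L1' + `|c| * L2') (fun v => a v + c * b v) /\
    partial (fun v => a v + c * b v) = (fun i v => partial a i v + c * partial b i v) by [].
apply: (@C1b_build _ _ _ _ (p1 + `|c| * p2)) => [v|i v|i|i v].
- by rewrite (le_trans (ler_normD _ _))// lerD// normrM ler_wpM2l.
- have := is_deriveD (partial_chain i v b1) (is_derive_affine 0 c (partial_chain i v b2)).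
  by under [in X in is_derive _ _ (_ + X) _ -> _]eq_fun do rewrite add0r.
- apply: cvg3_continuous => x y xy; apply: cvgD; first exact: (continuous_cvg3 (C1b_continuous b1 (i := i))).
  by apply: cvgM; [exact: cvg_cst|exact: (continuous_cvg3 (C1b_continuous b2 (i := i)))].
- by rewrite (le_trans (ler_normD _ _))// lerD ?(C1b_le b1)// normrM ler_wpM2l// (C1b_le b2).
Qed.

Section Profile.
Variable eta : R.
Hypothesis eta0 : 0 < eta.

(* [1 + psi b] is [(t + eta) / (1 - t + eta)] with [t = (1 + b)^2 / (2 (1 + b^2))] in [0, 1]:
   a smooth bounded substitute for the optimal ratio of square roots of densities. *)
Definition psi (b : R) := 4 * b / ((1 - b) ^+ 2 + 2 * eta * (1 + b ^+ 2)).
Definition theta (b : R) := 4 * b / ((1 + b) ^+ 2 + 2 * eta * (1 + b ^+ 2)).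

Let q0 (b : R) : 0 < 1 + b ^+ 2. Proof. by rewrite ltr_wpDr ?sqr_ge0. Qed.
Let d1 (b : R) : 0 < (1 - b) ^+ 2 + 2 * eta * (1 + b ^+ 2).
Proof. by rewrite ltr_wpDl ?sqr_ge0// !mulr_gt0. Qed.
Let d2 (b : R) : 0 < (1 + b) ^+ 2 + 2 * eta * (1 + b ^+ 2).
Proof. by rewrite ltr_wpDl ?sqr_ge0// !mulr_gt0. Qed.

Let b4 (b : R) : `|4 * b| <= 2 * (1 + b ^+ 2).
Proof.
rewrite normrM ger0_norm// -(real_normK (num_real b)).
by have := sqr_ge0 (`|b| - 1); rewrite sqrrB expr1n; lra.
Qed.

Lemma psi_le b : `|psi b| <= eta^-1.
Proof.
rewrite /psi normrM normfV (ger0_norm (ltW (d1 b))) ler_pdivrMr//.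
have -> : eta^-1 * ((1 - b) ^+ 2 + 2 * eta * (1 + b ^+ 2)) = eta^-1 * (1 - b) ^+ 2 + 2 * (1 + b ^+ 2).
  by field; rewrite gt_eqF.
by rewrite (le_trans (b4 b))// lerDr mulr_ge0 ?sqr_ge0// invr_ge0 ltW.
Qed.

Lemma theta_le b : `|theta b| <= eta^-1.
Proof.
rewrite /theta normrM normfV (ger0_norm (ltW (d2 b))) ler_pdivrMr//.
have -> : eta^-1 * ((1 + b) ^+ 2 + 2 * eta * (1 + b ^+ 2)) = eta^-1 * (1 + b) ^+ 2 + 2 * (1 + b ^+ 2).
  by field; rewrite gt_eqF.
by rewrite (le_trans (b4 b))// lerDr mulr_ge0 ?sqr_ge0// invr_ge0 ltW.
Qed.

Lemma psi_pos b : eta / (1 + eta) <= 1 + psi b.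
Proof.
have e1 : 0 < 1 + eta by rewrite ltr_wpDl.
rewrite /psi.
have -> : 1 + 4 * b / ((1 - b) ^+ 2 + 2 * eta * (1 + b ^+ 2)) =
    ((1 + b) ^+ 2 + 2 * eta * (1 + b ^+ 2)) / ((1 - b) ^+ 2 + 2 * eta * (1 + b ^+ 2)).
  by move: (d1 b) => d; field; rewrite gt_eqF.
rewrite ler_pdivrMr// mulrAC ler_pdivlMr//.
have h1 : eta * ((1 - b) ^+ 2) <= eta * (2 * (1 + b ^+ 2)).
  by rewrite ler_wpM2l ?(ltW eta0)//; have := sqr_ge0 (1 + b); rewrite sqrrD sqrrB !expr1n; lra.
have h2 : 0 <= (1 + b) ^+ 2 * (1 + eta) by rewrite mulr_ge0 ?sqr_ge0// ltW.
by move: h1 h2; lra.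
Qed.

Lemma theta_psi b : psi b / (1 + psi b) = theta b.
Proof.
have h : 1 + psi b != 0.
  by rewrite gt_eqF// (lt_le_trans _ (psi_pos b))// divr_gt0// ltr_wpDl.
move: h; rewrite /theta /psi; have := d1 b; have := d2 b => h2 h1.
have -> : 1 + 4 * b / ((1 - b) ^+ 2 + 2 * eta * (1 + b ^+ 2)) =
    ((1 + b) ^+ 2 + 2 * eta * (1 + b ^+ 2)) / ((1 - b) ^+ 2 + 2 * eta * (1 + b ^+ 2)).
  by field; rewrite gt_eqF.
by move=> _; rewrite invf_div mulrA divfK// gt_eqF.
Qed.

Lemma psi_C1b L b : C1b L b -> exists L', C1b L' (fun v : V R => psi (b v)).
Proof.
move=> hb; have [p hp] := C1b_bounded hb.
pose dpsi (x : R) := 4 * (1 + 2 * eta) * (1 - x ^+ 2) / ((1 - x) ^+ 2 + 2 * eta * (1 + x ^+ 2)) ^+ 2.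
have p0 : 0 <= p := le_trans (normr_ge0 _) (hp V0).
exists (4 * (1 + 2 * eta) * (1 + p ^+ 2) / (2 * eta) ^+ 2 * L).
apply: (@C1b_comp R L b psi dpsi p _ eta^-1 hb hp _ _ _ _).1.
- move=> x _.
  have hD : is_derive x 1 (fun y : R => (1 - y) ^+ 2 + 2 * eta * (1 + y ^+ 2)) (- 2 * (1 - x) + 4 * eta * x).
    apply: (@is_derive_quadratic _ _ _ _ (1 + 2 * eta) 1) => // t _.
    rewrite (_ : _ - _ - _ = (1 + 2 * eta) * t ^+ 2); last by ring.
    by rewrite ger0_norm// mulr_ge0 ?sqr_ge0// addr_ge0// mulr_ge0// ltW.
  have hN := is_derive_affine 0 4 (is_derive_id x (1 : R)).
  have D : is_derive x 1 (fun y : R => (0 + 4 * y) * ((1 - y) ^+ 2 + 2 * eta * (1 + y ^+ 2))^-1) _ :=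
    is_deriveM hN (@is_deriveV _ (fun y : R => (1 - y) ^+ 2 + 2 * eta * (1 + y ^+ 2)) x _ _ (lt0r_neq0 (d1 x)) hD).
  have E : psi = (fun y : R => (0 + 4 * y) * ((1 - y) ^+ 2 + 2 * eta * (1 + y ^+ 2))^-1).
    by apply/funext => y; rewrite add0r.
  rewrite E; apply: (is_derive_eq D); rewrite /dpsi /GRing.scale /=.
  by have := d1 x => h; field; rewrite gt_eqF.
- move=> x _; have c2 : (y ^+ 2 : R) @[y --> x] --> x ^+ 2.
    by rewrite expr2; under eq_fun do rewrite expr2; apply: cvgM; exact: cvg_id.
  have cD : (1 - y) ^+ 2 + 2 * eta * (1 + y ^+ 2) @[y --> x] --> (1 - x) ^+ 2 + 2 * eta * (1 + x ^+ 2).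
    apply: cvgD.
      by rewrite expr2; under eq_fun do rewrite expr2; apply: cvgM; (apply: cvgB; [exact: cvg_cst|exact: cvg_id]).
    by apply: cvgM; [exact: cvg_cst|apply: cvgD; [exact: cvg_cst|exact: c2]].
  apply: cvgM; first by apply: cvgM; [exact: cvg_cst|apply: cvgB; [exact: cvg_cst|exact: c2]].
  apply: cvgV; first by rewrite sqrf_eq0 gt_eqF.
  by rewrite expr2; under eq_fun do rewrite expr2; exact: cvgM.
- move=> x xp; rewrite /dpsi normrM normfV [`|(_ + _) ^+ 2|]ger0_norm ?sqr_ge0//.
  have c0 : 0 <= 4 * (1 + 2 * eta) by rewrite mulr_ge0// addr_ge0// mulr_ge0// ltW.
  rewrite ler_pM ?invr_ge0 ?sqr_ge0//.
    rewrite normrM (ger0_norm c0) ler_wpM2l// (le_trans (ler_normB _ _))// normr1 lerD2l.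
    by rewrite normrX lerXn2r ?nnegrE.
  have e2 : 0 < 2 * eta by rewrite mulr_gt0.
  have h : 2 * eta <= (1 - x) ^+ 2 + 2 * eta * (1 + x ^+ 2).
    have := sqr_ge0 (1 - x); have := mulr_ge0 (ltW e2) (sqr_ge0 x); lra.
  by rewrite lef_pV2 ?posrE ?exprn_gt0// lerXn2r ?nnegrE ?(ltW e2)// ltW.
- by move=> x _; exact: psi_le.
Qed.

Lemma psi_continuous : continuous psi /\ continuous theta.
Proof.
have c2 (x : R) : (y ^+ 2 : R) @[y --> x] --> x ^+ 2.
  by rewrite expr2; under eq_fun do rewrite expr2; apply: cvgM; exact: cvg_id.
have c4 (x : R) : (4 * y : R) @[y --> x] --> 4 * x by apply: cvgM; [exact: cvg_cst|exact: cvg_id].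
have ce (x : R) : 2 * eta * (1 + y ^+ 2) @[y --> x] --> 2 * eta * (1 + x ^+ 2).
  by apply: cvgM; [exact: cvg_cst|apply: cvgD; [exact: cvg_cst|exact: c2]].
split=> x; (apply: cvgM; first exact: c4); (apply: cvgV; [by rewrite gt_eqF|apply: cvgD; [|exact: ce]]).
  by rewrite expr2; under eq_fun do rewrite expr2; apply: cvgM; (apply: cvgB; [exact: cvg_cst|exact: cvg_id]).
by rewrite expr2; under eq_fun do rewrite expr2; apply: cvgM; (apply: cvgD; [exact: cvg_cst|exact: cvg_id]).
Qed.

(** For fourth roots [P], [Q] of two densities [p], [q], this choice of [b] gives [1 + psi b] close
    to [P^2 / Q^2], the ratio of square roots, which is the value of [1 + a] maximizing
    [p a / (1 + a) - q a]. *)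
Lemma psi_theta_value (P Q : R) : 0 <= P -> 0 <= Q -> 0 < P + Q ->
  let b := (P - Q) / (P + Q) in
  theta b = (P ^+ 2 - Q ^+ 2) / (P ^+ 2 + eta * (P ^+ 2 + Q ^+ 2)) /\
  psi b = (P ^+ 2 - Q ^+ 2) / (Q ^+ 2 + eta * (P ^+ 2 + Q ^+ 2)).
Proof.
move=> P0 Q0 PQ /=.
have PQ2 : 0 < P ^+ 2 + Q ^+ 2.
  rewrite lt_def addr_ge0 ?sqr_ge0// andbT; apply/negP => /eqP h.
  have hp : P = 0 by have := sqr_ge0 Q; have := sqr_ge0 P; nra.
  have hq : Q = 0 by have := sqr_ge0 Q; have := sqr_ge0 P; nra.
  by move: PQ; rewrite hp hq addr0 ltxx.
have n1 : 0 < P ^+ 2 + eta * (P ^+ 2 + Q ^+ 2) by rewrite ltr_wpDl ?sqr_ge0// mulr_gt0.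
have n2 : 0 < Q ^+ 2 + eta * (P ^+ 2 + Q ^+ 2) by rewrite ltr_wpDl ?sqr_ge0// mulr_gt0.
set b := (P - Q) / (P + Q).
have e1 : (1 + b) ^+ 2 + 2 * eta * (1 + b ^+ 2) = 4 * (P ^+ 2 + eta * (P ^+ 2 + Q ^+ 2)) / (P + Q) ^+ 2.
  by rewrite /b; field; rewrite gt_eqF.
have e2 : (1 - b) ^+ 2 + 2 * eta * (1 + b ^+ 2) = 4 * (Q ^+ 2 + eta * (P ^+ 2 + Q ^+ 2)) / (P + Q) ^+ 2.
  by rewrite /b; field; rewrite gt_eqF.
rewrite /theta /psi e1 e2 /b; move: n1 n2; move: (P ^+ 2 + eta * _) (Q ^+ 2 + eta * _) => x y x0 y0.
by split; field; rewrite !gt_eqF.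
Qed.

End Profile.

Variables (f : V R -> R) (i : 'I_3) (M : R).
Hypotheses (f0 : forall v, 0 <= f v) (fi : L1 f).
Hypothesis hM : forall L (a : V R -> R), C1b L a ->
  - 2 * Int (fun v => f v * partial a i v) - Int (fun v => f v * a v ^+ 2) <= M.
Variable s : R.

Let mf := L1_measurable fi.
Let p v := f (shiftV v i s).
Let w v := p v + f v.
Let p0 v : 0 <= p v. Proof. exact: f0. Qed.
Let w0 v : 0 <= w v. Proof. by rewrite addr_ge0. Qed.
Let pi' : L1 p. Proof. exact: L1_shift. Qed.
Let wi : L1 w. Proof. exact: L1D. Qed.
Let mp := L1_measurable pi'.
Let mw := L1_measurable wi.
Let P v := sqrt (sqrt (p v)).
Let Q v := sqrt (sqrt (f v)).
(** Unlike the optimal ratio [P^2 / Q^2], it is bounded by [1] everywhere, and it is [0] where both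
    densities vanish; this makes approximation in L^2 possible. *)
Let be v := (P v - Q v) / (P v + Q v).

Let mP : measurable_fun setT P. Proof. by do 2!apply: measurable_sqrtf. Qed.
Let mQ : measurable_fun setT Q. Proof. by do 2!apply: measurable_sqrtf. Qed.
Let mbe : measurable_fun setT be.
Proof.
apply: measurable_funM; first exact: measurable_funB.
by apply: (measurableT_comp (@measurable_invr R)); exact: measurable_funD.
Qed.
Let be_le v : `|be v| <= 1.
Proof.
have hP : 0 <= P v by exact: sqrtr_ge0.
have hQ : 0 <= Q v by exact: sqrtr_ge0.
rewrite /be normrM normfV (ger0_norm (addr_ge0 hP hQ)).
have [->|n0] := eqVneq (P v + Q v) 0; first by rewrite invr0 mulr0.
rewrite ler_pdivrMr ?lt_def ?n0 ?addr_ge0// mul1r ler_norml.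
by apply/andP; split; move: hP hQ; lra.
Qed.

Let kb v := sqrt (w v) * be v.
Let mkb : measurable_fun setT kb. Proof. by apply: measurable_funM => //; exact: measurable_sqrtf. Qed.

Let L1w2 (a : V R -> R) q : measurable_fun setT a -> (forall v, `|a v| <= q) -> L1 (fun v => (sqrt (w v) * a v) ^+ 2).
Proof.
move=> ma ha; under eq_fun do rewrite exprMn sqr_sqrtr//.
apply: (L1M (M := q ^+ 2) wi); first exact: measurable_funX.
by move=> v; rewrite normrX lerXn2r ?nnegrE// (le_trans _ (ha v)).
Qed.

(** [riesz_limit] on the space of functions [sqrt w a], for the product with [sqrt w be]: the
    representative agrees with [sqrt w be] by [integral_zero_ae], and the factor [sqrt w] can be
    divided out where [w] is positive. *)
Lemma C1b_dense : exists b : nat -> V R -> R, (forall n, exists L, C1b L (b n)) /\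
  {ae mu3, forall v, 0 < w v -> b ^~ v @ \oo --> be v}.
Proof.
pose A (g : V R -> R) := exists L a, C1b L a /\ g = (fun v => sqrt (w v) * a v).
have mA a : A a -> measurable_fun setT a.
  by move=> [L [a' [h ->]]]; apply: measurable_funM; [exact: measurable_sqrtf|exact: C1b_measurable h].
have A2 a : A a -> L1 (fun x => a x ^+ 2).
  by move=> [L [a' [h ->]]]; have [q hq] := C1b_bounded h; exact: (L1w2 (C1b_measurable h) hq).
have kb2 : L1 (fun v => kb v ^+ 2) by exact: (L1w2 mbe be_le).
have [G [a_ [mG G2 _ Gl [Aa ae1]]]] : exists (G : V R -> R) (a_ : nat -> V R -> R),
  [/\ measurable_fun setT G, L1 (fun x => G x ^+ 2), Int (fun x => G x ^+ 2) <= Int (fun v => kb v ^+ 2),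
    (forall a, A a -> Int (fun x => G x * a x) = Int (fun v => kb v * a v)) &
    (forall n, A (a_ n)) /\ {ae mu3, forall x, a_ ^~ x @ \oo --> G x}].
  apply: (@riesz_limit _ _ R mu3 A (fun a => Int (fun v => kb v * a v))).
  - by exists 0, (fun=> 0); split; [exact: (C1b_cst (0 : R)).1|apply/funext => v; rewrite mulr0].
  - move=> a b c [L1' [a' [ha ->]]] [L2' [b' [hb ->]]].
    exists (L1' + `|c| * L2'), (fun v => a' v + c * b' v); split; first exact: C1b_lin.
    by apply/funext => v; ring.
  - move=> a b c ha hb; have i1 := L1_mul mkb (mA _ ha) kb2 (A2 _ ha).
    have i2 := L1_mul mkb (mA _ hb) kb2 (A2 _ hb).
    rewrite -IntZ// -IntD//; last exact: L1Z.
    by congr Int; apply/funext => v; ring.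
  - exact: mA.
  - exact: A2.
  - by apply: Int_ge0 => v; exact: sqr_ge0.
  - by move=> a ha; apply: cauchy_schwarz_Int => //; [exact: mA|exact: A2].
have sw2 : L1 (fun v => sqrt (w v) ^+ 2) by under eq_fun do rewrite sqr_sqrtr//.
have msw := measurable_sqrtf mw.
have ae2 : {ae mu3, forall v, (G v - kb v) * sqrt (w v) = 0}.
  have i1 := L1_mul mG msw G2 sw2; have i2 := L1_mul mkb msw kb2 sw2.
  apply: integral_zero_ae.
    have := L1B i1 i2; congr L1; apply/funext => v; ring.
  move=> L a ha; have hA : A (fun v => sqrt (w v) * a v) by exists L, a.
  have j1 := L1_mul mG (mA _ hA) G2 (A2 _ hA); have j2 := L1_mul mkb (mA _ hA) kb2 (A2 _ hA).
  have E : (fun v => (G v - kb v) * sqrt (w v) * a v) =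
      (fun v => G v * (sqrt (w v) * a v) - kb v * (sqrt (w v) * a v)) by apply/funext => v; ring.
  by rewrite E IntB// Gl// subrr.
have /choice[b hb] : forall n, exists b, (exists L, C1b L b) /\ a_ n = (fun v => sqrt (w v) * b v).
  by move=> n; have [L [b [h E]]] := Aa n; exists b; split => //; exists L.
exists b; split; first by move=> n; have [] := hb n.
apply: filterS2 ae1 ae2 => v h1 h2 wv.
have sw0 : sqrt (w v) != 0 by rewrite gt_eqF// sqrtr_gt0.
have Gv : G v = kb v.
  by move/eqP: h2; rewrite mulf_eq0 (negbTE sw0) orbF subr_eq0 => /eqP.
have -> : be v = (sqrt (w v))^-1 * G v by rewrite Gv /kb mulKf.
have c : (sqrt (w v))^-1 * a_ n v @[n --> \oo] --> (sqrt (w v))^-1 * G v.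
  by apply: cvgM; [exact: cvg_cst|exact: h1].
by apply: (cvg_ext c) => n; have [_ ->] := hb n; rewrite mulKf.
Qed.

Let C := s ^+ 2 * M / 4.

(** [homotopy] needs a C^1 function, so it is applied to [psi (b n)] for the smooth approximations
    [b n] of [be]; [psi] and [theta] are bounded by [1 / eta], which gives domination. *)
Let profile_le eta : 0 < eta -> Int (fun v => p v * theta eta (be v) - f v * psi eta (be v)) <= C.
Proof.
move=> e0; have [b [hb ae1]] := C1b_dense.
have mb n : measurable_fun setT (b n) by have [L h] := hb n; exact: C1b_measurable h.
have [cp ct] := psi_continuous e0.
have mpsi : measurable_fun setT (psi eta) by exact: continuous_measurable_fun.
have mth : measurable_fun setT (theta eta) by exact: continuous_measurable_fun.
have mint (g : V R -> R) : measurable_fun setT g -> measurable_fun setT (fun v => p v * theta eta (g v) - f v * psi eta (g v)).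
  move=> mg; apply: measurable_funB; apply: measurable_funM => //; exact: measurableT_comp.
have bnd g v : `|p v * theta eta g - f v * psi eta g| <= eta^-1 * w v.
  rewrite (le_trans (ler_normB _ _))// /w mulrDr (normrM (p v)) (normrM (f v)) (ger0_norm (p0 v)) (ger0_norm (f0 v)).
  have h1 := ler_wpM2l (p0 v) (theta_le e0 g); have h2 := ler_wpM2l (f0 v) (psi_le e0 g).
  by rewrite [eta^-1 * p v]mulrC [eta^-1 * f v]mulrC; exact: (lerD h1 h2).
have [_ c] : L1 (fun v => p v * theta eta (be v) - f v * psi eta (be v)) /\
    Int (fun v => p v * theta eta (b n v) - f v * psi eta (b n v)) @[n --> \oo] -->
    Int (fun v => p v * theta eta (be v) - f v * psi eta (be v)).
  apply: (Int_dct_ae _ _ (L1Z eta^-1 wi)).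
  - by move=> n; exact: mint.
  - exact: mint.
  - by move=> n v; exact: bnd.
  - apply: filterS ae1 => v hv; have := w0 v; rewrite le_eqVlt => /orP[/eqP w_0|/hv cb].
      have pz : p v = 0 by move: w_0 (p0 v) (f0 v); rewrite /w; lra.
      have fz : f v = 0 by move: w_0 (p0 v) (f0 v); rewrite /w; lra.
      by rewrite pz fz !mul0r subr0; under eq_fun do rewrite !mul0r subr0; exact: cvg_cst.
    apply: cvgB; apply: cvgM; try exact: cvg_cst.
      by apply: continuous_cvg => //; exact: ct.
    by apply: continuous_cvg => //; exact: cp.
apply: (cvg_le c (cvg_cst C)) => n.
have [L hL] := hb n; have [L' hL'] := psi_C1b e0 hL.
have e1 : 0 < eta / (1 + eta) <= 1.
  by rewrite divr_gt0 ?ltr_wpDl//= ler_pdivrMr ?ltr_wpDl// mul1r lerDr.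
have := homotopy f0 fi hM s hL' e1 (fun v => psi_pos e0 (b n v)).
have i1 : L1 (fun v => p v * theta eta (b n v)).
  by apply: (L1M (M := eta^-1) pi') => [|v]; [exact: measurableT_comp|exact: theta_le].
have i2 : L1 (fun v => f v * psi eta (b n v)).
  by apply: (L1M (M := eta^-1) fi) => [|v]; [exact: measurableT_comp|exact: psi_le].
rewrite IntB//; congr (_ - _ <= _); congr Int; apply/funext => v.
by rewrite theta_psi.
Qed.

(** As [eta] tends to [0] the integrand tends to [(sqrt p - sqrt f)^2], the supremum over [a > -1]
    of [p a / (1 + a) - f a]; it is dominated by [p + f]. *)
Lemma hellinger_of_score : hell f i s <= C.
Proof.
pose en (n : nat) : R := n.+1%:R^-1.
have en0 n : 0 < en n by rewrite invr_gt0.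
pose H n v := (sqrt (p v) - sqrt (f v)) * (p v / (sqrt (p v) + en n * (sqrt (p v) + sqrt (f v)))
  - f v / (sqrt (f v) + en n * (sqrt (p v) + sqrt (f v)))).
have HE n v : p v * theta (en n) (be v) - f v * psi (en n) (be v) = H n v.
  have x0 : 0 <= sqrt (p v) := sqrtr_ge0 _; have y0 : 0 <= sqrt (f v) := sqrtr_ge0 _.
  have P0 : 0 <= P v by exact: sqrtr_ge0.
  have Q0 : 0 <= Q v by exact: sqrtr_ge0.
  have P2 : P v ^+ 2 = sqrt (p v) by rewrite /P sqr_sqrtr.
  have Q2 : Q v ^+ 2 = sqrt (f v) by rewrite /Q sqr_sqrtr.
  have := addr_ge0 P0 Q0; rewrite le_eqVlt => /orP[/eqP h|PQ].
    have Pz : P v = 0 by move: h P0 Q0; lra.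
    have Qz : Q v = 0 by move: h P0 Q0; lra.
    have pz : p v = 0 by rewrite -(sqr_sqrtr (p0 v)) -P2 Pz !expr0n.
    have fz : f v = 0 by rewrite -(sqr_sqrtr (f0 v)) -Q2 Qz !expr0n.
    by rewrite /H pz fz !mul0r subr0 mulr0.
  have [t1 t2] := psi_theta_value (en0 n) P0 Q0 PQ.
  by rewrite /be t1 t2 /H P2 Q2 mulrBr !mulrA [p v * _]mulrC [f v * _]mulrC.
have frac n (x y : R) : 0 <= x -> 0 <= y -> 0 <= x ^+ 2 / (x + en n * (x + y)) <= x.
  move=> x0 y0; have d0 : 0 <= x + en n * (x + y) by rewrite addr_ge0// mulr_ge0 ?addr_ge0// ltW.
  rewrite divr_ge0 ?sqr_ge0//=; have [d_0|dn] := eqVneq (x + en n * (x + y)) 0.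
    by rewrite d_0 invr0 mulr0.
  rewrite ler_pdivrMr ?lt_def ?dn// expr2 ler_wpM2l// lerDl mulr_ge0 ?addr_ge0//.
  exact: ltW.
have frac_lim (x y : R) : 0 <= x -> 0 <= y -> x ^+ 2 / (x + en n * (x + y)) @[n --> \oo] --> x.
  move=> x0 y0; have := x0; rewrite le_eqVlt => /orP[/eqP <-|xp].
    by rewrite expr0n; under eq_fun do rewrite mul0r; exact: cvg_cst.
  have h : x + en n * (x + y) @[n --> \oo] --> x + 0 * (x + y).
    apply: cvgD; first exact: cvg_cst.
    by apply: cvgM; [exact: cvg_harmonic|exact: cvg_cst].
  rewrite mul0r addr0 in h.
  have h2 : x ^+ 2 / (x + en n * (x + y)) @[n --> \oo] --> x ^+ 2 / x.
    by apply: cvgM; [exact: cvg_cst|apply: cvgV => //; rewrite gt_eqF].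
  by rewrite expr2 mulfK ?gt_eqF// in h2.
have msp := measurable_sqrtf mp; have msf := measurable_sqrtf mf.
have mH n : measurable_fun setT (H n).
  have md (g : V R -> R) : measurable_fun setT g -> measurable_fun setT (fun v => (sqrt (g v) + en n * (sqrt (p v) + sqrt (f v)))^-1).
    move=> mg; apply: (measurableT_comp (@measurable_invr R)); apply: measurable_funD; first exact: measurable_sqrtf.
    by apply: measurable_funM => //; exact: measurable_funD.
  by apply: measurable_funM; apply: measurable_funB => //; apply: measurable_funM => //; exact: md.
have [_ c] : L1 (fun v => (sqrt (p v) - sqrt (f v)) ^+ 2) /\ Int (H n) @[n --> \oo] --> Int (fun v => (sqrt (p v) - sqrt (f v)) ^+ 2).
  apply: (Int_dct _ _ wi).
  - exact: mH.
  - by apply: measurable_funX; exact: measurable_funB.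
  - move=> n v; have -> : H n v = (sqrt (p v) - sqrt (f v)) *
      (sqrt (p v) ^+ 2 / (sqrt (p v) + en n * (sqrt (p v) + sqrt (f v))) -
       sqrt (f v) ^+ 2 / (sqrt (f v) + en n * (sqrt (p v) + sqrt (f v)))) by rewrite !sqr_sqrtr.
    have -> : w v = sqrt (p v) ^+ 2 + sqrt (f v) ^+ 2 by rewrite !sqr_sqrtr.
    have x0 : 0 <= sqrt (p v) := sqrtr_ge0 _; have y0 : 0 <= sqrt (f v) := sqrtr_ge0 _.
    have := frac n _ _ x0 y0; have := frac n _ _ y0 x0; rewrite [sqrt (f v) + sqrt (p v)]addrC.
    move: (sqrt (p v)) (sqrt (f v)) x0 y0 => x y x0 y0.
    move: (_ / _) (_ / _) => a b /andP[a0 a1] /andP[b0 b1].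
    rewrite (normrM (x - y)); have /orP[xy|yx] := le_total x y.
      have h1 : `|x - y| <= y by rewrite ler_norml; apply/andP; split; move: x0 xy; lra.
      have h2 : `|a - b| <= y by rewrite ler_norml; apply/andP; split; move: x0 xy a0 a1 b0 b1; lra.
      by apply: (le_trans (ler_pM (normr_ge0 _) (normr_ge0 _) h1 h2)); rewrite -[y * y]expr2 lerDr sqr_ge0.
    have h1 : `|x - y| <= x by rewrite ler_norml; apply/andP; split; move: y0 yx; lra.
    have h2 : `|a - b| <= x by rewrite ler_norml; apply/andP; split; move: y0 yx a0 a1 b0 b1; lra.
    by apply: (le_trans (ler_pM (normr_ge0 _) (normr_ge0 _) h1 h2)); rewrite -[x * x]expr2 lerDl sqr_ge0.
  - move=> v; rewrite /H expr2.
    have x0 : 0 <= sqrt (p v) := sqrtr_ge0 _; have y0 : 0 <= sqrt (f v) := sqrtr_ge0 _.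
    apply: cvgM; first exact: cvg_cst.
    have h1 : p v / (sqrt (p v) + en n * (sqrt (p v) + sqrt (f v))) @[n --> \oo] --> sqrt (p v).
      by have := frac_lim _ _ x0 y0; rewrite sqr_sqrtr.
    have h2 : f v / (sqrt (f v) + en n * (sqrt (p v) + sqrt (f v))) @[n --> \oo] --> sqrt (f v).
      by have := frac_lim _ _ y0 x0; rewrite sqr_sqrtr// [sqrt (f v) + sqrt (p v)]addrC.
    exact: (cvgB h1 h2).
apply: (cvg_le c (cvg_cst C)) => n.
by rewrite (_ : H n = (fun v => p v * theta (en n) (be v) - f v * psi (en n) (be v))); [exact: profile_le|apply/funext => v; rewrite HE].
Qed.

End ScoreToHellinger.

(** * Derivatives of collision averages along moving relative velocities *)

Section Paths.
Variables (R : realType) (e : R) (B : R -> R).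
Hypotheses (he : 0 < e <= 1) (hB : admissible_B B).
Implicit Types (u v w d x Y : V R) (g : V R -> R).
Local Notation EY := (EY e B).
Local Notation Yv := (Yv e).
Local Notation Ann := (Ann e).
Local Notation okY := (okY e).

Lemma EY_dct u (gn : nat -> V R -> R) g M :
  (forall n, measurable_fun setT (gn n)) -> measurable_fun setT g ->
  (forall n Y, Ann u Y -> `|gn n Y| <= M) ->
  (forall Y, Ann u Y -> gn n Y @[n --> \oo] --> g Y) ->
  EY u (gn n) @[n --> \oo] --> EY u g.
Proof.
move=> mgn mg hM hg; have [iW _] := Int_W hB (enorm_dirV u).
have mW := L1_measurable iW.
have mY : measurable_fun setT (fun x => Yv u (unitV x)) by exact: measurable_Yv.
apply: (Int_dct _ _ (L1Z M iW) _ _).2.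
- by move=> n; apply: measurable_funM => //; exact: (measurableT_comp (mgn n)).
- by apply: measurable_funM => //; exact: (measurableT_comp mg).
- move=> n x; have w0 := W_ge0 hB (dirV u) x.
  by rewrite normrM ger0_norm// mulrC ler_wpM2r// hM//; exact: Yv_Ann.
- by move=> x; apply: cvgM; [exact: cvg_cst|apply: hg; exact: Yv_Ann].
Qed.

Lemma EY_udiff u (F : V R -> R -> R) dF : udiff (Ann u) F dF ->
  (forall s, measurable_fun setT (F ^~ s)) -> measurable_fun setT dF ->
  is_derive (0 : R) 1 (fun s => EY u (F ^~ s)) (EY u dF).
Proof.
move=> [C [eps [C0 e0 h]]] mF mdF; apply/derive_seqP => s s0 s_0.
have ok0 : okY u (F ^~ 0) by split => //; exists C => Y /h[].
have oks t : `|t| < eps -> okY u (F ^~ t).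
  move=> te; split => //; exists (C + C * `|t|) => Y /h[h1 h2 _].
  by rewrite -[F Y t](subrK (F Y 0)) addrC (le_trans (ler_normD _ _))// lerD// h2.
pose gn n Y := if `|s n| < eps then (s n)^-1 * (F Y (s n) - F Y 0) else 0.
have H : EY u (gn n) @[n --> \oo] --> EY u dF.
  apply: (@EY_dct _ _ _ C) => //.
  - move=> n; rewrite /gn; case: (`|s n| < eps) => //.
    by apply: measurable_funM => //; exact: measurable_funB.
  - move=> n Y /h[_ h2 _]; rewrite /gn; case: ifP => [se|_]; last by rewrite normr0.
    by rewrite normrM normfV ler_pdivrMl ?normr_gt0// mulrC h2.
  - move=> Y /h[_ _ /derive_seqP/(_ s s0 s_0)]; apply: cvg_trans; apply: near_eq_cvg.
    move: s_0 => /cvgr0_norm_lt/(_ _ e0); apply: filterS => n se.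
    by rewrite /gn se add0r.
apply: cvg_trans H; apply: near_eq_cvg.
move: s_0 => /cvgr0_norm_lt/(_ _ e0); apply: filterS => n se.
rewrite add0r -(EYB he hB (oks _ se) ok0).
rewrite -(EYZ he hB _ (okYB (oks _ se) ok0)); congr EY; apply/funext => Y.
by rewrite /gn se.
Qed.

Lemma okY_id u i : okY u (fun Y => Defs.coord Y i).
Proof.
split.
  by elim/I3_ind: i; [exact: measurable_c1|exact: measurable_c2|exact: measurable_c3].
exists (enorm u / 2) => Y /andP[_]; apply: le_trans.
by have [] := ler_coord_enorm Y; elim/I3_ind: i.
Qed.

Lemma okY_dot u a : okY u (dotV a).
Proof. by apply: okYD; [apply: okYD|]; apply: okYZ; [exact: (okY_id u i0)|exact: (okY_id u i1)|exact: (okY_id u i2)]. Qed.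

Lemma okY_cross u a i : okY u (fun Y => Defs.coord (crossV a Y) i).
Proof.
have h0 := okY_id u i0; have h1 := okY_id u i1; have h2 := okY_id u i2.
by elim/I3_ind: i; apply: okYB; apply: okYZ.
Qed.

(** The velocity at [s = 0] of [steer u (u + s d) Y]: dilation rate [u . d / |u|^2], angular
    velocity [u x d / |u|^2]. The transpose of this map of [d], times [|u|^2 / (2 |Y|^2)], is the
    matrix [N] in the transported field. *)
Definition Ydot u d Y : V R :=
  scaleV (enorm u ^- 2) (addV (scaleV (dotV u d) Y) (crossV (crossV u d) Y)).

Lemma okY_Ydot u d i : okY u (fun Y => Defs.coord (Ydot u d Y) i).
Proof.
have h := okY_id u i; have k := okY_cross u (crossV u d) i.
by move: h k; elim/I3_ind: i => h k; apply: okYZ; apply: okYD => //; exact: okYZ.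
Qed.

Lemma udiff_okY u g : okY u g -> udiff (Ann u) (fun Y _ => g Y) (fun=> 0).
Proof. by move=> [_ [M hM]]; exact: udiff_cst hM. Qed.

Lemma steer_pos u d : u != ((0, 0), 0) -> exists2 eps, 0 < eps &
  forall s, `|s| < eps -> enorm u ^+ 2 / 2 <= dotV u (addV u (scaleV s d)).
Proof.
rewrite -enorm_eq0 => u0; have r0 : 0 < enorm u ^+ 2 by rewrite exprn_gt0// lt_def u0 enorm_ge0.
have d0 : 0 < `|dotV u d| + 1 by rewrite ltr_wpDl.
exists (enorm u ^+ 2 / 2 / (`|dotV u d| + 1)) => [|s hs].
  by rewrite divr_gt0// divr_gt0.
have -> : dotV u (addV u (scaleV s d)) = enorm u ^+ 2 + s * dotV u d.
  by rewrite sqr_enorm /dotV /=; ring.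
move: hs; rewrite ltr_pdivlMr// => hs.
have : `|s * dotV u d| <= enorm u ^+ 2 / 2.
  by rewrite normrM (le_trans _ (ltW hs))// ler_wpM2l// lerDl.
by rewrite ler_norml; move: (s * _) (enorm u ^+ 2) => p q; lra.
Qed.

Lemma udiff_steer u d i : u != ((0, 0), 0) ->
  udiff (Ann u) (fun Y s => Defs.coord (steer u (addV u (scaleV s d)) Y) i)
    (fun Y => Defs.coord (Ydot u d Y) i).
Proof.
move=> u0; have r0 : 0 < enorm u ^+ 2.
  by move: u0; rewrite -enorm_eq0 => u0; rewrite exprn_gt0// lt_def u0 enorm_ge0.
pose be s := (enorm u * enorm (addV u (scaleV s d)) + dotV u (addV u (scaleV s d)))^-1.
pose A := crossV u d.
(* Since [u x (u + s d) = s (u x d)], the last term of [rod] is of second order in [s], with a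
   coefficient that stays bounded near [s = 0]. *)
pose Z Y := enorm u ^- 2 * (dotV A Y * Defs.coord A i).
have E : (fun Y s => Defs.coord (steer u (addV u (scaleV s d)) Y) i) =
    (fun Y s => (Defs.coord Y i + s * Defs.coord (Ydot u d Y) i) + (s ^+ 2 * be s) * Z Y).
  apply/funext => Y; apply/funext => s.
  rewrite /steer -/(be s) /Z /Ydot -/A.
  have -> : crossV u (addV u (scaleV s d)) = scaleV s A by apply: eqV => /=; ring.
  have -> : dotV u (addV u (scaleV s d)) = enorm u ^+ 2 + s * dotV u d.
    by rewrite sqr_enorm /dotV /=; ring.
  clear Z; move: (be s) A (dotV u d) (enorm u ^+ 2) r0 => b A' p r r0.
  by elim/I3_ind: i; rewrite /Defs.coord /rod /dotV /=; field; rewrite gt_eqF.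
have oZ : okY u Z by apply: okYZ; apply: okYM; [exact: okY_dot|exact: okY_cst].
have db : is_derive (0 : R) 1 (fun s => s ^+ 2 * be s) 0.
  have [eps e0 hp] := steer_pos d u0.
  apply: (@is_derive_quadratic _ _ _ _ (2 / enorm u ^+ 2) eps) => // s se.
  rewrite add0r expr0n /= !mul0r !subr0 normrM [`|s ^+ 2|]ger0_norm ?sqr_ge0// mulrC.
  rewrite ler_wpM2r ?sqr_ge0//; have hs := hp _ se.
  have h1 : enorm u ^+ 2 / 2 <= enorm u * enorm (addV u (scaleV s d)) + dotV u (addV u (scaleV s d)).
    by rewrite (le_trans hs)// lerDr mulr_ge0// enorm_ge0.
  have p0 : 0 < enorm u ^+ 2 / 2 by rewrite divr_gt0.
  rewrite /be ger0_norm; last by rewrite invr_ge0 (le_trans (ltW p0)).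
  by rewrite -invf_div lef_pV2 ?posrE// (lt_le_trans p0).
rewrite E.
have U1 : udiff (Ann u) (fun Y s => s * Defs.coord (Ydot u d Y) i)
    (fun Y => 0 * 0 + 1 * Defs.coord (Ydot u d Y) i) :=
  udiffM (@udiff_id R _ (Ann u)) (udiff_okY (okY_Ydot u d i)).
have U2 : udiff (Ann u) (fun Y s => s ^+ 2 * be s * Z Y)
    (fun Y => 0 ^+ 2 * be 0 * 0 + 0 * Z Y) := udiffM (udiff_scalar _ db) (udiff_okY oZ).
apply: (udiff_eq (udiffD (udiffD (udiff_okY (okY_id u i)) U1) U2)) => Y _.
by ring.
Qed.

(** The law moves with [s]; steering back to [u] freezes it, so that only the integrand, composed
    with [steer], is differentiated. *)
Lemma EY_path u d (G : V R -> R -> R) dG : u != ((0, 0), 0) ->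
  (forall s, addV u (scaleV s d) != ((0, 0), 0) -> okY (addV u (scaleV s d)) (G ^~ s)) ->
  (forall s, measurable_fun setT (G ^~ s)) -> measurable_fun setT dG ->
  udiff (Ann u) (fun Y s => G (steer u (addV u (scaleV s d)) Y) s) dG ->
  is_derive (0 : R) 1 (fun s => EY (addV u (scaleV s d)) (G ^~ s)) (EY u dG).
Proof.
move=> u0 okG mG mdG uG.
have mGs s : measurable_fun setT (fun Y => G (steer u (addV u (scaleV s d)) Y) s).
  by apply: (measurableT_comp (mG s)); exact: measurable_steer.
have /derive_seqP H := EY_udiff uG mGs mdG; apply/derive_seqP => s s0 s_0.
have [eps e0 hp] := steer_pos d u0.
have r0 : 0 < enorm u ^+ 2 / 2.
  by move: u0; rewrite -enorm_eq0 => u0; rewrite divr_gt0// exprn_gt0// lt_def u0 enorm_ge0.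
have K t : `|t| < eps -> EY (addV u (scaleV t d)) (G ^~ t) = EY u (fun Y => G (steer u (addV u (scaleV t d)) Y) t).
  move=> /hp ht; have pt := lt_le_trans r0 ht.
  apply: (EY_steer he hB); first by rewrite ltr_wpDl// mulr_ge0// enorm_ge0.
  apply: okG; apply: contraTneq pt => ->; rewrite -leNgt.
  by rewrite /dotV /= !mulr0 !addr0.
have := H s s0 s_0; apply: cvg_trans; apply: near_eq_cvg.
move: s_0 => /cvgr0_norm_lt/(_ _ e0); apply: filterS => n se.
by rewrite add0r K// K ?normr0.
Qed.

End Paths.

Section Coordinates.
Variable R : realType.
Implicit Types (a b : V R).

Lemma coordD a b i : Defs.coord (addV a b) i = Defs.coord a i + Defs.coord b i.
Proof. by elim/I3_ind: i. Qed.

Lemma coordZ k a i : Defs.coord (scaleV k a) i = k * Defs.coord a i.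
Proof. by elim/I3_ind: i. Qed.

Lemma coordB a b i : Defs.coord (subV a b) i = Defs.coord a i - Defs.coord b i.
Proof. by rewrite coordD coordZ mulN1r. Qed.

Lemma dotVE a b : dotV a b = \sum_(i < 3) Defs.coord a i * Defs.coord b i.
Proof. by rewrite sum3E. Qed.

Lemma coord_le a i : `|Defs.coord a i| <= enorm a.
Proof. by have [] := ler_coord_enorm a; elim/I3_ind: i. Qed.

End Coordinates.

(** * The field transported back through a collision, and its derivatives *)

Section TestField.
Variables (R : realType) (e : R) (B : R -> R).
Hypotheses (he : 0 < e <= 1) (hB : admissible_B B).
Variables (L : R) (xi : 'I_3 -> V R -> R).
Hypothesis hxi : forall i, C1b L (xi i).
Implicit Types (h u d x Y : V R) (k l i j m : 'I_3).
Local Notation EY := (EY e B).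
Local Notation Ann := (Ann e).
Local Notation okY := (okY e).
Local Notation c_ := (@Defs.coord R).

Definition Dxi h Y l := xi l (addV h Y) - xi l (subV h Y).
Definition Sxi h Y l := xi l (addV h Y) + xi l (subV h Y).
(** The tensor [Y (x) D / |Y|^2]. The transported field depends on [D] only through it, and its
    derivative along rotations about [u] is what averages to zero. *)
Definition qf h Y k l := c_ Y k * Dxi h Y l * (dotV Y Y)^-1.
Definition dP h Y dh dY l := \sum_(m < 3) partial (xi l) m (addV h Y) * (c_ dh m + c_ dY m).
Definition dM h Y dh dY l := \sum_(m < 3) partial (xi l) m (subV h Y) * (c_ dh m - c_ dY m).
Definition dq h Y dh dY k l :=
  (c_ dY k * Dxi h Y l + c_ Y k * (dP h Y dh dY l - dM h Y dh dY l)) * (dotV Y Y)^-1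
  - 2 * (c_ Y k * Dxi h Y l) * (dotV Y dY * (dotV Y Y)^-1 ^+ 2).

(* [Gf] is the pre-collisional field whose [EY]-average transports [xi] back through the collision:
   one quarter of [S + N D] with [N z = ((Y.u) z + (Y.z) u - (u.z) Y) / (2 |Y|^2)]. *)
Definition Gf h u Y j := 4^-1 * (Sxi h Y j + 2^-1 *
  (\sum_(k < 3) c_ u k * (qf h Y k j - qf h Y j k) + c_ u j * \sum_(k < 3) qf h Y k k)).
Definition dGf h u Y dh du dY j := 4^-1 * (dP h Y dh dY j + dM h Y dh dY j + 2^-1 *
  (\sum_(k < 3) (c_ du k * (qf h Y k j - qf h Y j k) + c_ u k * (dq h Y dh dY k j - dq h Y dh dY j k))
   + (c_ du j * (\sum_(k < 3) qf h Y k k) + c_ u j * \sum_(k < 3) dq h Y dh dY k k))).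

Lemma Ann_gt0 u Y : u != ((0, 0), 0) -> Ann u Y -> 0 < enorm Y.
Proof.
rewrite -enorm_eq0 => u0 /andP[+ _]; apply: lt_le_trans.
by rewrite mulr_gt0 ?divr_gt0//; [case/andP: he|rewrite lt_def u0 enorm_ge0].
Qed.

Lemma Ann_dot_gt0 u Y : u != ((0, 0), 0) -> Ann u Y -> 0 < dotV Y Y.
Proof. by move=> u0 /(Ann_gt0 u0) h; rewrite -sqr_enorm exprn_gt0. Qed.

Lemma okY_bounded u (g : V R -> R) M : measurable_fun setT g -> (forall Y, `|g Y| <= M) -> okY u g.
Proof. by move=> mg hM; split => //; exists M. Qed.

Let m_add h : measurable_fun setT (addV h).
Proof. by apply: measurable_addV; [exact: measurable_cst|exact: measurable_id]. Qed.
Let m_sub h : measurable_fun setT (subV h).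
Proof. by apply: measurable_subV; [exact: measurable_cst|exact: measurable_id]. Qed.

Lemma okY_xiD u h l : okY u (fun Y => xi l (addV h Y)).
Proof.
have [p hp] := C1b_bounded (hxi l); apply: (@okY_bounded _ _ p) => //.
exact: (measurableT_comp (C1b_measurable (hxi l)) (m_add h)).
Qed.

Lemma okY_xiB u h l : okY u (fun Y => xi l (subV h Y)).
Proof.
have [p hp] := C1b_bounded (hxi l); apply: (@okY_bounded _ _ p) => //.
exact: (measurableT_comp (C1b_measurable (hxi l)) (m_sub h)).
Qed.

Lemma okY_pD u h l m : okY u (fun Y => partial (xi l) m (addV h Y)).
Proof.
apply: (@okY_bounded _ _ L) => [|Y]; last exact: (C1b_le (hxi l)).
exact: (measurableT_comp (C1b_measurable_partial m (hxi l)) (m_add h)).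
Qed.

Lemma okY_pB u h l m : okY u (fun Y => partial (xi l) m (subV h Y)).
Proof.
apply: (@okY_bounded _ _ L) => [|Y]; last exact: (C1b_le (hxi l)).
exact: (measurableT_comp (C1b_measurable_partial m (hxi l)) (m_sub h)).
Qed.

Lemma okY_invdot u : u != ((0, 0), 0) -> okY u (fun Y => (dotV Y Y)^-1).
Proof.
move=> u0; split.
  by apply: (measurableT_comp (@measurable_invr R)); apply: measurable_dotV; exact: measurable_id.
have r0 : 0 < e / 2 * enorm u.
  rewrite mulr_gt0 ?divr_gt0//; first by case/andP: he.
  by rewrite lt_def enorm_ge0 enorm_eq0 u0.
exists ((e / 2 * enorm u) ^+ 2)^-1 => Y hY; have Y0 := Ann_dot_gt0 u0 hY.
rewrite ger0_norm ?invr_ge0 ?(ltW Y0)// lef_pV2 ?posrE ?exprn_gt0//.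
by rewrite -sqr_enorm lerXn2r ?nnegrE ?enorm_ge0 ?(ltW r0)//; case/andP: hY.
Qed.

Lemma okY_Dxi u h l : okY u (fun Y => Dxi h Y l).
Proof. by apply: okYB; [exact: okY_xiD|exact: okY_xiB]. Qed.

Lemma okY_Sxi u h l : okY u (fun Y => Sxi h Y l).
Proof. by apply: okYD; [exact: okY_xiD|exact: okY_xiB]. Qed.

Lemma okY_qf u h k l : u != ((0, 0), 0) -> okY u (fun Y => qf h Y k l).
Proof.
move=> u0; apply: okYM; last exact: okY_invdot.
by apply: okYM; [exact: okY_id|exact: okY_Dxi].
Qed.

Lemma okY_Gf u u' h j : u != ((0, 0), 0) -> okY u (fun Y => Gf h u' Y j).
Proof.
move=> u0; have hq k l := okY_qf h k l u0.
apply: okYZ; apply: okYD; first exact: okY_Sxi.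
apply: okYZ; apply: okYD; first by apply: okY_sum => k; apply: okYZ; exact: okYB.
by apply: okYZ; exact: okY_sum.
Qed.

Section Derivatives.
Variables (u : V R) (u0 : u != ((0, 0), 0)) (dY : V R -> V R).
Hypothesis okdY : forall i, okY u (fun Y => c_ (dY Y) i).

Lemma okY_dP h dh l : okY u (fun Y => dP h Y dh (dY Y) l).
Proof.
by apply: okY_sum => m; apply: okYM; [exact: okY_pD|apply: okYD => //; exact: okY_cst].
Qed.

Lemma okY_dM h dh l : okY u (fun Y => dM h Y dh (dY Y) l).
Proof.
by apply: okY_sum => m; apply: okYM; [exact: okY_pB|apply: okYB => //; exact: okY_cst].
Qed.

Lemma okY_dq h dh k l : okY u (fun Y => dq h Y dh (dY Y) k l).
Proof.
have hD := okY_Dxi u h l; have hV := okY_invdot u0.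
have hk := okY_id e u k.
apply: okYB.
  apply: okYM => //; apply: okYD; first exact: okYM.
  by apply: okYM => //; apply: okYB; [exact: okY_dP|exact: okY_dM].
apply: okYM; first by apply: okYZ; exact: okYM.
apply: okYM; last exact: okYX.
under eq_fun do rewrite dotVE.
by apply: okY_sum => m; apply: okYM => //; exact: okY_id.
Qed.

Lemma okY_dGf h u' dh du j : okY u (fun Y => dGf h u' Y dh du (dY Y) j).
Proof.
have hq k l := okY_qf h k l u0; have hdq k l := okY_dq h dh k l.
apply: okYZ; apply: okYD; first by apply: okYD; [exact: okY_dP|exact: okY_dM].
apply: okYZ; apply: okYD.
  by apply: okY_sum => k; apply: okYD; apply: okYZ; exact: okYB.
by apply: okYD; apply: okYZ; exact: okY_sum.
Qed.

Variable P : V R -> R -> V R.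
Hypothesis P0 : forall Y, Ann u Y -> P Y 0 = Y.
Hypothesis dPY : forall i, udiff (Ann u) (fun Y s => c_ (P Y s) i) (fun Y => c_ (dY Y) i).
Variables h dh du : V R.
Let H s := addV h (scaleV s dh).
Let U s := addV u (scaleV s du).

Let H0 : H 0 = h.
Proof. by apply: eqV => /=; ring. Qed.

Lemma udiff_line a da i : udiff (Ann u) (fun _ s => c_ (addV a (scaleV s da)) i) (fun=> c_ da i).
Proof.
have -> : (fun (_ : V R) s => c_ (addV a (scaleV s da)) i) = (fun _ s => c_ a i + c_ da i * s).
  by do 2!apply/funext => ?; rewrite coordD coordZ mulrC.
apply: udiff_scalar; apply: (is_derive_eq (is_derive_affine _ _ (is_derive_id (0 : R) (1 : R)))).
by rewrite mulr1.
Qed.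

Lemma udiff_xiD l : udiff (Ann u) (fun Y s => xi l (addV (H s) (P Y s))) (fun Y => dP h Y dh (dY Y) l).
Proof.
have hc i : udiff (Ann u) (fun Y s => c_ (addV (H s) (P Y s)) i) (fun Y => c_ (addV dh (dY Y)) i).
  have := udiffD (udiff_line h dh i) (dPY i).
  under [in X in udiff _ X _ -> _]eq_fun do under eq_fun do rewrite -coordD.
  by under [in X in udiff _ _ X -> _]eq_fun do rewrite -coordD.
apply: (udiff_eq (udiff_C1b (hxi l) hc)) => Y hY; rewrite P0// H0.
by apply: eq_bigr => i _; rewrite coordD.
Qed.

Lemma udiff_xiB l : udiff (Ann u) (fun Y s => xi l (subV (H s) (P Y s))) (fun Y => dM h Y dh (dY Y) l).
Proof.
have hc i : udiff (Ann u) (fun Y s => c_ (subV (H s) (P Y s)) i) (fun Y => c_ (subV dh (dY Y)) i).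
  have := udiffB (udiff_line h dh i) (dPY i).
  under [in X in udiff _ X _ -> _]eq_fun do under eq_fun do rewrite -coordB.
  by under [in X in udiff _ _ X -> _]eq_fun do rewrite -coordB.
apply: (udiff_eq (udiff_C1b (hxi l) hc)) => Y hY; rewrite P0// H0.
by apply: eq_bigr => i _; rewrite coordB.
Qed.

Lemma udiff_invdot : udiff (Ann u) (fun Y s => (dotV (P Y s) (P Y s))^-1)
  (fun Y => - (2 * dotV Y (dY Y)) * (dotV Y Y)^-1 ^+ 2).
Proof.
have r0 : 0 < (e / 2 * enorm u) ^+ 2.
  rewrite exprn_gt0// mulr_gt0 ?divr_gt0//; first by case/andP: he.
  by rewrite lt_def enorm_ge0 enorm_eq0 u0.
have hd : udiff (Ann u) (fun Y s => dotV (P Y s) (P Y s))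
    (fun Y => \sum_(i < 3) (c_ (P Y 0) i * c_ (dY Y) i + c_ (dY Y) i * c_ (P Y 0) i)).
  under eq_fun do under eq_fun do rewrite dotVE.
  exact: (udiff_sum (fun i => udiffM (dPY i) (dPY i))).
apply: (udiff_eq (udiffV r0 _ hd)) => Y hY; rewrite P0//.
  rewrite ger0_norm ?dotV_ge0// -sqr_enorm lerXn2r ?nnegrE ?enorm_ge0//.
    by rewrite mulr_ge0 ?enorm_ge0// divr_ge0//; case/andP: he => /ltW.
  by case/andP: hY.
rewrite -exprVn; congr (- _ * _); rewrite dotVE mulr_sumr.
by apply: eq_bigr => i _; ring.
Qed.

Lemma udiff_qf k l : udiff (Ann u) (fun Y s => qf (H s) (P Y s) k l)
  (fun Y => dq h Y dh (dY Y) k l).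
Proof.
apply: (udiff_eq (udiffM (udiffM (dPY k) (udiffB (udiff_xiD l) (udiff_xiB l))) udiff_invdot)) => Y hY.
by rewrite P0// H0 /dq /Dxi; ring.
Qed.

Lemma udiff_Gf j : udiff (Ann u) (fun Y s => Gf (H s) (U s) (P Y s) j)
  (fun Y => dGf h u Y dh du (dY Y) j).
Proof.
have hU i := udiff_line u du i.
have T1 k := udiffM (hU k) (udiffB (udiff_qf k j) (udiff_qf j k)).
have T2 := udiffM (hU j) (udiff_sum (fun k => udiff_qf k k)).
apply: (udiff_eq (udiffZ 4^-1 (udiffD (udiffD (udiff_xiD j) (udiff_xiB j))
  (udiffZ 2^-1 (udiffD (udiff_sum T1) T2))))) => Y hY.
rewrite P0// H0 /dGf !sum3E.
have -> : addV u (scaleV 0 du) = u by apply: eqV => /=; ring.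
by ring.
Qed.

End Derivatives.

End TestField.

(** * Bounds and continuity for the transported field *)

Section TestFieldBounds.
Variables (R : realType) (e : R) (B : R -> R).
Hypotheses (he : 0 < e <= 1) (hB : admissible_B B).
Variables (L : R) (xi : 'I_3 -> V R -> R).
Hypothesis hxi : forall i, C1b L (xi i).
Implicit Types (h u d x Y v w : V R) (k l i j m : 'I_3).
Local Notation EY := (EY e B).
Local Notation Ann := (Ann e).
Local Notation okY := (okY e).
Local Notation c_ := (@Defs.coord R).
Local Notation Dxi := (Dxi xi).
Local Notation qf := (qf xi).
Local Notation dP := (dP xi).
Local Notation dM := (dM xi).
Local Notation dq := (dq xi).
Local Notation Gf := (Gf xi).
Local Notation dGf := (dGf xi).

Let L0 : 0 <= L.
Proof. by rewrite (le_trans _ (C1b_le (hxi i0) i0 ((0, 0), 0))). Qed.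
Let e0 : 0 < e. Proof. by case/andP: he. Qed.
Let e1 : e <= 1. Proof. by case/andP: he. Qed.

Lemma norm_sum3 (F : 'I_3 -> R) M : (forall i, `|F i| <= M) -> `|\sum_(i < 3) F i| <= 3 * M.
Proof.
move=> h; rewrite sum3E (le_trans (ler_normD _ _))//.
by have := ler_normD (F i0) (F i1); move: (h i0) (h i1) (h i2); lra.
Qed.

Lemma normM_le (a b p q : R) : `|a| <= p -> `|b| <= q -> `|a * b| <= p * q.
Proof. by move=> h1 h2; rewrite normrM ler_pM. Qed.

Lemma Dxi_le h Y l : `|Dxi h Y l| <= 6 * L * enorm Y.
Proof.
apply: (le_trans (C1b_lipschitz_enorm (hxi l) _ _)).
have -> : subV (addV h Y) (subV h Y) = scaleV 2 Y by apply: eqV => /=; ring.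
by rewrite enormZ ger0_norm//; move: (enorm Y) => y; lra.
Qed.

Lemma qf_le h Y k l : 0 < enorm Y -> `|qf h Y k l| <= 6 * L.
Proof.
move=> Y0; rewrite /qf -sqr_enorm.
have h1 := normM_le (coord_le Y k) (Dxi_le h Y l).
rewrite normrM normfV [`|enorm Y ^+ 2|]ger0_norm ?sqr_ge0// ler_pdivrMr ?exprn_gt0//.
by apply: (le_trans h1); rewrite expr2; move: (enorm Y) => y; lra.
Qed.

(** [D] is of order [|Y|], so [qf] is bounded and its contraction with [u] is of order [|u|]: as the
    two velocities merge, only half of [xi] at the centre of mass is left. *)
Lemma Gf_near h u Y j : 0 < enorm Y -> enorm Y <= enorm u / 2 ->
  `|Gf h u Y j - 2^-1 * xi j h| <= 8 * L * enorm u.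
Proof.
move=> Y0 Yu; have r0 : 0 <= enorm u by exact: enorm_ge0.
have S1 : `|xi j (addV h Y) - xi j h| <= 3 * L * enorm Y.
  apply: (le_trans (C1b_lipschitz_enorm (hxi j) _ _)).
  by have -> : subV (addV h Y) h = Y by apply: eqV => /=; ring.
have S2 : `|xi j (subV h Y) - xi j h| <= 3 * L * enorm Y.
  apply: (le_trans (C1b_lipschitz_enorm (hxi j) _ _)).
  have -> : subV (subV h Y) h = scaleV (-1) Y by apply: eqV => /=; ring.
  by rewrite enormZ normrN1 mul1r.
have A1 : `|\sum_(k < 3) c_ u k * (qf h Y k j - qf h Y j k)| <= 3 * (enorm u * (12 * L)).
  apply: norm_sum3 => k; apply: normM_le; first exact: coord_le.
  rewrite (le_trans (ler_normB _ _))//.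
  by move: (qf_le h k j Y0) (qf_le h j k Y0); lra.
have A2 : `|c_ u j * \sum_(k < 3) qf h Y k k| <= enorm u * (3 * (6 * L)).
  by apply: normM_le; [exact: coord_le|apply: norm_sum3 => k; exact: qf_le].
have LY : L * enorm Y <= L * (enorm u / 2) by rewrite ler_wpM2l.
rewrite /Gf /Sxi; move: S1 S2 A1 A2; rewrite !ler_norml.
move: (\sum_(k < 3) c_ u k * _) (c_ u j * _) => p q.
move: (xi j (addV h Y)) (xi j (subV h Y)) (xi j h) => a b c.
move=> /andP[? ?] /andP[? ?] /andP[? ?] /andP[? ?].
have Lu : 0 <= L * enorm u by rewrite mulr_ge0.
by apply/andP; split; lra.
Qed.

Lemma Ydot_le u d Y i : 0 < enorm u -> enorm Y <= enorm u / 2 ->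
  `|c_ (Ydot u d Y) i| <= 3 / 2 * enorm d.
Proof.
move=> u0 Yu; rewrite /Ydot.
have -> : addV (scaleV (dotV u d) Y) (crossV (crossV u d) Y) =
   addV (scaleV (dotV u d) Y) (addV (scaleV (dotV u Y) d) (scaleV (- dotV d Y) u)).
  by apply: eqV; rewrite /dotV /=; ring.
have r2 : 0 < enorm u ^+ 2 by rewrite exprn_gt0.
rewrite coordZ !coordD !coordZ normrM normfV (ger0_norm (ltW r2)).
rewrite ler_pdivrMl//.
have d0 := enorm_ge0 d; have Y0 := enorm_ge0 Y.
have h1 := normM_le (cauchy_schwarzV u d) (coord_le Y i).
have h2 := normM_le (cauchy_schwarzV u Y) (coord_le d i).
have h3 : `|- dotV d Y * c_ u i| <= (enorm d * enorm Y) * enorm u.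
  by rewrite mulNr normrN; exact: normM_le (cauchy_schwarzV d Y) (coord_le u i).
apply: (le_trans (ler_normD _ _)); apply: (le_trans (lerD h1 (le_trans (ler_normD _ _) (lerD h2 h3)))).
have hk : enorm u * enorm d * enorm Y <= enorm u * enorm d * (enorm u / 2).
  by rewrite ler_wpM2l// mulr_ge0// ltW.
by move: hk; rewrite expr2; move: (enorm u) (enorm d) (enorm Y) => r s y; lra.
Qed.

Section At.
Variables (u Y d dh : V R) (h : V R).
Hypotheses (u0 : u != ((0, 0), 0)) (hY : Ann u Y) (d1 : enorm d <= 1)
  (dh1 : forall m, `|c_ dh m| <= 2^-1).
Let dY := Ydot u d Y.

Let y0 : 0 < enorm Y. Proof. exact: (Ann_gt0 he u0 hY). Qed.
Let r0 : 0 < enorm u. Proof. by rewrite lt_def enorm_ge0 enorm_eq0 u0. Qed.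
Let Yu : enorm Y <= enorm u / 2. Proof. by case/andP: hY. Qed.

Lemma dY_le m : `|c_ dY m| <= 3 / 2.
Proof. by apply: (le_trans (Ydot_le d m r0 Yu)); move: d1; lra. Qed.

Lemma dP_le l : `|dP h Y dh dY l| <= 6 * L.
Proof.
have -> : 6 * L = 3 * (L * 2) by ring.
apply: norm_sum3 => m; apply: normM_le; first exact: C1b_le (hxi l) m _.
by rewrite (le_trans (ler_normD _ _))//; move: (dY_le m) (dh1 m); lra.
Qed.

Lemma dM_le l : `|dM h Y dh dY l| <= 6 * L.
Proof.
have -> : 6 * L = 3 * (L * 2) by ring.
apply: norm_sum3 => m; apply: normM_le; first exact: C1b_le (hxi l) m _.
by rewrite (le_trans (ler_normB _ _))//; move: (dY_le m) (dh1 m); lra.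
Qed.

Lemma dq_le k l : `|dq h Y dh dY k l| <= 75 * L / enorm Y.
Proof.
have n1 : `|c_ dY k * Dxi h Y l + c_ Y k * (dP h Y dh dY l - dM h Y dh dY l)| <= 21 * L * enorm Y.
  apply: (le_trans (ler_normD _ _)).
  have a1 := normM_le (dY_le k) (Dxi_le h Y l).
  have a2 : `|c_ Y k * (dP h Y dh dY l - dM h Y dh dY l)| <= enorm Y * (12 * L).
    apply: normM_le; first exact: coord_le.
    by rewrite (le_trans (ler_normB _ _))//; move: (dP_le l) (dM_le l); lra.
  by move: a1 a2; move: (enorm Y) => y; lra.
have n2 : `|2 * (c_ Y k * Dxi h Y l)| <= 2 * (enorm Y * (6 * L * enorm Y)).
  apply: normM_le; first by rewrite ger0_norm.
  by apply: normM_le; [exact: coord_le|exact: Dxi_le].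
have n3 : `|dotV Y dY| <= 3 * (enorm Y * (3 / 2)).
  by rewrite dotVE; apply: norm_sum3 => m; apply: normM_le; [exact: coord_le|exact: dY_le].
have i0' : `|(dotV Y Y)^-1| <= (enorm Y ^+ 2)^-1 by rewrite -sqr_enorm ger0_norm ?invr_ge0 ?sqr_ge0.
have i1' : `|(dotV Y Y)^-1 ^+ 2| <= (enorm Y ^+ 2)^-1 ^+ 2 by rewrite normrX lerXn2r ?nnegrE ?invr_ge0 ?sqr_ge0.
apply: (le_trans (ler_normB _ _)).
apply: (le_trans (lerD (normM_le n1 i0') (normM_le n2 (normM_le n3 i1')))).
by rewrite le_eqVlt; apply/orP; left; apply/eqP; field; rewrite gt_eqF.
Qed.

Lemma dGf_le j : (forall m, `|c_ d m| <= 1) -> `|dGf h u Y dh d dY j| <= 179 * L / e.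
Proof.
move=> cd; set K := 75 * L / enorm Y.
have K0 : 0 <= K by rewrite divr_ge0 ?mulr_ge0// ltW.
(* The derivative of [qf] blows up like [1 / |Y|], but it always comes multiplied by [u], and
   [|u| <= 2 |Y| / e]. *)
have uK : enorm u * K <= 150 * L / e.
  rewrite /K mulrA ler_pdivrMr// mulrAC ler_pdivlMr//.
  have : e * enorm u <= 2 * enorm Y by case/andP: hY => + _; move: (enorm u) => r; lra.
  move=> hh; have : 75 * L * (e * enorm u) <= 75 * L * (2 * enorm Y) by rewrite ler_wpM2l// mulr_ge0.
  by move: (enorm u) (enorm Y) => r y; lra.
have T1 : `|\sum_(k < 3) (c_ d k * (qf h Y k j - qf h Y j k) + c_ u k * (dq h Y dh dY k j - dq h Y dh dY j k))|
    <= 3 * (12 * L + enorm u * (2 * K)).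
  apply: norm_sum3 => k; apply: (le_trans (ler_normD _ _)); apply: lerD.
    rewrite -[12 * L]mul1r; apply: normM_le; first exact: cd.
    by rewrite (le_trans (ler_normB _ _))//; move: (qf_le h k j y0) (qf_le h j k y0); lra.
  apply: normM_le; first exact: coord_le.
  by rewrite (le_trans (ler_normB _ _))//; move: (dq_le k j) (dq_le j k); rewrite -/K; lra.
have T2 : `|c_ d j * (\sum_(k < 3) qf h Y k k)| <= 1 * (3 * (6 * L)).
  by apply: normM_le; [exact: cd|apply: norm_sum3 => k; exact: qf_le].
have T3 : `|c_ u j * \sum_(k < 3) dq h Y dh dY k k| <= enorm u * (3 * K).
  by apply: normM_le; [exact: coord_le|apply: norm_sum3 => k; exact: dq_le].
have Le : L <= L / e by rewrite ler_pdivlMr// ler_piMr.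
move: (dP_le j) (dM_le j) T1 T2 T3; rewrite /dGf !ler_norml.
move: (\sum_(k < 3) (_ + _)) (c_ d j * _) (c_ u j * _) (dP _ _ _ _ _) (dM _ _ _ _ _) => p q s a b.
move=> /andP[? ?] /andP[? ?] /andP[? ?] /andP[? ?] /andP[? ?].
clearbody K; move: uK Le; rewrite -!mulrA; move: (L * e^-1) => x ? ?.
by apply/andP; split; lra.
Qed.

End At.

Section Limit.
Variables (hn un Yn : nat -> V R) (h u Y d dh : V R).
Hypotheses (ch : cvg3 hn h) (cu : cvg3 un u) (cY : cvg3 Yn Y)
  (u0 : enorm u != 0) (Y0 : dotV Y Y != 0).
Let dYn n := Ydot (un n) d (Yn n).
Let dY := Ydot u d Y.

Let cdY : cvg3 dYn dY.
Proof.
apply: cvg3_scale.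
  apply: cvgV; first by rewrite sqrf_eq0.
  by rewrite !expr2; apply: cvgM; exact: cvg3_enorm.
have cd := cvg3_cst d.
by apply: cvg3_add; [apply: cvg3_scale => //; exact: cvg3_dot|apply: cvg3_cross => //; exact: cvg3_cross].
Qed.

Lemma cvg_sum3 (F : 'I_3 -> nat -> R) (a : 'I_3 -> R) : (forall i, F i n @[n --> \oo] --> a i) ->
  \sum_(i < 3) F i n @[n --> \oo] --> \sum_(i < 3) a i.
Proof.
move=> H; under eq_fun do rewrite sum3E; rewrite sum3E.
by apply: cvgD => //; exact: cvgD.
Qed.

Let cD l : Dxi (hn n) (Yn n) l @[n --> \oo] --> Dxi h Y l.
Proof.
apply: cvgB; apply: (continuous_cvg3 (C1b_continuous0 (hxi l))); [exact: cvg3_add|exact: cvg3_sub].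
Qed.

Let ci : (dotV (Yn n) (Yn n))^-1 @[n --> \oo] --> (dotV Y Y)^-1.
Proof. by apply: cvgV => //; exact: cvg3_dot. Qed.

Let cq k l : qf (hn n) (Yn n) k l @[n --> \oo] --> qf h Y k l.
Proof. by apply: cvgM; [apply: cvgM; [exact: cvg3_coord|exact: cD]|exact: ci]. Qed.

Let cP l : dP (hn n) (Yn n) dh (dYn n) l @[n --> \oo] --> dP h Y dh dY l.
Proof.
apply: cvg_sum3 => m; apply: cvgM.
  by apply: (continuous_cvg3 (C1b_continuous (hxi l) (i := m))); exact: cvg3_add.
by apply: cvgD; [exact: cvg_cst|exact: (cvg3_coord cdY)].
Qed.

Let cM l : dM (hn n) (Yn n) dh (dYn n) l @[n --> \oo] --> dM h Y dh dY l.
Proof.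
apply: cvg_sum3 => m; apply: cvgM.
  by apply: (continuous_cvg3 (C1b_continuous (hxi l) (i := m))); exact: cvg3_sub.
by apply: cvgB; [exact: cvg_cst|exact: (cvg3_coord cdY)].
Qed.

Let cdq k l : dq (hn n) (Yn n) dh (dYn n) k l @[n --> \oo] --> dq h Y dh dY k l.
Proof.
apply: cvgB.
  apply: cvgM; last exact: ci.
  apply: cvgD; apply: cvgM.
  - exact: (cvg3_coord cdY).
  - exact: cD.
  - exact: (cvg3_coord cY).
  - by apply: cvgB; [exact: cP|exact: cM].
apply: cvgM.
  apply: cvgM; first exact: cvg_cst.
  by apply: cvgM; [exact: (cvg3_coord cY)|exact: cD].
apply: cvgM; first exact: (cvg3_dot cY cdY).
by rewrite expr2; exact: (cvgM ci ci).
Qed.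

Lemma cvg_dGf j : dGf (hn n) (un n) (Yn n) dh d (Ydot (un n) d (Yn n)) j @[n --> \oo]
  --> dGf h u Y dh d (Ydot u d Y) j.
Proof.
apply: cvgM; first exact: cvg_cst.
apply: cvgD; first by apply: cvgD; [exact: cP|exact: cM].
apply: cvgM; first exact: cvg_cst.
apply: cvgD.
  apply: cvg_sum3 => k; apply: cvgD; apply: cvgM.
  - exact: cvg_cst.
  - by apply: cvgB; exact: cq.
  - exact: (cvg3_coord cu).
  - by apply: cvgB; exact: cdq.
apply: cvgD; apply: cvgM.
- exact: cvg_cst.
- by apply: cvg_sum3 => k; exact: cq.
- exact: (cvg3_coord cu).
- by apply: cvg_sum3 => k; exact: cdq.
Qed.

Lemma cvg_Gf j : Gf (hn n) (un n) (Yn n) j @[n --> \oo] --> Gf h u Y j.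
Proof.
apply: cvgM; first exact: cvg_cst.
apply: cvgD.
  by apply: cvgD; apply: (continuous_cvg3 (C1b_continuous0 (hxi j))); [exact: cvg3_add|exact: cvg3_sub].
apply: cvgM; first exact: cvg_cst.
apply: cvgD.
  apply: cvg_sum3 => k; apply: cvgM; first exact: (cvg3_coord cu).
  by apply: cvgB; exact: cq.
by apply: cvgM; [exact: (cvg3_coord cu)|apply: cvg_sum3 => k; exact: cq].
Qed.

End Limit.

End TestFieldBounds.

(** * The averaged field and its regularization on the diagonal *)

Section RegularizedField.
Variables (R : realType) (e : R) (B : R -> R).
Hypotheses (he : 0 < e <= 1) (hB : admissible_B B).
Variables (L : R) (xi : 'I_3 -> V R -> R).
Hypothesis hxi : forall i, C1b L (xi i).
Implicit Types (h u x Y v w : V R) (k l i j m : 'I_3).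
Local Notation EY := (EY e B).
Local Notation Ann := (Ann e).
Local Notation okY := (okY e).
Local Notation c_ := (@Defs.coord R).
Local Notation Gf := (Gf xi).
Local Notation dGf := (dGf xi).
Local Notation V0 := (((0, 0), 0) : V R).

Let L0 : 0 <= L.
Proof. by rewrite (le_trans _ (C1b_le (hxi i0) i0 V0)). Qed.
Let e0 : 0 < e. Proof. by case/andP: he. Qed.
Let e1 : e <= 1. Proof. by case/andP: he. Qed.

Definition basisV i : V R := shiftV V0 i 1.
Definition cm v w : V R := scaleV 2^-1 (addV v w).

(** The velocity [w] is a frozen parameter, so that [zeta w j] is the component of a field in [v]
    alone and can be tested against the density. *)
Definition zeta w j v := EY (subV v w) (fun Y => Gf (cm v w) (subV v w) Y j).
Definition dzeta w j i v := EY (subV v w) (fun Y =>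
  dGf (cm v w) (subV v w) Y (scaleV 2^-1 (basisV i)) (basisV i) (Ydot (subV v w) (basisV i) Y) j).

Lemma subV_shift v w i s : subV (shiftV v i s) w = addV (subV v w) (scaleV s (basisV i)).
Proof. by elim/I3_ind: i; apply: eqV => /=; ring. Qed.

Lemma cm_shift v w i s : cm (shiftV v i s) w = addV (cm v w) (scaleV s (scaleV 2^-1 (basisV i))).
Proof. by elim/I3_ind: i; apply: eqV => /=; ring. Qed.

Lemma coord_basis i m : c_ (basisV i) m = (i == m)%:R.
Proof. by move: i m; apply: I3_ind; apply: I3_ind; rewrite /Defs.coord /= ?addr0 ?add0r. Qed.

Lemma coord0 i : c_ V0 i = 0.
Proof. by elim/I3_ind: i. Qed.

Lemma enorm_basis i : enorm (basisV i) = 1.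
Proof.
rewrite /enorm dotVE sum3E !coord_basis.
by elim/I3_ind: i; rewrite /= ?mulr0 ?mulr1 ?addr0 ?add0r sqrtr1.
Qed.

Lemma zeta_derive w j i v : subV v w != V0 ->
  is_derive (0 : R) 1 (fun s => zeta w j (shiftV v i s)) (dzeta w j i v).
Proof.
set u := subV v w => u0.
have E : (fun s => zeta w j (shiftV v i s)) = (fun s => EY (addV u (scaleV s (basisV i)))
    ((fun Y s => Gf (addV (cm v w) (scaleV s (scaleV 2^-1 (basisV i)))) (addV u (scaleV s (basisV i))) Y j) ^~ s)).
  by apply/funext => s; rewrite /zeta subV_shift cm_shift.
rewrite E; apply: (EY_path he hB) => //.
- by move=> s us; exact: (okY_Gf he hxi).
- by move=> s; have [] := okY_Gf he hxi (addV u (scaleV s (basisV i))) (addV (cm v w) (scaleV s (scaleV 2^-1 (basisV i)))) j u0.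
- by have [] := okY_dGf he hxi u0 (okY_Ydot e u (basisV i)) (cm v w) u (scaleV 2^-1 (basisV i)) (basisV i) j.
- apply: (udiff_Gf he hxi u0) => [Y hY|k].
    have -> : addV u (scaleV 0 (basisV i)) = u by apply: eqV => /=; ring.
    exact: steer_id.
  exact: udiff_steer.
Qed.

Lemma zeta_near w j v : subV v w != V0 ->
  `|zeta w j v - 2^-1 * xi j (cm v w)| <= 8 * L * enorm (subV v w).
Proof.
move=> u0; have hG := okY_Gf he hxi (subV v w) (cm v w) j u0.
rewrite /zeta -[2^-1 * xi j _](EY_cst he hB (subV v w)) -(EYB he hB hG (okY_cst _ _ _)).
apply: (EY_norm he hB); first by apply: okYB => //; exact: okY_cst.
move=> Y hY; apply: (Gf_near hxi); first exact: (Ann_gt0 he u0 hY).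
by case/andP: hY.
Qed.

Lemma dzeta_le w j i v : subV v w != V0 -> `|dzeta w j i v| <= 179 * L / e.
Proof.
move=> u0; apply: (EY_norm he hB); first exact: (okY_dGf he hxi u0 (okY_Ydot e _ _)).
move=> Y hY; apply: (dGf_le he hxi) => //; first by rewrite enorm_basis.
  move=> m; rewrite coordZ coord_basis normrM ger0_norm ?invr_ge0//.
  by case: (i == m); rewrite ?normr0 ?normr1 ?mulr0 ?mulr1// invr_ge0.
by move=> m; rewrite coord_basis; case: (i == m); rewrite ?normr0 ?normr1.
Qed.

Lemma cvg3_nonzero (x : nat -> V R) (y : V R) : cvg3 x y -> y != V0 ->
  exists N, forall n, x (n + N)%N != V0 /\ enorm (x (n + N)%N) <= enorm y + 1.
Proof.
move=> xl l0; have := cvg3_enorm xl; have p : 0 < enorm y by rewrite lt_def enorm_ge0 enorm_eq0 l0.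
move=> cx; have p1 : enorm y < enorm y + 1 by rewrite ltrDl.
have := cvgr_gt _ cx _ p; have := cvgr_lt _ cx _ p1 => -[N1 _ h1] [N2 _ h2].
exists (maxn N1 N2) => n; split.
  have := h2 (n + maxn N1 N2)%N; rewrite /= => /(_ (leq_trans (leq_maxr _ _) (leq_addl _ _))).
  by rewrite lt_def enorm_eq0 => /andP[].
have := h1 (n + maxn N1 N2)%N; rewrite /= => /(_ (leq_trans (leq_maxl _ _) (leq_addl _ _))).
exact: ltW.
Qed.

Lemma dzeta_cvg j i (vn wn : nat -> V R) v w : cvg3 vn v -> cvg3 wn w -> subV v w != V0 ->
  dzeta (wn n) j i (vn n) @[n --> \oo] --> dzeta w j i v.
Proof.
move=> cv cw u0; have cu := cvg3_sub cv cw.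
have [N hNN] := cvg3_nonzero cu u0; have hN n := (hNN n).1.
rewrite -(cvg_shiftn N); have cN := cvg3_shift N cv; have cwN := cvg3_shift N cw; have cuN := cvg3_shift N cu.
have ccN : cvg3 (fun n => cm (vn (n + N)%N) (wn (n + N)%N)) (cm v w).
  by apply: cvg3_scale; [exact: cvg_cst|exact: (cvg3_add cN cwN)].
apply: (EY_cvg he hB (M := 179 * L / e) cuN u0).
- by move=> n; have [] := okY_dGf he hxi (hN n) (okY_Ydot e _ (basisV i)) (cm (vn (n + N)%N) (wn (n + N)%N))
   (subV (vn (n + N)%N) (wn (n + N)%N)) (scaleV 2^-1 (basisV i)) (basisV i) j.
- by have [] := okY_dGf he hxi u0 (okY_Ydot e _ (basisV i)) (cm v w)
   (subV v w) (scaleV 2^-1 (basisV i)) (basisV i) j.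
- move=> n Y hY; apply: (dGf_le he hxi) => //; first by rewrite enorm_basis.
    move=> m; rewrite coordZ coord_basis normrM ger0_norm ?invr_ge0//.
    by case: (i == m); rewrite ?normr0 ?normr1 ?mulr0 ?mulr1// invr_ge0.
  by move=> m; rewrite coord_basis; case: (i == m); rewrite ?normr0 ?normr1.
- move=> Yn Y hY cY; apply: (cvg_dGf hxi) => //; first by rewrite enorm_eq0.
  by rewrite gt_eqF// (Ann_dot_gt0 he u0).
Qed.

Variable del : R.
Hypothesis del0 : 0 < del.

(** At [v = w] the field tends to half of [xi] with bounded derivatives, but the derivatives need
    not have a limit. Multiplying the deviation, of order [|u|], by [|u|^2 / (del + |u|^2)] makes it
    C^1 across the diagonal. *)
Definition cutoff u := dotV u u / (del + dotV u u).
Definition dcutoff u i := 2 * del * c_ u i / (del + dotV u u) ^+ 2.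
Definition zreg w j v := 2^-1 * xi j (cm v w) + cutoff (subV v w) * (zeta w j v - 2^-1 * xi j (cm v w)).
Definition dzreg w j i v := 4^-1 * partial (xi j) i (cm v w) +
  (dcutoff (subV v w) i * (zeta w j v - 2^-1 * xi j (cm v w)) +
   cutoff (subV v w) * (dzeta w j i v - 4^-1 * partial (xi j) i (cm v w))).

Let den_gt0 u : 0 < del + dotV u u.
Proof. by rewrite ltr_wpDr// dotV_ge0. Qed.

Lemma xi_cm_derive w j i v :
  is_derive (0 : R) 1 (fun s => 2^-1 * xi j (cm (shiftV v i s) w)) (4^-1 * partial (xi j) i (cm v w)).
Proof.
have E : (fun s => 2^-1 * xi j (cm (shiftV v i s) w)) =
    (fun s => 0 + 2^-1 * (xi j (shiftV (cm v w) i (2^-1 * s)))).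
  apply/funext => s; rewrite add0r cm_shift; congr (_ * xi j _).
  by elim/I3_ind: i; apply: eqV => /=; ring.
rewrite E.
have h1 : is_derive (0 + 2^-1 * (0 : R)) 1 (fun r : R => xi j (shiftV (cm v w) i r)) (partial (xi j) i (cm v w)).
  by rewrite mulr0 addr0; exact: partial_chain (hxi j).
have h2 := is_derive_affine 0 2^-1 (is_derive_id (0 : R) (1 : R)).
have E2 : (fun s : R => xi j (shiftV (cm v w) i (2^-1 * s))) =
    (fun r : R => xi j (shiftV (cm v w) i r)) \o (fun s => 0 + 2^-1 * s).
  by apply/funext => s /=; rewrite add0r.
apply: (is_derive_eq (is_derive_affine 0 2^-1 (F := fun s : R => xi j (shiftV (cm v w) i (2^-1 * s))) (l := partial (xi j) i (cm v w) * (2^-1 * 1)) _)).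
  by rewrite E2; exact: (@is_derive1_comp _ _ (fun s : R => 0 + 2^-1 * s) 0 _ _ h1 h2).
by field.
Qed.

Lemma cutoff_derive u i : is_derive (0 : R) 1 (fun s => cutoff (addV u (scaleV s (basisV i)))) (dcutoff u i).
Proof.
have E : (fun s => cutoff (addV u (scaleV s (basisV i)))) =
    (fun s : R => 1 + (- del) * (del + (dotV u u + 2 * c_ u i * s + s ^+ 2))^-1).
  apply/funext => s; rewrite /cutoff.
  have -> : dotV (addV u (scaleV s (basisV i))) (addV u (scaleV s (basisV i))) = dotV u u + 2 * c_ u i * s + s ^+ 2.
    by elim/I3_ind: i; rewrite /dotV /Defs.coord /=; ring.
  have : del + (dotV u u + 2 * c_ u i * s + s ^+ 2) != 0.
    have := den_gt0 (addV u (scaleV s (basisV i))).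
    have -> : dotV (addV u (scaleV s (basisV i))) (addV u (scaleV s (basisV i))) = dotV u u + 2 * c_ u i * s + s ^+ 2.
      by elim/I3_ind: i; rewrite /dotV /Defs.coord /=; ring.
    by move=> /gt_eqF ->.
  by move: (dotV u u + _ + _) => q q0; field.
have hq : is_derive (0 : R) 1 (fun s : R => del + (dotV u u + 2 * c_ u i * s + s ^+ 2)) (2 * c_ u i).
  apply: (@is_derive_quadratic _ _ _ _ 1 1) => // s _.
  rewrite add0r !mulr0 expr0n /= !addr0.
  by rewrite (_ : _ - _ - _ = s ^+ 2); [rewrite ger0_norm ?sqr_ge0// mul1r|ring].
have d0 : del + (dotV u u + 2 * c_ u i * 0 + 0 ^+ 2) != 0.
  by rewrite mulr0 expr0n /= !addr0 gt_eqF.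
rewrite E; have hv := is_derive_affine 1 (- del) (@is_deriveV _ (fun s : R => del + (dotV u u + 2 * c_ u i * s + s ^+ 2)) 0 _ _ d0 hq).
apply: (is_derive_eq hv); rewrite /dcutoff /GRing.scale /= mulr0 expr0n /= !addr0.
by field; rewrite gt_eqF.
Qed.

Lemma cutoff_ge0 u : 0 <= cutoff u.
Proof. by rewrite divr_ge0 ?dotV_ge0// ltW. Qed.

Lemma cutoff_le1 u : cutoff u <= 1.
Proof. by rewrite ler_pdivrMr// mul1r lerDr ltW. Qed.

Lemma cutoff_le u : cutoff u <= enorm u ^+ 2 / del.
Proof. by rewrite /cutoff sqr_enorm ler_wpM2l ?dotV_ge0// lef_pV2 ?posrE// lerDl dotV_ge0. Qed.

Lemma dcutoff_le u i : `|dcutoff u i| <= 2 * enorm u / del.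
Proof.
rewrite /dcutoff normrM normfV [`|(_ + _) ^+ 2|]ger0_norm ?sqr_ge0//.
rewrite ler_pdivrMr ?exprn_gt0//.
have h1 : `|2 * del * c_ u i| <= 2 * del * enorm u.
  by rewrite normrM ger0_norm ?mulr_ge0 ?(ltW del0)// ler_wpM2l ?coord_le// mulr_ge0// ltW.
apply: (le_trans h1); have := dotV_ge0 u; move: (dotV u u) (enorm_ge0 u) => q.
move: (enorm u) => r r0 q0.
have -> : 2 * r / del * (del + q) ^+ 2 = 2 * del * r + 2 * r * (2 * q + q ^+ 2 / del).
  by field; rewrite gt_eqF.
have q2 : 0 <= q ^+ 2 / del by rewrite divr_ge0 ?sqr_ge0// ltW.
by rewrite lerDl; apply: mulr_ge0; [exact: mulr_ge0|apply: addr_ge0 => //; exact: mulr_ge0].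
Qed.

(** Uniform in [del], in contrast with [dcutoff_le]: against a deviation of order [|u|] the slope of
    the cutoff costs only a constant, so the bound on the derivatives survives [del -> 0]. *)
Lemma dcutoff_enorm_le u i : `|dcutoff u i| * enorm u <= 2.
Proof.
rewrite /dcutoff normrM normfV [`|(_ + _) ^+ 2|]ger0_norm ?sqr_ge0//.
rewrite mulrAC ler_pdivrMr ?exprn_gt0//.
have h1 : `|2 * del * c_ u i| <= 2 * del * enorm u.
  by rewrite normrM ger0_norm ?mulr_ge0 ?(ltW del0)// ler_wpM2l ?coord_le// mulr_ge0// ltW.
apply: (le_trans (ler_wpM2r (enorm_ge0 u) h1)).
have -> : 2 * del * enorm u * enorm u = 2 * del * enorm u ^+ 2 by ring.
rewrite sqr_enorm; have := dotV_ge0 u; move: (dotV u u) => q q0.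
rewrite sqrrD; have := sqr_ge0 del; have := sqr_ge0 q; have := mulr_ge0 (ltW del0) q0; lra.
Qed.

Lemma zreg_derive w j i v : is_derive (0 : R) 1 (fun s => zreg w j (shiftV v i s)) (dzreg w j i v).
Proof.
have hx := xi_cm_derive w j i v.
apply: (is_deriveD hx).
have [u0|u0] := eqVneq (subV v w) V0.
  have -> : dcutoff (subV v w) i * (zeta w j v - 2^-1 * xi j (cm v w)) +
      cutoff (subV v w) * (dzeta w j i v - 4^-1 * partial (xi j) i (cm v w)) = 0.
    rewrite u0 /dcutoff /cutoff (_ : dotV V0 V0 = 0); last by rewrite /dotV /= !mulr0 !addr0.
    rewrite (coord0 i).
    by rewrite !mulr0 !mul0r addr0.
  (* On the diagonal the cutoff is at most [s^2 / del] and the deviation at most [8 L |s|], so the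
     error is cubic in [s]. *)
  apply: (@is_derive_quadratic _ _ _ _ (8 * L / del) 1) => // s s1.
  rewrite add0r mul0r subr0 shiftV0 u0 {2}/cutoff (_ : dotV V0 V0 = 0); last by rewrite /dotV /= !mulr0 !addr0.
  rewrite !mul0r subr0 normrM.
  have Es : enorm (subV (shiftV v i s) w) = `|s|.
    rewrite subV_shift u0 (_ : addV V0 _ = scaleV s (basisV i)); last by apply: eqV => /=; ring.
    by rewrite enormZ enorm_basis mulr1.
  have [->|s0] := eqVneq s 0.
    rewrite shiftV0 u0 /cutoff (_ : dotV V0 V0 = 0); last by rewrite /dotV /= !mulr0 !addr0.
    by rewrite !mul0r normr0 mul0r expr0n mulr0.
  have us : subV (shiftV v i s) w != V0 by rewrite -enorm_eq0 Es normr_eq0.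
  have h1 := zeta_near j us; have h2 := cutoff_le (subV (shiftV v i s) w).
  rewrite Es in h1 h2.
  rewrite (ger0_norm (cutoff_ge0 _)); apply: (le_trans (ler_pM (cutoff_ge0 _) _ h2 h1)) => //.
  rewrite -[s ^+ 2]real_normK ?num_real//.
  have -> : `|s| ^+ 2 / del * (8 * L * `|s|) = 8 * L / del * `|s| ^+ 2 * `|s| by ring.
  by rewrite ler_piMr ?(ltW s1)// !mulr_ge0 ?sqr_ge0// invr_ge0 ltW.
have hz : is_derive (0 : R) 1 (fun s => zeta w j (shiftV v i s) - 2^-1 * xi j (cm (shiftV v i s) w))
    (dzeta w j i v - 4^-1 * partial (xi j) i (cm v w)) := is_deriveB (zeta_derive j i u0) hx.
have hc := cutoff_derive (subV v w) i.
have E : (fun s => cutoff (subV (shiftV v i s) w) * (zeta w j (shiftV v i s) - 2^-1 * xi j (cm (shiftV v i s) w))) =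
  (fun s => cutoff (addV (subV v w) (scaleV s (basisV i))) * (zeta w j (shiftV v i s) - 2^-1 * xi j (cm (shiftV v i s) w))).
  by apply/funext => s; rewrite subV_shift.
rewrite E; apply: (is_derive_eq (is_deriveM hc hz)).
have Eu : addV (subV v w) (scaleV 0 (basisV i)) = subV v w by apply: eqV => /=; ring.
by rewrite /GRing.scale /= Eu !shiftV0; ring.
Qed.

Lemma dzreg_le w j i v : `|dzreg w j i v| <= 200 * L / e.
Proof.
have Le : L <= L / e by rewrite ler_pdivlMr// ler_piMr.
have hp := C1b_le (hxi j) i (cm v w).
have h4 : `|4^-1 * partial (xi j) i (cm v w)| <= 4^-1 * L.
  by rewrite normrM ger0_norm ?invr_ge0// ler_wpM2l// invr_ge0.
have [u0|u0] := eqVneq (subV v w) V0.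
  have -> : dzreg w j i v = 4^-1 * partial (xi j) i (cm v w).
    rewrite /dzreg u0 /dcutoff /cutoff (_ : dotV V0 V0 = 0); last by rewrite /dotV /= !mulr0 !addr0.
    rewrite (coord0 i).
    by rewrite !mulr0 !mul0r !addr0.
  by rewrite (le_trans h4)// -mulrA; move: Le; move: (L / e) L0 => x; lra.
have h1 := zeta_near j u0; have h2 := dzeta_le j i u0.
have h3 : `|dcutoff (subV v w) i * (zeta w j v - 2^-1 * xi j (cm v w))| <= 16 * L.
  rewrite normrM (le_trans (ler_wpM2l (normr_ge0 _) h1))//.
  have := dcutoff_enorm_le (subV v w) i; move: (`|dcutoff _ _|) (enorm _) => p q pq.
  have : L * (p * q) <= L * 2 by rewrite ler_wpM2l.
  by lra.
have h5 : `|cutoff (subV v w) * (dzeta w j i v - 4^-1 * partial (xi j) i (cm v w))| <= 1 * (179 * L / e + 4^-1 * L).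
  apply: (normM_le); first by rewrite (ger0_norm (cutoff_ge0 _)) cutoff_le1.
  by rewrite (le_trans (ler_normB _ _))// lerD.
rewrite /dzreg; apply: (le_trans (ler_normD _ _)); apply: (le_trans (lerD h4 (le_trans (ler_normD _ _) (lerD h3 h5)))).
by rewrite -!mulrA; move: Le; move: (L / e) L0 => x; lra.
Qed.

Lemma zeta_continuous j (vn wn : nat -> V R) v w : cvg3 vn v -> cvg3 wn w -> subV v w != V0 ->
  zeta (wn n) j (vn n) @[n --> \oo] --> zeta w j v.
Proof.
move=> cv cw u0; have cu := cvg3_sub cv cw.
have [N hNN] := cvg3_nonzero cu u0; have hN n := (hNN n).1.
rewrite -(cvg_shiftn N); have cN := cvg3_shift N cv; have cwN := cvg3_shift N cw; have cuN := cvg3_shift N cu.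
have ccN : cvg3 (fun n => cm (vn (n + N)%N) (wn (n + N)%N)) (cm v w).
  by apply: cvg3_scale; [exact: cvg_cst|exact: (cvg3_add cN cwN)].
have cxi := continuous_cvg3 (C1b_continuous0 (hxi j)) ccN.
set M := enorm (subV v w) + 1.
have [p hp] := C1b_bounded (hxi j).
apply: (EY_cvg he hB (M := 8 * L * M + 2^-1 * p) cuN u0).
- by move=> n; have [] := okY_Gf he hxi (subV (vn (n + N)%N) (wn (n + N)%N)) (cm (vn (n + N)%N) (wn (n + N)%N)) j (hN n).
- by have [] := okY_Gf he hxi (subV v w) (cm v w) j u0.
- move=> n Y hY; have := Gf_near hxi (cm (vn (n + N)%N) (wn (n + N)%N)) j (Ann_gt0 he (hN n) hY) (proj2 (andP hY)).
  have h1 : 8 * L * enorm (subV (vn (n + N)%N) (wn (n + N)%N)) <= 8 * L * M by rewrite ler_wpM2l ?mulr_ge0//; exact: (hNN n).2.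
  move=> h2; rewrite -[Gf _ _ _ _](subrK (2^-1 * xi j (cm (vn (n + N)%N) (wn (n + N)%N)))).
  rewrite (le_trans (ler_normD _ _))// lerD// ?(le_trans h2)//.
  by rewrite normrM ger0_norm ?invr_ge0// ler_wpM2l// invr_ge0.
- move=> Yn Y hY cY.
  by apply: (cvg_Gf hxi) => //; rewrite gt_eqF// (Ann_dot_gt0 he u0).
Qed.

(** Convergence is in both velocities, as measurability over pairs requires. At the diagonal the
    terms beyond the first are bounded by a multiple, depending on [del], of [|u|^2]. *)
Lemma dzreg_cvg j i (vn wn : nat -> V R) v w : cvg3 vn v -> cvg3 wn w ->
  dzreg (wn n) j i (vn n) @[n --> \oo] --> dzreg w j i v.
Proof.
move=> cv cw.
have cc : cvg3 (fun n => cm (vn n) (wn n)) (cm v w).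
  by apply: cvg3_scale; [exact: cvg_cst|exact: (cvg3_add cv cw)].
have cu := cvg3_sub cv cw.
have cxi := continuous_cvg3 (C1b_continuous0 (hxi j)) cc.
have cp : 4^-1 * partial (xi j) i (cm (vn n) (wn n)) @[n --> \oo] --> 4^-1 * partial (xi j) i (cm v w).
  by apply: cvgM; [exact: cvg_cst|exact: (continuous_cvg3 (C1b_continuous (hxi j) (i := i)))].
apply: cvgD => //.
have cd := cvg3_dot cu cu.
have cden : (del + dotV (subV (vn n) (wn n)) (subV (vn n) (wn n)))^-1 @[n --> \oo] --> (del + dotV (subV v w) (subV v w))^-1.
  by apply: cvgV; [rewrite gt_eqF|apply: cvgD => //; exact: cvg_cst].
have [u0|u0] := eqVneq (subV v w) V0; last first.
  apply: cvgD; apply: cvgM.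
  - rewrite /dcutoff -exprVn; under eq_fun do rewrite -exprVn.
    apply: cvgM; first by apply: cvgM; [exact: cvg_cst|exact: (cvg3_coord cu)].
    by rewrite expr2; exact: (cvgM cden cden).
  - apply: cvgB; first exact: zeta_continuous.
    by apply: cvgM; [exact: cvg_cst|exact: cxi].
  - exact: cvgM.
  - by apply: cvgB => //; exact: dzeta_cvg.
set K := (2 * (8 * L) + (179 * L / e + 4^-1 * L)) / del.
have bd n : `|dcutoff (subV (vn n) (wn n)) i * (zeta (wn n) j (vn n) - 2^-1 * xi j (cm (vn n) (wn n))) +
   cutoff (subV (vn n) (wn n)) * (dzeta (wn n) j i (vn n) - 4^-1 * partial (xi j) i (cm (vn n) (wn n)))| <=
   K * enorm (subV (vn n) (wn n)) ^+ 2.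
  have [un0|un0] := eqVneq (subV (vn n) (wn n)) V0.
    rewrite un0 /dcutoff /cutoff (_ : dotV V0 V0 = 0); last by rewrite /dotV /= !mulr0 !addr0.
    rewrite (coord0 i).
    rewrite !mulr0 !mul0r addr0 normr0 mulr_ge0 ?sqr_ge0// divr_ge0 ?(ltW del0)//.
    by rewrite !addr_ge0 ?mulr_ge0// ?invr_ge0// ?mulr_ge0// ltW.
  have h1 := normM_le (dcutoff_le (subV (vn n) (wn n)) i) (zeta_near j un0).
  have h2 : `|cutoff (subV (vn n) (wn n)) * (dzeta (wn n) j i (vn n) - 4^-1 * partial (xi j) i (cm (vn n) (wn n)))|
     <= enorm (subV (vn n) (wn n)) ^+ 2 / del * (179 * L / e + 4^-1 * L).
    apply: normM_le; first by rewrite (ger0_norm (cutoff_ge0 _)) cutoff_le.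
    rewrite (le_trans (ler_normB _ _))// lerD//; first exact: dzeta_le.
    by rewrite normrM ger0_norm ?invr_ge0// ler_wpM2l ?invr_ge0//; exact: C1b_le (hxi j) i _.
  apply: (le_trans (ler_normD _ _)); apply: (le_trans (lerD h1 h2)).
  by rewrite /K le_eqVlt; apply/orP; left; apply/eqP; ring.
have -> : dcutoff (subV v w) i * (zeta w j v - 2^-1 * xi j (cm v w)) +
    cutoff (subV v w) * (dzeta w j i v - 4^-1 * partial (xi j) i (cm v w)) = 0.
  rewrite u0 /dcutoff /cutoff (_ : dotV V0 V0 = 0); last by rewrite /dotV /= !mulr0 !addr0.
  rewrite (coord0 i).
  by rewrite !mulr0 !mul0r addr0.
have K0 : K * enorm (subV (vn n) (wn n)) ^+ 2 @[n --> \oo] --> 0.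
  have E0 : enorm (subV v w) = 0 by apply/eqP; rewrite enorm_eq0 u0.
  have := cvg3_enorm cu; rewrite E0 => ce.
  rewrite -(mulr0 K); apply: cvgM; first exact: cvg_cst.
  by rewrite -(mulr0 (0 : R)); under eq_fun do rewrite expr2; exact: cvgM.
apply: (@squeeze_cvgr _ _ _ _ (fun n => - (K * enorm (subV (vn n) (wn n)) ^+ 2)) (fun n => K * enorm (subV (vn n) (wn n)) ^+ 2)) => //.
  by apply: nearW => n; rewrite -ler_norml; exact: bd.
by rewrite -oppr0; exact: cvgN.
Qed.

Lemma zreg_cvg j (vn wn : nat -> V R) v w : cvg3 vn v -> cvg3 wn w ->
  zreg (wn n) j (vn n) @[n --> \oo] --> zreg w j v.
Proof.
move=> cv cw.
have cc : cvg3 (fun n => cm (vn n) (wn n)) (cm v w).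
  by apply: cvg3_scale; [exact: cvg_cst|exact: (cvg3_add cv cw)].
have cu := cvg3_sub cv cw.
have cx : 2^-1 * xi j (cm (vn n) (wn n)) @[n --> \oo] --> 2^-1 * xi j (cm v w).
  by apply: cvgM; [exact: cvg_cst|exact: (continuous_cvg3 (C1b_continuous0 (hxi j)) cc)].
apply: cvgD => //.
have cd := cvg3_dot cu cu.
have cc1 : cutoff (subV (vn n) (wn n)) @[n --> \oo] --> cutoff (subV v w).
  by apply: cvgM => //; apply: cvgV; [rewrite gt_eqF|apply: cvgD => //; exact: cvg_cst].
have [u0|u0] := eqVneq (subV v w) V0; last first.
  by apply: cvgM => //; apply: cvgB => //; exact: zeta_continuous.
have c0 : cutoff V0 = 0 by rewrite /cutoff (_ : dotV V0 V0 = 0) ?mul0r// /dotV /= !mulr0 !addr0.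
rewrite u0 c0 mul0r; rewrite u0 c0 in cc1.
have E0 : enorm (subV v w) = 0 by apply/eqP; rewrite enorm_eq0 u0.
have ce : 8 * L * enorm (subV (vn n) (wn n)) @[n --> \oo] --> 0.
  have := cvg3_enorm cu; rewrite E0 => ce.
  by rewrite -(mulr0 (8 * L)); apply: cvgM => //; exact: cvg_cst.
have bd n : `|cutoff (subV (vn n) (wn n)) * (zeta (wn n) j (vn n) - 2^-1 * xi j (cm (vn n) (wn n)))|
    <= 8 * L * enorm (subV (vn n) (wn n)).
  have [un0|un0] := eqVneq (subV (vn n) (wn n)) V0.
    by rewrite un0 c0 mul0r normr0 !mulr_ge0// enorm_ge0.
  rewrite -[leRHS]mul1r; apply: normM_le; last exact: zeta_near.
  by rewrite (ger0_norm (cutoff_ge0 _)) cutoff_le1.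
apply: (@squeeze_cvgr _ _ _ _ (fun n => - (8 * L * enorm (subV (vn n) (wn n)))) (fun n => 8 * L * enorm (subV (vn n) (wn n)))) => //.
  by apply: nearW => n; rewrite -ler_norml; exact: bd.
by rewrite -oppr0; exact: cvgN.
Qed.

Lemma zeta_bounded j : exists p, forall w v, subV v w != V0 -> `|zeta w j v| <= p.
Proof.
have [p0 h0] := C1b_bounded (hxi i0); have [p1 h1] := C1b_bounded (hxi i1).
have [p2 h2] := C1b_bounded (hxi i2).
have P0 := le_trans (normr_ge0 _) (h0 V0); have P1 := le_trans (normr_ge0 _) (h1 V0).
have P2 := le_trans (normr_ge0 _) (h2 V0).
set p := p0 + p1 + p2.
have hp l v : `|xi l v| <= p.
  by elim/I3_ind: l; rewrite /p; [have := h0 v|have := h1 v|have := h2 v]; lra.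
have pp : 0 <= p by rewrite /p; lra.
exists (2 * p + 9 * (4 * p / e)) => w v u0; set u := subV v w.
apply: (EY_norm he hB); first exact: (okY_Gf he hxi).
move=> Y hY; have y0 := Ann_gt0 he u0 hY.
have hD l : `|Dxi xi (cm v w) Y l| <= 2 * p.
  by rewrite (le_trans (ler_normB _ _))//; move: (hp l (addV (cm v w) Y)) (hp l (subV (cm v w) Y)); lra.
have hq k l : enorm u * `|qf xi (cm v w) Y k l| <= 4 * p / e.
  rewrite /qf -sqr_enorm normrM normfV (ger0_norm (sqr_ge0 _)).
  have h3 := normM_le (coord_le Y k) (hD l).
  rewrite mulrA ler_pdivrMr ?exprn_gt0// mulrAC ler_pdivlMr//.
  apply: (@le_trans _ _ (enorm u * (enorm Y * (2 * p)) * e)).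
    by rewrite ler_wpM2r ?(ltW e0)// ler_wpM2l ?enorm_ge0.
  have : e * enorm u <= 2 * enorm Y by case/andP: hY => + _; rewrite -/u; move: (enorm u) => r; lra.
  move=> hh; have : 2 * p * enorm Y * (e * enorm u) <= 2 * p * enorm Y * (2 * enorm Y).
    by rewrite ler_wpM2l// !mulr_ge0// ltW.
  by rewrite expr2; move: (enorm u) (enorm Y) => r y; lra.
have cq m k l : `|c_ u m * qf xi (cm v w) Y k l| <= 4 * p / e.
  by rewrite normrM (le_trans _ (hq k l))// ler_wpM2r// coord_le.
rewrite /Gf -/u /Sxi !sum3E.
move: (hp j (addV (cm v w) Y)) (hp j (subV (cm v w) Y)) (fun m k l => cq m k l).
move: (xi j _) (xi j _) (4 * p / e) => a b z ha hb {}cq.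
have := cq i0 i0 j; have := cq i0 j i0; have := cq i1 i1 j; have := cq i1 j i1.
have := cq i2 i2 j; have := cq i2 j i2; have := cq j i0 i0; have := cq j i1 i1; have := cq j i2 i2.
move: ha hb; rewrite !ler_norml => /andP[? ?] /andP[? ?].
move=> /andP[? ?] /andP[? ?] /andP[? ?] /andP[? ?] /andP[? ?] /andP[? ?] /andP[? ?] /andP[? ?] /andP[? ?].
by apply/andP; split; lra.
Qed.

Lemma zreg_le j p q w v : (forall v, `|xi j v| <= p) ->
  (forall w v, subV v w != V0 -> `|zeta w j v| <= q) -> `|zreg w j v| <= p + (`|q| + p).
Proof.
move=> hp hq; have p0 : 0 <= p := le_trans (normr_ge0 _) (hp V0).
have hx : `|2^-1 * xi j (cm v w)| <= p.
  by rewrite normrM ger0_norm ?invr_ge0//; have := hp (cm v w); have := normr_ge0 (xi j (cm v w)); lra.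
rewrite (le_trans (ler_normD _ _))// lerD//.
have [u0|u0] := eqVneq (subV v w) V0.
  rewrite u0 /cutoff (_ : dotV V0 V0 = 0); last by rewrite /dotV /= !mulr0 !addr0.
  by rewrite !mul0r normr0 addr_ge0.
rewrite -[leRHS]mul1r; apply: normM_le; first by rewrite (ger0_norm (cutoff_ge0 _)) cutoff_le1.
by rewrite (le_trans (ler_normB _ _))// lerD// (le_trans (hq _ _ u0))// ler_norm.
Qed.

(** The factor [2 e^2] turns the bound [200 L / e] into [400 L e], hence a constant independent of
    [e], [w] and [del]. *)
Lemma zreg_C1b w j : C1b (400 * L) (fun v => 2 * e ^+ 2 * zreg w j v) /\
  forall i v, partial (fun v => 2 * e ^+ 2 * zreg w j v) i v = 2 * e ^+ 2 * dzreg w j i v.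
Proof.
have [p1 hp1] := C1b_bounded (hxi j); have [q hq] := zeta_bounded j.
set p := p1 + (`|q| + p1); have hp v : `|zreg w j v| <= p by exact: zreg_le.
have e2 : 0 <= 2 * e ^+ 2 by rewrite mulr_ge0 ?sqr_ge0.
have [h E] : C1b (400 * L) (fun v => 2 * e ^+ 2 * zreg w j v) /\
    partial (fun v => 2 * e ^+ 2 * zreg w j v) = (fun i v => 2 * e ^+ 2 * dzreg w j i v).
  apply: (@C1b_build _ _ _ _ (2 * e ^+ 2 * p)) => [v|i v|i|i v].
  - by rewrite normrM ger0_norm// ler_wpM2l.
  - have E : (fun s => 2 * e ^+ 2 * zreg w j (shiftV v i s)) = (fun s => 0 + 2 * e ^+ 2 * zreg w j (shiftV v i s)).
      by apply/funext => s; rewrite add0r.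
    by rewrite E; exact: (is_derive_affine 0 (2 * e ^+ 2) (zreg_derive w j i v)).
  - apply: cvg3_continuous => vn y cv; apply: cvgM; first exact: cvg_cst.
    by apply: (dzreg_cvg (wn := fun=> w)) => //; exact: cvg3_cst.
  - rewrite normrM ger0_norm// (le_trans (ler_wpM2l e2 (dzreg_le w j i v)))//.
    have -> : 2 * e ^+ 2 * (200 * L / e) = 400 * L * e by field; rewrite gt_eqF.
    by rewrite ler_piMr// mulr_ge0.
by split => // i v; rewrite E.
Qed.

End RegularizedField.

(** * The divergence identity before averaging *)

Section CollisionIdentity.
Variables (R : realType) (xi : 'I_3 -> V R -> R).
Implicit Types (h u d x Y v w : V R) (k l i j m : 'I_3).
Local Notation c_ := (@Defs.coord R).
Local Notation V0 := (((0, 0), 0) : V R).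

(** A motion of [v] along a basis vector moves [h] by half of it, [u] by all of it and [Y] by
    [Ydot]; for [w] the signs of [u] and [Y] are reversed. Beyond half of the two divergences there
    remain only derivatives of [qf] along the infinitesimal rotation [u x Y] with [h] fixed. *)
Lemma dGf_trace h u Y : dotV u u != 0 -> dotV Y Y != 0 ->
  \sum_(j < 3) (dGf xi h u Y (scaleV 2^-1 (basisV R j)) (basisV R j) (Ydot u (basisV R j) Y) j
    + dGf xi h (scaleV (-1) u) (scaleV (-1) Y) (scaleV 2^-1 (basisV R j)) (basisV R j)
        (Ydot (scaleV (-1) u) (basisV R j) (scaleV (-1) Y)) j) =
  2^-1 * \sum_(j < 3) (partial (xi j) j (addV h Y) + partial (xi j) j (subV h Y))
  + \sum_(k < 3) \sum_(j < 3) (- 4^-1 * dotV (crossV (basisV R k) (basisV R j)) u / dotV u u) *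
      dq xi h Y V0 (crossV u Y) k j.
Proof.
move=> u0 Y0.
have e1 : subV h (scaleV (-1) Y) = addV h Y by apply: eqV => /=; ring.
have e3 : enorm (scaleV (-1) u) ^+ 2 = dotV u u by rewrite sqr_enorm /dotV /=; ring.
have e4 : dotV (scaleV (-1) Y) (scaleV (-1) Y) = dotV Y Y by rewrite /dotV /=; ring.
rewrite !sum3E /dGf /dq /Dxi /qf /dP /dM /Ydot !e3 !e4 !sqr_enorm !sum3E.
rewrite /Dxi !e1 -!/(subV h Y).
(* Once the values and partial derivatives of [xi] are generalized, the identity is one between
   rational functions. *)
move: (xi i0 (addV h Y)) (xi i1 (addV h Y)) (xi i2 (addV h Y)) => a0 a1 a2.
move: (xi i0 (subV h Y)) (xi i1 (subV h Y)) (xi i2 (subV h Y)) => b0 b1 b2.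
do 3![move: (partial (xi i0) _ (addV h Y)) => ?].
do 3![move: (partial (xi i1) _ (addV h Y)) => ?].
do 3![move: (partial (xi i2) _ (addV h Y)) => ?].
do 3![move: (partial (xi i0) _ (subV h Y)) => ?].
do 3![move: (partial (xi i1) _ (subV h Y)) => ?].
do 3![move: (partial (xi i2) _ (subV h Y)) => ?].
case: Y u u0 Y0 {e1 e3 e4} => [[y1 y2] y3] [[u1 u2] u3].
rewrite /dotV /Defs.coord /= => u0 Y0.
field.
by rewrite u0 Y0.
Qed.

End CollisionIdentity.

(** * The pointwise inequality for a pair of velocities *)

Section CollisionInequality.
Variables (R : realType) (e : R) (B : R -> R).
Hypotheses (he : 0 < e <= 1) (hB : admissible_B B).
Variables (L : R) (xi : 'I_3 -> V R -> R).
Hypothesis hxi : forall i, C1b L (xi i).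
Implicit Types (h u x Y v w : V R) (k l i j m : 'I_3).
Local Notation EY := (EY e B).
Local Notation Ann := (Ann e).
Local Notation okY := (okY e).
Local Notation c_ := (@Defs.coord R).
Local Notation V0 := (((0, 0), 0) : V R).
Local Notation zeta := (zeta e B xi).
Local Notation dzeta := (dzeta e B xi).

Let e0 : 0 < e. Proof. by case/andP: he. Qed.

(** The rotation about [u] by the angle with half-angle tangent [s |u| / 2]; this parametrization is
    rational in [s], with velocity [u x Y] at [s = 0]. *)
Definition turn u s Y : V R :=
  scaleV (1 + s ^+ 2 * dotV u u / 4)^-1 (rod (1 - s ^+ 2 * dotV u u / 4) (scaleV s u) 2^-1 Y).

Let den u (s : R) : 0 < 1 + s ^+ 2 * dotV u u / 4.
Proof. by rewrite ltr_wpDr// divr_ge0// mulr_ge0 ?sqr_ge0 ?dotV_ge0. Qed.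

Lemma isometry_turn u s : isometryV (turn u s).
Proof.
apply: isometry_rod; first exact: den; first by rewrite /dotV /=; field.
by rewrite /dotV /=; field.
Qed.

Lemma turn_axis u s : turn u s u = u.
Proof.
have := den u s; rewrite /turn /rod => d0.
have -> : dotV (scaleV s u) u = s * dotV u u by rewrite /dotV /=; ring.
have -> : crossV (scaleV s u) u = V0 by apply: eqV => /=; ring.
by move: d0; move: (dotV u u) => q d0; apply: eqV => /=; field; rewrite gt_eqF//; move: d0; lra.
Qed.

Lemma EY_turn u s g : u != V0 -> okY u g -> EY u (fun Y => g (turn u s Y)) = EY u g.
Proof.
move=> u0 hg; have E : scaleV 1 (turn u s u) = u by rewrite turn_axis; apply: eqV => /=; ring.
have := @EY_similarity R e B he hB (turn u s) 1 u g (isometry_turn u s) ltr01 u0.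
rewrite E => /(_ hg) ->; congr EY; apply/funext => Y; congr g.
by apply: eqV => /=; rewrite mul1r.
Qed.

Lemma udiff_turn u i : udiff (Ann u) (fun Y s => c_ (turn u s Y) i) (fun Y => c_ (crossV u Y) i).
Proof.
pose Z1 Y := - (dotV u u / 2) * c_ Y i + 2^-1 * (dotV u Y * c_ u i).
pose Z2 Y := - (dotV u u / 4) * c_ (crossV u Y) i.
have E : (fun Y s => c_ (turn u s Y) i) = (fun Y s => (c_ Y i + s * c_ (crossV u Y) i) +
   (s ^+ 2 * (1 + s ^+ 2 * dotV u u / 4)^-1) * (Z1 Y + s * Z2 Y)).
  apply/funext => Y; apply/funext => s; rewrite /turn /rod /Z1 /Z2 coordZ !coordD !coordZ.
  have -> : dotV (scaleV s u) Y = s * dotV u Y by rewrite /dotV /=; ring.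
  have -> : crossV (scaleV s u) Y = scaleV s (crossV u Y) by apply: eqV => /=; ring.
  rewrite coordZ; move: (den u s); move: (dotV u u) (c_ Y i) (c_ (crossV u Y) i) (dotV u Y) (c_ u i).
  by move=> q a b p r d0; field; rewrite gt_eqF//; move: d0; lra.
have o1 : okY u Z1.
  apply: okYD; first exact: okYZ (okY_id _ _ _).
  by apply: okYZ; apply: okYM; [exact: okY_dot|exact: okY_cst].
have o2 : okY u Z2 by apply: okYZ; exact: okY_cross.
have db : is_derive (0 : R) 1 (fun s => s ^+ 2 * (1 + s ^+ 2 * dotV u u / 4)^-1) 0.
  apply: (@is_derive_quadratic _ _ _ _ 1 1) => // s _.
  rewrite add0r expr0n /= !mul0r !subr0 mul1r ger0_norm; last by rewrite mulr_ge0 ?sqr_ge0// invr_ge0 ltW.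
  by rewrite ler_piMr ?sqr_ge0// invf_le1// lerDl divr_ge0// mulr_ge0 ?sqr_ge0 ?dotV_ge0.
have U1 : udiff (Ann u) (fun Y s => s * c_ (crossV u Y) i) (fun Y => 0 * 0 + 1 * c_ (crossV u Y) i) :=
  udiffM (@udiff_id R _ (Ann u)) (udiff_okY (okY_cross e u u i)).
have U2 : udiff (Ann u) (fun Y s => s * Z2 Y) (fun Y => 0 * 0 + 1 * Z2 Y) :=
  udiffM (@udiff_id R _ (Ann u)) (udiff_okY o2).
have U3 : udiff (Ann u) (fun Y s => s ^+ 2 * (1 + s ^+ 2 * dotV u u / 4)^-1 * (Z1 Y + s * Z2 Y)) _ :=
  udiffM (udiff_scalar _ db) (udiffD (udiff_okY o1) U2).
rewrite E; apply: (udiff_eq (udiffD (udiffD (udiff_okY (okY_id e u i)) U1) U3)) => Y _.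
by rewrite expr0n /=; ring.
Qed.

Lemma turn0 u Y : turn u 0 Y = Y.
Proof. by apply: eqV; rewrite /turn /rod /dotV /=; field. Qed.

(* Invariance of the collision average under rotations about the relative velocity. *)
Lemma EY_dq_axis u h k l : u != V0 -> EY u (fun Y => dq xi h Y V0 (crossV u Y) k l) = 0.
Proof.
move=> u0; have ok := okY_qf he hxi h k l u0.
have hu := udiff_qf he hxi u0 (fun Y _ => turn0 u Y) (udiff_turn u) h V0 k l.
have Eh s : addV h (scaleV s V0) = h by apply: eqV => /=; ring.
have E : (fun Y s => qf xi (addV h (scaleV s V0)) (turn u s Y) k l) = (fun Y s => qf xi h (turn u s Y) k l).
  by apply/funext => Y; apply/funext => s; rewrite Eh.
rewrite E in hu.
have mt s : measurable_fun setT (fun Y => qf xi h (turn u s Y) k l).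
  by apply: (measurableT_comp ok.1); exact: (isometry_measurable (isometry_turn u s)).
have D1 := EY_udiff he hB hu mt (okY_dq he hxi u0 (okY_cross e u u) h V0 k l).1.
have E2 : (fun s => EY u ((fun Y s => qf xi h (turn u s Y) k l) ^~ s)) = (fun=> EY u (fun Y => qf xi h Y k l)).
  by apply/funext => s; exact: (EY_turn s u0 ok).
rewrite E2 in D1.
have D2 := is_derive_cst (EY u (fun Y => qf xi h Y k l)) (0 : R) (1 : R).
by have [_ <-] := D1; have [_ ->] := D2.
Qed.

Lemma subVC v w : subV w v = scaleV (-1) (subV v w).
Proof. by apply: eqV => /=; ring. Qed.

Lemma cmC v w : cm w v = cm v w.
Proof. by apply: eqV => /=; ring. Qed.

Lemma scaleN1_neq0 u : u != V0 -> scaleV (-1) u != V0.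
Proof. by rewrite -!enorm_eq0 enormZ normrN1 mul1r. Qed.

(** [dGf_trace] is averaged, and its rotational terms vanish by [EY_dq_axis]. The field of the
    second velocity is an average for [-u], brought to the same law by [Y -> -Y]. *)
Lemma zeta_div v w : subV v w != V0 ->
  \sum_(j < 3) (dzeta w j j v + dzeta v j j w) = 2^-1 * EY (subV v w) (fun Y =>
    \sum_(j < 3) (partial (xi j) j (addV (cm v w) Y) + partial (xi j) j (subV (cm v w) Y))).
Proof.
set u := subV v w => u0; have u0' := scaleN1_neq0 u0.
pose h := cm v w.
have okd j := okY_dGf he hxi u0 (okY_Ydot e u (basisV R j)) h u (scaleV 2^-1 (basisV R j)) (basisV R j) j.
have okd' j := okY_dGf he hxi u0' (okY_Ydot e (scaleV (-1) u) (basisV R j)) h (scaleV (-1) u) (scaleV 2^-1 (basisV R j)) (basisV R j) j.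
have okn g : okY (scaleV (-1) u) g -> okY u (fun Y => g (scaleV (-1) Y)).
  move=> [mg [M hM]]; split.
    apply: (measurableT_comp mg); apply: measurable_scaleV; [exact: measurable_cst|exact: measurable_id].
  by exists M => Y hY; apply: hM; move: hY; rewrite /Ann !enormZ normrN1 !mul1r.
have okt : okY u (fun Y => \sum_(j < 3) (partial (xi j) j (addV h Y) + partial (xi j) j (subV h Y))).
  by apply: okY_sum => j; apply: okYD; [exact: (okY_pD e hxi)|exact: (okY_pB e hxi)].
have okq k j := okY_dq he hxi u0 (okY_cross e u u) h V0 k j.
have E j : dzeta w j j v + dzeta v j j w = EY u (fun Y =>
   dGf xi h u Y (scaleV 2^-1 (basisV R j)) (basisV R j) (Ydot u (basisV R j) Y) j
    + dGf xi h (scaleV (-1) u) (scaleV (-1) Y) (scaleV 2^-1 (basisV R j)) (basisV R j)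
        (Ydot (scaleV (-1) u) (basisV R j) (scaleV (-1) Y)) j).
  rewrite (EYD he hB); [|exact: okd|exact: (okn _ (okd' j))].
  by rewrite /dzeta -/u -/h (subVC v w) -/u cmC -/h (EY_opp he hB u0 (okd' j)).
rewrite (eq_bigr _ (fun j _ => E j)) -(EY_sum he hB); last first.
  by move=> j; apply: okYD; [exact: okd|exact: (okn _ (okd' j))].
pose cf k j := - 4^-1 * dotV (crossV (basisV R k) (basisV R j)) u / dotV u u.
have uu : dotV u u != 0 by rewrite dotV_eq0.
rewrite (@eq_EY R e B he u _ (fun Y => 2^-1 * (\sum_(j < 3) (partial (xi j) j (addV h Y) + partial (xi j) j (subV h Y)))
  + \sum_(k < 3) \sum_(j < 3) cf k j * dq xi h Y V0 (crossV u Y) k j)); last first.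
  by move=> Y hY; apply: dGf_trace => //; rewrite gt_eqF// (Ann_dot_gt0 he u0).
have oks : okY u (fun Y => \sum_(k < 3) \sum_(j < 3) cf k j * dq xi h Y V0 (crossV u Y) k j).
  by apply: okY_sum => k; apply: okY_sum => j; apply: okYZ.
rewrite (EYD he hB) ?(EYZ he hB)//; last exact: okYZ.
rewrite [X in _ + X](EY_sum he hB); last by move=> k; apply: okY_sum => j; apply: okYZ.
rewrite big1 ?addr0// => k _.
rewrite (EY_sum he hB); last by move=> j; apply: okYZ.
by rewrite big1// => j _; rewrite (EYZ he hB)// EY_dq_axis// mulr0.
Qed.

(** Changing the signs of [u] and [Y] keeps the sum [S] and reverses [N], so the cross terms cancel.
    For the rest, [|N|^2 = |u|^2 |Y|^2 |D|^2 - (D . (u x Y))^2] and [|u| <= 2 |Y| / e]. *)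
Lemma Gf_sqr h u Y : u != V0 -> Ann u Y ->
  \sum_(j < 3) (Gf xi h u Y j ^+ 2 + Gf xi h (scaleV (-1) u) (scaleV (-1) Y) j ^+ 2) <=
  (4 * e ^+ 2)^-1 * \sum_(j < 3) (xi j (addV h Y) ^+ 2 + xi j (subV h Y) ^+ 2).
Proof.
move=> u0 hY; have y0 := Ann_dot_gt0 he u0 hY.
have e1 : subV h (scaleV (-1) Y) = addV h Y by apply: eqV => /=; ring.
have e4 : dotV (scaleV (-1) Y) (scaleV (-1) Y) = dotV Y Y by rewrite /dotV /=; ring.
pose S j := xi j (addV h Y) + xi j (subV h Y).
pose D j := xi j (addV h Y) - xi j (subV h Y).
pose N j := (dotV u Y * D j - (c_ u i0 * D i0 + c_ u i1 * D i1 + c_ u i2 * D i2) * c_ Y j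
   + (c_ Y i0 * D i0 + c_ Y i1 * D i1 + c_ Y i2 * D i2) * c_ u j).
have G1 j : Gf xi h u Y j = 4^-1 * (S j + 2^-1 * (dotV Y Y)^-1 * N j).
  by rewrite /Gf /qf /Sxi /Dxi !sum3E /N /S /D (dotVE u Y) sum3E; ring.
have G2 j : Gf xi h (scaleV (-1) u) (scaleV (-1) Y) j = 4^-1 * (S j - 2^-1 * (dotV Y Y)^-1 * N j).
  by rewrite /Gf /qf /Sxi /Dxi e4 e1 -/(subV h Y) !sum3E !coordZ /N /S /D (dotVE u Y) sum3E; ring.
have NN : \sum_(j < 3) N j ^+ 2 <= dotV u u * dotV Y Y * \sum_(j < 3) D j ^+ 2.
  rewrite !sum3E /N /dotV /Defs.coord /=.
  move: (D i0) (D i1) (D i2) => a b c.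
  have := sqr_ge0 (a * (u.1.2 * Y.2 - u.2 * Y.1.2) + b * (u.2 * Y.1.1 - u.1.1 * Y.2) + c * (u.1.1 * Y.1.2 - u.1.2 * Y.1.1)).
  rewrite -subr_ge0 => hh; rewrite -subr_ge0; apply: (le_trans hh).
  by rewrite le_eqVlt; apply/orP; left; apply/eqP; ring.
have uY : dotV u u * (dotV Y Y)^-1 <= 4 / e ^+ 2.
  rewrite ler_pdivrMr// mulrAC ler_pdivlMr ?exprn_gt0// -!sqr_enorm.
  have : e * enorm u <= 2 * enorm Y by case/andP: hY => + _; move: (enorm u) => r; lra.
  move=> hh; have : (e * enorm u) ^+ 2 <= (2 * enorm Y) ^+ 2.
    by rewrite lerXn2r ?nnegrE ?mulr_ge0 ?enorm_ge0// ltW.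
  by rewrite !exprMn; lra.
have SD : 0 <= \sum_(j < 3) D j ^+ 2 by apply: sumr_ge0 => j _; exact: sqr_ge0.
have SS : 0 <= \sum_(j < 3) S j ^+ 2 by apply: sumr_ge0 => j _; exact: sqr_ge0.
have i2 : 0 <= (dotV Y Y)^-1 by rewrite invr_ge0 ltW.
have NE : ((dotV Y Y)^-1) ^+ 2 * \sum_(j < 3) N j ^+ 2 <= 4 / e ^+ 2 * \sum_(j < 3) D j ^+ 2.
  apply: (le_trans (ler_wpM2l (sqr_ge0 _) NN)).
  have -> : (dotV Y Y)^-1 ^+ 2 * (dotV u u * dotV Y Y * \sum_(j < 3) D j ^+ 2) =
     dotV u u * (dotV Y Y)^-1 * \sum_(j < 3) D j ^+ 2 by field; rewrite gt_eqF.
  by rewrite ler_wpM2r.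
have ee : 1 <= (e ^+ 2)^-1.
  by rewrite -[leLHS]invr1 lef_pV2 ?posrE ?exprn_gt0// exprn_ile1 ?(ltW e0)//; case/andP: he.
have -> : \sum_(j < 3) (Gf xi h u Y j ^+ 2 + Gf xi h (scaleV (-1) u) (scaleV (-1) Y) j ^+ 2) =
   8^-1 * (\sum_(j < 3) S j ^+ 2 + 4^-1 * ((dotV Y Y)^-1 ^+ 2 * \sum_(j < 3) N j ^+ 2)).
  by rewrite !sum3E !G1 !G2; field; rewrite gt_eqF.
have -> : (4 * e ^+ 2)^-1 * \sum_(j < 3) (xi j (addV h Y) ^+ 2 + xi j (subV h Y) ^+ 2) =
   8^-1 * ((e ^+ 2)^-1 * \sum_(j < 3) S j ^+ 2 + (e ^+ 2)^-1 * \sum_(j < 3) D j ^+ 2).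
  by rewrite !sum3E /S /D; field; rewrite gt_eqF.
rewrite ler_wpM2l ?invr_ge0//.
move: NE; move: (_ ^+ 2 * \sum_(j < 3) N j ^+ 2) => X NE.
have := ler_wpM2r SS ee; rewrite mul1r.
by move: NE; move: (e ^+ 2)^-1 (\sum_(j < 3) D j ^+ 2) (\sum_(j < 3) S j ^+ 2) => p q r; lra.
Qed.

Definition fphi (eta : 'I_3 -> V R -> R) v :=
  \sum_(j < 3) (- 2 * partial (eta j) j v - eta j v ^+ 2).

(** The value [fphi] would have on the field [2 e^2 zeta w] without regularization; meaningful off
    the diagonal. *)
Definition Psi v w := \sum_(j < 3) (- 2 * (2 * e ^+ 2 * dzeta w j j v) - (2 * e ^+ 2 * zeta w j v) ^+ 2).

Lemma okY_fphiD u h : okY u (fun Y => fphi xi (addV h Y)).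
Proof.
apply: okY_sum => j; apply: okYB; first by apply: okYZ; exact: (okY_pD e hxi).
by apply: okYX; exact: (okY_xiD e hxi).
Qed.

Lemma okY_fphiB u h : okY u (fun Y => fphi xi (subV h Y)).
Proof.
apply: okY_sum => j; apply: okYB; first by apply: okYZ; exact: (okY_pB e hxi).
by apply: okYX; exact: (okY_xiB e hxi).
Qed.

(** The divergence parts of the two sides are equal by [zeta_div]. Only the squares lose, by
    Jensen's inequality for the average defining [zeta] and then by [Gf_sqr]. *)
Lemma collision_inequality v w : subV v w != V0 ->
  EY (subV v w) (fun Y => fphi xi (addV (cm v w) Y)) + EY (subV v w) (fun Y => fphi xi (subV (cm v w) Y))
  <= (e ^+ 2)^-1 * (Psi v w + Psi w v).
Proof.
set u := subV v w => u0; have u0' := scaleN1_neq0 u0; set h := cm v w.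
have e2 : 0 < e ^+ 2 by rewrite exprn_gt0.
have okG j := okY_Gf he hxi u h j u0.
have okG' j : okY u (fun Y => Gf xi h (scaleV (-1) u) (scaleV (-1) Y) j).
  have [mg [M hM]] := okY_Gf he hxi (scaleV (-1) u) h j u0'; split.
    apply: (measurableT_comp mg); apply: measurable_scaleV; [exact: measurable_cst|exact: measurable_id].
  by exists M => Y hY; apply: hM; move: hY; rewrite /Ann !enormZ normrN1 !mul1r.
have Z1 j : zeta w j v = EY u (fun Y => Gf xi h u Y j) by [].
have Z2 j : zeta v j w = EY u (fun Y => Gf xi h (scaleV (-1) u) (scaleV (-1) Y) j).
  by rewrite /zeta (subVC v w) -/u cmC -/h (EY_opp he hB u0 (okY_Gf he hxi _ _ _ u0')).
pose DV Y := \sum_(j < 3) (partial (xi j) j (addV h Y) + partial (xi j) j (subV h Y)).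
pose SQ Y := \sum_(j < 3) (xi j (addV h Y) ^+ 2 + xi j (subV h Y) ^+ 2).
have okDV : okY u DV.
  by apply: okY_sum => j; apply: okYD; [exact: (okY_pD e hxi)|exact: (okY_pB e hxi)].
have okSQ : okY u SQ.
  by apply: okY_sum => j; apply: okYD; apply: okYX; [exact: (okY_xiD e hxi)|exact: (okY_xiB e hxi)].
have zsq : \sum_(j < 3) (zeta w j v ^+ 2 + zeta v j w ^+ 2) <= (4 * e ^+ 2)^-1 * EY u SQ.
  apply: (@le_trans _ _ (EY u (fun Y => \sum_(j < 3) (Gf xi h u Y j ^+ 2 + Gf xi h (scaleV (-1) u) (scaleV (-1) Y) j ^+ 2)))).
    rewrite (EY_sum he hB); last by move=> j; apply: okYD; exact: okYX.
    apply: ler_sum => j _; rewrite (EYD he hB); [|exact: okYX|exact: okYX].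
    by rewrite Z1 Z2 lerD//; exact: (EY_sqr he hB).
  rewrite -(EYZ he hB)//; apply: (EY_le he hB).
  - by apply: okY_sum => j; apply: okYD; exact: okYX.
  - exact: okYZ.
  - by move=> Y hY; exact: Gf_sqr.
have dz := zeta_div u0; rewrite -/u -/h -/(DV) in dz.
have -> : EY u (fun Y => fphi xi (addV h Y)) + EY u (fun Y => fphi xi (subV h Y)) = - 2 * EY u DV - EY u SQ.
  rewrite -(EYD he hB); [|exact: okY_fphiD|exact: okY_fphiB].
  rewrite -(EYZ he hB)// -(EYB he hB)//; last exact: okYZ.
  by congr EY; apply/funext => Y; rewrite /fphi /DV /SQ !sum3E; ring.
have -> : Psi v w + Psi w v = - 4 * e ^+ 2 * (\sum_(j < 3) (dzeta w j j v + dzeta v j j w))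
   - 4 * e ^+ 4 * \sum_(j < 3) (zeta w j v ^+ 2 + zeta v j w ^+ 2).
  by rewrite /Psi !sum3E; ring.
rewrite dz.
have -> : (e ^+ 2)^-1 * (- 4 * e ^+ 2 * (2^-1 * EY u DV) - 4 * e ^+ 4 * \sum_(j < 3) (zeta w j v ^+ 2 + zeta v j w ^+ 2))
   = - 2 * EY u DV - 4 * e ^+ 2 * \sum_(j < 3) (zeta w j v ^+ 2 + zeta v j w ^+ 2).
  by field; rewrite gt_eqF.
rewrite lerD2l lerN2.
apply: (le_trans (ler_wpM2l _ zsq)); first by rewrite mulr_ge0 ?(ltW e2).
by rewrite mulrA mulfV ?mul1r// mulf_neq0// gt_eqF.
Qed.

End CollisionInequality.

Lemma double_le (R : realType) (a b c k : R) : a + a <= k * (b + b) -> k * b <= k * c -> a <= c * k.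
Proof. by lra. Qed.

(** * The integrated bound on the collision operator *)

Section CollisionBound.
Variables (R : realType) (e : R) (B : R -> R).
Hypotheses (he : 0 < e <= 1) (hB : admissible_B B).
Variables (L : R) (xi : 'I_3 -> V R -> R).
Hypothesis hxi : forall i, C1b L (xi i).
Implicit Types (h u x Y v w : V R) (i j : 'I_3).
Local Notation EY := (EY e B).
Local Notation Ann := (Ann e).
Local Notation okY := (okY e).
Local Notation V0 := (((0, 0), 0) : V R).
Local Notation zeta := (zeta e B xi).
Local Notation dzeta := (dzeta e B xi).
Local Notation Psi := (Psi e B xi).
Local Notation phi := (fphi xi).

Definition zfield del w j v := 2 * e ^+ 2 * zreg e B xi del w j v.

Lemma fphi_bounded (eta : 'I_3 -> V R -> R) : (forall i, exists M, C1b M (eta i)) ->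
  exists M, forall v, `|fphi eta v| <= M.
Proof.
move=> H; have [M0 h0] := H i0; have [M1 h1] := H i1; have [M2 h2] := H i2.
have [p0 k0] := C1b_bounded h0; have [p1 k1] := C1b_bounded h1; have [p2 k2] := C1b_bounded h2.
have K i M p v : C1b M (eta i) -> (forall v, `|eta i v| <= p) ->
    `|- 2 * partial (eta i) i v - eta i v ^+ 2| <= 2 * M + p ^+ 2.
  move=> hM hp; apply: (le_trans (ler_normB _ _)); apply: lerD.
    by rewrite normrM normrN (ger0_norm (ler0n _ 2)) ler_wpM2l//; exact: C1b_le hM i v.
  by rewrite normrX lerXn2r ?nnegrE// (le_trans _ (hp v)).
exists ((2 * M0 + p0 ^+ 2) + (2 * M1 + p1 ^+ 2) + (2 * M2 + p2 ^+ 2)) => v.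
rewrite /fphi sum3E; apply: (le_trans (ler_normD _ _)); apply: lerD; last exact: K.
by apply: (le_trans (ler_normD _ _)); apply: lerD; exact: K.
Qed.

Lemma fphi_cvg (eta : 'I_3 -> V R -> R) : (forall i, exists M, C1b M (eta i)) ->
  forall (x : nat -> V R) (y : V R), cvg3 x y -> fphi eta (x n) @[n --> \oo] --> fphi eta y.
Proof.
move=> H x y xy; apply: cvg_sum3 => i; have [M hM] := H i.
apply: cvgB; first by apply: cvgM; [exact: cvg_cst|exact: (continuous_cvg3 (C1b_continuous hM (i := i)))].
by rewrite expr2; under eq_fun do rewrite expr2; apply: cvgM; exact: (continuous_cvg3 (C1b_continuous0 hM)).
Qed.

Lemma fphi_measurable (eta : 'I_3 -> V R -> R) : (forall i, exists M, C1b M (eta i)) ->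
  measurable_fun setT (fphi eta).
Proof.
by move=> H; apply: continuous_measurableV; apply: cvg3_continuous => x y; exact: fphi_cvg.
Qed.

Let hxi' i : exists M, C1b M (xi i). Proof. by exists L. Qed.

Lemma measurable_separately (F : V R -> V R -> R) :
  (forall (vn wn : nat -> V R) (v w : V R), cvg3 vn v -> cvg3 wn w -> F (vn n) (wn n) @[n --> \oo] --> F v w) ->
  measurable_fun setT (fun z : V R * V R => F z.1 z.2).
Proof.
move=> H; apply: measurable_caratheodoryV => [w|v].
- apply: continuous_measurableV; apply: cvg3_continuous => x y xy.
  by apply: (H x (fun=> w)) => //; exact: cvg3_cst.
- apply: cvg3_continuous => x y xy.
  by apply: (H (fun=> v) x) => //; exact: cvg3_cst.
Qed.

Definition offdiag v w : R := (subV v w != V0)%:R.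

Lemma cutoff_lim u : cutoff n.+1%:R^-1 u @[n --> \oo] --> ((u != V0)%:R : R).
Proof.
have [->|u0] := eqVneq u V0.
  apply: cvg_ext (cvg_cst (0 : R)) _ => n.
  by rewrite /cutoff (_ : dotV V0 V0 = 0) ?mul0r// /dotV /= !mulr0 !addr0.
have uu : dotV u u != 0 by rewrite dotV_eq0.
have -> : true%:R = dotV u u / dotV u u by rewrite divff.
apply: cvgM; first exact: cvg_cst.
have h1 : n.+1%:R^-1 + dotV u u @[n --> \oo] --> (0 + dotV u u : R).
  by apply: cvgD; [exact: cvg_harmonic|exact: cvg_cst].
by rewrite add0r in h1; apply: cvgV; [exact: uu|exact: h1].
Qed.

Lemma measurable_offdiag : measurable_fun setT (fun z : V R * V R => offdiag z.1 z.2).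
Proof.
apply: (measurable_fun_cvg (h := fun n (z : V R * V R) => cutoff n.+1%:R^-1 (subV z.1 z.2))).
  move=> n; apply: (@measurable_separately (fun v w => cutoff n.+1%:R^-1 (subV v w))).
  move=> vn wn v w cv cw; have cd := cvg3_dot (cvg3_sub cv cw) (cvg3_sub cv cw).
  apply: cvgM => //; apply: cvgV; last by apply: cvgD => //; exact: cvg_cst.
  by rewrite gt_eqF// ltr_wpDr ?dotV_ge0.
by move=> z _; exact: cutoff_lim.
Qed.

Definition Phi v w := EY (subV v w) (fun Y => phi (addV (cm v w) Y)).

Lemma Phi_le : exists M, 0 <= M /\ forall v w, `|Phi v w| <= M.
Proof.
have [M hM] := fphi_bounded hxi'; exists M; split; first exact: le_trans (normr_ge0 _) (hM V0).
by move=> v w; apply: (EY_norm he hB); [exact: (okY_fphiD e hxi)|].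
Qed.

Lemma measurable_Phi : measurable_fun setT (fun z : V R * V R => offdiag z.1 z.2 * Phi z.1 z.2).
Proof.
have [M [M0 hM]] := Phi_le; have [M' hM'] := fphi_bounded hxi'.
apply: (measurable_fun_cvg (h := fun n (z : V R * V R) => cutoff n.+1%:R^-1 (subV z.1 z.2) * Phi z.1 z.2)); last first.
  by move=> z _; apply: cvgM; [exact: cutoff_lim|exact: cvg_cst].
move=> n; have d0 : 0 < n.+1%:R^-1 :> R by rewrite invr_gt0.
apply: (@measurable_separately (fun v w => cutoff n.+1%:R^-1 (subV v w) * Phi v w)) => vn wn v w cv cw.
have cu := cvg3_sub cv cw; have cd := cvg3_dot cu cu.
have cc : cvg3 (fun n => cm (vn n) (wn n)) (cm v w).
  by apply: cvg3_scale; [exact: cvg_cst|exact: (cvg3_add cv cw)].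
have cc1 : cutoff n.+1%:R^-1 (subV (vn n0) (wn n0)) @[n0 --> \oo] --> cutoff n.+1%:R^-1 (subV v w).
  apply: cvgM => //; apply: cvgV; last by apply: cvgD => //; exact: cvg_cst.
  by rewrite gt_eqF// ltr_wpDr ?dotV_ge0.
have [u0|u0] := eqVneq (subV v w) V0; last first.
  apply: cvgM => //; apply: (EY_cvg he hB (M := M') cu u0).
  - by move=> k; have [] := okY_fphiD e hxi (subV v w) (cm (vn k) (wn k)).
  - by have [] := okY_fphiD e hxi (subV v w) (cm v w).
  - by [].
  - by move=> Yn Y _ cY; apply: (fphi_cvg hxi'); exact: cvg3_add.
have c0 : cutoff n.+1%:R^-1 V0 = 0 by rewrite /cutoff (_ : dotV V0 V0 = 0) ?mul0r// /dotV /= !mulr0 !addr0.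
rewrite u0 c0 mul0r; rewrite u0 c0 in cc1.
apply: (@squeeze_cvgr _ _ _ _ (fun k => - (cutoff n.+1%:R^-1 (subV (vn k) (wn k)) * M))
    (fun k => cutoff n.+1%:R^-1 (subV (vn k) (wn k)) * M)).
- apply: nearW => k; rewrite -ler_norml normrM (ger0_norm (cutoff_ge0 d0 _)).
  by rewrite ler_wpM2l// cutoff_ge0.
- by rewrite -oppr0; apply: cvgN; rewrite -(mul0r M); apply: cvgM => //; exact: cvg_cst.
- by rewrite -(mul0r M); apply: cvgM => //; exact: cvg_cst.
Qed.

Lemma zfield_C1b del w j : 0 < del -> C1b (400 * L) (zfield del w j).
Proof. by move=> d0; exact: (zreg_C1b he hB hxi d0 w j).1. Qed.

Lemma fphi_zfield_bounded : exists M, forall del w v, 0 < del -> `|fphi (zfield del w) v| <= M.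
Proof.
have K j : exists p, forall del w v, 0 < del -> `|zfield del w j v| <= p.
  have [p hp] := C1b_bounded (hxi j); have [q hq] := zeta_bounded he hB hxi j.
  exists (2 * e ^+ 2 * (p + (`|q| + p))) => del w v d0.
  have e2 : 0 <= 2 * e ^+ 2 by rewrite mulr_ge0 ?sqr_ge0.
  by rewrite /zfield normrM (ger0_norm e2) ler_wpM2l//; exact: (zreg_le d0 _ _ hp hq).
have [p0 k0] := K i0; have [p1 k1] := K i1; have [p2 k2] := K i2.
exists ((2 * (400 * L) + p0 ^+ 2) + (2 * (400 * L) + p1 ^+ 2) + (2 * (400 * L) + p2 ^+ 2)) => del w v d0.
have Q i p : (forall del w v, 0 < del -> `|zfield del w i v| <= p) ->
    `|- 2 * partial (zfield del w i) i v - zfield del w i v ^+ 2| <= 2 * (400 * L) + p ^+ 2.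
  move=> hp; apply: (le_trans (ler_normB _ _)); apply: lerD.
    by rewrite normrM normrN (ger0_norm (ler0n _ 2)) ler_wpM2l//; exact: C1b_le (zfield_C1b w i d0) i v.
  by rewrite normrX lerXn2r ?nnegrE ?hp// (le_trans _ (hp del w v d0)).
rewrite /fphi sum3E; apply: (le_trans (ler_normD _ _)); apply: lerD; last exact: Q.
by apply: (le_trans (ler_normD _ _)); apply: lerD; exact: Q.
Qed.

Lemma fphi_zfield_cvg v w : subV v w != V0 -> fphi (zfield n.+1%:R^-1 w) v @[n --> \oo] --> Psi v w.
Proof.
move=> u0; apply: cvg_sum3 => j.
have cl : cutoff n.+1%:R^-1 (subV v w) @[n --> \oo] --> ((subV v w != V0)%:R : R) by exact: cutoff_lim.
rewrite u0 in cl.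
have dl i : dcutoff n.+1%:R^-1 (subV v w) i @[n --> \oo] --> 0.
  have uu : dotV (subV v w) (subV v w) != 0 by rewrite dotV_eq0.
  have h1 : (n.+1%:R^-1 + dotV (subV v w) (subV v w))^-1 @[n --> \oo] --> (dotV (subV v w) (subV v w))^-1.
    have h0 : n.+1%:R^-1 + dotV (subV v w) (subV v w) @[n --> \oo] --> (0 + dotV (subV v w) (subV v w) : R).
      by apply: cvgD; [exact: cvg_harmonic|exact: cvg_cst].
    by rewrite add0r in h0; apply: cvgV; [exact: uu|exact: h0].
  rewrite /dcutoff -(mul0r ((dotV (subV v w) (subV v w))^-1 ^+ 2)).
  under eq_fun do rewrite -exprVn; apply: cvgM.
    rewrite -(mul0r (Defs.coord (subV v w) i)); apply: cvgM; last exact: cvg_cst.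
    by rewrite -(mulr0 2); apply: cvgM; [exact: cvg_cst|exact: cvg_harmonic].
  by rewrite expr2; exact: (cvgM h1 h1).
apply: cvgB.
  apply: cvgM; first exact: cvg_cst.
  have E n : partial (zfield n.+1%:R^-1 w j) j v = 2 * e ^+ 2 * dzreg e B xi n.+1%:R^-1 w j j v.
    have d0 : 0 < n.+1%:R^-1 :> R by rewrite invr_gt0.
    exact: (zreg_C1b he hB hxi d0 w j).2.
  apply: cvg_ext E; apply: cvgM; first exact: cvg_cst.
  have h : dzreg e B xi n.+1%:R^-1 w j j v @[n --> \oo] --> 4^-1 * partial (xi j) j (cm v w) +
      (0 * (zeta w j v - 2^-1 * xi j (cm v w)) + 1 * (dzeta w j j v - 4^-1 * partial (xi j) j (cm v w))).
    apply: cvgD; first exact: cvg_cst.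
    apply: cvgD; first by apply: cvgM; [exact: dl|exact: cvg_cst].
    by apply: cvgM; [exact: cl|exact: cvg_cst].
  have E2 : 4^-1 * partial (xi j) j (cm v w) + (0 * (zeta w j v - 2^-1 * xi j (cm v w)) +
    1 * (dzeta w j j v - 4^-1 * partial (xi j) j (cm v w))) = dzeta w j j v by ring.
  by rewrite E2 in h.
have cz : zfield n.+1%:R^-1 w j v @[n --> \oo] --> 2 * e ^+ 2 * zeta w j v.
  apply: cvgM; first exact: cvg_cst.
  have h : zreg e B xi n.+1%:R^-1 w j v @[n --> \oo] --> 2^-1 * xi j (cm v w) + 1 * (zeta w j v - 2^-1 * xi j (cm v w)).
    apply: cvgD; first exact: cvg_cst.
    by apply: cvgM; [exact: cl|exact: cvg_cst].
  have E2 : 2^-1 * xi j (cm v w) + 1 * (zeta w j v - 2^-1 * xi j (cm v w)) = zeta w j v by ring.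
  by rewrite E2 in h.
by rewrite expr2; under eq_fun do rewrite expr2; exact: (cvgM cz cz).
Qed.

Lemma fphi_zfield_measurable del : 0 < del ->
  measurable_fun setT (fun z : V R * V R => fphi (zfield del z.2) z.1).
Proof.
move=> d0; apply: (@measurable_separately (fun v w => fphi (zfield del w) v)) => vn wn v w cv cw.
apply: cvg_sum3 => j; have hz : zfield del (wn n) j (vn n) @[n --> \oo] --> zfield del w j v.
  by apply: cvgM; [exact: cvg_cst|exact: (zreg_cvg he hB hxi d0)].
apply: cvgB; last by rewrite expr2; under eq_fun do rewrite expr2; exact: cvgM.
apply: cvgM; first exact: cvg_cst.
rewrite (zreg_C1b he hB hxi d0 w j).2; under eq_fun do rewrite (zreg_C1b he hB hxi d0 _ j).2.
by apply: cvgM; [exact: cvg_cst|exact: (dzreg_cvg he hB hxi d0)].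
Qed.

Lemma measurable_Psi : measurable_fun setT (fun z : V R * V R => offdiag z.1 z.2 * Psi z.1 z.2).
Proof.
apply: (measurable_fun_cvg (h := fun n (z : V R * V R) => offdiag z.1 z.2 * fphi (zfield n.+1%:R^-1 z.2) z.1)).
  by move=> n; apply: measurable_funM; [exact: measurable_offdiag|apply: fphi_zfield_measurable; rewrite invr_gt0].
move=> z _; rewrite /offdiag; have [_|u0] := eqVneq (subV z.1 z.2) V0.
  by rewrite mul0r; under eq_fun do rewrite mul0r; exact: cvg_cst.
by apply: cvgM; [exact: cvg_cst|exact: fphi_zfield_cvg].
Qed.

Lemma Psi_bounded : exists M, 0 <= M /\ forall v w, `|offdiag v w * Psi v w| <= M.
Proof.
have [M hM] := fphi_zfield_bounded.
have M0 : 0 <= M by apply: le_trans (hM 1 V0 V0 ltr01).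
exists M; split => // v w; rewrite /offdiag; have [_|u0] := eqVneq (subV v w) V0; first by rewrite mul0r normr0.
rewrite mul1r; have := fphi_zfield_cvg u0.
move=> /cvg_norm c; apply: (cvg_le c (cvg_cst M)) => n.
by apply: hM; rewrite invr_gt0.
Qed.

Variables (f : V R -> R) (X : R).
Hypotheses (f0 : forall v, 0 <= f v) (fi : L1 (mu3 R) f) (f1 : Int (mu3 R) f = 1)
  (hX : forall eta, (forall i, C1b (400 * L) (eta i)) -> Int (mu3 R) (fun v => f v * fphi eta v) <= X).

Let mf := L1_measurable fi.

Lemma mu3_set1 w : mu3 R [set w] = 0%E.
Proof.
have m1 : measurable [set w].
  have -> : [set w] = ([set w.1.1] `*` [set w.1.2]) `*` [set w.2].
    apply/seteqP; split => [v /= ->//|[[v1 v2] v3]] /= [[-> ->] ->].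
    by case: w => -[].
  by do 2?apply: measurableX; exact: measurable_set1.
have E : (mu3 R [set w] = \int[sprod (lam R) (lam R)]_x lam R (xsection [set w] x))%E.
  exact: sprod_xsection.
rewrite E; apply: integral0_eq => x _.
have -> : xsection [set w] x = if x == w.1 then [set w.2] else set0.
  rewrite xsectionE; apply/seteqP; split => y /=.
    by move=> <-; rewrite eqxx.
  by case: eqP => // -> ->; case: w {m1 E}.
by case: ifP => _; [rewrite lamE lebesgue_measure_set1|exact: measure0].
Qed.

Lemma offdiag_ae w : {ae mu3 R, forall v, offdiag v w = 1}.
Proof.
exists [set w]; split.
- have -> : [set w] = ([set w.1.1] `*` [set w.1.2]) `*` [set w.2].
    apply/seteqP; split => [v /= ->//|[[v1 v2] v3]] /= [[-> ->] ->].
    by case: w => -[].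
  by do 2?apply: measurableX; exact: measurable_set1.
- exact: mu3_set1.
- move=> v /= h; apply: contrapT => vw; apply: h; rewrite /offdiag.
  have [E|//] := eqVneq (subV v w) V0; exfalso; apply: vw.
  by move: E => [h1 h2 h3]; apply: eqV; [move: h1|move: h2|move: h3]; lra.
Qed.

Let dbl (J : V R * V R -> R) := Int (mu3 R \x mu3 R)%E (fun z => f z.1 * f z.2 * J z).
Let bmeas (J : V R * V R -> R) := measurable_fun setT J /\ exists M, forall z, `|J z| <= M.

Let dbl_L1 J : bmeas J -> L1 (mu3 R \x mu3 R)%E (fun z => f z.1 * f z.2 * J z).
Proof. by move=> [mJ [M hM]]; exact: L1_prod fi fi mJ hM. Qed.

Let dbl_iter J : bmeas J -> L1 (mu3 R) (fun w => f w * Int (mu3 R) (fun v => f v * J (v, w))) /\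
  dbl J = Int (mu3 R) (fun w => f w * Int (mu3 R) (fun v => f v * J (v, w))).
Proof.
move=> hJ; have := Int_fubini21 (dbl_L1 hJ).
have E : (fun y => Int (mu3 R) (fun x => f (x, y).1 * f (x, y).2 * J (x, y))) =
   (fun w => f w * Int (mu3 R) (fun v => f v * J (v, w))).
  apply/funext => w /=; rewrite -IntZ; last first.
    have [mJ [M hM]] := hJ; apply: (L1M fi (M := M)) => //.
    exact: (measurableT_comp mJ (measurable_pair2 w)).
  by congr Int; apply/funext => v; rewrite mulrCA mulrA.
by rewrite E => -[h ->].
Qed.

Let dbl_swap J : bmeas J -> dbl (fun z => J (z.2, z.1)) = dbl J.
Proof.
move=> hJ; have [mJ [M hM]] := hJ.
have hJ' : bmeas (fun z => J (z.2, z.1)).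
  split; last by exists M.
  by apply: (measurableT_comp mJ); exact: measurable_swap.
rewrite {1}/dbl /dbl -(Int_fubini21 (dbl_L1 hJ')).2 -(Int_fubini12 (dbl_L1 hJ)).2.
by congr Int; apply/funext => w; congr Int; apply/funext => v /=; rewrite [f v * f w]mulrC.
Qed.

Let dblD J1 J2 : bmeas J1 -> bmeas J2 -> bmeas (fun z => J1 z + J2 z) /\
  dbl (fun z => J1 z + J2 z) = dbl J1 + dbl J2.
Proof.
move=> h1 h2; split.
  have [m1 [M1 k1]] := h1; have [m2 [M2 k2]] := h2; split; first exact: measurable_funD.
  by exists (M1 + M2) => z; rewrite (le_trans (ler_normD _ _))// lerD.
rewrite /dbl -IntD; [|exact: dbl_L1|exact: dbl_L1].
by congr Int; apply/funext => z; rewrite mulrDr.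
Qed.

Let dblZ k J : bmeas J -> bmeas (fun z => k * J z) /\ dbl (fun z => k * J z) = k * dbl J.
Proof.
move=> h1; split.
  have [m1 [M1 k1]] := h1; split; first exact: measurable_funM.
  by exists (`|k| * M1) => z; rewrite normrM ler_wpM2l.
rewrite /dbl -IntZ; last exact: dbl_L1.
by congr Int; apply/funext => z; rewrite mulrCA.
Qed.

Let dbl_le J1 J2 : bmeas J1 -> bmeas J2 -> (forall z, J1 z <= J2 z) -> dbl J1 <= dbl J2.
Proof.
move=> h1 h2 h; apply: Int_le; [exact: dbl_L1|exact: dbl_L1|].
by move=> z; rewrite ler_wpM2l// mulr_ge0.
Qed.

Let P1 (z : V R * V R) := offdiag z.1 z.2 * Phi z.1 z.2.
Let Q1 (z : V R * V R) := offdiag z.1 z.2 * Psi z.1 z.2.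

Let od_le v w : `|offdiag v w| <= 1.
Proof. by rewrite /offdiag; case: (_ != _); rewrite ?normr0 ?normr1. Qed.

Let bP : bmeas P1.
Proof.
split; first exact: measurable_Phi.
have [M [M0 hM]] := Phi_le; exists M => z; rewrite normrM -[leRHS]mul1r ler_pM//; exact: od_le.
Qed.

Let bQ : bmeas Q1.
Proof. by split; [exact: measurable_Psi|have [M [_ hM]] := Psi_bounded; exists M => z; exact: hM]. Qed.

Let bswap J : bmeas J -> bmeas (fun z => J (z.2, z.1)).
Proof.
move=> [mJ [M hM]]; split; last by exists M.
by apply: (measurableT_comp mJ); exact: measurable_swap.
Qed.

(** For each fixed [w] the regularized field satisfies the derivative bound in [hX]; the cutoff is
    removed by dominated convergence, the diagonal being null, and averaging over [w] uses mass
    one. *)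
Let Q1_le : dbl Q1 <= X.
Proof.
have [h ->] := dbl_iter bQ.
suff K w : Int (mu3 R) (fun v => f v * Q1 (v, w)) <= X.
  have : Int (mu3 R) (fun w => f w * Int (mu3 R) (fun v => f v * Q1 (v, w))) <= Int (mu3 R) (fun w => X * f w).
    apply: Int_le => //; first exact: L1Z.
    by move=> w; rewrite [X * _]mulrC ler_wpM2l.
  by rewrite IntZ// f1 mulr1.
have [M hM] := fphi_zfield_bounded.
have d0 n : 0 < n.+1%:R^-1 :> R by rewrite invr_gt0.
have mz n : measurable_fun setT (fun v => fphi (zfield n.+1%:R^-1 w) v).
  by apply: fphi_measurable => i; exists (400 * L); exact: zfield_C1b.
have mQw : measurable_fun setT (fun v => Q1 (v, w)).
  by apply: (measurableT_comp bQ.1); exact: measurable_pair2.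
have [_ c] : L1 (mu3 R) (fun v => f v * Q1 (v, w)) /\
    Int (mu3 R) (fun v => f v * fphi (zfield n.+1%:R^-1 w) v) @[n --> \oo] --> Int (mu3 R) (fun v => f v * Q1 (v, w)).
  apply: (Int_dct_ae _ _ (L1Z M fi)).
  - by move=> n; apply: measurable_funM.
  - exact: measurable_funM.
  - by move=> n v; rewrite normrM ger0_norm// mulrC ler_wpM2r// hM.
  - apply: filterS (offdiag_ae w) => v ov; apply: cvgM; first exact: cvg_cst.
    rewrite /Q1 /= ov mul1r; apply: fphi_zfield_cvg.
    by move: ov; rewrite /offdiag; case: eqP => // _ /eqP; rewrite eq_sym oner_eq0.
apply: (cvg_le c (cvg_cst X)) => n; apply: hX => i; exact: zfield_C1b.
Qed.

(** [collision_inequality] is about sums symmetric in [v] and [w]; exchanging the variables in the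
    double integral shows that the two halves of each sum contribute equally. *)
Let P1_le : dbl P1 <= X / e ^+ 2.
Proof.
have e2 : 0 < e ^+ 2 by rewrite exprn_gt0//; case/andP: he.
have [b1 E1] := dblD bP (bswap bP); have [b2 E2] := dblD bQ (bswap bQ).
have [b3 E3] := dblZ (e ^+ 2)^-1 b2.
have := dbl_le b1 b3; rewrite E1 E3 E2 !dbl_swap// => /(_ _) H.
have {}H : dbl P1 + dbl P1 <= (e ^+ 2)^-1 * (dbl Q1 + dbl Q1).
  apply: H => -[v w]; rewrite /P1 /Q1 /= /offdiag (subVC v w).
  have [E|u0] := eqVneq (subV v w) V0.
    have -> : scaleV (-1) (subV v w) = V0 by rewrite E; apply: eqV => /=; ring.
    by rewrite eqxx !mul0r addr0 mulr0.
  rewrite (scaleN1_neq0 u0) !mul1r; apply: le_trans (collision_inequality he hB hxi u0).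
  rewrite /Phi lerD2l (subVC v w) cmC (EY_opp he hB u0); last exact: (okY_fphiD e hxi).
  exact: lexx.
have k0 : 0 <= (e ^+ 2)^-1 by rewrite invr_ge0 ltW.
exact: (double_le H (ler_wpM2l k0 Q1_le)).
Qed.

(** For equal velocities the annulus reduces to the origin, so the collision changes nothing. *)
Let Phi_diag v w : Phi v w - phi v = offdiag v w * (Phi v w - phi v).
Proof.
rewrite /offdiag; have [E|u0] := eqVneq (subV v w) V0; last by rewrite mul1r.
rewrite mul0r /Phi E; apply/eqP; rewrite subr_eq0; apply/eqP.
rewrite -[RHS](EY_cst he hB V0); apply: (@eq_EY R e B he V0) => Y /andP[_].
have -> : enorm V0 = 0 by apply/eqP; rewrite enorm_eq0.
rewrite mul0r => hY; have : Y == V0 by rewrite -enorm_eq0 eq_le hY enorm_ge0.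
move=> /eqP ->; congr fphi.
by move: E => [h1 h2 h3]; apply: eqV => /=; [move: h1|move: h2|move: h3]; lra.
Qed.

(** [sphere_int] carries the factor [3] of the cone measure and [W] the factor [3 / (4 pi)], whence
    [4 pi]. The restriction of [B] to [[-1, 1]] in [Bt] is harmless by Cauchy-Schwarz. *)
Let sphereE v w : sphere_int (fun n => B (dotV n (scaleV (enorm (subV v w))^-1 (subV v w))) * f v * f w *
  (phi (vprime e v w n) - phi v)) = 4 * pi * (f v * f w * (Phi v w - phi v)).
Proof.
set u := subV v w.
have [E|u0] := eqVneq u V0.
  rewrite Phi_diag /offdiag -/u E eqxx mul0r !mulr0 /sphere_int.
  rewrite (_ : (fun x => _) = (fun=> 0)); last first.
    apply/funext => x; rewrite (_ : vprime e v w _ = v); first by rewrite subrr mulr0.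
    by rewrite /vprime -/u E; apply: eqV; rewrite /dotV /=; ring.
  have := @leb3_Int_in R [set x | enorm x <= 1] (fun=> 0).
  rewrite (_ : _ \_ _ = (fun=> 0)); last by apply/funext => x; rewrite patchE; case: ifP.
  by move=> -> ; rewrite ?Int0 ?mulr0//; exact: L1_0.
have pi0 : 4 * pi != 0 :> R by rewrite mulf_neq0// gt_eqF// pi_gt0.
have ok := okYB (okY_fphiD e hxi u (cm v w)) (okY_cst e u (phi v)).
have iW := EY_L1 he hB ok.
pose F x := (4 * pi) / 3 * (f v * f w) * (W B (dirV u) x * (phi (addV (cm v w) (Yv e u (unitV x))) - phi v)).
have Epatch : (fun x => B (dotV (scaleV (enorm x)^-1 x) (scaleV (enorm u)^-1 u)) * f v * f w *
    (phi (vprime e v w (scaleV (enorm x)^-1 x)) - phi v)) \_ [set x | enorm x <= 1] = F.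
  apply/funext => x; rewrite patchE /F /W indicE.
  have -> : addV (cm v w) (Yv e u (unitV x)) = vprime e v w (scaleV (enorm x)^-1 x).
    by rewrite /vprime /Yv -/u /unitV; move: (scaleV (enorm x)^-1 x) => n; move: (_ * dotV u _) => c; rewrite /u /cm; apply: eqV => /=; field.
  case: ifP => _; last by rewrite mulr0 !mul0r mulr0.
  rewrite mulr1 /dirV (negbTE u0) -/(unitV x) -/(unitV u) /Bt patchE ifT; last first.
    rewrite inE /= in_itv /= -ler_norml.
    apply: (le_trans (cauchy_schwarzV _ _)); rewrite (enorm_unitV u0) mulr1.
    have [->|x0] := eqVneq x V0; last by rewrite enorm_unitV.
    rewrite /unitV (_ : scaleV _ _ = V0); last by apply: eqV => /=; rewrite mulr0.
    by rewrite (_ : enorm V0 = 0) //; apply/eqP; rewrite enorm_eq0.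
  have EE (p a b c d : R) : p != 0 -> a * b * c * d = 4 * p / 3 * (b * c) * (3 / (4 * p) * a * d).
    by move=> ?; field.
  by apply: EE; rewrite gt_eqF// pi_gt0.
rewrite /sphere_int -/u leb3_Int_in; rewrite Epatch; last exact: L1Z.
rewrite /F IntZ// -/(EY u (fun Y => phi (addV (cm v w) Y) - phi v)) (EYB he hB)//; last exact: okY_cst.
  by rewrite EY_cst// /Phi -/u; field.
exact: (okY_fphiD e hxi).
Qed.

(** The gain term is bounded by [P1_le]; the loss term is exactly the integral of [f phi], because
    the collision law and [f] both have mass one. *)
Lemma Qform_le : Qform e B f phi <= X / e ^+ 2 - Int (mu3 R) (fun v => f v * phi v).
Proof.
have pi0 : 4 * pi != 0 :> R by rewrite mulf_neq0// gt_eqF// pi_gt0.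
have [M hM] := fphi_bounded hxi'.
have mphi := fphi_measurable hxi'.
pose O1 (z : V R * V R) := offdiag z.1 z.2 * phi z.1.
have bO : bmeas O1.
  split; first by apply: measurable_funM; [exact: measurable_offdiag|exact: (measurableT_comp mphi measurable_fst)].
  by exists M => z; rewrite normrM -[leRHS]mul1r ler_pM//; exact: od_le.
have [bO' EO'] := dblZ (-1) bO; have [bJ EJ] := dblD bP bO'.
have EO : dbl O1 = Int (mu3 R) (fun v => f v * phi v).
  have [_ ->] := dbl_iter bO.
  have K w : Int (mu3 R) (fun v => f v * O1 (v, w)) = Int (mu3 R) (fun v => f v * phi v).
    apply: Int_eq_ae.
    - by apply: measurable_funM => //; exact: (measurableT_comp bO.1 (measurable_pair2 w)).
    - exact: measurable_funM.
    - by apply: filterS (offdiag_ae w) => v ov; rewrite /O1 /= ov mul1r.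
  under eq_fun do rewrite K mulrC.
  by rewrite IntZ// f1 mulr1.
have -> : Qform e B f phi = dbl (fun z => P1 z + -1 * O1 z).
  have [iJ ->] := dbl_iter bJ.
  rewrite /Qform.
  have K w : Rintegral (@leb3 R) setT (fun v => sphere_int (fun n =>
       B (dotV n (scaleV (enorm (subV v w))^-1 (subV v w))) * f v * f w * (phi (vprime e v w n) - phi v))) =
     4 * pi * (f w * Int (mu3 R) (fun v => f v * (P1 (v, w) + -1 * O1 (v, w)))).
    have iw : L1 (mu3 R) (fun v => f v * (P1 (v, w) + -1 * O1 (v, w))).
      have [mJ [M' hM']] := bJ; apply: (L1M fi (M := M')) => [|v]; last exact: (hM' (v, w)).
      exact: (measurableT_comp mJ (measurable_pair2 w)).
    have E : (fun v => sphere_int (fun n =>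
       B (dotV n (scaleV (enorm (subV v w))^-1 (subV v w))) * f v * f w * (phi (vprime e v w n) - phi v))) =
       (fun v => 4 * pi * f w * (f v * (P1 (v, w) + -1 * O1 (v, w)))).
      by apply/funext => v; rewrite sphereE Phi_diag /P1 /O1 /=; ring.
    by rewrite E leb3_Int; [rewrite IntZ// mulrA|exact: L1Z].
  rewrite (_ : (fun w => Rintegral _ _ _) = (fun w => 4 * pi * (f w * Int (mu3 R) (fun v => f v * (P1 (v, w) + -1 * O1 (v, w))))));
    last exact/funext.
  by rewrite leb3_Int; [rewrite IntZ// mulKf|exact: L1Z].
by rewrite EJ EO' EO mulN1r lerD2r; exact: P1_le.
Qed.

End CollisionBound.

(** * Propagation of the dual functional in time *)

Section TimeEvolution.
Variable R : realType.

Lemma exp_coeffM (c s : R) n : exp_coeff (c * s) n = c ^+ n / n`!%:R * s ^+ n.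
Proof. by rewrite /exp_coeff /= exprMn mulrAC. Qed.

Lemma gronwall_gain (I E a b m q k : R) : 0 <= a -> q <= (I * E + b) * k - m ->
  0 <= (k - 1) * I * E + k * b - q + (I * E + a - m).
Proof. by lra. Qed.

Lemma is_derive_pow (t : R) n : is_derive t 1 (fun s : R => s ^+ n.+1) (n.+1%:R * t ^+ n).
Proof.
elim: n => [|n IH].
  by rewrite expr0 mulr1; under eq_fun do rewrite expr1; exact: is_derive_id.
have D : is_derive t 1 (fun s : R => s * s ^+ n.+1) _ := is_deriveM (is_derive_id t (1 : R)) IH.
under eq_fun do rewrite exprS.
by apply: (is_derive_eq D); rewrite /GRing.scale /= [in RHS]mulrS exprS; ring.
Qed.

(** The weak equation gives derivatives for positive times and right continuity at [0], which is
    what the mean value theorem needs on [[0, t]]. *)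
Lemma nondecreasing_from0 (g dg : R -> R) : g t @[t --> 0^'+] --> g 0 ->
  (forall t : R, 0 < t -> is_derive t 1 g (dg t)) -> (forall t, 0 < t -> 0 <= dg t) ->
  forall t, 0 <= t -> g 0 <= g t.
Proof.
move=> g0 hd hp t; rewrite le_eqVlt => /orP[/eqP <-//|t0].
have cd x : 0 < x -> {for x, continuous g}.
  by move=> x0; apply: differentiable_continuous; apply/derivable1_diffP; have [] := hd x x0.
have ct : {within `[0, t], continuous g}.
  apply/continuous_within_itvP => //; split => //.
    by move=> x; rewrite in_itv /= => /andP[x0 _]; exact: cd.
  by apply: cvg_at_left_filter; exact: cd.
have hd' x : x \in `]0, t[ -> is_derive x 1 g (dg x).
  by rewrite in_itv /= => /andP[x0 _]; exact: hd.
have [c cin E] := MVT (f := g) t0 hd' ct.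
rewrite -subr_ge0 E mulr_ge0 ?subr_ge0 ?(ltW t0)//.
by apply: hp; move: cin; rewrite in_itv /= => /andP[].
Qed.

Variables (e : R) (B : R -> R).
Hypotheses (he : 0 < e <= 1) (hB : admissible_B B).
Variable f : V R -> R -> R.
Hypothesis sol : solves_E1 e B f.
Hypothesis mass0 : Int (mu3 R) (fun v => f v 0) = 1.

Let f_ge0 t v : 0 <= t -> 0 <= f v t. Proof. by move=> t0; have [_ []] := sol.1 t t0. Qed.
Let f_L1 t : 0 <= t -> L1 (mu3 R) (fun v => f v t).
Proof. by move=> t0; have [_ [_ h]] := sol.1 t t0; apply/leb3_L1. Qed.

(** [solves_E1] gives integrability for nonnegative times only, so the integrals for [leb3] and
    [mu3] are identified there and limits are compared near the relevant time. *)
Lemma moment_evolution phi : bounded_continuous phi -> let m t := Int (mu3 R) (fun v => f v t * phi v) in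
  m t @[t --> 0^'+] --> m 0 /\ forall t : R, 0 < t -> is_derive t 1 m (Qform e B (fun v => f v t) phi).
Proof.
move=> hphi; have := sol.2 phi hphi; have [cphi [M hM]] := hphi.
have mphi := continuous_measurableV cphi.
have E t : 0 <= t -> Rintegral (@leb3 R) setT (fun v => f v t * phi v) = Int (mu3 R) (fun v => f v t * phi v).
  by move=> t0; apply: leb3_Int; apply: (L1M (f_L1 t0) mphi hM).
move=> /= [h1 h2]; split.
  rewrite -(E 0)//; apply: cvg_trans h1; apply: near_eq_cvg; near=> t.
  by rewrite E//; apply: ltW; near: t; exact: nbhs_right_gt.
move=> t t0; have [d1 d2] := h2 t t0.
have D : is_derive t 1 (fun t => Rintegral (@leb3 R) setT (fun v => f v t * phi v)) (Qform e B (fun v => f v t) phi).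
  by apply: DeriveDef => //; rewrite -d2 derive1E.
apply/derive_seqP => s s0 s_0; move/derive_seqP: D => /(_ s s0 s_0).
apply: cvg_trans; apply: near_eq_cvg.
have := s_0 => /cvgr0_norm_lt/(_ _ t0); apply: filterS => n hn.
rewrite !E ?(ltW t0)//.
by move: hn; rewrite ltr_norml => /andP[h _]; rewrite -lerBlDl sub0r ltW.
Unshelve. all: by end_near. Qed.

Lemma mass_conservation t : 0 <= t -> Int (mu3 R) (fun v => f v t) = 1.
Proof.
have bc : bounded_continuous (fun _ : V R => 1 : R).
  by split; [exact: cst_continuous|exists 1 => v; rewrite normr1].
have [h1 h2] := moment_evolution bc.
have Q0 s : Qform e B (fun v => f v s) (fun=> 1) = 0.
  rewrite /Qform (_ : (fun w => Rintegral _ _ _) = (fun=> 0)).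
    by rewrite (@leb3_Int R (fun=> 0) (L1_0 _)) Int0 mulr0.
  apply/funext => w; rewrite (_ : (fun v => sphere_int _) = (fun=> 0)).
    by rewrite (@leb3_Int R (fun=> 0) (L1_0 _)) Int0.
  apply/funext => v; rewrite /sphere_int (_ : (fun x => _) = (fun=> 0)); last first.
    by apply/funext => x; rewrite subrr mulr0.
  rewrite leb3_Int_in; rewrite (_ : _ \_ _ = (fun=> 0)) ?Int0 ?mulr0//; try exact: L1_0;
  by apply/funext => x; rewrite patchE; case: ifP.
have h2' (s : R) : 0 < s -> is_derive s 1 (fun t => Int (mu3 R) (fun v => f v t * 1)) 0.
  by move=> s0; have := h2 s s0; rewrite Q0.
have E s : (fun v => f v s * 1) = (fun v => f v s) by apply/funext => v; rewrite mulr1.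
move=> t0; rewrite -mass0 -(E t) -(E 0); apply/eqP; rewrite eq_le; apply/andP; split.
  rewrite -lerN2; apply: (@nondecreasing_from0 (fun t => - Int (mu3 R) (fun v => f v t * 1)) (fun=> - 0)) => //.
  - exact: cvgN.
  - by move=> s s0; apply: is_deriveN; exact: h2'.
exact: (@nondecreasing_from0 (fun t => Int (mu3 R) (fun v => f v t * 1)) (fun=> 0)).
Qed.

Variable I0 : R.
Hypothesis hI0 : forall L (xi : 'I_3 -> V R -> R), (forall i, C1b L (xi i)) -> Int (mu3 R) (fun v => f v 0 * fphi xi v) <= I0.

Let K := (e ^+ 2)^-1.
Let K0 : 0 <= K. Proof. by rewrite invr_ge0 sqr_ge0. Qed.

(** Three coordinates, each contributing at most [2 L], as the squares have the favourable sign: a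
    bound by the derivatives alone, which starts the induction. *)
Lemma fphi_le6 L (xi : 'I_3 -> V R -> R) : (forall i, C1b L (xi i)) -> forall v, fphi xi v <= 6 * L.
Proof.
move=> h v; rewrite /fphi sum3E.
have k i : - 2 * partial (xi i) i v - xi i v ^+ 2 <= 2 * L.
  have := C1b_le (h i) i v; rewrite ler_norml => /andP[h1 h2]; have := sqr_ge0 (xi i v); lra.
by move: (k i0) (k i1) (k i2); lra.
Qed.

(** The second term is [6 L (400 K t)^N / N!]. Its derivative in [t] is [K] times the same term with
    [N] lowered by one and [L] replaced by [400 L], exactly the effect of one collision on the test
    field. *)
Let bnd N (L t : R) := I0 * expR ((K - 1) * t) + 6 * L * exp_coeff (K * 400 * t) N.

Let bnd_derive N L (t : R) : is_derive t 1 (bnd N.+1 L)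
  ((K - 1) * I0 * expR ((K - 1) * t) + K * (6 * (400 * L) * exp_coeff (K * 400 * t) N)).
Proof.
have lin c : is_derive t 1 (fun s : R => c * s) c.
  have := is_derive_affine 0 c (is_derive_id t (1 : R)); rewrite mulr1.
  by under eq_fun do rewrite add0r.
have h1 : is_derive t 1 (fun s => I0 * expR ((K - 1) * s)) ((K - 1) * I0 * expR ((K - 1) * t)).
  have := is_derive_affine 0 I0 (is_derive1_comp (is_derive_expR ((K - 1) * t)) (lin (K - 1))).
  by under eq_fun do rewrite add0r; move/is_derive_eq; apply; ring.
have h2 : is_derive t 1 (fun s => 6 * L * exp_coeff (K * 400 * s) N.+1) (K * (6 * (400 * L) * exp_coeff (K * 400 * t) N)).
  have hx : is_derive t 1 (fun s : R => s ^+ N.+1) (N.+1%:R * t ^+ N).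
    exact: is_derive_pow.
  have := is_derive_affine 0 (6 * L * ((K * 400) ^+ N.+1 / N.+1`!%:R)) hx.
  rewrite (_ : (fun y : R => _) = (fun s => 6 * L * exp_coeff (K * 400 * s) N.+1)); last first.
    by apply/funext => s; rewrite exp_coeffM add0r mulrA.
  move/is_derive_eq; apply; rewrite exp_coeffM factS natrM exprS.
  have n0 : N.+1%:R != 0 :> R by rewrite pnatr_eq0.
  have n1 : N`!%:R != 0 :> R by rewrite pnatr_eq0 -lt0n fact_gt0.
  move: (N.+1%:R) (N`!%:R) (t ^+ N) ((K * 400) ^+ N) n0 n1 => a b c d n0 n1.
  by field; rewrite n0 n1.
exact: is_deriveD.
Qed.

Lemma fisher_iteration N : forall L (xi : 'I_3 -> V R -> R), (forall i, C1b L (xi i)) -> forall t, 0 <= t ->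
  Int (mu3 R) (fun v => f v t * fphi xi v) <= bnd N L t.
Proof.
have I00 : 0 <= I0.
  have H : Int (mu3 R) (fun v => f v 0 * fphi (fun (_ : 'I_3) (_ : V R) => 0) v) <= I0.
    by apply: (hI0 (L := 0)) => i; exact: (C1b_cst (0 : R)).1.
  have E : (fun v => f v 0 * fphi (fun (_ : 'I_3) (_ : V R) => 0) v) = (fun=> 0).
    apply/funext => v; rewrite /fphi big1 ?mulr0// => i _.
    by rewrite (C1b_cst (0 : R)).2 mulr0 expr0n subr0.
  by rewrite E Int0 in H.
(* The case [N = 0] is the crude bound [6 L] together with conservation of mass. *)
elim: N => [|N IH] L xi hxi t t0; have bx i : exists M, C1b M (xi i) by exists L.
  rewrite /bnd /exp_coeff /= expr0 fact0 divr1 mulr1.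
  have [M hM] := fphi_bounded bx.
  have i1 : L1 (mu3 R) (fun v => f v t * fphi xi v) by apply: (L1M (f_L1 t0) (fphi_measurable bx) hM).
  have : Int (mu3 R) (fun v => f v t * fphi xi v) <= Int (mu3 R) (fun v => 6 * L * f v t).
    apply: Int_le => //; first exact: L1Z (f_L1 t0).
    by move=> v; rewrite mulrC ler_wpM2r ?f_ge0//; exact: fphi_le6.
  rewrite IntZ ?mass_conservation ?mulr1//; last exact: f_L1.
  by move=> h; apply: (le_trans h); rewrite lerDr mulr_ge0// expR_ge0.
have bc : bounded_continuous (fphi xi).
  by split; [apply: cvg3_continuous => x y; exact: fphi_cvg|exact: fphi_bounded].
have [m0 md] := moment_evolution bc.
pose m t := Int (mu3 R) (fun v => f v t * fphi xi v); rewrite -/m in m0 md.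
pose db t := (K - 1) * I0 * expR ((K - 1) * t) + K * (6 * (400 * L) * exp_coeff (K * 400 * t) N).
(* The weight [expR t] absorbs the loss term of the collision operator. *)
pose g t := expR t * (bnd N.+1 L t - m t).
pose dg t := expR t * (db t - Qform e B (fun v => f v t) (fphi xi)) + expR t * (bnd N.+1 L t - m t).
have g0 : 0 <= g 0.
  rewrite /g expR0 mul1r subr_ge0 /bnd mulr0 expR0 mulr1 /exp_coeff /= mulr0 expr0n /= mul0r mulr0 addr0.
  exact: hI0 hxi.
suff : g 0 <= g t.
  by move=> /(le_trans g0); rewrite /g pmulr_rge0 ?expR_gt0// subr_ge0.
apply: (@nondecreasing_from0 g dg _ _ _ t t0).
- apply: cvgM.
    by apply: cvg_at_right_filter; exact: continuous_expR.
  apply: cvgB; last exact: m0.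
  apply: cvg_at_right_filter.
  by apply: differentiable_continuous; apply/derivable1_diffP; have [] := bnd_derive N L 0.
- move=> s s0; have hs : is_derive s 1 (fun s => bnd N.+1 L s - m s) (db s - Qform e B (fun v => f v s) (fphi xi)) :=
    is_deriveB (bnd_derive N L s) (md s s0).
  apply: (is_derive_eq (is_deriveM (is_derive_expR s) hs)).
  by rewrite /dg /GRing.scale /=; congr (_ + _); exact: mulrC.
- move=> s s0; have sl := ltW s0.
  have mi := f_L1 sl.
  have := Qform_le he hB hxi (f := fun v => f v s) (X := bnd N (400 * L) s) (fun v => f_ge0 v sl) mi (mass_conservation sl).
  move=> /(_ (fun eta heta => IH (400 * L) eta heta s sl)) hQ.
  rewrite /dg -mulrDr mulr_ge0 ?expR_ge0//.
  apply: gronwall_gain; last exact: hQ.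
  have L0 : 0 <= L := le_trans (normr_ge0 _) (C1b_le (hxi i0) i0 ((0, 0), 0)).
  apply: mulr_ge0; first exact: mulr_ge0.
  apply: exp_coeff_ge0; apply: mulr_ge0; last exact: sl.
  by apply: mulr_ge0; first exact: K0.
Qed.

Lemma fisher_propagation L (xi : 'I_3 -> V R -> R) : (forall i, C1b L (xi i)) -> forall t, 0 <= t ->
  Int (mu3 R) (fun v => f v t * fphi xi v) <= I0 * expR ((K - 1) * t).
Proof.
move=> hxi t t0.
have h0 : 6 * L * exp_coeff (K * 400 * t) n @[n --> \oo] --> 0.
  rewrite -(mulr0 (6 * L)); apply: cvgM; first exact: cvg_cst.
  exact: cvg_series_cvg_0 (is_cvg_series_exp_coeff _).
have h1 : bnd n L t @[n --> \oo] --> I0 * expR ((K - 1) * t) + 0.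
  by apply: cvgD => //; exact: cvg_cst.
rewrite addr0 in h1; apply: (cvg_le (cvg_cst _) h1) => n.
exact: fisher_iteration.
Qed.

End TimeEvolution.

(** * The exponent as a function of the restitution coefficient *)

Section Rate.
Variables (R : realType) (B : R -> R).
Hypothesis hB : admissible_B B.

Lemma second_moment_le : Rintegral (@lebesgue_measure R) `[-1, 1] (fun s => s ^+ 2 * B s) <= 2.
Proof.
have [B0 [iB [_ E]]] := hB; rewrite -E.
have mB := measurable_int _ iB.
apply: le_Rintegral => //.
  apply: (le_integrable _ _ _ iB) => //.
    apply/measurable_EFinP; apply: measurable_funM; last exact/measurable_EFinP.
    by apply: measurable_funX; exact: measurable_id.
  move=> s hs /=; rewrite lee_fin normrM ler_piMl// normrX exprn_ile1//.
  by move: hs; rewrite /= in_itv /= ler_norml.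
move=> s hs; have := B0 s hs => b0; rewrite ler_piMl ?(ltW b0)//.
rewrite -real_normK ?num_real// exprn_ile1//.
by move: hs; rewrite /= in_itv /= ler_norml.
Qed.

(** Since [s^2 <= 1], twice [Ecoef] is at most [(1 - e^2) / 2]. What remains is
    [4 e^3 (1 + e) < 2 + e + 15 e^2], where the left side is at most [8 e^2]. *)
Lemma rate_pos e : 0 < e < 1 -> 0 < rate e B.
Proof.
move=> /andP[e0 e1]; have := second_moment_le.
rewrite /rate /Ecoef; move: (Rintegral _ _ _) => I hI.
have e3 : 0 < e ^+ 3 by rewrite exprn_gt0.
have h1 : 2 * ((1 - e ^+ 2) / 8 * I) <= (1 - e ^+ 2) / 2.
  have : 0 <= 1 - e ^+ 2 by rewrite subr_ge0 exprn_ile1// ltW.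
  by move=> q; have := ler_wpM2l q hI; lra.
rewrite subr_gt0; apply: (le_lt_trans h1).
rewrite ltr_pdivlMr; last by rewrite mulr_gt0.
have : 0 < (1 - e) * (2 + e + 15 * e ^+ 2 - 4 * e ^+ 3 * (1 + e)).
  apply: mulr_gt0; first by rewrite subr_gt0.
  have : e ^+ 3 <= e ^+ 2 by rewrite exprS ler_piMl ?sqr_ge0// ltW.
  have : e ^+ 4 <= e ^+ 2.
    by rewrite (_ : e ^+ 4 = e ^+ 2 * e ^+ 2); [rewrite ler_piMl ?sqr_ge0// exprn_ile1// ltW|ring].
  by have := sqr_ge0 e; rewrite !exprS !expr0; nra.
by rewrite !exprS !expr0; lra.
Qed.

(** After clearing denominators the difference is [(1 - e) (7 e^2 - 7 e + 2)], and the quadratic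
    factor is [7 (e - 1/2)^2 + 1/4]. *)
Lemma rate_ge e : 0 < e <= 1 -> (e ^+ 2)^-1 - 1 - 2 * Ecoef e B <= rate e B.
Proof.
move=> /andP[e0 e1]; rewrite /rate lerD2r.
rewrite ler_pdivlMr; last by rewrite mulr_gt0// exprn_gt0.
have -> : ((e ^+ 2)^-1 - 1) * (8 * e ^+ 3) = 8 * e * (1 - e ^+ 2) by field; rewrite gt_eqF.
have : 0 <= (1 - e) * (7 * (e - 2^-1) ^+ 2 + 4^-1).
  apply: mulr_ge0; first by rewrite subr_ge0.
  by have := sqr_ge0 (e - 2^-1); lra.
by rewrite !exprS !expr0; lra.
Qed.

Lemma rate_lim : rate x B @[x --> 1^'-] --> 0.
Proof.
apply: cvg_at_left_filter.
have -> : 0 = rate 1 B by rewrite /rate /Ecoef subrr expr1n subrr !mul0r mulr0 subrr.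
have ci : (x : R) @[x --> (1 : R)] --> (1 : R) by exact: cvg_id.
have c2 : (x ^+ 2 : R) @[x --> (1 : R)] --> (1 ^+ 2 : R) by rewrite expr2; under eq_fun do rewrite expr2; exact: cvgM.
have c3 : (x ^+ 3 : R) @[x --> (1 : R)] --> (1 ^+ 3 : R) by rewrite exprS; under eq_fun do rewrite exprS; exact: cvgM.
apply: cvgB.
  apply: cvgM.
    apply: cvgM; first by apply: cvgB => //; exact: cvg_cst.
    apply: cvgD; first by apply: cvgD => //; exact: cvg_cst.
    by apply: cvgM => //; exact: cvg_cst.
  apply: cvgV; first by rewrite expr1n mulr1.
  by apply: cvgM => //; exact: cvg_cst.
apply: cvgM; first exact: cvg_cst.
apply: cvgM; last exact: cvg_cst.
apply: cvgM; last exact: cvg_cst.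
by apply: cvgB => //; exact: cvg_cst.
Qed.

End Rate.

(** * The variational formula for the Fisher information and its scaling *)

Section FisherDuality.
Variable R : realType.
Implicit Types (s t : R) (i : 'I_3).
Local Notation mu3 := (mu3 R).
Local Notation L1 := (L1 mu3).
Local Notation Int := (Int mu3).
Local Notation V0 := (((0, 0), 0) : V R).
Local Notation sqrt := (@Num.sqrt R).

(** The contribution of one coordinate to the dual functional; its supremum over [a], when finite,
    is four times the squared norm of the corresponding weak derivative of [sqrt g]. *)
Definition score (g : V R -> R) i (a : V R -> R) : R :=
  - 2 * Int (fun v => g v * partial a i v) - Int (fun v => g v * a v ^+ 2).

Lemma Int_fphi (g : V R -> R) L xi : L1 g -> (forall i, C1b L (xi i)) ->
  Int (fun v => g v * fphi xi v) = \sum_(i < 3) score g i (xi i).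
Proof.
move=> gi hxi.
have j1 i : L1 (fun v => g v * partial (xi i) i v).
  exact: (L1M gi (C1b_measurable_partial i (hxi i)) (C1b_le (hxi i) i)).
have j2 i : L1 (fun v => g v * xi i v ^+ 2).
  have [p hp] := C1b_bounded (hxi i).
  apply: (L1M (M := p ^+ 2) gi); first by apply: measurable_funX; exact: C1b_measurable (hxi i).
  by move=> v; rewrite (normrX 2 (xi i v)); apply: lerXn2r => //; rewrite nnegrE// (le_trans _ (hp v)).
have -> : (fun v => g v * fphi xi v) =
    (fun v => \sum_(i < 3) (- 2 * (g v * partial (xi i) i v) - g v * xi i v ^+ 2)).
  by apply/funext => v; rewrite /fphi mulr_sumr; apply: eq_bigr => i _; ring.
rewrite Int_sum => [|i]; last by apply: L1B => //; exact: L1Z.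
by apply: eq_bigr => i _; rewrite IntB//; [rewrite IntZ|exact: L1Z].
Qed.

Lemma score0 (g : V R -> R) i : score g i (fun=> 0) = 0.
Proof.
rewrite /score (_ : (fun v => g v * partial _ i v) = (fun=> 0)); last first.
  by apply/funext => v; rewrite (C1b_cst (0 : R)).2 mulr0.
rewrite (_ : (fun v => g v * 0 ^+ 2) = (fun=> 0)); last by apply/funext => v; rewrite expr0n mulr0.
by rewrite Int0 mulr0 subr0.
Qed.

Lemma thirds (e : R) : e = e / 3 + e / 3 + e / 3.
Proof. by field. Qed.

Section Upper.
Variables (g : V R -> R) (M : R).
Hypotheses (g0 : forall v, 0 <= g v) (gi : L1 g).
Hypothesis hM : forall L xi, (forall i, C1b L (xi i)) -> Int (fun v => g v * fphi xi v) <= M.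

Let scores i : set R := [set y | exists L a, C1b L a /\ y = score g i a].
Let m i := sup (scores i).

Let scores_sup i : has_sup (scores i).
Proof.
split; first by exists (score g i (fun=> 0)), 0, (fun=> 0); split => //; exact: (C1b_cst (0 : R)).1.
exists M => _ [L [a [ha ->]]].
have L0 : 0 <= L := le_trans (normr_ge0 _) (C1b_le ha i V0).
pose xi j : V R -> R := if j == i then a else (fun=> 0).
have hxi j : C1b L (xi j).
  by rewrite /xi; case: eqP => // _; exact: (C1b_weak L0 (C1b_cst (0 : R)).1).
have := hM hxi; rewrite (Int_fphi gi hxi) (bigD1 i)//= big1 ?addr0; first by rewrite /xi eqxx.
by move=> j /negbTE ji; rewrite /xi ji score0.
Qed.

Let score_le i L a : C1b L a -> score g i a <= m i.
Proof. by move=> ha; apply: (ub_le_sup (scores_sup i).2); exists L, a. Qed.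

(** The components of a field are chosen independently, so the supremum of the sum is the sum of the
    suprema. *)
Let sum_m : \sum_(i < 3) m i <= M.
Proof.
apply/ler_addgt0Pr => e e0.
have e3 : 0 < e / 3 by rewrite divr_gt0.
have /choice[La hLa] : forall i, exists La : R * (V R -> R), C1b La.1 La.2 /\ m i - e / 3 < score g i La.2.
  move=> i; have [_ [L [a [ha ->]]] h] := sup_adherent e3 (scores_sup i).
  by exists (L, a).
(* A derivative bound common to the three near-optimal components. *)
pose L := \sum_(i < 3) `|(La i).1|.
have hxi i : C1b L (La i).2.
  apply: C1b_weak (hLa i).1; rewrite /L (bigD1 i)//= (le_trans (ler_norm _))// lerDl.
  by apply: sumr_ge0.
have := hM hxi; rewrite (Int_fphi gi hxi) => h.
rewrite -lerBlDr; apply: le_trans h.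
have -> : \sum_(i < 3) m i - e = \sum_(i < 3) (m i - e / 3) 
  by rewrite sumrB; congr (_ - _); rewrite sum3E; exact: thirds.
by apply: ler_sum => i _; apply: ltW; have [] := hLa i.
Qed.

Let m0 i : 0 <= m i.
Proof. by have := score_le i (C1b_cst (0 : R)).1; rewrite score0. Qed.

Let hell_le i s : hell g i s <= s ^+ 2 * m i / 4.
Proof. exact: (hellinger_of_score g0 gi (fun L a ha => score_le i ha) s). Qed.

Let h v := sqrt (g v).
Let mh : measurable_fun setT h. Proof. by apply: measurable_sqrtf; exact: L1_measurable gi. Qed.
Let h2 : L1 (fun v => h v ^+ 2). Proof. by under eq_fun do rewrite sqr_sqrtr//. Qed.

Let hp_L1 i phi : C1c phi -> L1 (fun v => h v * partial phi i v).
Proof.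
move=> /C1c_facts[L [N [p [b1 s1 _ _ _]]]].
exact: (support_L1 (partial_support s1 i) (C1b_le b1 i) (C1b_measurable_partial i b1) mh h2).
Qed.

Let test i phi : C1c phi -> (- Int (fun v => h v * partial phi i v)) ^+ 2 <= m i / 4 * Int (fun v => phi v ^+ 2).
Proof.
move=> hphi; have [L [N [p [b1 s1 p1 mphi phi2]]]] := C1c_facts hphi.
(* On supports of the small translates of [phi], [sqrt g] agrees with an integrable function. *)
pose k v := h v * ball1 (N + 1) v.
have b10 v : 0 <= ball1 (N + 1) v by rewrite /ball1 indicE.
have b1s v : enorm v <= N + 1 -> ball1 (N + 1) v = 1 by move=> hv; rewrite /ball1 indicE mem_set.
have b1z v : N + 1 < enorm v -> ball1 (N + 1) v = 0.
  by move=> hv; rewrite /ball1 indicE memNset//= => hv'; move: hv; rewrite ltNge hv'.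
have k0 v : 0 <= k v by rewrite mulr_ge0// sqrtr_ge0.
have ki : L1 k.
  apply: (support_L1 b1z (p := 1) _ (measurable_ball1 _) mh h2) => v.
  by rewrite /ball1 indicE; case: (_ \in _); rewrite ?normr1 ?normr0.
have kE psi : (forall v, N + 1 < enorm v -> psi v = 0) -> (fun v => k v * psi v) = (fun v => h v * psi v).
  move=> hpsi; apply/funext => v; rewrite /k; have [hv|hv] := leP (enorm v) (N + 1).
    by rewrite b1s// mulr1.
  by rewrite hpsi// !mulr0.
pose sn (n : nat) : R := n.+1%:R^-1.
have s0 n : sn n != 0 by rewrite invr_eq0 pnatr_eq0.
have s_0 : sn @ \oo --> 0 by exact: cvg_harmonic.
pose u n := (sn n)^-1 * (Int (fun v => k v * phi (shiftV v i (- sn n))) - Int (fun v => k v * phi v)).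
have lim : u n @[n --> \oo] --> - Int (fun v => h v * partial phi i v).
  rewrite -(kE (partial phi i)); last by move=> v; exact: partial_support s1 i v.
  exact: (quotient_lim k0 ki b1 s0 s_0).
have lim2 : u n * u n @[n --> \oo] -->
    (- Int (fun v => h v * partial phi i v)) * (- Int (fun v => h v * partial phi i v)) by exact: (cvgM lim lim).
rewrite expr2; apply: (cvg_le lim2 (cvg_cst _)) => n; rewrite -expr2 /u.
have sub1 v : N + 1 < enorm v -> phi v = 0 by move=> hv; apply: s1; rewrite (lt_trans _ hv)// ltrDl.
have sub2 v : N + 1 < enorm v -> phi (shiftV v i (- sn n)) = 0.
  move=> hv; apply: s1; have := ler_enormD (shiftV v i (- sn n)) (shiftV V0 i (sn n)).
  have -> : addV (shiftV v i (- sn n)) (shiftV V0 i (sn n)) = v.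
    by elim/I3_ind: (i); apply: eqV => /=; ring.
  have -> : enorm (shiftV V0 i (sn n)) = `|sn n|.
    rewrite /enorm (_ : dotV _ _ = sn n ^+ 2) ?sqrtr_sqr//.
    by elim/I3_ind: (i); rewrite /dotV /=; ring.
  have : `|sn n| <= 1 by rewrite ger0_norm ?invr_ge0// invf_le1// ler1n.
  by move: hv; lra.
rewrite (kE _ sub1) (kE _ sub2).
have mphis := measurableT_comp mphi (measurable_shift i (- sn n)).
have i1 : L1 (fun v => h v * phi v) by exact: (support_L1 s1 p1 mphi mh h2).
have i2 : L1 (fun v => h v * phi (shiftV v i (- sn n))).
  by apply: (support_L1 sub2 (p := p) _ mphis mh h2) => v; exact: p1.
rewrite -(Int_shift i (sn n) i2); have i3 := L1_shift i (sn n) i2.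
rewrite -(IntB i3 i1).
have -> : (fun v => h (shiftV v i (sn n)) * phi (shiftV (shiftV v i (sn n)) i (- sn n)) - h v * phi v) =
    (fun v => (h (shiftV v i (sn n)) - h v) * phi v).
  by apply/funext => v; rewrite shiftVD subrr shiftV0 mulrBl.
have mhs : measurable_fun setT (fun v => h (shiftV v i (sn n)) - h v).
  by apply: measurable_funB => //; exact: (measurableT_comp mh (measurable_shift i _)).
have CS := cauchy_schwarz_Int mhs mphi (L1_hell i g0 gi (sn n)) phi2.
have P0 : 0 <= Int (fun v => phi v ^+ 2) by apply: Int_ge0 => v; exact: sqr_ge0.
have CS2 := le_trans CS (ler_wpM2r P0 (hell_le i (sn n))).
rewrite exprMn exprVn ler_pdivrMl; last by rewrite lt_def sqr_ge0 sqrf_eq0 s0.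
by apply: (le_trans CS2); rewrite !mulrA.
Qed.

(** [test] says that the distributional derivative of [sqrt g] is continuous for the L^2 norm on
    [C1c], so it is represented by a square integrable function with the same bound. *)
Let grad i : exists G : V R -> R, [/\ measurable_fun setT G, L1 (fun v => G v ^+ 2),
  Int (fun v => G v ^+ 2) <= m i / 4 &
  forall phi, C1c phi -> Int (fun v => G v * phi v) = - Int (fun v => h v * partial phi i v)].
Proof.
have [K [a_ [mK K2 KN Kl _]]] : exists (K : V R -> R) (a_ : nat -> V R -> R),
  [/\ measurable_fun setT K, L1 (fun x => K x ^+ 2), Int (fun x => K x ^+ 2) <= m i / 4,
    (forall a, C1c a -> Int (fun x => K x * a x) = - Int (fun v => h v * partial a i v)) &
    (forall n, C1c (a_ n)) /\ {ae mu3, forall x, a_ ^~ x @ \oo --> K x}].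
  apply: (@riesz_limit _ _ R mu3 (fun a => C1c a) (fun a => - Int (fun v => h v * partial a i v)) (m i / 4)).
  - exact: C1c_zero.
  - by move=> a b c ha hb; exact: (C1c_lin c ha hb).1.
  - move=> a b c ha hb; have i1 := hp_L1 i ha; have i2 := hp_L1 i hb.
    rewrite mulrN -opprD -(IntZ c i2) -(IntD i1 (L1Z c i2)); congr (- Int _); apply/funext => v.
    by rewrite (C1c_lin c ha hb).2; ring.
  - by move=> a ha; have [_ [_ [_ [_ _ _ ma _]]]] := C1c_facts ha.
  - by move=> a ha; have [_ [_ [_ [_ _ _ _ a2]]]] := C1c_facts ha.
  - by rewrite mulr_ge0.
  - by move=> a ha; exact: test.
by exists K; split.
Qed.

Lemma fisher_le : (fisher g <= M%:E)%E.
Proof.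
have /choice[G hG] := grad.
have mG i : measurable_fun setT (G i) by have [] := hG i.
have G2 i : L1 (fun v => G i v ^+ 2) by have [] := hG i.
have S1 : L1 (fun v => \sum_(i < 3) G i v ^+ 2) by exact: L1_sum.
have S0 v : 0 <= \sum_(i < 3) G i v ^+ 2 by apply: sumr_ge0 => i _; exact: sqr_ge0.
have hw : weak_grad (fun v => sqrt (g v)) G.
  split; first exact: mh.
  split => // phi hphi i; have [_ _ _ E] := hG i.
  have [_ [_ [_ [_ _ _ mphi phi2]]]] := C1c_facts hphi.
  have i1 := hp_L1 i hphi; have i2 := L1_mul (mG i) mphi (G2 i) phi2.
  split; first by apply/leb3_L1.
  split; first by apply/leb3_L1.
  by rewrite (leb3_Int i1) (leb3_Int i2) E// opprK.
apply: (@le_trans _ _ (4%:E * \int[@leb3 R]_v (\sum_(i < 3) (G i v) ^+ 2)%:E)%E).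
  by apply: ereal_inf_lbound; exists G.
rewrite leb3_integral_ge0; last by move=> v; rewrite lee_fin.
  rewrite (Int_EFin S1) -EFinM lee_fin Int_sum//; apply: le_trans sum_m.
  rewrite mulr_sumr; apply: ler_sum => i _; have [_ _ q _] := hG i.
  by move: q; lra.
by apply/measurable_EFinP; exact: L1_measurable S1.
Qed.

End Upper.

(** A finite energy makes every [G i] square integrable; then the weak derivative bounds the
    Hellinger distances and these bound the scores, one coordinate at a time. *)
Lemma Int_fphi_le_energy (g : V R -> R) G (I : R) : (forall v, 0 <= g v) -> L1 g ->
  weak_grad (fun v => sqrt (g v)) G ->
  (4%:E * \int[@leb3 R]_v (\sum_(i < 3) (G i v) ^+ 2)%:E)%E = I%:E ->
  forall L xi, (forall i, C1b L (xi i)) -> Int (fun v => g v * fphi xi v) <= I.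
Proof.
move=> g0 gi hG EI L xi hxi; have [_ [mG _]] := hG.
have mS : measurable_fun setT (fun v => \sum_(i < 3) G i v ^+ 2).
  by under eq_fun do rewrite sum3E; do 2?apply: measurable_funD; exact: measurable_funX.
have S0 v : 0 <= \sum_(i < 3) G i v ^+ 2 by apply: sumr_ge0 => i _; exact: sqr_ge0.
have mSE : measurable_fun setT (fun v => (\sum_(i < 3) G i v ^+ 2)%:E) by apply/measurable_EFinP.
have S0E v : (0 <= (\sum_(i < 3) G i v ^+ 2)%:E)%E by rewrite lee_fin.
rewrite (leb3_integral_ge0 mSE S0E) in EI.
have S1 : L1 (fun v => \sum_(i < 3) G i v ^+ 2).
  apply/integrableP; split => //.
  under eq_integral do rewrite /= ger0_norm//.
  move: EI; case: (\int[_]_x _)%E => [r _|/eqP|/eqP]; first exact: ltry.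
    by rewrite mulry gtr0_sg// mul1e.
  by rewrite mulrNy gtr0_sg// mul1e.
have G2 i : L1 (fun v => G i v ^+ 2).
  apply: (L1_le _ _ S1); first exact: measurable_funX.
  move=> v; rewrite (ger0_norm (sqr_ge0 _)) (bigD1 i)//= lerDl.
  by apply: sumr_ge0 => j _; exact: sqr_ge0.
move: EI; rewrite (Int_EFin S1) -EFinM => -[<-].
rewrite (Int_fphi gi hxi) Int_sum// mulr_sumr; apply: ler_sum => i _.
exact: (score_of_hellinger g0 gi (hellinger_of_weak_grad g0 gi hG (G2 i)) (hxi i)).
Qed.

Lemma C1b_dilate L a (c k : R) : C1b L a ->
  C1b (`|c * k| * L) (fun v => c * a (scaleV k v)) /\
  forall i v, partial (fun v => c * a (scaleV k v)) i v = c * k * partial a i (scaleV k v).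
Proof.
move=> ha; have [p hp] := C1b_bounded ha.
have [h E] : C1b (`|c * k| * L) (fun v => c * a (scaleV k v)) /\
    partial (fun v => c * a (scaleV k v)) = (fun i v => c * k * partial a i (scaleV k v)).
  apply: (@C1b_build _ _ _ _ (`|c| * p)) => [v|i v|i|i v].
  - by rewrite normrM ler_wpM2l.
  - have h1 : is_derive (0 + k * 0 : R) 1 (fun r : R => a (shiftV (scaleV k v) i r)) (partial a i (scaleV k v)).
      have := is_derive_line (C1b_derivable ha (i := i)) (scaleV k v) 0.
      by rewrite shiftV0 mulr0 addr0.
    have hl := is_derive_affine 0 k (is_derive_id (0 : R) (1 : R)).
    have D1 := @is_derive1_comp _ _ (fun r : R => 0 + k * r) 0 _ _ h1 hl.
    have E : (fun r : R => c * a (scaleV k (shiftV v i r))) =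
        (fun r => 0 + c * ((fun r : R => a (shiftV (scaleV k v) i r)) \o (fun r : R => 0 + k * r)) r).
      apply/funext => r /=; rewrite !add0r; congr (_ * a _).
      by elim/I3_ind: i {h1 D1}; apply: eqV => /=; ring.
    rewrite E; apply: (is_derive_eq (is_derive_affine 0 c D1)).
    by ring.
  - apply: cvg3_continuous => x y xy; apply: cvgM; first exact: cvg_cst.
    apply: (continuous_cvg3 (C1b_continuous ha (i := i))).
    by apply: cvg3_scale => //; exact: cvg_cst.
  - by rewrite normrM ler_wpM2l// (C1b_le ha).
by split; [exact: h|rewrite E].
Qed.

(** With [eta v = xi (v / l) / l] one has [fphi eta (l v) = l^-2 fphi xi v], while the
    mass-preserving dilation is invisible to the integral: the dual functional is homogeneous of
    degree two. *)
Lemma Int_fphi_dilate (f : V R -> R) L xi (l : R) : 0 < l -> L1 f -> (forall i, C1b L (xi i)) ->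
  exists L' eta, (forall i, C1b L' (eta i)) /\
    Int (fun v => l ^+ 3 * f (scaleV l v) * fphi xi v) = l ^+ 2 * Int (fun v => f v * fphi eta v).
Proof.
move=> l0 fi hxi; have ln : l != 0 by rewrite gt_eqF.
pose eta i v := l^-1 * xi i (scaleV l^-1 v).
have hd i := C1b_dilate l^-1 l^-1 (hxi i).
have he i : C1b (`|l^-1 * l^-1| * L) (eta i) := (hd i).1.
exists (`|l^-1 * l^-1| * L), eta; split => //.
have [N hN] := fphi_bounded (fun i => ex_intro _ _ (he i)).
have Fi : L1 (fun v => f v * fphi eta v).
  exact: (L1M fi (fphi_measurable (fun i => ex_intro _ _ (he i))) hN).
have -> : (fun v => l ^+ 3 * f (scaleV l v) * fphi xi v) =
    (fun v => l ^+ 5 * (f (addV (scaleV l v) V0) * fphi eta (addV (scaleV l v) V0))).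
  apply/funext => v.
  have -> : addV (scaleV l v) V0 = scaleV l v by apply: eqV => /=; ring.
  have E : scaleV l^-1 (scaleV l v) = v by apply: eqV => /=; rewrite mulKf.
  rewrite /fphi mulr_sumr mulrA mulr_sumr; apply: eq_bigr => i _.
  rewrite (hd i).2 /eta E; field; exact: ln.
rewrite IntZ; last exact: (L1_mu3_affine V0 l0 Fi).
by rewrite (Int_mu3_affine V0 l0 Fi) mulrA; congr (_ * _); field.
Qed.

End FisherDuality.

(** * Conclusion for the rescaled solution *)

Section MainTheorem.
Variables (R : realType) (e : R) (B : R -> R) (f : V R -> R -> R).
Hypotheses (he : 0 < e <= 1) (hB : admissible_B B) (sol : solves_E1 e B f).
Hypothesis mass0 : Rintegral (@leb3 R) setT (fun v => f v 0) = 1.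
Local Notation mu3 := (mu3 R).
Local Notation L1 := (L1 mu3).
Local Notation Int := (Int mu3).
Local Notation V0 := (((0, 0), 0) : V R).

Let f_ge0 t : 0 <= t -> forall v, 0 <= f v t. Proof. by case: sol => + _ => /[apply] -[_ []]. Qed.
Let f_L1 t : 0 <= t -> L1 (fun v => f v t).
Proof. by case: sol => + _ => /[apply] -[_ [_ h]]; apply/leb3_L1. Qed.

Let fisher_le_of_energy (I : R) t : 0 <= t -> 0 <= I ->
  (forall L xi, (forall i, C1b L (xi i)) -> Int (fun v => f v 0 * fphi xi v) <= I) ->
  (fisher (fun v => rescale e B f v t) <= (expR (rate e B * t) * I)%:E)%E.
Proof.
move=> t0 I0 hI; pose l := expR (- (Ecoef e B * t)); have l0 : 0 < l by exact: expR_gt0.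
have fi := f_L1 t0.
have E : (fun v => rescale e B f v t) = (fun v => l ^+ 3 * f (scaleV l v) t).
  apply/funext => v; rewrite /rescale /l -expRM_natl; congr (expR _ * _); ring.
rewrite E; apply: fisher_le.
- by move=> v; rewrite mulr_ge0 ?f_ge0// exprn_ge0// ltW.
- apply: L1Z; have := L1_mu3_affine V0 l0 fi; congr L1; apply/funext => v.
  by congr (f _ t); apply: eqV => /=; rewrite addr0.
move=> L xi hxi; have [L' [eta [he' ->]]] := Int_fphi_dilate l0 fi hxi.
have m1 : Int (fun v => f v 0) = 1 by rewrite -leb3_Int//; exact: f_L1.
have h := fisher_propagation he hB sol m1 hI he' t0.
apply: (le_trans (ler_wpM2l (exprn_ge0 2 (ltW l0)) h)).
rewrite mulrCA mulrC ler_wpM2r// /l -expRM_natl -expRD ler_expR.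
have := ler_wpM2r t0 (rate_ge B he).
by move: (rate e B) (Ecoef e B) ((e ^+ 2)^-1) => r E' k; lra.
Qed.

(** The infimum on the right is bounded below through each weak gradient of the initial datum
    separately, which includes the case where there is none. *)
Lemma fisher_rescale t : 0 <= t ->
  (fisher (fun v => rescale e B f v t) <=
   (expR (rate e B * t))%:E * fisher (fun v => rescale e B f v 0))%E.
Proof.
move=> t0; have c0 : 0 < expR (rate e B * t) := expR_gt0 _.
have -> : (fun v => rescale e B f v 0) = (fun v => f v 0).
  apply/funext => v; rewrite /rescale !mulr0 oppr0 expR0 mul1r; congr (f _ 0).
  by apply: eqV => /=; rewrite mul1r.
rewrite -lee_pdivrMl//; apply: le_ereal_inf_tmp => y [G [hG ->]].
rewrite lee_pdivrMl//.
have S0 : (0 <= 4%:E * \int[@leb3 R]_v (\sum_(i < 3) (G i v) ^+ 2)%:E)%E.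
  apply: mule_ge0; first by rewrite lee_fin.
  by apply: integral_ge0 => v _; rewrite lee_fin; apply: sumr_ge0 => i _; exact: sqr_ge0.
(* An infinite energy leaves nothing to prove, as the exponential factor is positive. *)
case EI : (4%:E * _)%E S0 => [I| |//] S0; last by rewrite gt0_muley ?lte_fin// leey.
rewrite -EFinM; rewrite lee_fin in S0; apply: (fisher_le_of_energy t0 S0).
exact: (Int_fphi_le_energy (f_ge0 (lexx 0)) (f_L1 (lexx 0)) hG EI).
Qed.

End MainTheorem.

Theorem theorem1p1 (R : realType) :
  (forall (e : R) (B : R -> R) (f : V R -> R -> R) (f0 : V R -> R),
     0 < e <= 1 -> admissible_B B ->
     solves_E1 e B f ->
     (forall v, f v 0 = f0 v) -> prob_density_zero_mean f0 ->
     forall t : R, 0 <= t ->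
       (fisher (fun v => rescale e B f v t)
        <= (expR (rate e B * t))%:E * fisher (fun v => rescale e B f v 0))%E)
  /\
  (forall B : R -> R, admissible_B B ->
     (forall e : R, 0 < e < 1 -> 0 < rate e B) /\
     rate x B @[x --> 1^'-] --> 0).
Proof.
split; last by move=> B hB; split; [exact: rate_pos hB|exact: rate_lim].
move=> e B f f0 he hB sol ff0 [_ [_ [_ [m0 _]]]] t t0.
apply: (fisher_rescale he hB sol _ t0); rewrite -m0.
by congr (Rintegral _ _ _); apply/funext => v; exact: ff0.
Qed.
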